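(* Let $K$ be an imaginary multi-quadratic number field with $\sqrt{2}\in K$. Then the class number $h(K)$ is odd if and only if $K$ is one of the following: (1) $\mathbb{Q}(\sqrt{2},\sqrt{-p})$, where $p$ is a prime with $p\equiv 3\pmod 8$; (2) $\mathbb{Q}(\sqrt{2},\sqrt{-1},\sqrt{-p})$, where $p$ is a prime with $p\equiv 3$ or $5\pmod 8$; (3) $\mathbb{Q}(\sqrt{2},\sqrt{-p},\sqrt{-q})$, where $p,q$ are distinct primes with $p\equiv q\equiv 3\pmod 8$; (4) $\mathbb{Q}(\sqrt{2},\sqrt{-1})$. Moreover, for $K=\mathbb{Q}(\sqrt{2},\sqrt{-p})$ with $p$ a prime, $p\equiv 5\pmod 8$, one has $2\mid h(K)$ but $4\nmid h(K)$.
   Context: A multi-quadratic number field is a field of the form $\mathbb{Q}(\sqrt{a_1},\dots,\sqrt{a_m})$ with $a_i\in\mathbb{Z}$; it is imaginary if it is not contained in $\mathbb{R}$. $h(K)$ denotes the class number of $K$. *)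

(* Defs.v *)
From HB Require Import structures.
From mathcomp Require Import all_boot all_order all_algebra all_field.
Set Implicit Arguments. Unset Strict Implicit. Unset Printing Implicit Defensive.
Import Order.TTheory GRing.Theory Num.Theory.
Local Open Scope ring_scope.

Definition is_subfield (S : algC -> Prop) : Prop :=
  [/\ S 0, S 1,
      (forall x y, S x -> S y -> S (x + y)),
      (forall x, S x -> S (- x)) &
      (forall x y, S x -> S y -> S (x * y) /\ S (x^-1))].

Definition multiquad (s : seq int) : algC -> Prop :=
  fun x => forall S : algC -> Prop, is_subfield S ->
    (forall a, a \in s -> S (sqrtC (a%:~R))) -> S x.

Definition imaginary (K : algC -> Prop) : Prop :=
  exists x, K x /\ x \isn't Num.real.

Definition same_field (K L : algC -> Prop) : Prop := forall x, K x <-> L x.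

Definition ring_of_integers (K : algC -> Prop) : algC -> Prop :=
  fun x => K x /\ x \in Aint.

Definition is_nz_ideal (K : algC -> Prop) (I : algC -> Prop) : Prop :=
  [/\ (forall x, I x -> ring_of_integers K x),
      I 0,
      (forall x y, I x -> I y -> I (x + y)),
      (forall r x, ring_of_integers K r -> I x -> I (r * x)) &
      (exists x, x != 0 /\ I x)].

Definition ideal_equiv (K : algC -> Prop) (I J : algC -> Prop) : Prop :=
  exists a b, [/\ K a, K b, a != 0, b != 0 &
    forall x, (exists y, I y /\ x = a * y) <-> (exists z, J z /\ x = b * z)].

Definition class_number (K : algC -> Prop) (h : nat) : Prop :=
  exists C : 'I_h -> (algC -> Prop),
    [/\ (forall i, is_nz_ideal K (C i)),
        (forall i j, ideal_equiv K (C i) (C j) -> i = j) &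
        (forall I, is_nz_ideal K I -> exists i, ideal_equiv K I (C i))].

(* Main.v *)
(** The class number is odd exactly when every ideal with principal square is
    principal, and this property is followed along quadratic extensions L = K(s).

    If L / K is unramified and K is totally complex, the class number of K is even.
    Otherwise, for a unit x = b / rho b of norm 1, the invariant ideal (b) would come
    from an ideal of K, necessarily principal, and x would be u / rho u for a unit u;
    this contradicts the Herbrand inequality |H^1(E_L)| >= 2 [E_K : N E_L].  That
    inequality needs no unit theorem: the number of units of bounded size is estimated
    from below by Minkowski's theorem and from above by the product formula, and
    the two orders of growth are compared.

    Even class numbers.  If K is imaginary with odd class number and p is an odd
    prime ramified in K, then K contains the square root of p' = p or -p, p' = 1 mod 4,
    since K(sqrt p') / K is unramified.  Further unramified extensions
    K(sqrt alpha), with alpha a square modulo 4 whose product with a conjugate is a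
    square in K, exclude p = 1, 7 mod 8 (alpha in Z[sqrt 2] of norm p'), two primes
    5 mod 8 or two primes 3 mod 8 in the presence of sqrt(-1) (alpha of norm pq in
    Z[i] or Z[sqrt -2]), and residues (3, 5) or (3, 3, 3) modulo 8 (alpha a generator
    of an odd power of primes of Q(sqrt 2, sqrt -p), corrected by a unit and by p^2).
    Only the four families remain.

    Odd class numbers.  The four families are built up by quadratic steps from the
    principal ring Z[sqrt 2].  Either all ambiguous ideals are visibly principal and
    totally positive units of Z[sqrt 2] are squares, or exactly two primes ramify and
    a unit (zeta_8 or 1 + sqrt 2) is a nonresidue at one of them, hence not a norm;
    the Herbrand inequality then leaves no room for other ambiguous classes.

    For Q(sqrt 2, sqrt -p) with p = 5 mod 8, the only class of order two is that of the
    prime above 2, and it is not a square because 2 + sqrt 2 is not a norm. *)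
Require Import Defs.
From HB Require Import structures.
From mathcomp Require Import all_boot all_order all_fingroup all_algebra all_solvable all_field.
From mathcomp Require Import boolp zify ring.
Import Order.TTheory GRing.Theory Num.Theory.
Local Open Scope ring_scope.
Set Implicit Arguments.
Unset Strict Implicit.
Unset Printing Implicit Defensive.

(** Everything lives inside [algC]: a field is a predicate, and a conjugation is the restriction of
    an automorphism of [algC]. Fields are climbed from Q by quadratic steps L = K(s), so each step
    has a single conjugation [rho], and ideals stay invertible because B rho(B) comes from the base.

    Invariant ideals are handled by divisibility. If A = rho(A) and a = A ∩ K, then E = a A^-1 is
    integral, E^2 = n O_L for an ideal n of K, and n contains the norm of any element of the
    relative different. As an ideal is determined by its square, E is known once n is, and n has few
    possibilities when that norm generates a product of at most two maximal ideals of K.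

    The factor 2 in the Herbrand inequality comes from ranks. With r complex places of K, the units
    of K have rank r - 1, those of L have rank 2 r - 1, and those of relative norm 1 have rank r.
    Counting -1, this means 2^r square classes of units of K against 2^(r+1) square classes of
    norm-one units. The map e / rho e -> e rho e sends the latter, colour by colour, into the
    former. *)

Notation cpred := (algC -> Prop).
Notation OK := ring_of_integers.

(** * Subfields of [algC] and algebraic integers *)

Section Subfield.
Variables (K : cpred) (hK : is_subfield K).

Lemma sf0 : K 0. Proof. by case: hK. Qed.
Lemma sf1 : K 1. Proof. by case: hK. Qed.
Lemma sfD x y : K x -> K y -> K (x + y). Proof. by case: hK => _ _ h _ _; apply: h. Qed.
Lemma sfN x : K x -> K (- x). Proof. by case: hK => _ _ _ h _; apply: h. Qed.
Lemma sfM x y : K x -> K y -> K (x * y).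
Proof. by case: hK => _ _ _ _ h hx hy; case: (h _ _ hx hy). Qed.
Lemma sfV x : K x -> K x^-1.
Proof. by case: hK => _ _ _ _ h hx; case: (h _ _ hx hx). Qed.
Lemma sfX x n : K x -> K (x ^+ n).
Proof.
by move=> hx; elim: n => [|n IH]; rewrite ?expr0 ?exprS; [exact: sf1|apply: sfM].
Qed.
Lemma sf_nat n : K n%:R.
Proof.
by elim: n => [|n IH]; [exact: sf0|rewrite -natr1; apply: sfD => //; exact: sf1].
Qed.
Lemma sf_int n : K n%:~R.
Proof. by case: n => n; rewrite ?NegzE ?rmorphN; [|apply: sfN]; exact: sf_nat. Qed.
Lemma sf_rat x : x \in Crat -> K x.
Proof.
case/CratP=> a ->; rewrite -[a]divq_num_den fmorph_div !rmorph_int.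
by apply: sfM; [|apply: sfV]; exact: sf_int.
Qed.
Lemma sf_sum (I : Type) (r : seq I) (P : pred I) (F : I -> algC) :
  (forall i, P i -> K (F i)) -> K (\sum_(i <- r | P i) F i).
Proof. by move=> h; apply: big_ind => //; [exact: sf0|exact: sfD]. Qed.

Lemma OK_sub x : OK K x -> K x. Proof. by case. Qed.
Lemma OK_int n : OK K n%:~R. Proof. by split; [exact: sf_int|exact: Aint_int]. Qed.
Lemma OK_nat n : OK K n%:R. Proof. exact: (OK_int n). Qed.
Lemma OK0 : OK K 0. Proof. exact: (OK_nat 0). Qed.
Lemma OK1 : OK K 1. Proof. exact: (OK_nat 1). Qed.
Lemma OKD x y : OK K x -> OK K y -> OK K (x + y).
Proof. by case=> a b [c d]; split; [exact: sfD|rewrite rpredD]. Qed.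
Lemma OKN x : OK K x -> OK K (- x).
Proof. by case=> a b; split; [exact: sfN|rewrite rpredN]. Qed.
Lemma OKM x y : OK K x -> OK K y -> OK K (x * y).
Proof. by case=> a b [c d]; split; [exact: sfM|rewrite rpredM]. Qed.
Lemma OKX x n : OK K x -> OK K (x ^+ n).
Proof. by case=> a b; split; [exact: sfX|rewrite rpredX]. Qed.
Lemma OK_sum (I : Type) (r : seq I) (P : pred I) (F : I -> algC) :
  (forall i, P i -> OK K (F i)) -> OK K (\sum_(i <- r | P i) F i).
Proof. by move=> h; apply: big_ind => //; [exact: OK0|exact: OKD]. Qed.
End Subfield.

(** Settles memberships in a subfield, in its ring of integers or in [Aint] by following the shape
    of the term. *)
Ltac sf := repeat first [ assumption | match goal with
 | |- ring_of_integers _ (_ + _) => apply: OKD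
 | |- ring_of_integers _ (- _) => apply: OKN
 | |- ring_of_integers _ (_ * _) => apply: OKM
 | |- ring_of_integers _ (_ ^+ _) => apply: OKX
 | |- ring_of_integers _ 0 => apply: OK0
 | |- ring_of_integers _ 1 => apply: OK1
 | |- ring_of_integers _ (_ %:~R) => apply: OK_int
 | |- ring_of_integers _ (_ %:R) => apply: OK_nat
 | |- is_true (_ \in Aint) => first [exact: Aint_int | rewrite rpredD | rewrite rpredN |
       rewrite rpredM | rewrite rpredX | exact: rpred_nat | exact: rpred1 | exact: rpred0]
 | |- ?K 0 => apply: (@sf0 K)
 | |- ?K 1 => apply: (@sf1 K)
 | |- ?K (_ + _) => apply: (@sfD K)
 | |- ?K (- _) => apply: (@sfN K)
 | |- ?K (_ * _) => apply: (@sfM K)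
 | |- ?K (_ ^-1) => apply: (@sfV K)
 | |- ?K (_ ^+ _) => apply: (@sfX K)
 | |- ?K (_ %:~R) => apply: (@sf_int K)
 | |- ?K (_ %:R) => apply: (@sf_nat K)
 end ].

(** Transitivity of integrality in degree two. It certifies half-integers such as (1 + s) / 2 and
    the products in Gauss's lemma for ideals. *)
Lemma Aint_quadratic (t n x : algC) :
  t \in Aint -> n \in Aint -> x ^+ 2 - t * x + n = 0 -> x \in Aint.
Proof.
have toI z : z \in Aint -> integralOver (intr : int -> algC) z.
  move=> hz; have /floorpP[q Dq] : minCpoly z \is a polyOver Num.int by [].
  exists q; last by rewrite -Dq root_minCpoly.
  have := minCpoly_monic z; rewrite Dq !monicE lead_coef_map_inj //; last exact: intr_inj.
  by rewrite -(inj_eq (@intr_inj algC)).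
move=> ht hn hx.
suff [p mp rp] : integralOver (intr : int -> algC) x.
  apply: (root_monic_Aint rp); first by rewrite monic_map.
  by apply/polyOverP => i; rewrite coef_map /= intr_int.
pose p : {poly algC} := 'X^2 - (t%:P * 'X - n%:P).
have szp : (size (t%:P * 'X - n%:P : {poly algC})%R <= 2)%N.
  have -> : t%:P * 'X - n%:P = t%:P * 'X + (- n)%:P by rewrite polyCN.
  by rewrite size_MXaddC; case: ifP => // _; rewrite ltnS size_polyC leq_b1.
apply: (@integral_root_monic _ _ _ x p).
- by rewrite monicE lead_coefDl ?size_polyN ?size_polyXn ?ltnS // lead_coefXn.
- by rewrite rootE !hornerE -hx; apply/eqP; ring.
- apply/integral_poly => i; rewrite !(coefB, coefXn, coefCM, coefX, coefC).
  apply: integral_sub; first by apply: integral_nat.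
  apply: integral_sub; first by apply: integral_mul; [exact: toI|exact: integral_nat].
  by case: ifP => _; [exact: toI|exact: integral0].
Qed.

Lemma Aint_sqr x : x ^+ 2 \in Aint -> x \in Aint.
Proof.
move=> h; apply: (@Aint_quadratic 0 (- x ^+ 2)); rewrite ?rpred0 ?rpredN //; ring.
Qed.

(** * Fractional ideals *)

Definition incl (I J : cpred) := forall x, I x -> J x.

Lemma incl_eq I J : incl I J -> incl J I -> I = J.
Proof. by move=> a b; rewrite predeqE => x; split; [exact: a|exact: b]. Qed.

(** Finite sums of products as an inductive closure, so that inclusions of products are proved by
    induction on the sum. *)
Inductive imul (I J : cpred) : cpred :=
| imul_0 : imul I J 0
| imul_S u v w : I u -> J v -> imul I J w -> imul I J (u * v + w).

Lemma imul_in I J u v : I u -> J v -> imul I J (u * v).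
Proof. by move=> hu hv; rewrite -[u * v]addr0; apply: imul_S => //; exact: imul_0. Qed.

Lemma imulD I J x y : imul I J x -> imul I J y -> imul I J (x + y).
Proof.
move=> hx hy; elim: hx => [|u v w hu hv _ IH]; first by rewrite add0r.
by rewrite -addrA; apply: imul_S.
Qed.

Lemma imul_sub I J (S : cpred) : S 0 -> (forall x y, S x -> S y -> S (x + y)) ->
  (forall u v, I u -> J v -> S (u * v)) -> incl (imul I J) S.
Proof. by move=> h0 hD hM x; elim=> // u v w hu hv _ hw; apply: hD => //; apply: hM. Qed.

Lemma imulC I J : imul I J = imul J I.
Proof.
suff h A B : incl (imul A B) (imul B A) by apply: incl_eq.
apply: imul_sub => [|x y|u v hu hv]; [exact: imul_0|exact: imulD|].
by rewrite mulrC; apply: imul_in.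
Qed.

Lemma imulA I J L : imul I (imul J L) = imul (imul I J) L.
Proof.
have h A B C : incl (imul A (imul B C)) (imul (imul A B) C).
  apply: imul_sub => [|x y|u v hu]; [exact: imul_0|exact: imulD|].
  elim=> [|a b w ha hb _ IH]; first by rewrite mulr0; exact: imul_0.
  by rewrite mulrDr mulrA; apply: imul_S => //; apply: imul_in.
apply: incl_eq; first exact: h.
rewrite (imulC (imul I J)) (imulC I J) (imulC I (imul J L)) (imulC J L); exact: h.
Qed.

Lemma imulAC I J L : imul (imul I J) L = imul (imul I L) J.
Proof. by rewrite -!imulA (imulC J). Qed.
Lemma imulCA I J L : imul I (imul J L) = imul J (imul I L).
Proof. by rewrite !imulA (imulC I). Qed.
Lemma imulACA I J L M : imul (imul I J) (imul L M) = imul (imul I L) (imul J M).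
Proof. by rewrite -!imulA (imulCA J). Qed.

Lemma imulS I I' J J' : incl I I' -> incl J J' -> incl (imul I J) (imul I' J').
Proof.
move=> a b; apply: imul_sub => [|x y|u v hu hv]; [exact: imul_0|exact: imulD|].
by apply: imul_in; [exact: a|exact: b].
Qed.

(* Fractional ideals are predicates, so by extensionality two of them with the
   same elements are equal. *)
Record fid (K I : cpred) : Prop := Fid {
  fid_sub : incl I K;
  fid0 : I 0;
  fidD : forall x y, I x -> I y -> I (x + y);
  fidM : forall r x, OK K r -> I x -> I (r * x);
  fid_nz : exists x, x != 0 /\ I x;
  fid_den : exists d, [/\ d != 0, K d & forall x, I x -> d * x \in Aint] }.

Definition pr (K : cpred) (a : algC) : cpred := fun x => exists r, OK K r /\ x = a * r.
Definition prin (K I : cpred) := exists a, [/\ a != 0, K a & I = pr K a].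
Definition iadd (I J : cpred) : cpred := fun x => exists u v, [/\ I u, J v & x = u + v].
Definition no2 (K : cpred) := forall I, fid K I -> prin K (imul I I) -> prin K I.
Definition invertible (K : cpred) := forall I, fid K I -> exists2 J, fid K J & imul I J = OK K.
Definition pid (K : cpred) := forall I, fid K I -> prin K I.
Definition unit (K : cpred) (u : algC) := [/\ u != 0, OK K u & OK K u^-1].
Definition maxid (K P : cpred) := [/\ fid K P, incl P (OK K), ~ P 1 &
  forall x, OK K x -> P x \/ exists2 y, OK K y & P (x * y - 1)].

Section Ideals.
Variables (K : cpred) (hK : is_subfield K).

Lemma fidN I x : fid K I -> I x -> I (- x).
Proof. by move=> f hx; rewrite -mulN1r; apply: (fidM f) => //; sf. Qed.
Lemma fidB I x y : fid K I -> I x -> I y -> I (x - y).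
Proof. by move=> f hx hy; apply: (fidD f) => //; apply: fidN. Qed.

Lemma fid_pr a : K a -> a != 0 -> fid K (pr K a).
Proof.
move=> ha na; split.
- by move=> x [r [[hr _] ->]]; sf.
- by exists 0; split; [sf|rewrite mulr0].
- by move=> x y [r [hr ->]] [r' [hr' ->]]; exists (r + r'); split; [sf|ring].
- by move=> r x hr [r' [hr' ->]]; exists (r * r'); split; [sf|ring].
- by exists a; split=> //; exists 1; split; [sf|rewrite mulr1].
- exists a^-1; split; [by rewrite invr_eq0|by sf|].
  by move=> x [r [[_ hr] ->]]; rewrite mulrA mulVf // mul1r.
Qed.

Lemma pr1 : pr K 1 = OK K.
Proof.
rewrite predeqE => x; split=> [[r [hr ->]]|h]; first by rewrite mul1r.
by exists x; rewrite mul1r.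
Qed.

Lemma fid_OK : fid K (OK K).
Proof. by rewrite -pr1; apply: fid_pr; [sf|exact: oner_neq0]. Qed.

Lemma pr_id a : pr K a a.
Proof. by exists 1; split; [sf|rewrite mulr1]. Qed.

Lemma fid_imul I J : fid K I -> fid K J -> fid K (imul I J).
Proof.
move=> fI fJ; split.
- apply: imul_sub => [|x y|u v hu hv]; [by sf|by move=> *; sf|].
  by have := fid_sub fI hu; have := fid_sub fJ hv => *; sf.
- exact: imul_0.
- exact: imulD.
- move=> r x hr; elim=> [|u v w hu hv _ IH]; first by rewrite mulr0; exact: imul_0.
  by rewrite mulrDr mulrA; apply: imul_S => //; apply: (fidM fI).
- case: (fid_nz fI) => x [nx hx]; case: (fid_nz fJ) => y [ny hy].
  by exists (x * y); rewrite mulf_neq0 //; split=> //; apply: imul_in.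
- case: (fid_den fI) => x [nx kx hx]; case: (fid_den fJ) => y [ny ky hy].
  exists (x * y); split; [by rewrite mulf_neq0|by sf|].
  apply: imul_sub => [|a b ha hb|u v hu hv]; first by rewrite mulr0 rpred0.
    by rewrite mulrDr rpredD.
  by rewrite mulrACA rpredM ?hx ?hy.
Qed.

Lemma imul_prP I a x : fid K I -> imul (pr K a) I x <-> exists2 y, I y & x = a * y.
Proof.
move=> fI; split; last first.
  by case=> y hy ->; apply: imul_in => //; exact: pr_id.
elim=> [|u v w [r [hr ->]] hv _ [y hy ->]].
  by exists 0; rewrite ?mulr0 //; exact: (fid0 fI).
exists (r * v + y); last by ring.
by apply: (fidD fI) => //; apply: (fidM fI).
Qed.

Lemma imul1 I : fid K I -> imul (OK K) I = I.
Proof.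
move=> fI; rewrite -pr1 predeqE => x; rewrite imul_prP //; split.
  by case=> y hy ->; rewrite mul1r.
by exists x; rewrite ?mul1r.
Qed.
Lemma imul1r I : fid K I -> imul I (OK K) = I.
Proof. by move=> fI; rewrite imulC imul1. Qed.

Lemma imul_pr a b : K b -> b != 0 -> imul (pr K a) (pr K b) = pr K (a * b).
Proof.
move=> hb nb; rewrite predeqE => x; rewrite imul_prP; last exact: fid_pr.
split=> [[y [r [hr ->]] ->]|[r [hr ->]]]; first by exists r; rewrite mulrA.
by exists (b * r); [exists r|rewrite mulrA].
Qed.

Lemma pr_imulK a I : K a -> a != 0 -> fid K I -> imul (pr K a^-1) (imul (pr K a) I) = I.
Proof. by move=> ha na fI; rewrite imulA imul_pr // mulVf // pr1 imul1. Qed.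

Lemma prinM I J : prin K I -> prin K J -> prin K (imul I J).
Proof.
case=> a [na ha ->] [b [nb hb ->]]; exists (a * b); split; [by rewrite mulf_neq0|by sf|].
by rewrite imul_pr.
Qed.

Lemma prin_pr a : K a -> a != 0 -> prin K (pr K a).
Proof. by move=> ha na; exists a. Qed.

Lemma prin_OK : prin K (OK K).
Proof. by rewrite -pr1; apply: prin_pr; [sf|exact: oner_neq0]. Qed.

Lemma unitM u v : unit K u -> unit K v -> unit K (u * v).
Proof. by case=> n a b [m c d]; split; [rewrite mulf_neq0|sf|rewrite invfM; sf]. Qed.
Lemma unitV u : unit K u -> unit K u^-1.
Proof. by case=> n a b; split; rewrite ?invrK ?invr_eq0. Qed.
Lemma unit1 : unit K 1.
Proof. by split; rewrite ?invr1 ?oner_neq0 //; sf. Qed.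
Lemma unitN u : unit K u -> unit K (- u).
Proof. by case=> n a b; split; rewrite ?invrN ?oppr_eq0 //; sf. Qed.
Lemma unitX u n : unit K u -> unit K (u ^+ n).
Proof. by case=> m a b; split; rewrite -?exprVn ?expf_neq0 //; sf. Qed.
Lemma unit_sub u : unit K u -> K u. Proof. by case=> _ []. Qed.
Lemma unit_neq0 u : unit K u -> u != 0. Proof. by case. Qed.

Lemma pr_unit a u : unit K u -> pr K (a * u) = pr K a.
Proof.
case=> n h1 h2; rewrite predeqE => x; split=> [[r [hr ->]]|[r [hr ->]]].
  by exists (u * r); split; [sf|rewrite mulrA].
exists (u^-1 * r); split; first by sf.
by rewrite !mulrA mulfK.
Qed.

Lemma pr_eq a b : K a -> a != 0 -> b != 0 -> pr K a = pr K b ->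
  unit K (a / b).
Proof.
move=> ha na nb h.
have : pr K b a by rewrite -h; exact: pr_id.
have : pr K a b by rewrite h; exact: pr_id.
case=> r [hr e1] [r' [hr' e2]]; split; first by rewrite mulf_neq0 ?invr_eq0.
  by rewrite e2 mulrC mulKf.
by rewrite invf_div e1 mulrC mulKf.
Qed.

Lemma pr_mem I a : fid K I -> I a -> incl (pr K a) I.
Proof. by move=> f ha x [r [hr ->]]; rewrite mulrC; apply: (fidM f). Qed.

Lemma fid_iadd I J : fid K I -> fid K J -> incl I (OK K) -> incl J (OK K) -> fid K (iadd I J).
Proof.
move=> fI fJ sI sJ; split.
- by move=> x [u [v [/sI [hu _] /sJ [hv _] ->]]]; sf.
- by exists 0, 0; rewrite addr0; split=> //; [exact: (fid0 fI)|exact: (fid0 fJ)].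
- move=> x y [u [v [a b ->]]] [u' [v' [a' b' ->]]]; exists (u + u'), (v + v').
  by rewrite addrACA; split=> //; [apply: (fidD fI)|apply: (fidD fJ)].
- move=> r x hr [u [v [a b ->]]]; exists (r * u), (r * v).
  by rewrite mulrDr; split=> //; [apply: (fidM fI)|apply: (fidM fJ)].
- case: (fid_nz fI) => x [nx hx]; exists x; split=> //.
  by exists x, 0; rewrite addr0; split=> //; exact: (fid0 fJ).
- exists 1; split; [exact: oner_neq0|by sf|].
  by move=> x [u [v [/sI [_ hu] /sJ [_ hv] ->]]]; rewrite mul1r rpredD.
Qed.

Hypothesis inv : invertible K.

Lemma imul_inj I J J' : fid K I -> fid K J -> fid K J' -> imul I J = imul I J' -> J = J'.
Proof.
move=> fI fJ fJ' e; case: (inv fI) => H fH eH.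
by rewrite -(imul1 fJ) -(imul1 fJ') -eH !(imulC I) -!imulA e.
Qed.

Lemma imul_incl I J J' : fid K I -> fid K J -> fid K J' ->
  incl (imul I J) (imul I J') -> incl J J'.
Proof.
move=> fI fJ fJ' e; case: (inv fI) => H fH eH.
rewrite -(imul1 fJ) -(imul1 fJ') -eH !(imulC I) -!imulA; exact: imulS.
Qed.

(* O_K is integrally closed, so an element whose square lies in J^2 lies in J. *)
Lemma sq_inj I J : fid K I -> fid K J -> imul I I = imul J J -> I = J.
Proof.
have main A B : fid K A -> fid K B -> imul A A = imul B B -> incl A B.
  move=> fA fB e x hx; case: (inv fB) => C fC eC.
  have xC : incl (imul (pr K x) C) (OK K).
    move=> y; rewrite imul_prP // => -[c hc ->]; split.
      by have := fid_sub fA hx; have := fid_sub fC hc => *; sf.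
    apply: Aint_sqr.
    have : imul (imul B B) (imul C C) (x * x * (c * c)).
      by apply: imul_in; rewrite -?e; apply: imul_in.
    by rewrite imulACA eC imul1; [case=> _; rewrite expr2 mulrACA|exact: fid_OK].
  have [x0|x0] := eqVneq x 0; first by rewrite x0; exact: (fid0 fB).
  have fx : fid K (pr K x) by apply: fid_pr => //; exact: (fid_sub fA hx).
  have : incl (imul (imul (pr K x) C) B) B.
    by rewrite -[X in incl _ X]imul1 //; apply: imulS.
  by rewrite -imulA (imulC C) eC (imul1r fx); apply; exact: pr_id.
by move=> fI fJ e; apply: incl_eq; apply: main.
Qed.

Lemma fid_inv_sub I J P : fid K I -> fid K P -> fid K J -> imul P J = OK K -> incl I P ->
  incl (imul I J) (OK K).
Proof. by move=> fI fP fJ <- h; apply: imulS. Qed.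

(** Peels one maximal factor off. If I is not inside P, some x in I has an inverse y modulo P, and j
    = x y j - (x y - 1) j lies in I; if I is inside P, then I is P times the quotient I P^-1. *)
Lemma maxid_step P I J : maxid K P -> fid K J -> fid K I -> incl I (OK K) ->
  incl (imul P J) I -> incl J (OK K) ->
  incl J I \/ exists2 I', fid K I' & [/\ incl I' (OK K), I = imul P I' & incl J I'].
Proof.
move=> [fP sP P1 mP] fJ fI sI h sJ.
have [hI|] := pselect (incl I P).
  right; case: (inv fP) => Q fQ eQ; exists (imul I Q); first exact: fid_imul.
  split; first exact: (fid_inv_sub fI fP fQ eQ hI).
    by rewrite imulCA eQ imul1r.
  by rewrite -(imul1 fJ) -eQ imulAC; apply: imulS.
move=> hn; left; have [x hx nx] : exists2 x, I x & ~ P x.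
  apply: contrapT => hh; apply: hn => x hx; apply: contrapT => nx; apply: hh; by exists x.
case: (mP x (sI _ hx)) => // -[y hy hp] j hj.
have -> : j = x * y * j - (x * y - 1) * j by ring.
apply: (fidB fI).
  by rewrite -mulrA mulrC; apply: (fidM fI) => //; apply: OKM => //; apply: sJ.
by apply: h; apply: imul_in.
Qed.

Lemma maxid_over P I : maxid K P -> fid K I -> incl I (OK K) -> incl P I ->
  I = OK K \/ I = P.
Proof.
move=> mP fI sI h; have [fP _ _ _] := mP.
have [] := maxid_step mP fid_OK fI sI _ (fun x hx => hx).
- by rewrite imul1r.
- by move=> h1; left; apply: incl_eq.
by case=> I' fI' [s1 -> s2]; right; rewrite (incl_eq s1 s2) imul1r.
Qed.

(** Two peelings. The case P = Q is included and serves for the ramified prime above 2. *)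
Lemma maxid2_over P Q I : maxid K P -> maxid K Q -> fid K I -> incl I (OK K) ->
  incl (imul P Q) I -> [\/ I = OK K, I = P, I = Q | I = imul P Q].
Proof.
move=> mP mQ fI sI h; have [fP _ _ _] := mP; have [fQ sQ _ _] := mQ.
case: (maxid_step mP fQ fI sI h sQ) => [h1|[I' fI' [s1 -> h1]]].
  by case: (maxid_over mQ fI sI h1) => ->; [constructor 1|constructor 3].
by case: (maxid_over mQ fI' s1 h1) => ->; [rewrite imul1r //; constructor 2|constructor 4].
Qed.

Lemma max_prime P x y : maxid K P -> OK K x -> OK K y -> P (x * y) -> P x \/ P y.
Proof.
move=> [fP sP P1 mP] hx hy h; case: (mP x hx) => [|[z hz hp]]; first by left.
right; have -> : y = z * (x * y) - y * (x * z - 1) by ring.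
by apply: (fidB fP); apply: (fidM fP).
Qed.

End Ideals.

(** * Quadratic extensions *)

Definition qext (K : cpred) (s : algC) : cpred :=
  fun x => exists y z, [/\ K y, K z & x = y + z * s].
Definition fracs (K : cpred) := forall x, K x -> exists2 m : nat, (0 < m)%N & m%:R * x \in Aint.

Section QExt.
Variables (K : cpred) (hK : is_subfield K) (s : algC).
Hypotheses (hs : K (s ^+ 2)) (ns : ~ K s).
Local Notation L := (qext K s).

Lemma qext_subK x : K x -> L x.
Proof. by exists x, 0; rewrite mul0r addr0; split=> //; sf. Qed.
Lemma qext_gen : L s.
Proof. by exists 0, 1; rewrite mul1r add0r; split=> //; sf. Qed.

Lemma qext_eq0 y z : K y -> K z -> y + z * s = 0 -> y = 0 /\ z = 0.
Proof.
move=> hy hz e; have [z0|z0] := eqVneq z 0; first by rewrite z0 mul0r addr0 in e.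
case: ns; have -> : s = - y / z by apply: (mulIf z0); rewrite divfK // -[- y]addr0 -e; ring.
by sf.
Qed.

Lemma qext_sf : is_subfield L.
Proof.
split.
- by apply: qext_subK; sf.
- by apply: qext_subK; sf.
- move=> x x' [y [z [a b ->]]] [y' [z' [a' b' ->]]].
  by exists (y + y'), (z + z'); split; [by sf|by sf|ring].
- by move=> x [y [z [a b ->]]]; exists (- y), (- z); split; [by sf|by sf|ring].
move=> x x' [y [z [a b ->]]] [y' [z' [a' b' ->]]]; split.
  exists (y * y' + z * z' * s ^+ 2), (y * z' + z * y'); split; [by sf|by sf|ring].
have [e|n0] := eqVneq (y + z * s) 0; first by rewrite e invr0; apply: qext_subK; sf.
have n1 : y - z * s != 0.
  apply/eqP => e; have [] := @qext_eq0 y (- z); rewrite ?mulNr //; first by sf.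
  by move=> y0 /eqP; rewrite oppr_eq0 => /eqP z0; rewrite y0 z0 mul0r addr0 eqxx in n0.
exists (y / (y ^+ 2 - z ^+ 2 * s ^+ 2)), (- z / (y ^+ 2 - z ^+ 2 * s ^+ 2)).
split; [by sf|by sf|].
have -> : y ^+ 2 - z ^+ 2 * s ^+ 2 = (y + z * s) * (y - z * s) by ring.
by field; rewrite n0 n1.
Qed.

Lemma qext_fracs : fracs K -> s \in Aint -> fracs L.
Proof.
move=> fK hsA x [y [z [/fK [m m0 hm] /fK [n n0 hn] ->]]].
exists (m * n)%N; first by rewrite muln_gt0 m0.
have -> : (m * n)%:R * (y + z * s) = n%:R * (m%:R * y) + m%:R * (n%:R * z) * s.
  by rewrite natrM; ring.
by apply: rpredD; [apply: rpredM|apply: rpredM => //; apply: rpredM]; rewrite ?rpred_nat.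
Qed.
End QExt.

(* rho is an automorphism of algC restricting to the conjugation of K(s)/K. *)
Record quad (K : cpred) (s : algC) (rho : {rmorphism algC -> algC}) : Prop := Quad {
  qd_sf : is_subfield K;
  qd_s : K (s ^+ 2);
  qd_ns : ~ K s;
  qd_fix : forall x, K x -> rho x = x;
  qd_opp : rho s = - s }.

Section Rho.
Variables (K : cpred) (s : algC) (rho : {rmorphism algC -> algC}).
Hypothesis Q : quad K s rho.
Let hK := qd_sf Q.
Let hs := qd_s Q.
Let ns := qd_ns Q.
Let rK := qd_fix Q.
Let rs := qd_opp Q.
Local Notation L := (qext K s).
Let hL := qext_sf hK hs ns.

Lemma quad_sf : is_subfield L. Proof. exact: hL. Qed.

Lemma rho_qext y z : K y -> K z -> rho (y + z * s) = y - z * s.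
Proof. by move=> a b; rewrite rmorphD rmorphM rs !rK // mulrN. Qed.

Lemma rho_L x : L x -> L (rho x).
Proof.
case=> y [z [a b ->]]; rewrite rho_qext //; exists y, (- z).
by split=> //; [sf|rewrite mulNr].
Qed.

Lemma rhoK x : L x -> rho (rho x) = x.
Proof.
by case=> y [z [a b ->]]; rewrite rho_qext // rmorphB rmorphM rs !rK // mulrN opprK.
Qed.

Lemma rho_fix x : L x -> rho x = x -> K x.
Proof.
case=> y [z [a b ->]]; rewrite rho_qext // => /addrI /eqP.
rewrite eq_sym -addr_eq0 -mulr2n mulrn_eq0 /= => /eqP ->; by rewrite addr0.
Qed.

Lemma norm_K x : L x -> K (x * rho x).
Proof.
move=> h; apply: rho_fix; first by apply: (sfM hL) => //; exact: rho_L.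
by rewrite rmorphM rhoK // mulrC.
Qed.

Lemma trace_K x : L x -> K (x + rho x).
Proof.
move=> h; apply: rho_fix; first by apply: (sfD hL) => //; exact: rho_L.
by rewrite rmorphD rhoK // addrC.
Qed.

Lemma OK_rho x : OK L x -> OK L (rho x).
Proof. by case=> a b; split; [exact: rho_L|rewrite Aint_aut]. Qed.

Lemma OK_ext x : OK K x -> OK L x.
Proof. by case=> a b; split=> //; exact: qext_subK. Qed.

Lemma OK_norm x : OK L x -> OK K (x * rho x).
Proof. by move=> h; split; [apply: norm_K; case: h|case: h => _ a; rewrite rpredM ?Aint_aut]. Qed.

Lemma OK_trace x : OK L x -> OK K (x + rho x).
Proof. by move=> h; split; [apply: trace_K; case: h|case: h => _ a; rewrite rpredD ?Aint_aut]. Qed.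

Lemma unit_norm x : unit L x -> unit K (x * rho x).
Proof.
case=> n a b; split; first by rewrite mulf_neq0 // fmorph_eq0.
  exact: OK_norm.
by rewrite invfM -fmorphV; apply: OK_norm.
Qed.

Lemma unit_rho x : unit L x -> unit L (rho x).
Proof.
by case=> n a b; split; rewrite -?fmorphV ?fmorph_eq0 //; apply: OK_rho.
Qed.

Lemma unit_ext x : unit K x -> unit L x.
Proof. by case=> n a b; split=> //; apply: OK_ext. Qed.

Lemma unit_restr x : unit L x -> K x -> unit K x.
Proof. by case=> n [_ a] [_ b] h; split=> //; split=> //; sf. Qed.

(** The conjugate ideal, written as a preimage: on L the map [rho] is its own inverse. *)
Definition rimg (I : cpred) : cpred := fun x => L x /\ I (rho x).
Definition ext (I : cpred) : cpred := imul I (OK L).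
Definition cap (I : cpred) : cpred := fun x => K x /\ I x.
(** For a quadratic step this ideal is the relative different; it contains 1 exactly when no finite
    prime ramifies. *)
Definition diffs : cpred := imul (OK L) (fun w => exists2 y, OK L y & w = y - rho y).

Lemma rimg_fid I : fid L I -> fid L (rimg I).
Proof.
move=> fI; split.
- by move=> x [].
- by split; [sf|rewrite rmorph0; exact: (fid0 fI)].
- by move=> x y [a b] [c d]; split; [sf|rewrite rmorphD; apply: (fidD fI)].
- move=> r x hr [a b]; split; first by case: hr => *; sf.
  by rewrite rmorphM; apply: (fidM fI) => //; apply: OK_rho.
- case: (fid_nz fI) => x [nx hx]; exists (rho x); rewrite fmorph_eq0; split=> //.
  have := fid_sub fI hx => lx.
  by split; [exact: rho_L|rewrite rhoK].
- case: (fid_den fI) => d [nd ld hd]; exists (rho d).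
  split; [by rewrite fmorph_eq0|exact: rho_L|move=> x [lx hx]].
  by rewrite -(rhoK lx) -rmorphM Aint_aut; apply: hd.
Qed.

Lemma rimg_rimg I : fid L I -> rimg (rimg I) = I.
Proof.
move=> fI; rewrite predeqE => x; split=> [[lx [_ h]]|h]; first by rewrite rhoK in h.
have lx := fid_sub fI h; split=> //; split; [exact: rho_L|by rewrite rhoK].
Qed.

Lemma rimg_imul I J : fid L I -> fid L J -> rimg (imul I J) = imul (rimg I) (rimg J).
Proof.
have main A B : fid L A -> fid L B -> incl (imul (rimg A) (rimg B)) (rimg (imul A B)).
  move=> fA fB; have f := rimg_fid (fid_imul hL fA fB).
  apply: imul_sub => [|x y|u v [lu hu] [lv hv]]; [exact: (fid0 f)|exact: (fidD f)|].
  by split; [sf|rewrite rmorphM; apply: imul_in].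
move=> fI fJ; apply: incl_eq; last exact: main.
move=> x [lx hx]; rewrite -(rhoK lx).
have : rimg (imul (rimg I) (rimg J)) (rho x); last by case.
rewrite -{1}(rimg_rimg fI) -{1}(rimg_rimg fJ) in hx.
by apply: (main _ _ (rimg_fid fI) (rimg_fid fJ)).
Qed.

Lemma rimg_pr a : L a -> rimg (pr L a) = pr L (rho a).
Proof.
move=> la; rewrite predeqE => x; split.
  case=> lx [r [hr e]]; exists (rho r); split; first exact: OK_rho.
  by rewrite -rmorphM -e rhoK.
case=> r [hr ->]; have := rho_L la => la'; case: (hr) => hr' _; split; first by sf.
by exists (rho r); split; [exact: OK_rho|rewrite rmorphM rhoK].
Qed.

Lemma fid_ext I : fid K I -> fid L (ext I).
Proof.
move=> fI; split.
- apply: imul_sub => [|x y|u v /(fid_sub fI) /(@qext_subK _ hK s) hu [hv _]].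
  + by sf.
  + by move=> *; sf.
  + by sf.
- exact: imul_0.
- exact: imulD.
- move=> r x hr; elim=> [|u v w hu hv _ IH]; first by rewrite mulr0; exact: imul_0.
  by rewrite mulrDr mulrCA; apply: imul_S => //; sf.
- case: (fid_nz fI) => x [nx hx]; exists x; split=> //.
  by rewrite -[x]mulr1; apply: imul_in => //; sf.
- case: (fid_den fI) => d [nd kd hd]; exists d; split=> //; first exact: qext_subK.
  apply: imul_sub => [|x y a b|u v hu [_ hv]]; first by rewrite mulr0 rpred0.
    by rewrite mulrDr rpredD.
  by rewrite mulrA rpredM // hd.
Qed.

Lemma ext_in I x : I x -> ext I x.
Proof. by move=> h; rewrite -[x]mulr1; apply: imul_in => //; sf. Qed.

Lemma extM I J : imul (ext I) (ext J) = ext (imul I J).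
Proof. by rewrite /ext imulACA (imul1 hL) //; exact: fid_OK. Qed.

Lemma ext_OK : ext (OK K) = OK L.
Proof.
apply: incl_eq => [|x hx]; last by rewrite -[x]mul1r; apply: imul_in => //; sf.
apply: imul_sub => [|x y|u v hu hv]; [by sf|by move=> *; sf|].
by have := OK_ext hu => *; sf.
Qed.

Lemma ext_pr a : K a -> a != 0 -> ext (pr K a) = pr L a.
Proof.
move=> ha na; apply: incl_eq => [|x [r [hr ->]]]; last first.
  by apply: imul_in => //; exact: pr_id.
have f := fid_pr hL (qext_subK hK s ha) na.
apply: imul_sub => [|x y|u v [r [hr ->]] hv]; [exact: (fid0 f)|exact: (fidD f)|].
exists (r * v); rewrite mulrA; split=> //; have := OK_ext hr => *; sf.
Qed.

Lemma rimg_ext I : fid K I -> rimg (ext I) = ext I.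
Proof.
have main A : fid K A -> incl (ext A) (rimg (ext A)).
  move=> fA; have f := rimg_fid (fid_ext fA).
  apply: imul_sub => [|x y|u v hu hv]; [exact: (fid0 f)|exact: (fidD f)|].
  have ku := fid_sub fA hu; have := qext_subK hK s ku => lu; case: (hv) => lv _.
  split; first by sf.
  by rewrite rmorphM rK //; apply: imul_in => //; exact: OK_rho.
move=> fI; apply: incl_eq; last exact: main.
move=> x [lx /(main _ fI) [_]]; by rewrite rhoK.
Qed.

Section Inv.
Hypothesis inv : invertible K.

(** Multiplying by the inverse of I reduces the claim to O_L ∩ K = O_K. *)
Lemma ext_contr I x : fid K I -> K x -> ext I x -> I x.
Proof.
move=> fI kx hx; case: (inv fI) => J fJ e.
have main c : J c -> OK K (c * x).
  move=> hc; have : imul J (ext I) (c * x) by apply: imul_in.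
  rewrite /ext imulA (imulC J) e -/(ext _) ext_OK => -[_ h]; split=> //.
  by have := fid_sub fJ hc => *; sf.
have : imul I J 1 by rewrite e; sf.
rewrite -[x]mul1r => h; move: 1 h; apply: imul_sub => [|y z a b|u v hu hv].
- by rewrite mul0r; exact: (fid0 fI).
- by rewrite mulrDl; apply: (fidD fI).
- by rewrite -mulrA mulrC; apply: (fidM fI) => //; apply: main.
Qed.

Lemma ext_inj I J : fid K I -> fid K J -> ext I = ext J -> I = J.
Proof.
move=> fI fJ e; apply: incl_eq => x hx.
  by apply: (ext_contr fJ); [exact: (fid_sub fI)|rewrite -e; exact: ext_in].
by apply: (ext_contr fI); [exact: (fid_sub fJ)|rewrite e; exact: ext_in].
Qed.

Hypotheses (fr : fracs L).

Lemma fid_cap A : fid L A -> rimg A = A -> fid K (cap A).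
Proof.
move=> fA rA; split.
- by move=> x [].
- by split; [sf|exact: (fid0 fA)].
- by move=> x y [a b] [c d]; split; [sf|exact: (fidD fA)].
- move=> r x hr [a b]; split; first by case: hr => *; sf.
  by apply: (fidM fA) => //; exact: OK_ext.
- case: (fid_nz fA) => x [nx hx]; have lx := fid_sub fA hx.
  case: (fr lx) => m m0 hm.
  have mx : OK L (m%:R * x) by split=> //; sf.
  have mA : A (m%:R * x) by apply: (fidM fA) => //; sf.
  exists (m%:R * x * rho (m%:R * x)); split.
    by rewrite mulf_neq0 ?fmorph_eq0 // mulf_neq0 // pnatr_eq0 -lt0n.
  split; first by apply: norm_K; case: mx.
  by rewrite mulrC; apply: (fidM fA) => //; apply: OK_rho.
- case: (fid_den fA) => d [nd ld hd]; have ld' : L d^-1 by sf.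
  case: (fr ld') => m m0 hm; exists m%:R; split; [by rewrite pnatr_eq0 -lt0n|by sf|].
  by move=> x [_ hx]; rewrite -[x](mulKf nd) mulrA rpredM // hd.
Qed.

(* Gauss's lemma: an element b * rho b' of B * rho B is a root of
   X^2 - T X + N with T in n and N in n^2, hence lies in n O_L. *)
Lemma norm_ideal B : fid L B -> exists2 n, fid K n & imul B (rimg B) = ext n.
Proof.
move=> fB; have fR := rimg_fid fB; have fC := fid_imul hL fB fR.
have rC : rimg (imul B (rimg B)) = imul B (rimg B).
  by rewrite rimg_imul // rimg_rimg // imulC.
have fn := fid_cap fC rC; exists (cap (imul B (rimg B))) => //.
set C := imul B (rimg B) in fC rC fn *.
apply: incl_eq; last first.
  apply: imul_sub => [|x y|u v [_ hu] hv]; [exact: (fid0 fC)|exact: (fidD fC)|].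
  by rewrite mulrC; apply: (fidM fC).
have fe := fid_ext fn.
apply: imul_sub => [|x y|b c hb [lc hc]]; [exact: (fid0 fe)|exact: (fidD fe)|].
have lb := fid_sub fB hb; case: (inv fn) => J fJ e.
have lrb := rho_L lb; have lrc := rho_L lc.
have hrb : rimg B (rho b) by split=> //; rewrite rhoK.
have hT : cap C (b * c + rho (b * c)).
  split; first by apply: trace_K; sf.
  apply: (fidD fC); first by apply: imul_in.
  by rewrite rmorphM mulrC; apply: imul_in.
have hN x : B x -> cap C (x * rho x).
  move=> hx; have lx := fid_sub fB hx; split; first exact: norm_K.
  by apply: imul_in => //; split; [exact: rho_L|rewrite rhoK].
have main d : J d -> OK L (d * (b * c)).
  move=> hd; have kd := fid_sub fJ hd; have := qext_subK hK s kd => ld; split; first by sf.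
  apply: (@Aint_quadratic (d * (b * c + rho (b * c))) (d * d * (b * rho b * (rho c * rho (rho c))))).
  - have : imul (cap C) J ((b * c + rho (b * c)) * d) by apply: imul_in.
    by rewrite e mulrC => -[].
  - have : imul (imul (cap C) J) (imul (cap C) J) ((b * rho b) * d * ((rho c * rho (rho c)) * d)).
      by apply: imul_in; apply: imul_in => //; apply: hN.
    rewrite e imul1 //; last exact: fid_OK.
    by case=> _ hh; have <- : b * rho b * d * (rho c * rho (rho c) * d) = d * d * (b * rho b * (rho c * rho (rho c))) by ring.
  - by rewrite rhoK // rmorphM; ring.
have : imul (cap C) J 1 by rewrite e; sf.
rewrite -[b * c]mul1r => h; move: 1 h; apply: imul_sub => [|y z p q|u v hu hv].
- by rewrite mul0r; exact: (fid0 fe).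
- by rewrite mulrDl; apply: (fidD fe).
- by rewrite -mulrA; apply: imul_in => //; apply: main.
Qed.

Lemma inv_ext : invertible L.
Proof.
move=> B fB; case: (norm_ideal fB) => n fn e; case: (inv fn) => m fm e'.
exists (imul (rimg B) (ext m)); first by apply: fid_imul => //; [exact: rimg_fid|exact: fid_ext].
by rewrite imulA e extM e' ext_OK.
Qed.

(** From (y - rho y) a = Tr(y a) - Tr(a) rho y, where both traces lie in A ∩ K because A is
    invariant. *)
Lemma diffs_mul A d : fid L A -> rimg A = A -> diffs d ->
  forall a, A a -> ext (cap A) (d * a).
Proof.
move=> fA rA hd a ha; have fe := fid_ext (fid_cap fA rA).
have hra x : A x -> A (rho x) by rewrite -{1}rA => -[].
have la := fid_sub fA ha.
move: d hd; apply: imul_sub => [|x y p q|z w hz [y hy ->]].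
- by rewrite mul0r; exact: (fid0 fe).
- by rewrite mulrDl; apply: (fidD fe).
have hya : A (y * a) by apply: (fidM fA).
case: (hy) => ly _.
have -> : z * (y - rho y) * a = z * ((y * a + rho (y * a)) * 1 - (a + rho a) * rho y).
  by rewrite rmorphM; ring.
apply: (fidM fe) => //; apply: (fidB hL fe).
  apply: imul_in; [split|by sf]; first by apply: trace_K; sf.
  by apply: (fidD fA) => //; apply: hra.
apply: imul_in; [split|exact: OK_rho]; first exact: trace_K.
by apply: (fidD fA) => //; apply: hra.
Qed.

(** E = a A^-1 with a = A ∩ K measures how far A is from being extended from K. It is invariant, so
    E^2 = E rho(E) is extended from an ideal n of K. By [diffs_mul] the element d lies in E, so d
    rho d lies in n: only ramified primes can divide n. *)
Lemma invariant_decomp A d : fid L A -> rimg A = A -> diffs d -> d != 0 ->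
  exists a E n, [/\ fid K a, fid L E & fid K n] /\
    [/\ incl E (OK L), E d, imul E A = ext a & imul E E = ext n] /\
    [/\ incl n (OK K) & n (d * rho d)].
Proof.
move=> fA rA hd nd; have fa := fid_cap fA rA; case: (inv_ext fA) => A' fA' eA.
have ld : L d.
  have : fid L (pr L 1) by apply: fid_pr; [exact: hL|sf|exact: oner_neq0].
  rewrite pr1 => fo; move: d {nd} hd; apply: imul_sub => [|x y|z w [lz _] [y hy ->]].
  - by sf.
  - by move=> *; sf.
  - by have := OK_rho hy; case: hy => ? _ [? _]; sf.
have fE := fid_imul hL (fid_ext fa) fA'.
have sE : incl (imul (ext (cap A)) A') (OK L).
  rewrite -eA; apply: imulS => //; apply: imul_sub => [|x y|u v [_ hu] hv].
  - exact: (fid0 fA).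
  - exact: (fidD fA).
  - by rewrite mulrC; apply: (fidM fA).
have Ed : imul (ext (cap A)) A' d.
  have h1 : imul A A' 1 by rewrite eA; sf.
  rewrite -[d]mulr1; move: 1 h1; apply: imul_sub => [|x y p q|u v hu hv].
  - by rewrite mulr0; exact: (fid0 fE).
  - by rewrite mulrDr; apply: (fidD fE).
  - by rewrite mulrA; apply: imul_in => //; apply: diffs_mul.
have rA' : rimg A' = A'.
  apply: (imul_inj hL inv_ext fA) => //; first exact: rimg_fid.
  by rewrite -{1}rA -rimg_imul // eA -(ext_OK) rimg_ext //; exact: fid_OK.
have rE : rimg (imul (ext (cap A)) A') = imul (ext (cap A)) A'.
  by rewrite rimg_imul ?rA' ?rimg_ext //; exact: fid_ext.
case: (norm_ideal fE); rewrite rE => n fn en.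
exists (cap A), (imul (ext (cap A)) A'), n; split=> //; split.
  by split=> //; rewrite -imulA (imulC A') eA imul1r //; exact: fid_ext.
split.
  move=> x hx; have kx := fid_sub fn hx; split=> //.
  have : imul (OK L) (OK L) x by apply: (imulS sE sE); rewrite en; exact: ext_in.
  by rewrite imul1 //; [case|exact: fid_OK].
apply: (ext_contr fn); first exact: norm_K.
rewrite -en; apply: imul_in => //.
rewrite -rE; split; first exact: rho_L.
by rewrite rhoK.
Qed.

Lemma unramified_invariant A : fid L A -> rimg A = A -> diffs 1 ->
  exists2 a, fid K a & A = ext a.
Proof.
move=> fA rA h1; exists (cap A); first exact: fid_cap.
apply: incl_eq => [x hx|]; first by rewrite -[x]mul1r; apply: diffs_mul.
apply: imul_sub => [|x y|u v [_ hu] hv]; [exact: (fid0 fA)|exact: (fidD fA)|].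
by rewrite mulrC; apply: (fidM fA).
Qed.

(** The resolvent 1 + x works unless it vanishes, and for x = -1 the generator s does. *)
Lemma hilbert90 x : L x -> x * rho x = 1 -> exists b, [/\ L b, b != 0 & b = x * rho b].
Proof.
move=> lx e; have [e1|n1] := eqVneq x (-1).
  have sn : s != 0 by apply: contra_not_neq ns => ->; sf.
  by exists s; rewrite rs e1 mulN1r opprK; split=> //; exact: qext_gen.
exists (1 + x); split; first by sf.
  by rewrite addrC addr_eq0.
by rewrite rmorphD rmorph1 mulrDr e mulr1 addrC.
Qed.

(** Multiplying the hypothesis by its conjugate gives a^4 = (g rho g) already in K, and two
    applications of [no2] take the fourth root. *)
Lemma ext_prin_sq a g : no2 K -> fid K a -> L g -> g != 0 ->
  imul (ext a) (ext a) = pr L g -> prin K a.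
Proof.
move=> n2 fa lg ng e; have faa := fid_imul hK fa fa.
have e2 : imul (ext a) (ext a) = pr L (rho g).
  by rewrite -rimg_pr // -e extM rimg_ext.
apply: (n2 _ fa); apply: (n2 _ faa).
exists (g * rho g); have kN := norm_K lg.
have nN : g * rho g != 0 by rewrite mulf_neq0 ?fmorph_eq0.
split=> //; apply: ext_inj; [by apply: fid_imul|exact: fid_pr|].
rewrite ext_pr // -extM -extM {1}e e2 imul_pr // ?fmorph_eq0 //; exact: rho_L.
Qed.

(* A class killed by 1 + rho and by 2 contains an ideal invariant under rho. *)
Lemma ambiguous_rep B g n :
  (forall x, L x -> x != 0 -> unit K (x * rho x) ->
     exists2 e, unit L e & e * rho e = x * rho x) ->
  fid L B -> L g -> g != 0 -> imul B B = pr L g -> L n -> n != 0 -> imul B (rimg B) = pr L n ->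
  exists b, [/\ L b, b != 0 & rimg (imul (pr L b) B) = imul (pr L b) B].
Proof.
move=> h1 fB lg ng e ln nn en; have fR := rimg_fid fB.
pose al := n / g; have la : L al by rewrite /al; sf.
have na : al != 0 by rewrite mulf_neq0 ?invr_eq0.
have eR : rimg B = imul (pr L al) B.
  apply: (imul_inj hL inv_ext fB) => //.
    by apply: fid_imul => //; apply: fid_pr.
  by rewrite imulCA e imul_pr // en /al divfK.
have lra := rho_L la.
have nra : rho al != 0 by rewrite fmorph_eq0.
have fpa := fid_pr hL la na.
have ua : unit K (al * rho al).
  apply: unit_restr; last exact: norm_K.
  rewrite -[_ * _]divr1; apply: (pr_eq hL) => //; [by sf|by rewrite mulf_neq0|exact: oner_neq0|].
  apply: (imul_inj hL inv_ext fB); [by apply: fid_pr => //; [sf|rewrite mulf_neq0]|by rewrite pr1; exact: fid_OK|].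
  have e3 : imul (pr L (rho al)) (imul (pr L al) B) = B.
    by rewrite -[in RHS](rimg_rimg fB) eR rimg_imul // rimg_pr // eR.
  by rewrite pr1 imul1r // -[in RHS]e3 imulA imul_pr // imulC (mulrC al).
case: (h1 al la na ua) => e' ue ee; have [ne [le _] [le' _]] := ue.
case: (@hilbert90 (al / e')); first by sf.
  by rewrite rmorphM fmorphV mulrACA -invfM ee divff // mulf_neq0.
move=> b [lb nb eb]; exists b; split=> //.
have fb := fid_pr hL lb nb.
rewrite rimg_imul // rimg_pr // eR imulA imul_pr //.
congr imul; have -> : rho b * al = b * e'.
  by rewrite {2}eb; field; exact: ne.
exact: pr_unit.
Qed.

(** Let B^2 be principal. The ideal B rho(B) is invariant with principal square, so [step] makes it
    principal. Then [ambiguous_rep] yields an invariant ideal in the class of B, and [step] applies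
    once more. *)
Lemma ambiguous_no2 : no2 K ->
  (forall x, L x -> x != 0 -> unit K (x * rho x) ->
     exists2 e, unit L e & e * rho e = x * rho x) ->
  (forall A, fid L A -> rimg A = A ->
     exists x a, [/\ L x, x != 0, fid K a & A = imul (pr L x) (ext a)]) ->
  no2 L.
Proof.
move=> n2 h1 h2.
have step A : fid L A -> rimg A = A -> prin L (imul A A) -> prin L A.
  move=> fA rA; case: (h2 A fA rA) => x [a [lx nx fa ->]] [g [ng lg e]].
  have lx2 : L (x * x)^-1 by sf.
  have nx2 : (x * x)^-1 != 0 by rewrite invr_eq0 mulf_neq0.
  have : prin K a.
    apply: (@ext_prin_sq a ((x * x)^-1 * g)) => //; [by sf|by rewrite mulf_neq0|].
    have fe := fid_ext fa; have fee := fid_imul hL fe fe.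
    rewrite -(imul_pr hL) // -e imulACA imul_pr // pr_imulK //; first by sf.
    by rewrite mulf_neq0.
  case=> b [nb kb ->]; rewrite ext_pr //.
  by apply: prinM => //; apply: prin_pr => //; exact: qext_subK.
move=> B fB [g [ng lg e]]; have fR := rimg_fid fB.
have : prin L (imul B (rimg B)).
  apply: step; [exact: fid_imul|by rewrite rimg_imul // rimg_rimg // imulC|].
  rewrite imulACA -rimg_imul // e rimg_pr //.
  have lrg := rho_L lg.
  by apply: prinM => //; apply: prin_pr => //; rewrite fmorph_eq0.
case=> n [nn ln en].
have [b [lb nb eb]] := ambiguous_rep h1 fB lg ng e ln nn en.
have fb := fid_pr hL lb nb.
have : prin L (imul (pr L b) B).
  apply: step => //; first exact: fid_imul.
  by rewrite imulACA e !imul_pr //; apply: prin_pr; [sf|rewrite !mulf_neq0].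
move=> hp; rewrite -(pr_imulK hL lb nb fB); apply: prinM => //.
by apply: prin_pr; [sf|rewrite invr_eq0].
Qed.
End Inv.
End Rho.

(** * Number fields and multiquadratic towers *)

Lemma natP_min (P : nat -> Prop) : (exists n, P n) -> exists2 n, P n & forall m, P m -> (n <= m)%N.
Proof.
move=> [n hn]; have h : exists n, `[< P n >] by exists n; apply/asboolP.
case: (ex_minnP h) => m /asboolP hm hmin; exists m => // k hk; apply: hmin; exact/asboolP.
Qed.

Lemma fid_denn K I : is_subfield K -> fracs K -> fid K I ->
  exists2 m : nat, (0 < m)%N & forall x, I x -> OK K (m%:R * x).
Proof.
move=> hK fr fI; case: (fid_den fI) => d [nd kd hd].
have kd' : K d^-1 by sf.
case: (fr _ kd') => m m0 hm; exists m => // x hx; have kx := fid_sub fI hx.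
split; first by sf.
by rewrite -[x](mulKf nd) mulrA rpredM // hd.
Qed.

Lemma euclid_pid K (f : algC -> algC) : is_subfield K -> fracs K ->
  (forall x y, K x -> K y -> f (x * y) = f x * f y) ->
  (forall x, OK K x -> f x \in Num.nat) ->
  (forall x, K x -> f x = 0 <-> x = 0) ->
  (forall x, K x -> exists2 w, OK K w & f (x - w) < 1) -> pid K.
Proof.
move=> hK fr fM fN f0 fE I fI; case: (fid_denn hK fr fI) => m m0 hm.
have hex : exists n : nat, exists a, [/\ I a, a != 0 & f (m%:R * a) = n%:R].
  case: (fid_nz fI) => a [na ha]; case/natrP: (fN _ (hm _ ha)) => n en.
  by exists n, a.
have [n [a [ha na en]] hmin] := natP_min hex.
have ka := fid_sub fI ha.
exists a; split=> //; apply: incl_eq; last exact: pr_mem.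
move=> b hb; have kb := fid_sub fI hb; have kba : K (b / a) by sf.
case: (fE _ kba) => w hw hlt; have kw := OK_sub hw.
have hc : I (b - w * a) by apply: (fidB hK fI) => //; apply: (fidM fI).
have [c0|nc] := eqVneq (b - w * a) 0.
  by exists w; split=> //; rewrite mulrC; apply/eqP; rewrite -subr_eq0 c0.
case/natrP: (fN _ (hm _ hc)) => k ek.
have : (n <= k)%N by apply: hmin; exists (b - w * a).
have e1 : m%:R * (b - w * a) = m%:R * a * (b / a - w) by field.
rewrite leqNgt => /negP[]; rewrite -(ltr_nat algC) -ek e1 fM; [|by sf|by sf].
rewrite en gtr_pMr // ltr0n lt0n; apply/eqP => n0.
have /f0 : f (m%:R * a) = 0 by rewrite en n0.
move=> /(_ (sfM hK (sf_nat hK m) ka)) /eqP; rewrite mulf_eq0 (negPf na) orbF.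
by rewrite pnatr_eq0 => /eqP m00; rewrite m00 in m0.
Qed.

Lemma pid_invertible K : is_subfield K -> pid K -> invertible K.
Proof.
move=> hK hp I /hp [a [na ka ->]]; exists (pr K a^-1).
  by apply: fid_pr => //; [sf|rewrite invr_eq0].
by rewrite imul_pr ?divff ?pr1 //; [sf|rewrite invr_eq0].
Qed.

Lemma pid_no2 K : pid K -> no2 K. Proof. by move=> h I /h. Qed.

(** The data carried up the tower. The free family [bs] spans a lattice between [dn] O_K and O_K;
    this form is stable under a quadratic step, where a relative integral basis may fail to exist.
    The involution [cj] is complex conjugation on the indices of the embeddings. *)
Record nf (K : cpred) := Nf {
  nf_sf : is_subfield K;
  nf_fr : fracs K;
  nf_inv : invertible K;
  ix : finType;
  em : ix -> {rmorphism algC -> algC};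
  bs : ix -> algC;
  dn : nat;
  cj : ix -> ix;
  nf_norm : forall x, K x -> \prod_i em i x \in Crat;
  nf_bs : forall i, OK K (bs i);
  nf_dn : (0 < dn)%N;
  nf_lat : forall x, OK K x -> exists z : ix -> int, dn%:R * x = \sum_i (z i)%:~R * bs i;
  nf_free : forall z : ix -> int, \sum_i (z i)%:~R * bs i = 0 -> forall i, z i = 0;
  nf_cjK : involutive cj;
  nf_cjP : forall i x, K x -> em (cj i) x = (em i x)^* }.
Arguments nf_bs {K} _ _.
Arguments dn {K} _.
Arguments ix {K} _.

Section Tower.
Variables (K : cpred) (N : nf K) (s : algC) (rho : {rmorphism algC -> algC}).
Hypotheses (Q : quad K s rho) (sA : s \in Aint).
Local Notation L := (qext K s).
Let hK := qd_sf Q.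
Let hs := qd_s Q.
Let ns := qd_ns Q.
Let rK := qd_fix Q.
Let rs := qd_opp Q.
Let hL := quad_sf Q.

Let em' (i : (ix N * bool)%type) : {rmorphism algC -> algC} :=
  if i.2 then GRing.RMorphism.clone _ _ (em i.1 \o rho) _ else em i.1.
Let bs' (i : (ix N * bool)%type) := if i.2 then bs i.1 * s else bs i.1.
(** The conjugate of [em i] agrees with [em (cj i)] on K but may send s to the opposite root. This
    bit records the sign, and [cj'] twists the choice of the extension to L by it. *)
Let tt (i : ix N) := (em i s)^* != em (cj i) s.
Let cj' (i : (ix N * bool)%type) : (ix N * bool)%type := (cj i.1, i.2 (+) tt i.1).

Let sum' (F : (ix N * bool)%type -> algC) :
  \sum_i F i = \sum_i F (i, false) + \sum_i F (i, true).
Proof.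
transitivity (\sum_p F (p.1, p.2)); first by apply: eq_bigr => -[].
rewrite -(pair_bigA _ (fun i b => F (i, b))) /= -big_split /=.
by apply: eq_bigr => i _; rewrite big_bool addrC.
Qed.

Lemma nf_qext : {N' : nf L | [/\ #|ix N'| = (2 * #|ix N|)%N,
  forall i : ix N, exists j : ix N', forall x, em j x = em i x,
  forall j : ix N', exists j' : ix N', forall x, L x -> em j (rho x) = em j' x &
  (forall i : ix N, cj i <> i) -> forall j : ix N', cj j <> j]}.
Proof.
have sn0 : s != 0 by apply: contra_not_neq ns => ->; exact: sf0.
have fr := qext_fracs (nf_fr N) sA.
have hnorm x : L x -> \prod_i em' i x \in Crat.
  move=> lx; have -> : \prod_i em' i x = \prod_p em' (p.1, p.2) x by apply: eq_bigr => -[].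
  rewrite -(pair_bigA _ (fun i b => em' (i, b) x)) /=.
  rewrite (eq_bigr (fun i => em i (x * rho x))); first exact: (nf_norm N (norm_K Q lx)).
  by move=> i _; rewrite big_bool /em' /= rmorphM mulrC.
have hbs i : OK L (bs' i).
  have [a b] := nf_bs N i.1; have := qext_subK hK s a => c; have := qext_gen hK s => d.
  by rewrite /bs'; case: i.2; split=> //; sf.
have hfree (z : (ix N * bool)%type -> int) : \sum_i (z i)%:~R * bs' i = 0 -> forall i, z i = 0.
  rewrite sum' /bs' /=; under [X in _ + X]eq_bigr do rewrite mulrA.
  rewrite -mulr_suml => e.
  have hb (F : ix N -> int) : K (\sum_i (F i)%:~R * bs i).
    by apply: sf_sum => // i _; have [a _] := nf_bs N i; sf.
  have [] := qext_eq0 hK ns (hb _) (hb _) e => e1 e2 [i []].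
    exact: (nf_free (z := fun i => z (i, true)) e2).
  exact: (nf_free (z := fun i => z (i, false)) e1).
have ka' : K (s ^+ 2)^-1 by sf.
have /cid2 [m m0 hm] := nf_fr N ka'.
(* For x = y + z s integral, 2 y is a trace and 2 m z = (m / s^2) (x - rho x) s is integral; hence
   the new denominator 2 m [dn]. *)
have hlat x : OK L x -> exists z : (ix N * bool)%type -> int,
    (2 * m * dn N)%:R * x = \sum_i (z i)%:~R * bs' i.
  move=> hx; have [lx ax] := hx; have := OK_trace Q hx.
  case: (lx) ax => y [z [ky kz ->]] ax.
  rewrite (rho_qext Q ky kz).
  have -> : y + z * s + (y - z * s) = 2%:R * y by ring.
  move=> /(nf_lat N) [z1 e1].
  have : OK K (2%:R * m%:R * z).
    split; first by sf.
    have -> : 2%:R * m%:R * z = (m%:R * (s ^+ 2)^-1) * (((y + z * s) - rho (y + z * s)) * s).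
      by rewrite (rho_qext Q ky kz); field; exact: sn0.
    by rewrite rpredM // rpredM // rpredB // Aint_aut.
  move=> /(nf_lat N) [z2 e2].
  exists (fun i => if i.2 then z2 i.1 else (m%:Z * z1 i.1)%R).
  have e3 : \sum_i (m%:Z * z1 i)%:~R * bs i = m%:R * \sum_i (z1 i)%:~R * bs i.
    by rewrite mulr_sumr; apply: eq_bigr => i _; rewrite rmorphM mulrA.
  have e4 : \sum_i (z2 i)%:~R * (bs i * s) = (\sum_i (z2 i)%:~R * bs i) * s.
    by rewrite mulr_suml; apply: eq_bigr => i _; rewrite mulrA.
  by rewrite sum' /bs' /= e3 e4 -e1 -e2 !natrM; ring.
have ttE (i : ix N) : (em i s)^* = (-1) ^+ tt i * em (cj i) s.
  rewrite /tt; have [->|h] := eqVneq; first by rewrite mul1r.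
  have : ((em i s)^*) ^+ 2 == (em (cj i) s) ^+ 2.
    by rewrite -!rmorphXn /= nf_cjP.
  by rewrite eqf_sqr (negPf h) /= => /eqP ->; rewrite mulN1r.
have cjK' : involutive cj'.
  move=> [i b]; rewrite /cj' /= nf_cjK; congr pair.
  suff -> : tt (cj i) = tt i by rewrite -addbA addbb addbF.
  rewrite /tt nf_cjK; congr negb; rewrite -(inj_eq (can_inj (@conjCK _))) conjCK.
  by rewrite eq_sym.
have cjP' i x : L x -> em' (cj' i) x = (em' i x)^*.
  case: i => i b [y [z [ky kz ->]]].
  have eL j c : em' (j, c) (y + z * s) = em j y + em j z * ((-1) ^+ c * em j s).
    rewrite /em'; case: c => /=; last by rewrite mul1r rmorphD rmorphM.
    by rewrite (rho_qext Q) // rmorphB rmorphM mulN1r mulrN.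
  rewrite /cj' !eL /= rmorphD !rmorphM /= (nf_cjP i ky) (nf_cjP i kz) ttE rmorphXn rmorphN1.
  by rewrite signr_addb -!mulrA.
have d0 : (0 < 2 * m * dn N)%N by rewrite !muln_gt0 m0 nf_dn.
have inv' := inv_ext Q (nf_inv N) fr.
exists (Nf hL fr inv' hnorm hbs d0 hlat hfree cjK' cjP'); split.
- by rewrite /= card_prod card_bool mulnC.
- by move=> i; exists (i, false).
- move=> [i b]; exists (i, ~~ b) => x lx /=; rewrite /em' /=; case: b => //=.
  by rewrite (rhoK Q lx).
- by move=> h [i b] [] /h.
Qed.
End Tower.

(** * Fields generated by finitely many elements, conjugations, and the base field Q *)

Definition gen (gs : seq algC) : cpred := fun x =>
  forall S, is_subfield S -> (forall a, a \in gs -> S a) -> S x.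

Lemma gen_sf gs : is_subfield (gen gs).
Proof.
split=> [S hS _|S hS _|x y hx hy S hS h|x hx S hS h|x y hx hy].
- exact: sf0.
- exact: sf1.
- by apply: sfD => //; [exact: hx|exact: hy].
- by apply: sfN => //; exact: hx.
split=> S hS h; first by apply: sfM => //; [exact: hx|exact: hy].
by apply: sfV => //; exact: hx.
Qed.

Lemma gen_in gs a : a \in gs -> gen gs a.
Proof. by move=> h S hS; apply. Qed.

Lemma gen_sub gs S : is_subfield S -> (forall a, a \in gs -> S a) -> incl (gen gs) S.
Proof. by move=> hS h x; apply. Qed.

Lemma multiquad_gen s : multiquad s = gen [seq sqrtC (a%:~R) | a : int <- s].
Proof.
rewrite predeqE => x; split=> h S hS hg; apply: h => // a; last by case/mapP => b hb ->; exact: hg.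
by move=> ha; apply: hg; apply: map_f.
Qed.

Lemma gen_cons gs s : gen gs (s ^+ 2) -> ~ gen gs s -> gen (s :: gs) = qext (gen gs) s.
Proof.
move=> hs ns; apply: incl_eq.
  apply: gen_sub => [|a]; first exact: (qext_sf (gen_sf gs)).
  rewrite inE => /predU1P[->|/gen_in h]; first exact: (qext_gen (gen_sf gs)).
  exact: (qext_subK (gen_sf gs)).
have hG := gen_sf (s :: gs).
have sub : incl (gen gs) (gen (s :: gs)).
  by apply: gen_sub => // a ha; apply: gen_in; rewrite inE ha orbT.
move=> x [y [z [/sub ky /sub kz ->]]]; have : gen (s :: gs) s by apply: gen_in; rewrite mem_head.
by move=> ks; sf.
Qed.

Lemma gen_cons_in gs s : gen gs s -> gen (s :: gs) = gen gs.
Proof.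
move=> hs; apply: incl_eq; apply: gen_sub; try exact: gen_sf.
  by move=> a; rewrite inE => /predU1P[->//|/gen_in].
by move=> a ha; apply: gen_in; rewrite inE ha orbT.
Qed.

(** The conjugation y + z s -> y - z s is built on an abstract number field Qs whose image in [algC]
    is K(s), and is then extended to an automorphism of [algC]. *)
Lemma rho_exists gs s : gen gs (s ^+ 2) -> ~ gen gs s ->
  {rho : {rmorphism algC -> algC} | quad (gen gs) s rho}.
Proof.
set K := gen gs => hs ns; have hK : is_subfield K := gen_sf gs.
have hL := qext_sf hK hs ns; set L := qext K s in hL.
case: (num_field_exists (s :: gs)) => Qs [QC [s1 es genQ]].
have img : forall x, L (QC x).
  have main rs : (forall r, r \in rs -> L (QC r)) -> forall x, x \in <<1 & rs>>%VS -> L (QC x).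
    elim/last_ind: rs => [|rs r IH] h x.
      rewrite adjoin_nil subfield_closed => /vlineP[a ->].
      rewrite -in_algE /= rmorphZ_num rmorph1 mulr1; apply: (sf_rat hL); exact: Crat_rat.
    rewrite adjoin_rcons => /Fadjoin_polyP[p hp ->].
    rewrite horner_coef rmorph_sum; apply: (sf_sum hL) => i _.
    rewrite rmorphM rmorphXn; apply: (sfM hL).
      apply: IH => [r' hr'|]; last exact: (polyOverP hp).
      by apply: h; rewrite mem_rcons inE hr' orbT.
    by apply: (sfX hL); apply: h; rewrite mem_rcons mem_head.
  move=> x; apply: (main s1); last by rewrite genQ memvf.
  move=> r hr; have : QC r \in s :: gs by rewrite -es map_f.
  rewrite inE => /predU1P[->|/gen_in h]; first exact: (qext_gen hK).
  exact: (qext_subK hK).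
have surj : forall x, L x -> exists y, QC y = x.
  have hI : is_subfield (fun x => exists y, QC y = x).
    split; [by exists 0; rewrite rmorph0|by exists 1; rewrite rmorph1| | |].
    - by move=> _ _ [a <-] [b <-]; exists (a + b); rewrite rmorphD.
    - by move=> _ [a <-]; exists (- a); rewrite rmorphN.
    move=> _ _ [a <-] [b <-]; split; first by exists (a * b); rewrite rmorphM.
    by exists a^-1; rewrite fmorphV.
  rewrite /L -(gen_cons hs ns); apply: gen_sub => // a; rewrite -es => /mapP[y _ ->]; by exists y.
have sgE x : exists w, exists y z, [/\ K y, K z, QC x = y + z * s & QC w = y - z * s].
  case: (img x) => y [z [ky kz e]]; case: (surj (y - z * s)).
    by exists y, (- z); split; [|sf|rewrite mulNr].
  by move=> w hw; exists w, y, z.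
pose phi x := projT1 (cid (sgE x)).
have phiP x y z : K y -> K z -> QC x = y + z * s -> QC (phi x) = y - z * s.
  move=> ky kz e; rewrite /phi; case: cid => w [y' [z' [ky' kz' e' ew]]] /=; rewrite ew.
  have [] := @qext_eq0 K hK s ns (y - y') (z - z'); [by sf|by sf| |].
    by have /eqP := e'; rewrite e -subr_eq0 => /eqP <-; ring.
  by move=> /eqP; rewrite subr_eq0 => /eqP <- /eqP; rewrite subr_eq0 => /eqP <-.
have phiB : zmod_morphism phi.
  move=> a b; apply: (fmorph_inj QC); rewrite rmorphB.
  case: (img a) => y [z [ky kz e]]; case: (img b) => y' [z' [ky' kz' e']].
  rewrite (phiP a y z) // (phiP b y' z') // (phiP (a - b) (y - y') (z - z')); [by ring|by sf|by sf|].
  by rewrite rmorphB e e'; ring.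
have phiM : monoid_morphism phi.
  split; first by apply: (fmorph_inj QC); rewrite (phiP 1 1 0) ?rmorph1; [ring|sf|sf|ring].
  move=> a b; apply: (fmorph_inj QC); rewrite rmorphM.
  case: (img a) => y [z [ky kz e]]; case: (img b) => y' [z' [ky' kz' e']].
  rewrite (phiP a y z) // (phiP b y' z') //.
  rewrite (phiP (a * b) (y * y' + z * z' * s ^+ 2) (y * z' + z * y')); [by ring|by sf|by sf|].
  by rewrite rmorphM e e'; ring.
pose phi1 := GRing.isZmodMorphism.Build _ _ phi phiB.
pose phi2 := GRing.isMonoidMorphism.Build _ _ phi phiM.
pose phiR : {rmorphism Qs -> Qs} := HB.pack phi phi1 phi2.
have [nu hnu] := extend_algC_subfield_aut QC phiR.
exists nu; split=> // [x kx|].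
  case: (surj x); first exact: qext_subK.
  move=> y ey; rewrite -ey -hnu /= (phiP y x 0); rewrite ?ey //; [by rewrite mul0r subr0| |]; first by sf.
  by rewrite mul0r addr0.
case: (surj s); first exact: qext_gen.
move=> y ey; rewrite -{1}ey -hnu /= (phiP y 0 1); rewrite ?ey ?mul1r ?add0r //; by sf.
Qed.

Lemma gen_nil : gen [::] = (fun x => x \in Crat).
Proof.
apply: incl_eq; last by move=> x hx; apply: sf_rat => //; exact: gen_sf.
apply: gen_sub => //; split=> [||x y|x|x y a b]; rewrite ?rpred0 ?rpred1 //.
- exact: rpredD.
- by rewrite rpredN.
by rewrite rpredM ?rpredV.
Qed.

Lemma OK_Q x : OK (gen [::]) x <-> x \in Num.int.
Proof.
split; first by rewrite gen_nil => -[]; exact: Cint_rat_Aint.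
by case/intrP => n ->; apply: OK_int; exact: gen_sf.
Qed.

Lemma fracs_Q : fracs (gen [::]).
Proof.
move=> x; rewrite gen_nil => /CratP[a ->]; exists `|denq a|%N.
  by rewrite absz_gt0 denq_eq0.
rewrite -[in X in _ * X](divq_num_den a) fmorph_div !rmorph_int.
rewrite natr_absz ger0_norm ?denq_ge0 // mulrC divfK ?Aint_int //.
by rewrite intr_eq0 denq_eq0.
Qed.

Lemma pid_Q : pid (gen [::]).
Proof.
apply: (@euclid_pid _ (fun x => `|x|)); [exact: gen_sf|exact: fracs_Q|..].
- by move=> x y _ _; rewrite normrM.
- by move=> x /OK_Q; exact: natr_norm_int.
- by move=> x _; split=> [/eqP|->]; rewrite ?normr_eq0 ?normr0 // => /eqP.
move=> x; rewrite gen_nil => /Creal_Crat rx; exists (Num.floor x)%:~R.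
  by apply: OK_int; rewrite -gen_nil; exact: gen_sf.
have /andP[h1 h2] := real_floor_itv rx.
by rewrite ger0_norm ?subr_ge0 // ltrBlDr addrC -[X in _ + X](rmorph1 (intr : int -> algC)) -rmorphD.
Qed.

Lemma nf_Q : {N : nf (gen [::]) | #|ix N| = 1%N}.
Proof.
have hK := gen_sf [::].
have inv := pid_invertible hK pid_Q.
pose e (i : Datatypes.unit) : {rmorphism algC -> algC} := GRing.RMorphism.clone _ _ idfun _.
have hn x : gen [::] x -> \prod_i e i x \in Crat.
  by rewrite gen_nil => h; rewrite rpred_prod.
have hb (i : Datatypes.unit) : OK (gen [::]) 1 by apply: OK1.
have hl x : OK (gen [::]) x -> exists z : Datatypes.unit -> int, 1%N%:R * x = \sum_i (z i)%:~R * 1.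
  move=> /OK_Q /intrP[n ->]; exists (fun=> n).
  by rewrite (big_pred1 tt) ?mul1r ?mulr1 // => -[].
have hf (z : Datatypes.unit -> int) : \sum_i (z i)%:~R * (1 : algC) = 0 -> forall i, z i = 0.
  rewrite (big_pred1 tt) ?mulr1 => [|[]//] /eqP; rewrite intr_eq0 => /eqP h [] //.
have hc (i : Datatypes.unit) x : gen [::] x -> e (id i) x = (e i x)^*.
  by rewrite gen_nil => h /=; rewrite conj_Crat.
exists (Nf hK fracs_Q inv hn hb (ltn0Sn 0) hl hf (fun=> erefl) hc).
by rewrite /= card_unit.
Qed.

Lemma nf_gen_cons gs s : nf (gen gs) -> s \in Aint -> gen gs (s ^+ 2) -> nf (gen (s :: gs)).
Proof.
move=> N sA hs; have [h|ns] := pselect (gen gs s); first by rewrite gen_cons_in.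
rewrite gen_cons //; have [rho Q] := rho_exists hs ns.
by have [N' _] := nf_qext N Q sA.
Qed.

Lemma sqrt_int_Aint (a : int) : sqrtC (a%:~R : algC) \in Aint.
Proof. by apply: Aint_sqr; rewrite sqrtCK Aint_int. Qed.

Lemma nf_multiquad s : nf (multiquad s).
Proof.
rewrite multiquad_gen; elim: s => [|a s IH] /=; first by have [] := nf_Q.
apply: nf_gen_cons => //; first exact: sqrt_int_Aint.
by rewrite sqrtCK; apply: sf_int; exact: gen_sf.
Qed.

(** * The class number and its parity *)

Lemma pigeon (T1 T2 : finType) (f : T1 -> T2) : (#|T2| < #|T1|)%N ->
  exists x y, x != y /\ f x = f y.
Proof.
move=> h; have /injectivePn[x [y nxy e]] : ~~ injectiveb f.
  by apply/negP => /injectiveP /leq_card; rewrite leqNgt h.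
by exists x, y.
Qed.

Lemma odd_card_invol (T : finType) (A : {set T}) (f : T -> T) :
  (forall x, x \in A -> f x \in A) -> (forall x, x \in A -> f (f x) = x) ->
  odd #|A| = odd #|[set x in A | f x == x]|.
Proof.
move=> hA hf; set F := [set x in A | f x == x].
pose U := [set x in A | (enum_rank x < enum_rank (f x))%N].
pose V := [set x in A | (enum_rank (f x) < enum_rank x)%N].
have eUV : V = f @: U.
  apply/setP => x; rewrite inE; apply/andP/imsetP.
    move=> [a b]; exists (f x); rewrite ?hf //.
    by rewrite inE hA //= hf.
  case=> y; rewrite inE => /andP[a b] ->; rewrite hA // hf //.
have cUV : #|V| = #|U|.
  rewrite eUV card_in_imset // => x y; rewrite !inE => /andP[a _] /andP[b _] e.
  by rewrite -(hf x a) e hf.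
have eA : A = F :|: (U :|: V).
  apply/setP => x; rewrite !inE -!andb_orr; case: (x \in A) => //=.
  have [//|n] := eqVneq (f x) x; rewrite /= -neq_ltn.
  by apply/esym/negP => /eqP /val_inj /enum_rank_inj e; rewrite -e eqxx in n.
have d1 : [disjoint U & V].
  rewrite -setI_eq0; apply/eqP/setP => x; rewrite !inE; case: (x \in A) => //=.
  by apply/negP => /andP[a b]; have := ltn_trans a b; rewrite ltnn.
have d2 : [disjoint F & U :|: V].
  rewrite -setI_eq0; apply/eqP/setP => x; rewrite !inE; case: (x \in A) => //=.
  by case: eqP => //= ->; rewrite ltnn.
rewrite {1}eA cardsU (disjoint_setI0 d2) cards0 subn0 cardsU (disjoint_setI0 d1) cards0 subn0.
by rewrite cUV addnn oddD odd_double addbF.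
Qed.

Section ClassNumber.
Variables (K : cpred) (N : nf K).
Let hK := nf_sf N.
Let inv := nf_inv N.
Local Notation ix := (ix N).

Definition Nm x := \prod_(i : ix) em i x.

Lemma NmM x y : Nm (x * y) = Nm x * Nm y.
Proof. by rewrite /Nm -big_split; apply: eq_bigr => i _; rewrite rmorphM. Qed.

Lemma em_neq0 (i : ix) x : x != 0 -> em i x != 0.
Proof. by rewrite fmorph_eq0. Qed.

Lemma Nm_neq0 x : x != 0 -> Nm x != 0.
Proof. by move=> h; apply/prodf_neq0 => i _; apply: em_neq0. Qed.

Lemma Nm_int x : OK K x -> Nm x \in Num.int.
Proof.
case=> kx ax; apply: Cint_rat_Aint; first exact: nf_norm.
by apply: rpred_prod => i _; rewrite Aint_aut.
Qed.

Lemma Nm_ge1 x : OK K x -> x != 0 -> 1 <= `|Nm x|.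
Proof. by move=> a b; apply: norm_intr_ge1; [exact: Nm_int|exact: Nm_neq0]. Qed.

Lemma ix_inh : exists i : ix, true.
Proof.
case: (pickP (@predT ix)) => [i _|h]; first by exists i.
have [z] := nf_lat N (OK1 hK); rewrite mulr1 big_pred0 // => /eqP.
by rewrite pnatr_eq0; have := nf_dn N; rewrite lt0n => /negPf ->.
Qed.

(** The lattice coordinates of [dn] x modulo [dn] m determine x modulo m. *)
Lemma residues (m : nat) : (0 < m)%N -> exists (T : finType) (r : algC -> T),
  forall x y, OK K x -> OK K y -> r x = r y -> exists2 w, OK K w & x - y = m%:R * w.
Proof.
move=> m0; have d0 : (0 < dn N * m)%N by rewrite muln_gt0 nf_dn.
have hz x : exists z : ix -> int, OK K x -> (dn N)%:R * x = \sum_i (z i)%:~R * bs i.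
  by have [/(nf_lat N) [z e]|h] := pselect (OK K x); [exists z|exists (fun=> 0)].
pose z x := projT1 (cid (hz x)).
have zP x : OK K x -> (dn N)%:R * x = \sum_i (z x i)%:~R * bs i.
  by move=> h; rewrite /z; case: cid => /= z0; apply.
set D := (dn N * m)%N in d0.
pose r x : {ffun ix -> 'I_D.-1.+1} := [ffun i => inord `|(z x i %% D%:Z)%Z|%N].
exists _, r => x y hx hy e.
have q i : exists c, z x i - z y i = c * D%:Z.
  apply/dvdzP; rewrite -eqz_mod_dvd.
  have Dn : D%:Z != 0 by rewrite eqz_nat -lt0n.
  have hb u : (`|(u %% D%:Z)%Z| < D.-1.+1)%N.
    by rewrite prednK // -ltz_nat gez0_abs ?modz_ge0 // ltz_pmod // ltz_nat.
  have := congr1 (fun g : {ffun ix -> 'I_D.-1.+1} => nat_of_ord (g i)) e.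
  rewrite !ffunE !inordK ?hb // => /(congr1 Posz).
  by rewrite !gez0_abs ?modz_ge0 // => /eqP.
have /choice [c hc] := q.
exists (\sum_i (c i)%:~R * bs i).
  by apply: OK_sum => // i _; have := nf_bs N i => h; sf.
apply: (@mulfI _ (dn N)%:R); first by rewrite pnatr_eq0 -lt0n nf_dn.
rewrite mulrBr (zP x hx) (zP y hy) -sumrB mulrA mulr_sumr; apply: eq_bigr => i _.
rewrite -mulrBl -rmorphB hc rmorphM /D /= PoszM rmorphM /=; ring.
Qed.

Lemma em_bound : exists C : nat, forall i : ix, \sum_(j : ix) `|em i (bs j)| <= C%:R.
Proof.
have h (i : ix) : exists C : nat, \sum_(j : ix) `|em i (bs j)| <= C%:R.
  have p : 0 <= \sum_(j : ix) `|em i (bs j)| by apply: sumr_ge0.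
  by exists (Num.bound (\sum_(j : ix) `|em i (bs j)|)); rewrite ltW // archi_boundP.
have /choice [C hC] := h; exists (\sum_i C i)%N => i; apply: (le_trans (hC i)).
by rewrite ler_nat (bigD1 i) //= leq_addr.
Qed.

(* Dirichlet approximation in the coordinates of a lattice basis. *)
Lemma hurwitz : exists M : nat, forall x, K x ->
  exists t : nat, [/\ (0 < t)%N, (t <= M)%N & exists2 w, OK K w & `|Nm (t%:R * x - w)| < 1].
Proof.
have [C hC] := em_bound; pose m := C.+1; exists (m ^ #|ix|)%N => x kx.
case: (nf_fr N kx) => n n0 hn.
have onx : OK K (n%:R * x) by split=> //; sf.
have [z ez] := nf_lat N onx; pose Q := (dn N * n)%N.
have Q0 : (0 < Q)%N by rewrite muln_gt0 nf_dn.
have nQ : Q%:R != 0 :> algC by rewrite pnatr_eq0 -lt0n.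
have Qz : Q%:Z != 0 by rewrite eqz_nat -lt0n.
have Qz0 : 0 < Q%:Z by rewrite ltz_nat.
have eQ : Q%:R * x = \sum_i (z i)%:~R * bs i by rewrite -ez natrM; ring.
pose rm (t : nat) i := ((t%:Z * z i) %% Q%:Z)%Z.
have rm0 t i : 0 <= rm t i by apply: modz_ge0.
have rmQ t i : rm t i < Q%:Z by apply: ltz_pmod.
pose cell (t : 'I_(m ^ #|ix|).+1) : {ffun ix -> 'I_m} :=
  [ffun i => inord `|((rm t i * m%:Z) %/ Q%:Z)%Z|%N].
have cellb (t : nat) i : 0 <= ((rm t i * m%:Z) %/ Q%:Z)%Z < m%:Z.
  rewrite divz_ge0 // mulr_ge0 //= ltz_divLR // mulrC.
  by rewrite ltr_pM2l // ltz_nat.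
have [t1 [t2 [nt ecell]]] : exists t1 t2, t1 != t2 /\ cell t1 = cell t2.
  by apply: pigeon; rewrite card_ffun !card_ord.
wlog lt12 : t1 t2 nt ecell / (t1 < t2)%N.
  move=> H; have : nat_of_ord t1 != t2 by [].
  by rewrite neq_ltn => /orP[h|h]; [apply: (H t1 t2)|apply: (H t2 t1); rewrite // eq_sym].
exists (t2 - t1)%N; split; first by rewrite subn_gt0.
  by rewrite (leq_trans (leq_subr _ _)) // -ltnS.
pose qt (t : nat) i := ((t%:Z * z i) %/ Q%:Z)%Z.
exists (\sum_i (qt t2 i - qt t1 i)%:~R * bs i).
  by apply: OK_sum => // i _; have := nf_bs N i => h; sf.
have diff i : `|(rm t2 i - rm t1 i)%:~R / Q%:R| <= m%:R^-1 :> algC.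
  have := congr1 (fun g : {ffun ix -> 'I_m} => nat_of_ord (g i)) ecell.
  rewrite !ffunE; have /andP[a1 b1] := cellb t1 i; have /andP[a2 b2] := cellb t2 i.
  rewrite !inordK -?ltz_nat ?gez0_abs // => /(congr1 Posz); rewrite !gez0_abs // => ec.
  have h1 := divz_eq (rm t1 i * m%:Z) Q%:Z; have h2 := divz_eq (rm t2 i * m%:Z) Q%:Z.
  have g1 := modz_ge0 (rm t1 i * m%:Z) Qz; have g2 := modz_ge0 (rm t2 i * m%:Z) Qz.
  have k1 := ltz_pmod (rm t1 i * m%:Z) Qz0; have k2 := ltz_pmod (rm t2 i * m%:Z) Qz0.
  have : `|rm t2 i - rm t1 i| * m%:Z <= Q%:Z.
    have -> : `|rm t2 i - rm t1 i| * m%:Z = `|(rm t2 i - rm t1 i) * m%:Z| by rewrite normrM.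
    by rewrite mulrBl h1 h2 ec; move: g1 g2 k1 k2; clear; lia.
  rewrite normrM normfV normr_nat -intr_norm ler_pdivrMr ?ltr0n // (mulrC m%:R^-1).
  rewrite ler_pdivlMr ?ltr0n // -(@ler_int algC) rmorphM //.
have -> : (t2 - t1)%:R * x - \sum_i (qt t2 i - qt t1 i)%:~R * bs i =
    \sum_i ((rm t2 i - rm t1 i)%:~R / Q%:R) * bs i.
  apply: (mulfI nQ); rewrite mulrBr mulrCA eQ !mulr_sumr -sumrB.
  apply: eq_bigr => i _; rewrite natrB; last exact: ltnW.
  have e t : t%:R * (z i)%:~R = (qt t i)%:~R * Q%:R + (rm t i)%:~R :> algC.
    have := divz_eq (t%:Z * z i) Q%:Z; rewrite -/(qt t i) -/(rm t i).
    by move=> /(congr1 (intr : int -> algC)); rewrite rmorphD !rmorphM.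
  have e1 := e t1; have e2 := e t2.
  have alg (q' t t' z' c c' r r' b : algC) : q' != 0 -> t * z' = c * q' + r -> t' * z' = c' * q' + r' ->
      (t' - t) * (z' * b) - q' * ((c' - c) * b) = q' * ((r' - r) / q' * b).
    move=> n0' h1 h2; have -> : r = t * z' - c * q' by rewrite h1; ring.
    by have -> : r' = t' * z' - c' * q'; [rewrite h2; ring|field].
  move: (rm t2 i) (rm t1 i) (qt t2 i) (qt t1 i) e1 e2 => r2 r1 q2 q1 e1 e2.
  by rewrite !rmorphB /=; apply: (alg _ _ _ _ _ _ _ _ _ nQ e1 e2).
rewrite /Nm normr_prod.
have each (i : ix) : `|em i (\sum_j ((rm t2 j - rm t1 j)%:~R / Q%:R) * bs j)| <= C%:R / m%:R.
  rewrite rmorph_sum; apply: (le_trans (ler_norm_sum _ _ _)).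
  apply: (@le_trans _ _ ((\sum_j `|em i (bs j)|) / m%:R)); last by rewrite ler_pM2r ?invr_gt0 ?ltr0n.
  rewrite big_distrl /=; apply: ler_sum => j _; rewrite rmorphM normrM mulrC ler_wpM2l //.
  by rewrite fmorph_div rmorph_int rmorph_nat.
have lt1 : C%:R / m%:R < 1 :> algC by rewrite ltr_pdivrMr ?ltr0n // mul1r ltr_nat.
apply: (@le_lt_trans _ _ (\prod_(i : ix) (C%:R / m%:R))).
  by apply: ler_prod => i _; rewrite normr_ge0 each.
rewrite prodr_const; have [i0 _] := ix_inh.
by rewrite exprn_ilt1 ?divr_ge0 ?ler0n // -lt0n; apply/card_gt0P; exists i0.
Qed.

Definition ieq (I J : cpred) := exists g, [/\ g != 0, K g & I = imul (pr K g) J].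

Lemma ieq_refl I : fid K I -> ieq I I.
Proof.
by move=> fI; exists 1; rewrite oner_neq0 pr1 // imul1 //; split=> //; sf.
Qed.

Lemma ieq_sym I J : fid K J -> ieq I J -> ieq J I.
Proof.
move=> fJ [g [ng kg ->]]; exists g^-1; rewrite invr_eq0 pr_imulK //.
by split=> //; sf.
Qed.

Lemma ieq_trans I J L : ieq I J -> ieq J L -> ieq I L.
Proof.
move=> [g [ng kg ->]] [g' [ng' kg' ->]]; exists (g * g'); rewrite mulf_neq0 // imulA imul_pr //.
by split=> //; sf.
Qed.

Lemma ieq_mul I I' J J' : ieq I I' -> ieq J J' -> ieq (imul I J) (imul I' J').
Proof.
move=> [g [ng kg ->]] [g' [ng' kg' ->]]; exists (g * g').
by rewrite mulf_neq0 // imulACA imul_pr //; split=> //; sf.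
Qed.

Lemma ieq_prin I J : ieq I J -> prin K J -> prin K I.
Proof. by move=> [g [ng kg ->]] h; apply: prinM => //; exact: prin_pr. Qed.

Lemma prin_ieq I J : prin K I -> prin K J -> ieq I J.
Proof.
move=> [g [ng kg ->]] [g' [ng' kg' ->]]; exists (g / g').
by rewrite imul_pr // divfK // mulf_neq0 ?invr_eq0 //; split=> //; sf.
Qed.

Lemma nz_fid I : is_nz_ideal K I -> fid K I.
Proof.
move=> [a b c d e]; split=> //; first by move=> x /a [].
exists 1; rewrite oner_neq0; split=> //; first by sf.
by move=> x /a [_]; rewrite mul1r.
Qed.

Lemma fid_nzid I : fid K I -> incl I (OK K) -> is_nz_ideal K I.
Proof.
by move=> f s; split=> //; [exact: (fid0 f)|exact: (fidD f)|exact: (fidM f)|exact: (fid_nz f)].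
Qed.

Lemma ideal_equivP I J : fid K I -> fid K J -> ideal_equiv K I J <-> ieq I J.
Proof.
move=> fI fJ; have scal a A : fid K A -> (fun x => exists y, A y /\ x = a * y) = imul (pr K a) A.
  move=> fA; rewrite predeqE => x; rewrite imul_prP //; split; first by case=> y [h e]; exists y.
  by case=> y h e; exists y.
split.
  move=> [a [b [ka kb na nb h]]]; exists (b / a); rewrite mulf_neq0 ?invr_eq0 //; split=> //; first by sf.
  have e : imul (pr K a) I = imul (pr K b) J by rewrite -!scal // predeqE.
  by rewrite mulrC -imul_pr // -imulA -e pr_imulK.
move=> [g [ng kg e]]; exists 1, g; split; [by sf|by []|exact: oner_neq0|by []|].
have e1 := scal 1 I fI; rewrite pr1 // imul1 // in e1.
move=> x; by rewrite (congr1 (fun f => f x) (etrans e1 (etrans e (esym (scal g J fJ))))).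
Qed.

Lemma fid_int_rep I : fid K I -> exists2 J, is_nz_ideal K J & ieq I J.
Proof.
move=> fI; case: (fid_denn hK (nf_fr N) fI) => m m0 hm.
have nm : m%:R != 0 :> algC by rewrite pnatr_eq0 -lt0n.
have km : K m%:R by sf.
exists (imul (pr K m%:R) I).
  apply: fid_nzid; first by apply: fid_imul => //; apply: fid_pr.
  by move=> x; rewrite imul_prP // => -[y hy ->]; exact: hm.
by apply: ieq_sym => //; exists m%:R.
Qed.

(** Hurwitz's argument. Let a in I have least norm and F = M!. By [hurwitz] every b in I satisfies t
    b = w a with t dividing F, so J = (F / a) I is integral and contains F. Such a J is a union of
    residue classes modulo F, so finitely many sets of residues cover all ideal classes. *)
Lemma class_number_ex : exists h, class_number K h.
Proof.
have [M hM] := hurwitz; set F := M`!; have F0 : (0 < F)%N by apply: fact_gt0.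
have [T [r hr]] := residues F0.
pose cand (S : {set T}) : cpred := fun x => OK K x /\ r x \in S.
have nF : F%:R != 0 :> algC by rewrite pnatr_eq0 -lt0n.
have kF : K F%:R by sf.
have cover I : fid K I -> exists2 S, is_nz_ideal K (cand S) & ieq I (cand S).
  move=> /fid_int_rep [I' nzI' eI]; suff [S h1 h2] : exists2 S, is_nz_ideal K (cand S) & ieq I' (cand S).
    by exists S => //; exact: (ieq_trans eI h2).
  move: I' nzI' {I eI} => I nzI; have fI := nz_fid nzI; have [sI _ _ _ _] := nzI.
  have hex : exists n : nat, exists a, [/\ I a, a != 0 & `|Nm a| = n%:R].
    case: (fid_nz fI) => a [na ha].
    have /natrP[n en] := natr_norm_int (Nm_int (sI _ ha)); by exists n, a.
  have [n [a [ha na en]] hmin] := natP_min hex.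
  have ka := fid_sub fI ha; have kFa : K (F%:R / a) by sf.
  have nFa : F%:R / a != 0 by rewrite mulf_neq0 ?invr_eq0.
  set J := imul (pr K (F%:R / a)) I.
  have fJ : fid K J by apply: fid_imul => //; apply: fid_pr.
  have JF : J F%:R by apply/imul_prP => //; exists a; rewrite ?divfK.
  have sJ : incl J (OK K).
    move=> x /(imul_prP hK _ _ fI) [b hb ->]; have kb := fid_sub fI hb.
    have kba : K (b / a) by sf.
    have [t [t0 tM [w hw hlt]]] := hM _ kba.
    have hc : I (t%:R * b - w * a) by apply: (fidB hK fI); apply: (fidM fI) => //; sf.
    have e0 : t%:R * b - w * a = 0.
      apply/eqP; apply: contraTT isT => nc.
      have /natrP[k ek] := natr_norm_int (Nm_int (sI _ hc)).
      have : (n <= k)%N by apply: hmin; exists (t%:R * b - w * a).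
      have e1 : t%:R * b - w * a = a * (t%:R * (b / a) - w) by field.
      rewrite leqNgt => /negP[]; rewrite -(ltr_nat algC) -ek e1 NmM normrM en gtr_pMr //.
      by rewrite ltr0n lt0n; apply/eqP => n0; move: en; rewrite n0 => /eqP; rewrite normr_eq0 (negPf (Nm_neq0 na)).
    have /dvdnP[q eq] : (t %| F)%N by apply: dvdn_fact; rewrite t0.
    have -> : F%:R / a * b = q%:R * w.
      have : t%:R * b = w * a by apply/eqP; rewrite -subr_eq0 e0.
      by rewrite eq natrM => e2; apply: (mulIf na); rewrite -[RHS]mulrA -e2; field.
    by sf.
  pose S := [set t : T | `[< exists2 y, J y & r y = t >]].
  have eJ : cand S = J.
    apply: incl_eq => x; last first.
      by move=> hx; split; [exact: sJ|rewrite inE; apply/asboolP; exists x].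
    case=> hx; rewrite inE => /asboolP[y hy e].
    have [w hw ew] := hr x y hx (sJ _ hy) (esym e).
    have -> : x = F%:R * w + y by rewrite -ew subrK.
    by apply: (fidD fJ) => //; rewrite mulrC; apply: (fidM fJ).
  exists S; rewrite eJ; first exact: fid_nzid.
  by apply: ieq_sym => //; exists (F%:R / a).
pose good S := `[< is_nz_ideal K (cand S) >].
(* One representative per class: the set of residues of least rank among those giving an equivalent
   ideal. *)
pose A := [set S | good S && [forall S', good S' ==> `[< ieq (cand S) (cand S') >] ==> (enum_rank S <= enum_rank S')%N]].
have gf S : good S -> fid K (cand S) by move/asboolP => h; exact: nz_fid.
exists #|A|, (fun i => cand (enum_val i)); split.
- by move=> i; have := enum_valP i; rewrite inE => /andP[/asboolP].
- move=> i j; have := enum_valP i; have := enum_valP j; rewrite !inE.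
  move=> /andP[gj /forallP mj] /andP[gi /forallP mi]; rewrite ideal_equivP; [|exact: gf|exact: gf].
  move=> e; apply: enum_val_inj; apply: enum_rank_inj; apply/val_inj/eqP; rewrite eqn_leq.
  have := mi (enum_val j); rewrite gj /= => /implyP -> //; last exact/asboolP.
  have := mj (enum_val i); rewrite gi /= => /implyP -> //; apply/asboolP.
  by apply: ieq_sym => //; exact: gf.
move=> I nzI; have fI := nz_fid nzI; case: (cover I fI) => S0 hS0 e0.
have hex : exists n : nat, exists S, [/\ good S, ieq I (cand S) & nat_of_ord (enum_rank S) = n].
  by exists (enum_rank S0), S0; split=> //; apply/asboolP.
have [n [S [gS eS en]] hmin] := natP_min hex.
have SA : S \in A.
  rewrite inE gS; apply/forallP => S'; apply/implyP => gS'; apply/implyP => /asboolP h.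
  by rewrite en; apply: hmin; exists S'; split=> //; exact: (ieq_trans eS h).
exists (enum_rank_in SA S); rewrite ideal_equivP //; rewrite enum_rankK_in //; exact: gf.
Qed.

Section Parity.
Variables (h : nat).
Hypothesis hh : class_number K h.

Lemma class_fun : exists C : 'I_h -> cpred, exists cl : cpred -> 'I_h,
  [/\ forall i, fid K (C i),
      forall I, fid K I -> ieq I (C (cl I)),
      forall I J, fid K I -> fid K J -> ieq I J <-> cl I = cl J &
      forall i, cl (C i) = i].
Proof.
case: hh => C [nzC injC surjC]; exists C.
have fC i : fid K (C i) := nz_fid (nzC i).
have hcl I : exists i, fid K I -> ieq I (C i).
  have [fI|nI] := pselect (fid K I).
    have [J nzJ eJ] := fid_int_rep fI; have [i e] := surjC J nzJ.
    exists i => _; apply: (ieq_trans eJ); apply/ideal_equivP => //; exact: nz_fid.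
  have nzO : is_nz_ideal K (OK K) by apply: fid_nzid => //; exact: fid_OK.
  by have [i _] := surjC _ nzO; exists i.
have /choice [cl hcl'] := hcl; exists cl; split=> // [I J fI fJ|i]; last first.
  by apply: injC; apply/ideal_equivP => //; apply: ieq_sym => //; exact: hcl'.
split=> e.
  apply: injC; apply/ideal_equivP => //.
  apply: (ieq_trans (ieq_sym _ (hcl' I fI))) => //; exact: (ieq_trans e (hcl' J fJ)).
by apply: (ieq_trans (hcl' I fI)); rewrite e; apply: ieq_sym => //; exact: hcl'.
Qed.

Lemma ieq_cancel I J L : fid K I -> fid K J -> fid K L -> ieq (imul I J) (imul I L) -> ieq J L.
Proof.
move=> fI fJ fL [g [ng kg e]]; exists g; split=> //; apply: (imul_inj hK inv fI) => //.
  by apply: fid_imul => //; apply: fid_pr.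
by rewrite e imulCA.
Qed.

Lemma class_inv (C : 'I_h -> cpred) (cl : cpred -> 'I_h) :
  (forall i, fid K (C i)) -> (forall I, fid K I -> ieq I (C (cl I))) ->
  (forall I J, fid K I -> fid K J -> ieq I J <-> cl I = cl J) ->
  (forall i, cl (C i) = i) ->
  exists f : 'I_h -> 'I_h, forall i j, prin K (imul (C i) (C j)) <-> f i = j.
Proof.
move=> fC hcl clE clC.
have hinv i : exists j, prin K (imul (C i) (C j)).
  have [J fJ e] := inv (fC i); exists (cl J).
  apply: (@ieq_prin _ (imul (C i) J)); last by rewrite e; exact: prin_OK.
  by apply: ieq_mul; [exact: ieq_refl|apply: ieq_sym => //; exact: hcl].
have /choice [f hf] := hinv; exists f => i j; split=> [hp|<-//].
by rewrite -(clC (f i)) -(clC j); apply/clE => //; apply: (@ieq_cancel (C i)) => //; exact: prin_ieq.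
Qed.

(** Inversion is an involution of the classes, and under [no2] it fixes only the trivial class. *)
Lemma odd_class : no2 K -> odd h.
Proof.
move=> n2; have [C [cl [fC hcl clE clC]]] := class_fun.
have [f hf] := class_inv fC hcl clE clC.
have fK i : f (f i) = i by apply/hf; rewrite imulC; apply/hf.
have := @odd_card_invol _ [set: 'I_h] f (fun _ _ => in_setT _) (fun i _ => fK i).
rewrite cardsT card_ord => ->.
have -> : [set x in [set: 'I_h] | f x == x] = [set cl (OK K)]; last by rewrite cards1.
apply/setP => i; rewrite !inE /=; apply/eqP/eqP => [e|->].
  have /hf /(n2 _ (fC i)) hp := e; rewrite -(clC i); apply/clE => //; first exact: fid_OK.
  by apply: prin_ieq => //; exact: prin_OK.
apply/hf; have hp : prin K (C (cl (OK K))).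
  by apply: (@ieq_prin _ (OK K)); [apply: ieq_sym => //; apply: hcl; exact: fid_OK|exact: prin_OK].
exact: prinM.
Qed.

(** Translation by a class of order two, an involution without fixed points. *)
Lemma class_mul (C : 'I_h -> cpred) (cl : cpred -> 'I_h) I :
  (forall i, fid K (C i)) -> (forall I, fid K I -> ieq I (C (cl I))) ->
  (forall I J, fid K I -> fid K J -> ieq I J <-> cl I = cl J) ->
  (forall i, cl (C i) = i) -> fid K I -> prin K (imul I I) -> ~ prin K I ->
  let f := fun i => cl (imul I (C i)) in
  (forall i, f (f i) = i) /\ (forall i, f i != i).
Proof.
move=> fC hcl clE clC fI hp np f; have fIC i : fid K (imul I (C i)) by apply: fid_imul.
have fO := fid_OK hK.
split=> i; first rewrite -[RHS]clC.
  apply/clE => //; apply: (@ieq_trans _ (imul I (imul I (C i)))).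
    by apply: ieq_mul; [exact: ieq_refl|apply: ieq_sym => //; exact: hcl].
  rewrite imulA -[X in ieq _ X](imul1 hK (fC i)); apply: ieq_mul; last exact: ieq_refl.
  by apply: prin_ieq => //; exact: prin_OK.
apply/eqP => e; apply: np.
apply: (@ieq_prin _ (OK K)); last exact: prin_OK.
apply: (@ieq_cancel (C i)) => //; rewrite imul1r // imulC.
by apply/clE => //; rewrite clC.
Qed.

Lemma even_class : ~ no2 K -> ~~ odd h.
Proof.
move=> n2; have [C [cl [fC hcl clE clC]]] := class_fun.
have [I [fI hp np]] : exists I, [/\ fid K I, prin K (imul I I) & ~ prin K I].
  apply: contrapT => hn; apply: n2 => I fI hp; apply: contrapT => np; apply: hn; by exists I.
have [fK fn] := class_mul fC hcl clE clC fI hp np.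
have := @odd_card_invol _ [set: 'I_h] (fun i => cl (imul I (C i))) (fun _ _ => in_setT _) (fun i _ => fK i).
rewrite cardsT card_ord => ->.
suff -> : [set x in [set: 'I_h] | cl (imul I (C x)) == x] = set0 by rewrite cards0.
by apply/setP => i; rewrite !inE /=; apply/negP => e; have := fn i; rewrite e.
Qed.

(** The quotient of the class group by the class of I0 has odd order: inversion on it fixes the
    cosets of those C with C^2 trivial or equivalent to I0. The last hypothesis excludes the second
    kind, and the first kind is the trivial coset. *)
Lemma class_2mod4 I0 : fid K I0 -> prin K (imul I0 I0) -> ~ prin K I0 ->
  (forall I, fid K I -> prin K (imul I I) -> prin K I \/ prin K (imul I0 I)) ->
  (forall I, fid K I -> ~ prin K (imul I0 (imul I I))) ->
  (2 %| h)%N /\ ~~ (4 %| h)%N.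
Proof.
move=> fI hp np h2 h4; have [C [cl [fC hcl clE clC]]] := class_fun.
pose f i := cl (imul I0 (C i)).
have [fK fn] : (forall i, f (f i) = i) /\ (forall i, f i != i) := class_mul fC hcl clE clC fI hp np.
have [g hg] := class_inv fC hcl clE clC.
have gK i : g (g i) = i by apply/hg; rewrite imulC; apply/hg.
have fO := fid_OK hK.
have ieq_f i : ieq (imul I0 (C i)) (C (f i)) by apply: hcl; exact: fid_imul.
have gf i : g (f i) = f (g i).
  apply/hg; apply: (@ieq_prin _ (imul (imul I0 (C i)) (imul I0 (C (g i))))).
    by apply: ieq_mul; apply: ieq_sym; rewrite //; apply: fid_imul.
  by rewrite imulACA; apply: prinM => //; apply/hg.
(* A selects the smaller index in each coset {i, f i}, and k below is inversion transported to these
   representatives. *)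
pose lt (i : 'I_h) := (i < f i)%N.
have ltf i : lt (f i) = ~~ lt i.
  by rewrite /lt fK -leqNgt ltn_neqAle; have -> : nat_of_ord (f i) != i by exact: fn.
pose A := [set i : 'I_h | lt i].
have cA : (h = #|A| * 2)%N.
  have -> : (#|A| * 2 = #|A| + #|~: A|)%N; last by rewrite cardsC card_ord.
  rewrite muln2 -addnn; congr addn; rewrite -(card_imset (mem A) (can_inj fK)).
  apply: eq_card => i; rewrite !inE -ltf; apply/imsetP/idP.
    by case=> j; rewrite inE => hj ->; rewrite fK.
  by move=> hi; exists (f i); rewrite ?fK // inE.
pose k i := if lt (g i) then g i else f (g i).
have kA i : i \in A -> k i \in A by rewrite !inE /k; case: ifP => // hn _; rewrite ltf hn.
have kK i : i \in A -> k (k i) = i.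
  rewrite inE => hi; case: (boolP (lt (g i))) => h1.
    by have -> : k i = g i; rewrite /k ?h1 // gK hi.
  by have -> : k i = f (g i); rewrite /k ?(negPf h1) // gf gK ltf hi /= fK.
have oA : odd #|A|.
  rewrite (odd_card_invol kA kK).
  have prinC : prin K (C (cl (OK K))).
    by apply: (@ieq_prin _ (OK K)); [apply: ieq_sym => //; exact: hcl|exact: prin_OK].
  set o := cl (OK K) in prinC; pose o' := if lt o then o else f o.
  have go : g o = o by apply/hg; exact: prinM.
  suff -> : [set x in A | k x == x] = [set o'] by rewrite cards1.
  apply/setP => i; rewrite !inE; apply/andP/eqP => [[hi]|->]; last first.
    rewrite /o'; case: ifP => ho; first by rewrite ho /k go ho.
    by rewrite ltf ho /k gf go ltf ho /=.
  have key : g i = i -> i = o'.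
    move=> /hg /(h2 _ (fC i)) [hpi|hpi].
      have eo : i = o.
        by rewrite -(clC i); apply/clE => //; apply: prin_ieq => //; exact: prin_OK.
      by rewrite /o' -eo hi.
    have eo : f i = o.
      by apply/clE => //; [exact: fid_imul|apply: prin_ieq => //; exact: prin_OK].
    have : lt o = false by rewrite -eo ltf hi.
    by rewrite /o' => ->; rewrite -eo fK.
  rewrite /k; case: ifP => h1 /eqP e; first exact: key.
  exfalso; apply: (h4 _ (fC i)); rewrite imulA.
  apply: (@ieq_prin _ (imul (C (f i)) (C i))).
    by apply: ieq_mul; [exact: ieq_f|exact: ieq_refl].
  by apply/hg; rewrite gf.
rewrite cA dvdn_mull //; split=> //.
by rewrite (@dvdn_pmul2r 2 2) // dvdn2 oA.
Qed.
End Parity.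
End ClassNumber.

(** * Counting units *)

Lemma fiber_bound (T1 T2 : eqType) (f : T1 -> T2) (s : seq T1) (k : nat) : uniq s ->
  (forall s', uniq s' -> {subset s' <= s} -> (forall x y, x \in s' -> y \in s' -> f x = f y) ->
     (size s' <= k)%N) ->
  (size s <= k * size (undup (map f s)))%N.
Proof.
move=> us h; have : (forall s', uniq s' -> {subset s' <= s} -> forall t, uniq t ->
    (forall x, x \in s' -> f x \in t) -> (size s' <= k * size t)%N).
  move=> s' us' sub t; elim: t s' us' sub => [|y t IH] s' us' sub ut ht.
    by case: s' us' sub ht => [|x s'] // _ _ /(_ x (mem_head _ _)).
  have [_ ut'] := andP ut.
  rewrite -(count_predC (fun x => f x == y)) /= mulnS; apply: leq_add.
    rewrite -size_filter; apply: h; first exact: filter_uniq.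
      by move=> x; rewrite mem_filter => /andP[_ /sub].
    by move=> x x'; rewrite !mem_filter => /andP[/eqP-> _] /andP[/eqP-> _].
  rewrite -size_filter; apply: IH => //; first exact: filter_uniq.
    by move=> x; rewrite mem_filter => /andP[_ /sub].
  by move=> x; rewrite mem_filter /= => /andP[n /ht]; rewrite inE (negPf n).
apply=> //; first exact: undup_uniq.
by move=> x hx; rewrite mem_undup map_f.
Qed.

(** By Bernoulli, (W + 1)^k / W^k is at least 1 + k / W, which outgrows C. This removes the
    constants from the comparisons of growth below. *)
Lemma pow_growth (M W C : nat) : (0 < W)%N -> (forall k, (M ^ k <= C * W ^ k)%N) -> (M <= W)%N.
Proof.
move=> W0 h; rewrite leqNgt; apply/negP => hM.
have bern k : (W ^ k.+1 + k.+1 * W ^ k <= W.+1 ^ k.+1)%N.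
  elim: k => [|k IH]; first by rewrite expn1 expn0 expn1 mul1n addn1.
  have : (W.+1 * (W ^ k.+1 + k.+1 * W ^ k) <= W.+1 ^ k.+2)%N by rewrite (expnS W.+1 k.+1) leq_mul2l IH orbT.
  apply: leq_trans; rewrite !(expnS W); move: (W ^ k)%N => w; nia.
have := h (C * W).+1; apply/negP; rewrite -ltnNge.
apply: (@leq_trans (W.+1 ^ (C * W).+1)); last by rewrite leq_exp2r.
apply: leq_trans (bern (C * W)%N); rewrite expnS.
have : (0 < W ^ (C * W))%N by rewrite expn_gt0 W0.
by move: (W ^ (C * W))%N => w; nia.
Qed.

Lemma log_box (y : algC) : 1 <= y -> exists e : nat, 2%:R ^+ e <= y < 2%:R ^+ e.+1.
Proof.
move=> y1; have ry : y \is Num.real by rewrite ger1_real.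
have y0 : 0 <= y by rewrite (le_trans _ y1).
have /andP[h1 h2] := truncn_itv y0.
have t0 : (0 < Num.trunc y)%N.
  by rewrite -(ltr_nat algC) (lt_le_trans _ (le_refl _)) // ltr0n truncn_gt0.
have /andP[a b] := trunc_log_bounds (isT : (1 < 2)%N) t0.
exists (trunc_log 2 (Num.trunc y)); rewrite -!natrX; apply/andP; split.
  by apply: le_trans h1; rewrite ler_nat.
by apply: (lt_le_trans h2); rewrite ler_nat.
Qed.

Section Units.
Variables (K : cpred) (N : nf K).
Let hK := nf_sf N.
Local Notation ix := (ix N).
Local Notation house x A := (forall i : ix, `|em i x| <= 2%:R ^+ A).
Hypothesis tc : forall i : ix, cj i <> i.

(** One embedding from each conjugate pair: r counts the complex places, and r - 1 is the unit
    rank. *)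
Definition reps : {set ix} := [set i | (enum_rank i < enum_rank (cj i))%N].
Local Notation r := #|reps|.

Lemma reps_cj i : (cj i \in reps) = (i \notin reps).
Proof.
have ne : nat_of_ord (enum_rank (cj i)) != enum_rank i.
  by apply/negP => /eqP /val_inj /enum_rank_inj; exact: tc.
by rewrite !inE nf_cjK -leqNgt ltn_neqAle ne.
Qed.

Lemma prod_reps (F : ix -> algC) : (forall i, F (cj i) = F i) ->
  \prod_i F i = (\prod_(i in reps) F i) ^+ 2.
Proof.
move=> hF; rewrite (bigID (mem reps)) /= expr2; congr (_ * _).
rewrite (reindex_inj (can_inj (@nf_cjK _ N))) /=; apply: eq_big => i; first by rewrite reps_cj negbK.
by rewrite hF.
Qed.

Lemma card_reps : #|ix| = (2 * r)%N.
Proof.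
rewrite -(cardC (mem reps)) mul2n -addnn; congr addn.
rewrite -(card_image (can_inj (@nf_cjK _ N)) reps); apply: eq_card => i.
have -> : (i \in predC (mem reps)) = (cj i \in reps) by rewrite reps_cj.
by apply/idP/imageP => [h|[j hj ->]]; [exists (cj i); rewrite ?nf_cjK|rewrite nf_cjK].
Qed.

Lemma reps_inh : exists i, i \in reps.
Proof.
have [i _] := ix_inh N; have [h|h] := boolP (i \in reps); first by exists i.
by exists (cj i); rewrite reps_cj.
Qed.

Lemma norm_cj (i : ix) x : K x -> `|em (cj i) x| = `|em i x|.
Proof. by move=> kx; rewrite nf_cjP // norm_conjC. Qed.

Lemma norm_reps x : K x -> `|Nm N x| = (\prod_(i in reps) `|em i x|) ^+ 2.
Proof. by move=> kx; rewrite -prod_reps ?normr_prod // => i; rewrite norm_cj. Qed.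

Lemma Nm_unit u : unit K u -> `|Nm N u| = 1.
Proof.
move=> [nu ou ov]; apply/eqP; rewrite eq_le Nm_ge1 // andbT.
have h : `|Nm N u^-1| * `|Nm N u| = 1.
  rewrite -normrM -NmM mulVf // /Nm big1 ?normr1 // => i _; exact: rmorph1.
by rewrite -h ler_peMl ?normr_ge0 // Nm_ge1 // invr_eq0.
Qed.

Lemma two_ge0 A : 0 <= 2%:R ^+ A :> algC. Proof. by rewrite exprn_ge0. Qed.
Lemma two_gt0 A : 0 < 2%:R ^+ A :> algC. Proof. by rewrite exprn_gt0. Qed.
Lemma two_le A B : (2%:R ^+ A <= 2%:R ^+ B :> algC) = (A <= B)%N.
Proof. by rewrite ler_eXn2l // ltr1n. Qed.

Lemma house_le x A B : (A <= B)%N -> house x A -> house x B.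
Proof. by move=> h hx i; apply: (le_trans (hx i)); rewrite two_le. Qed.

Lemma houseM x y A B : house x A -> house y B -> house (x * y) (A + B)%N.
Proof. by move=> hx hy i; rewrite rmorphM normrM exprD ler_pM ?normr_ge0. Qed.

Lemma houseV u A : unit K u -> house u A -> house u^-1 (A * #|ix|)%N.
Proof.
move=> hu hA i; have [nu _ _] := hu; have := Nm_unit hu.
rewrite /Nm normr_prod (bigD1 i) //= => e.
have -> : `|em i u^-1| = \prod_(j | j != i) `|em j u|.
  have n0 : `|em i u| != 0 by rewrite normr_eq0 em_neq0.
  by apply: (mulfI n0); rewrite e fmorphV normfV divff.
apply: (@le_trans _ _ (\prod_(j : ix | j != i) 2%:R ^+ A)).
  by apply: ler_prod => j _; rewrite normr_ge0 hA.
by rewrite prodr_const -exprM two_le leq_mul2l max_card orbT.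
Qed.

Lemma house_ex x : exists A, house x A.
Proof.
have /choice [f hf] : forall i : ix, exists A, `|em i x| <= 2%:R ^+ A.
  move=> i; exists (Num.bound `|em i x|); apply: (le_trans (ltW (archi_boundP (normr_ge0 _)))).
  by rewrite -natrX ler_nat ltnW // ltn_expl.
exists (\sum_i f i)%N => i; apply: (le_trans (hf i)).
by rewrite two_le (bigD1 i) //= leq_addr.
Qed.

(** Two such integers congruent modulo m = 2^(B+1) + 1 differ by m w with every conjugate of w below
    1 in absolute value. Then the norm of w is an integer of absolute value below 1, so w = 0. *)
Lemma northcott (B : nat) : exists C : nat, forall s : seq algC, uniq s ->
  (forall x, x \in s -> OK K x /\ house x B) -> (size s <= C)%N.
Proof.
set m := (2 * 2 ^ B).+1.
have [T [f hf]] := residues N (ltn0Sn (2 * 2 ^ B)).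
exists #|T| => s us hs; rewrite -(size_map f) cardE; apply: uniq_leq_size; last by move=> t _; rewrite mem_enum.
rewrite map_inj_in_uniq // => x y hx hy e.
have [ox bx] := hs x hx; have [oy by'] := hs y hy.
have [w ow ew] := hf x y ox oy e.
apply/eqP; rewrite -subr_eq0 ew; have [->|nw] := eqVneq w 0; first by rewrite mulr0.
have := Nm_ge1 N ow nw; rewrite real_leNgt ?normr_real ?rpred1 //; case/negP.
rewrite /Nm normr_prod.
have lt (i : ix) : `|em i w| <= (2 * 2 ^ B)%:R / m%:R.
  rewrite ler_pdivlMr ?ltr0n // -[m%:R]normr_nat -(rmorph_nat (em i)) -normrM -rmorphM mulrC -ew.
  rewrite rmorphB; apply: (le_trans (ler_normB _ _)).
  by rewrite natrM natrX mulr_natl mulr2n lerD.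
apply: (@le_lt_trans _ _ (\prod_(i : ix) ((2 * 2 ^ B)%:R / m%:R))).
  by apply: ler_prod => i _; rewrite normr_ge0 lt.
rewrite prodr_const; have [i0 _] := ix_inh N.
rewrite exprn_ilt1 ?divr_ge0 ?ler0n //.
  by rewrite -lt0n; apply/card_gt0P; exists i0.
by rewrite ltr_pdivrMr ?ltr0n // mul1r ltr_nat.
Qed.

(* There are r - 1 free dyadic absolute values, the last being determined up to
   a bounded factor by the product formula. *)
Lemma units_upper : exists C : nat, forall A (s : seq algC), uniq s ->
  (forall u, u \in s -> unit K u /\ house u A) -> (size s <= C * A.+1 ^ r.-1)%N.
Proof.
have [i0 hi0] := reps_inh; have [C0 hC0] := northcott #|ix|.
set n := #|ix| in hC0 *.
exists (C0 * (2 * n.+1) ^ r.-1)%N => A s us hs.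
pose S := [pred i | (i \in reps) && (i != i0)].
have cS : #|{: {i | S i}}| = r.-1.
  rewrite card_sig (cardsD1 i0 reps) hi0 /=; apply: eq_card => i.
  by rewrite !inE /= andbC.
(* The shift by 2^(A n), the bound that [houseV] gives for the inverse, makes every dyadic exponent
   a natural number; M exceeds the largest one, A + A n. *)
set M := (2 * n.+1 * A.+1)%N.
have hbox u (i : ix) : exists e : nat, unit K u /\ house u A ->
    (e < M)%N /\ 2%:R ^+ e <= `|em i u| * 2%:R ^+ (A * n)%N < 2%:R ^+ e.+1.
  have [[hu hA]|h] := pselect (unit K u /\ house u A); last by exists 0%N.
  have h1 : 1 <= `|em i u| * 2%:R ^+ (A * n)%N.
    have p0 : 0 < `|em i u| by rewrite normr_gt0 em_neq0 //; case: hu.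
    have := houseV hu hA i; rewrite fmorphV normfV => hh.
    by rewrite -[leLHS](mulfV (lt0r_neq0 p0)) (ler_pM2l p0).
  have [e /andP[a b]] := log_box h1; exists e => _; split; last by rewrite a.
  have : 2%:R ^+ e <= 2%:R ^+ (A + A * n)%N :> algC.
    by apply: (le_trans a); rewrite exprD ler_pM2r ?two_gt0.
  by rewrite two_le /M; nia.
pose e u i := projT1 (cid (hbox u i)).
have eP u i : unit K u /\ house u A -> (e u i < M)%N /\
    2%:R ^+ (e u i) <= `|em i u| * 2%:R ^+ (A * n)%N < 2%:R ^+ (e u i).+1.
  by rewrite /e; case: cid.
have M0 : (0 < M)%N by rewrite /M.
pose f u : {ffun {i | S i} -> 'I_M.-1.+1} := [ffun i => inord (e u (val i))].
have := @fiber_bound _ _ f s C0 us; move=> /(_ _) h.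
apply: (leq_trans (h _)); last first.
  rewrite -mulnA leq_mul2l -expnMn; apply/orP; right.
  apply: (@leq_trans #|{ffun {i | S i} -> 'I_M.-1.+1}|).
    rewrite cardE; apply: uniq_leq_size; first exact: undup_uniq.
    by move=> x _; rewrite mem_enum.
  by rewrite card_ffun card_ord prednK // cS.
move=> [|u0 s'] us' sub eqf //.
have hu0 := hs u0 (sub u0 (mem_head _ _)); have [U0 _] := hu0; have [nu0 ou0 ov0] := U0.
rewrite -(size_map (fun u => u / u0)); apply: hC0.
  by rewrite map_inj_uniq // => x y; apply: mulIf; rewrite invr_eq0.
move=> w /mapP[u hu ->]; have hu' := hs u (sub u hu); have [U _] := hu'.
have UU : unit K (u / u0) by apply: unitM => //; apply: unitV.
have kw := unit_sub UU.
split; first by case: UU.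
have mid i : i \in reps -> i != i0 -> `|em i (u / u0)| <= 2%:R /\ 2%:R^-1 <= `|em i (u / u0)|.
  move=> a b; have Si : S i by rewrite /S /= a b.
  have := congr1 (fun g : {ffun {i | S i} -> 'I_M.-1.+1} => nat_of_ord (g (exist _ i Si)))
    (eqf u u0 hu (mem_head _ _)).
  have [l1 /andP[p1 q1]] := eP u i hu'; have [l2 /andP[p2 q2]] := eP u0 i hu0.
  rewrite !ffunE !inordK ?prednK //= => ee; rewrite ee in p1 q1.
  rewrite fmorph_div normf_div; have g0 : 0 < `|em i u0| by rewrite normr_gt0 em_neq0.
  rewrite ler_pdivrMr // ler_pdivlMr // ler_pdivrMl ?ltr0n //.
  split; rewrite -(ler_pM2r (two_gt0 (A * n))) -mulrA.
    by apply: (le_trans (ltW q1)); rewrite exprS ler_pM2l ?ltr0n.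
  by apply: (le_trans (ltW q2)); rewrite exprS ler_pM2l ?ltr0n.
have rn : (r <= n)%N by rewrite /n; exact: max_card.
have bnd i : i \in reps -> `|em i (u / u0)| <= 2%:R ^+ n.
  move=> hi; have [ei|ni] := eqVneq i i0; last first.
    have [a _] := mid i hi ni; apply: (le_trans a).
    by rewrite -{1}[2%:R]expr1 two_le (leq_trans _ rn) //; apply/card_gt0P; exists i0.
  have := Nm_unit UU; rewrite norm_reps // => /eqP; rewrite -[X in _ == X](expr1n _ 2).
  rewrite eqrXn2 ?ler01 //; last by apply: prodr_ge0.
  rewrite (bigD1 i0) //= ei => /eqP e1.
  have p0 : 0 < \prod_(j in reps | j != i0) `|em j (u / u0)|.
    by apply: prodr_gt0 => j _; rewrite normr_gt0 em_neq0 //; case: UU.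
  have -> : `|em i0 (u / u0)| = (\prod_(j in reps | j != i0) `|em j (u / u0)|)^-1.
    by rewrite -[LHS](mulfK (lt0r_neq0 p0)) e1 mul1r.
  apply: (@le_trans _ _ (2%:R ^+ r.-1)); last by rewrite two_le (leq_trans (leq_pred _)).
  rewrite -[leRHS]invrK lef_pV2 ?posrE ?invr_gt0 ?two_gt0 // -exprVn -cS card_sig.
  rewrite -prodr_const; apply: ler_prod => j /andP[a b].
  by rewrite invr_ge0 ler0n /=; have [_] := mid j a b.
move=> i; have [/bnd//|] := boolP (i \in reps); rewrite -reps_cj => /bnd.
by rewrite norm_cj.
Qed.
End Units.

Lemma pigeon_in (T1 T2 : finType) (A : {pred T2}) (f : T1 -> T2) :
  (forall x, f x \in A) -> (#|A| < #|T1|)%N -> exists x y, x != y /\ f x = f y.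
Proof.
move=> hA h; have /injectivePn[x [y nxy e]] : ~~ injectiveb f.
  apply/negP => /injectiveP inj; have : (#|T1| <= #|A|)%N.
    rewrite -(card_image inj T1); apply: subset_leq_card; apply/subsetP => _ /imageP[x _ ->].
    exact: hA.
  by rewrite leqNgt h.
by exists x, y.
Qed.

Lemma card_ord_lt (n k : nat) : (#|[pred z : 'I_n | (z < k)%N]| <= k)%N.
Proof.
rewrite -sum1_card -(big_mkord (fun z => (z < k)%N) (fun=> 1%N)) -big_filter sum1_size.
rewrite -[leqRHS](size_iota 0); apply: uniq_leq_size; first by rewrite filter_uniq ?iota_uniq.
by move=> z; rewrite mem_filter mem_iota => /andP[].
Qed.

(** * Minkowski's theorem and a lower bound for the number of units *)

Section Minkowski.
Variables (K : cpred) (N : nf K).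
Let hK := nf_sf N.
Local Notation ix := (ix N).
Local Notation house x A := (forall i : ix, `|em i x| <= 2%:R ^+ A).
Hypothesis tc : forall i : ix, cj i <> i.
Local Notation R := (reps N).
Local Notation r := #|reps N|.

(** Pigeonhole with X = 2^b. There are (X + 1)^(2 r) combinations of the basis with coefficients
    from 0 to X. The real and imaginary parts at the places of R are cut into 2^(y i) intervals
    each, which makes only X^(2 r) boxes. *)
Lemma minkowski : exists C : nat, (0 < C)%N /\ forall (b : nat) (y : ix -> nat),
  (forall i, 0 < y i)%N -> (\sum_(i in R) y i = b * r)%N ->
  exists a, [/\ OK K a, a != 0 & forall i, i \in R -> `|em i a| * 2%:R ^+ y i <= C%:R * 2%:R ^+ b].
Proof.
have [C hC] := em_bound N; exists (8 * C.+1)%N; split=> // b y y0 ey.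
set c := C.+1; have cC : C%:R <= c%:R :> algC by rewrite ler_nat.
pose X := (2 ^ b)%N; have X0 : (0 < X)%N by rewrite expn_gt0.
pose val (x : {ffun ix -> 'I_X.+1}) := \sum_j (x j)%:R * bs j : algC.
have vb (x : {ffun ix -> 'I_X.+1}) (i : ix) : `|em i (val x)| <= c%:R * X%:R.
  rewrite /val rmorph_sum; apply: (le_trans (ler_norm_sum _ _ _)).
  apply: (@le_trans _ _ (\sum_j `|em i (bs j)| * X%:R)).
    apply: ler_sum => j _; rewrite rmorphM normrM rmorph_nat normr_nat mulrC ler_wpM2l //.
    by rewrite ler_nat -ltnS.
  by rewrite -big_distrl /= ler_wpM2r ?ler0n // (le_trans (hC i)).
pose part (i : ix) (t : bool) (z : algC) := if t then 'Im (em i z) else 'Re (em i z).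
have preal i t z : part i t z \is Num.real by rewrite /part; case: t; rewrite ?Creal_Im ?Creal_Re.
have pB i t z z' : part i t (z - z') = part i t z - part i t z'.
  by rewrite /part; case: t; rewrite rmorphB raddfB.
have pb x i t : `|part i t (val x)| <= c%:R * X%:R.
  apply: (le_trans _ (vb x i)); rewrite /part; case: t.
    rewrite -ler_sqr ?nnegrE ?normr_ge0 // (normC2_Re_Im (em i (val x))) real_normK ?Creal_Im // lerDr.
    by rewrite real_exprn_even_ge0 ?Creal_Re.
  exact: (leif_normC_Re_Creal (em i (val x))).1.
pose M := (2 ^ (\sum_i y i))%N.
(* The range of a part has length 2 c X; dividing by 4 c X keeps the coordinate strictly below 2^(y
   i). Adding the real and imaginary bounds gives the constant 8 c. *)
pose w x i t := (part i t (val x) + c%:R * X%:R) * (2 ^ y i)%:R / (4 * c * X)%:R.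
have d0 : 0 < (4 * c * X)%:R :> algC by rewrite ltr0n !muln_gt0 X0.
have w0 x i t : 0 <= w x i t.
  rewrite /w divr_ge0 ?ler0n // mulr_ge0 ?ler0n // -lerBlDr sub0r.
  by have := pb x i t; rewrite real_ler_norml // => /andP[].
have wub x i t : w x i t < (2 ^ y i)%:R.
  rewrite /w ltr_pdivrMr // mulrC ltr_pM2l ?ltr0n ?expn_gt0 //.
  apply: (@le_lt_trans _ _ (c%:R * X%:R + c%:R * X%:R)).
    by rewrite lerD2r; have := pb x i t; rewrite real_ler_norml // => /andP[].
  by rewrite -!natrM -natrD ltr_nat; move: X0; rewrite /c; nia.
have yM i : (2 ^ y i <= M.-1.+1)%N.
  by rewrite prednK ?expn_gt0 // leq_exp2l // (bigD1 i) //= leq_addr.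
pose f (x : {ffun ix -> 'I_X.+1}) : {ffun (ix * bool)%type -> 'I_M.-1.+1} :=
  [ffun p => if p.1 \in R then inord (Num.trunc (w x p.1 p.2)) else ord0].
pose F (p : (ix * bool)%type) : pred 'I_M.-1.+1 :=
  [pred z : 'I_M.-1.+1 | (z < if p.1 \in R then 2 ^ y p.1 else 1)%N].
have wt x i t : (Num.trunc (w x i t) < 2 ^ y i)%N.
  rewrite -(ltr_nat algC); apply: (le_lt_trans _ (wub x i t)).
  by have /andP[] := truncn_itv (w0 x i t).
have fF x : f x \in family F.
  apply/familyP => p; rewrite !ffunE inE; case: ifP => hp //=.
  by rewrite inordK ?wt // (leq_trans (wt _ _ _)).
have cF : (#|family F| <= X ^ #|ix|)%N.
  rewrite card_family foldrE big_map big_enum /=.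
  apply: (@leq_trans (\prod_p if p.1 \in R then 2 ^ y p.1 else 1)%N).
    by apply: leq_prod => p _; exact: card_ord_lt.
  rewrite -(pair_bigA _ (fun i (_ : bool) => if i \in R then 2 ^ y i else 1)%N) /=.
  under eq_bigr do rewrite big_bool.
  rewrite (eq_bigr (fun i => if i \in R then 2 ^ (2 * y i) else 1)%N); last first.
    by move=> i _; case: ifP => // _ /=; rewrite -expnD addnn mul2n.
  by rewrite -big_mkcond -expn_sum -big_distrr /= ey /X -expnM (card_reps tc) mulnCA.
have cF' : (#|family F| < #|{ffun ix -> 'I_X.+1}|)%N.
  rewrite card_ffun card_ord; apply: (leq_ltn_trans cF); rewrite ltn_exp2r //.
  by have [i0 _] := ix_inh N; apply/card_gt0P; exists i0.
have [x1 [x2 [nx ef]]] := pigeon_in fF cF'.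
pose a := val x1 - val x2; exists a.
have ae : a = \sum_j ((x1 j)%:Z - (x2 j)%:Z)%:~R * bs j.
  by rewrite /a /val -sumrB; apply: eq_bigr => j _; rewrite rmorphB -mulrBl.
split.
- by rewrite ae; apply: OK_sum => // j _; have := nf_bs N j => hj; sf.
- apply/eqP => a0; move/eqP: nx; apply; apply/ffunP => j; apply: val_inj; apply/eqP.
  have := @nf_free _ N (fun j => (x1 j)%:Z - (x2 j)%:Z); rewrite -ae => /(_ a0 j) /eqP.
  by rewrite subr_eq0 eqz_nat.
move=> i hi; have hp t : `|part i t a| * (2 ^ y i)%:R <= (4 * c * X)%:R.
  have := congr1 (fun g : {ffun (ix * bool)%type -> 'I_M.-1.+1} => nat_of_ord (g (i, t))) ef.
  rewrite !ffunE /= hi !inordK; try by rewrite (leq_trans (wt _ _ _)).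
  move=> e; have /andP[a1 b1] := truncn_itv (w0 x1 i t); have /andP[a2 b2] := truncn_itv (w0 x2 i t).
  have : `|w x1 i t - w x2 i t| <= 1.
    have rw x : w x i t \is Num.real by rewrite ger0_real.
    rewrite e -natr1 in a1 b1; rewrite -natr1 in b2.
    rewrite real_ler_norml ?rpredB //; set k := (Num.trunc (w x2 i t))%:R in a1 b1 a2 b2.
    apply/andP; split.
      by have := lerB a1 (ltW b2); rewrite opprD addrA subrr sub0r.
    by have := lerB (ltW b1) a2; rewrite addrAC subrr add0r.
  have -> : w x1 i t - w x2 i t = part i t a * (2 ^ y i)%:R / (4 * c * X)%:R.
    by rewrite /w -mulrBl -mulrBl /a pB; congr (_ * _ / _); ring.
  by rewrite normrM normrM normfV !normr_nat ler_pdivrMr // mul1r.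
have h1 : `|em i a| <= `|part i false a| + `|part i true a|.
  rewrite [in leLHS](algCrect (em i a)); apply: (le_trans (ler_normD _ _)).
  by rewrite normrM normCi mul1r.
rewrite -!natrX; apply: (@le_trans _ _ ((`|part i false a| + `|part i true a|) * (2 ^ y i)%:R)).
  by rewrite ler_wpM2r ?ler0n.
rewrite mulrDl; apply: (le_trans (lerD (hp false) (hp true))).
by rewrite -natrD -natrM ler_nat /X /c; nia.
Qed.
End Minkowski.

Section UnitsLower.
Variables (K : cpred) (N : nf K).
Let hK := nf_sf N.
Local Notation ix := (ix N).
Local Notation house x A := (forall i : ix, `|em i x| <= 2%:R ^+ A).
Hypothesis tc : forall i : ix, cj i <> i.
Local Notation R := (reps N).
Local Notation r := #|reps N|.

(* Minkowski's theorem yields, for every vector of exponents e, an element of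
   bounded norm and prescribed size; those in the same residue class modulo a
   common multiple of all possible norms differ by units. *)
Lemma units_lower : exists D : nat, (0 < D)%N /\ forall A : nat, exists s : seq algC,
  [/\ uniq s, forall u, u \in s -> unit K u /\ house u (D * A.+1)%N & (A.+1 ^ r.-1 <= D * size s)%N].
Proof.
have [C [C0 hC]] := minkowski tc; have [i0 hi0] := reps_inh tc.
have r0 : (0 < r)%N by apply/card_gt0P; exists i0.
pose kp := (r * C)%N.
(* The normalised sizes [nz] of any two chosen elements at a place of R differ by a factor below
   2^kp. Spacing the prescribed exponents by kp therefore makes different vectors e give different
   elements. *)
have hkp : C%:R ^+ r < 2%:R ^+ kp :> algC.
  by rewrite -!natrX ltr_nat /kp mulnC expnM ltn_exp2r // ltn_expl.
set m := (C ^ (2 * r))`!.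
have m0 : (0 < m)%N by apply: fact_gt0.
have [T [res hres]] := residues N m0.
have T0 : (0 < #|T|)%N by apply/card_gt0P; exists (res 0).
exists (kp * r * #|T|).+1; split=> // A.
pose S := [pred i | (i \in R) && (i != i0)].
have cS : #|{: {i | S i}}| = r.-1.
  rewrite card_sig (cardsD1 i0 R) hi0 /=; apply: eq_card => i.
  by rewrite !inE /= andbC.
pose E := {ffun {i | S i} -> 'I_A.+1}.
pose ev (e : E) (i : ix) : nat := if @idP (S i) is ReflectT h then e (exist _ i h) else 0%N.
have evA e i : (ev e i <= A)%N by rewrite /ev; case: {-}_ / idP => // h; rewrite -ltnS.
have evS (e e' : E) : (forall i, S i -> ev e i = ev e' i) -> e = e'.
  move=> h; apply/ffunP => -[i hi]; apply: val_inj; have := h i hi; rewrite /ev /=.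
  by case: {-}_ / idP => // h'; rewrite (bool_irrelevance h' hi).
pose b := (kp * A).+1.
(* At i other than i0 this allows the size C 2^(kp e_i). The place i0 compensates, so that the
   exponents sum to b r; b exceeds every kp e_i, which keeps them positive. *)
pose y (e : E) (i : ix) := if i == i0 then (b + \sum_(j in R | j != i0) kp * ev e j)%N else (b - kp * ev e i)%N.
have yb e i : (kp * ev e i < b)%N by rewrite ltnS leq_mul2l evA orbT.
have y0 e i : (0 < y e i)%N by rewrite /y; case: ifP => // _; rewrite subn_gt0 yb.
have ysum e : (\sum_(i in R) y e i = b * r)%N.
  rewrite (bigD1 i0) //= {1}/y eqxx -addnA -big_split /=.
  rewrite (eq_bigr (fun=> b)); last first.
    by move=> i /andP[_ /negPf n]; rewrite /y n subnKC // ltnW.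
  rewrite sum_nat_const -mulSn mulnC; congr (_ * _)%N.
  rewrite [in RHS](cardsD1 i0 R) hi0 add1n; congr _.+1; by apply: eq_card => i; rewrite in_setD1 andbC.
have hal e := hC b (y e) (y0 e) (ysum e).
pose al e := projT1 (cid (hal e)).
have alP e : [/\ OK K (al e), al e != 0 & forall i, i \in R -> `|em i (al e)| * 2%:R ^+ y e i <= C%:R * 2%:R ^+ b].
  by rewrite /al; case: cid.
have upS e i : S i -> `|em i (al e)| <= C%:R * 2%:R ^+ (kp * ev e i).
  move=> /andP[a n]; have [_ _ h] := alP e; have := h i a.
  rewrite /y (negPf n) -{2}(subnK (ltnW (yb e i))) exprD mulrA [X in _ <= X]mulrAC.
  by rewrite ler_pM2r ?two_gt0.
have up0 e : `|em i0 (al e)| * 2%:R ^+ (\sum_(j in R | j != i0) kp * ev e j) <= C%:R.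
  have [_ _ h] := alP e; have := h i0 hi0; rewrite /y eqxx exprD (mulrC (2%:R ^+ b)) mulrA.
  by rewrite ler_pM2r ?two_gt0.
have Ck : forall e, al e != 0 by move=> e; have [] := alP e.
have pos e (i : ix) : 0 < `|em i (al e)| by rewrite normr_gt0 em_neq0.
(* the product over R of the normalised sizes *)
pose nz e i := if i == i0 then `|em i0 (al e)| * 2%:R ^+ (\sum_(j in R | j != i0) kp * ev e j)
               else `|em i (al e)| / 2%:R ^+ (kp * ev e i).
have nz0 e i : 0 <= nz e i by rewrite /nz; case: ifP => _; [rewrite mulr_ge0 ?two_ge0|rewrite divr_ge0 ?two_ge0].
have nzC e i : i \in R -> nz e i <= C%:R.
  move=> hi; rewrite /nz; case: (eqVneq i i0) => [_|n]; first exact: up0.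
  rewrite ler_pdivrMr ?two_gt0 //.
  by apply: upS; rewrite /S /= hi.
have nzP e : \prod_(i in R) nz e i = \prod_(i in R) `|em i (al e)|.
  rewrite (bigD1 i0) //= [in RHS](bigD1 i0) //= {1}/nz eqxx -mulrA; congr (_ * _).
  rewrite -prodrXr -big_split /=; apply: eq_bigr => i /andP[_ /negPf n].
  by rewrite /nz n mulrC divfK // expf_neq0 // pnatr_eq0.
have nz1 e : 1 <= \prod_(i in R) nz e i.
  have [oa na _] := alP e; have := Nm_ge1 N oa na; rewrite norm_reps ?nzP //; last by case: oa.
  by rewrite -[X in X <= _](expr1n _ 2) ler_pXn2r ?nnegrE ?ler01 //; apply: prodr_ge0.
have lo e i : i \in R -> 1 <= nz e i * C%:R ^+ r.-1.
  move=> hi; apply: (le_trans (nz1 e)); rewrite (bigD1 i) //= ler_wpM2l //.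
  have -> : C%:R ^+ r.-1 = \prod_(j in R | j != i) C%:R :> algC.
    rewrite prodr_const; congr (_ ^+ _); rewrite (cardsD1 i R) hi add1n; apply: eq_card => j.
    by rewrite in_setD1 andbC.
  by apply: ler_prod => j /andP[hj _]; rewrite nz0 nzC.
have Cr : C%:R ^+ r = C%:R * C%:R ^+ r.-1 :> algC by rewrite -exprS prednK.
have Cr0 : 0 <= C%:R ^+ r.-1 :> algC by rewrite exprn_ge0 ?ler0n.
have nzr e e' i : i \in R -> nz e i < 2%:R ^+ kp * nz e' i.
  move=> hi; apply: (le_lt_trans (nzC e i hi)).
  have h := lo e' i hi; have nzp : 0 < nz e' i.
    by rewrite lt0r nz0 andbT; apply/eqP => z; move: h; rewrite z mul0r ler10.
  have : C%:R <= nz e' i * C%:R ^+ r.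
    by rewrite Cr mulrCA -{1}[C%:R]mulr1 ler_wpM2l ?ler0n.
  by move=> h2; apply: (le_lt_trans h2); rewrite mulrC ltr_pM2r.
have nlt (x z : nat) : (x < z)%N -> (kp * x + kp <= kp * z)%N by move=> h; rewrite -mulnSr leq_mul2l h orbT.
have al_inj : injective al.
  move=> e e' ee; apply: evS => i hi; have /andP[hiR n] := hi.
  have main (f g : E) : al f = al g -> ~~ (ev f i < ev g i)%N.
    move=> efg; apply/negP => hlt; have := nzr f g i hiR; rewrite /nz (negPf n) efg.
    rewrite real_ltNge ?rpredM ?rpredV ?rpredX ?ger0_real ?ler0n ?normr_ge0 //; case/negP.
    rewrite mulrCA ler_pM2l // ler_pdivrMr ?two_gt0 // [leRHS]mulrC ler_pdivlMr ?two_gt0 //.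
    by rewrite -exprD two_le addnC nlt.
  by apply/eqP; rewrite eqn_leq (leqNgt (ev e i)) (leqNgt (ev e' i)) (main e' e) ?(main e e').
have divm e : OK K (m%:R / al e).
  have [oa na _] := alP e; have ka := OK_sub oa; split; first by sf.
  have /natrP[k ek] := natr_norm_int (Nm_int N oa).
  have kle : (k <= C ^ (2 * r))%N.
    rewrite -(ler_nat algC) -ek norm_reps // natrX mulnC exprM ler_pXn2r ?nnegrE ?exprn_ge0 ?ler0n //.
      by rewrite -nzP -prodr_const; apply: ler_prod => i hi; rewrite nz0 nzC.
    by apply: prodr_ge0.
  have k0 : (0 < k)%N by rewrite -(ltr_nat algC) -ek normr_gt0 Nm_neq0.
  have /dvdnP[q eq] : (k %| m)%N by apply: dvdn_fact; rewrite k0.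
  rewrite -(Aint_aut (em i0)) fmorph_div rmorph_nat eq natrM -ek -mulrA rpredM ?rpred_nat //.
  have -> : `|Nm N (al e)| / em i0 (al e) = (`|Nm N (al e)| / Nm N (al e)) * \prod_(j : ix | j != i0) em j (al e).
    have nn := Nm_neq0 N na; rewrite /Nm in nn *; rewrite (bigD1 i0) //=.
    set P := \prod_(_ | _) _; have P0 : P != 0 by apply/prodf_neq0 => j _; rewrite em_neq0.
    by field; rewrite P0 em_neq0.
  rewrite rpredM //; last by apply: rpred_prod => j _; rewrite Aint_aut; case: oa.
  have /intrP[z ez] := Nm_int N oa; rewrite ez -intr_norm.
  have z0 : z != 0 by rewrite -(intr_eq0 algC) -ez Nm_neq0.
  have [zz|zz] := leP 0 z; first by rewrite ger0_norm // divff ?rpred1 // intr_eq0.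
  by rewrite ltr0_norm // rmorphN mulNr divff ?rpredN ?rpred1 // intr_eq0.
have ratioO e e' : res (al e) = res (al e') -> OK K (al e / al e').
  move=> ee; have [oa na _] := alP e; have [ob nb _] := alP e'.
  have [w ow ew] := hres _ _ oa ob ee.
  have -> : al e / al e' = 1 + m%:R * w / al e' by rewrite -ew; field; exact: nb.
  rewrite mulrAC.
  by have := divm e' => ?; sf.
have ru e e' : res (al e) = res (al e') -> unit K (al e / al e').
  move=> ee; split; first by rewrite mulf_neq0 ?invr_eq0.
    exact: ratioO.
  by rewrite invf_div; apply: ratioO.
have [t ht] : exists t, (A.+1 ^ r.-1 <= #|T| * #|[set e | res (al e) == t]|)%N.
  apply: contrapT => hn.
  have : (\sum_t #|T| * #|[set e | res (al e) == t]| < \sum_(t : T) A.+1 ^ r.-1)%N.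
    have lt t : (#|T| * #|[set e | res (al e) == t]| < A.+1 ^ r.-1)%N.
      by rewrite ltnNge; apply/negP => h; apply: hn; exists t.
    rewrite (bigD1 (res 0)) //= [X in (_ < X)%N](bigD1 (res 0)) //= -addSn leq_add //.
    by apply: leq_sum => t _; exact: ltnW.
  have -> : (\sum_t #|T| * #|[set e | res (al e) == t]| = #|T| * #|E|)%N.
    rewrite -big_distrr /=; congr (_ * _)%N.
    rewrite -[RHS]sum1_card (partition_big (fun e : E => res (al e)) xpredT) //=.
    by apply: eq_bigr => t _; rewrite -sum1_card; apply: eq_bigl => e; rewrite inE.
  by rewrite sum_nat_const card_ffun card_ord cS ltnn.
set F := [set e | _] in ht.
have [e0 he0] : exists e, e \in F.
  apply/set0Pn; apply/eqP => F0; move: ht; rewrite F0 cards0 muln0 leqn0 expn_eq0 //.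
exists [seq al e / al e0 | e <- enum F]; split.
- rewrite map_inj_uniq ?enum_uniq // => e e' /mulIf h; apply: al_inj; apply: h.
  by rewrite invr_eq0.
- move=> _ /mapP[e he ->]; rewrite mem_enum in he.
  have ee : res (al e) = res (al e0) by move: he he0; rewrite !inE => /eqP-> /eqP->.
  have U := ru _ _ ee; split=> //.
  have ku := unit_sub U.
  have bnd i : i \in R -> `|em i (al e / al e0)| <= 2%:R ^+ ((kp * r * #|T|).+1 * A.+1)%N.
    move=> hi; apply: (@le_trans _ _ (2%:R ^+ (kp * r * A.+1)%N)); last first.
      by rewrite two_le leq_mul2r; apply/orP; right; rewrite (leq_trans (leq_pmulr _ T0)).
    rewrite fmorph_div normf_div ler_pdivrMr //.
    have := ltW (nzr e e0 i hi); rewrite /nz; case: ifP => [/eqP->|n].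
      have [_ hlo] := (up0 e, lo e i0 hi0).
      set s1 := (\sum_(_ | _) _)%N; set s0 := (\sum_(_ | _) _)%N => h.
      have s0b : (s0 <= kp * (r.-1 * A))%N.
        rewrite /s0 -big_distrr /= leq_mul2l; apply/orP; right.
        apply: (@leq_trans (\sum_(j in R | j != i0) A)%N); first by apply: leq_sum => j _.
        by rewrite sum_nat_const leq_mul2r -cS card_sig leqnn orbT.
      have le1 : `|em i0 (al e)| <= `|em i0 (al e)| * 2%:R ^+ s1.
        by rewrite ler_peMr // -[1](expr0 2%:R) two_le.
      apply: (le_trans le1); apply: (le_trans h); rewrite mulrCA mulrC ler_pM2r // -exprD two_le.
      rewrite (leq_trans (leq_add (leqnn kp) s0b)) // -mulnS -mulnA leq_mul2l; apply/orP; right.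
      by move: r0; clear; nia.
    rewrite ler_pdivrMr ?two_gt0 // => h; apply: (le_trans h).
    have d1 : `|em i (al e0)| / 2%:R ^+ (kp * ev e0 i)%N <= `|em i (al e0)|.
      by rewrite ler_pdivrMr ?two_gt0 // ler_peMr // -[1](expr0 2%:R) two_le.
    have d2 : 2%:R ^+ (kp * ev e i)%N <= 2%:R ^+ (kp * A)%N :> algC by rewrite two_le leq_mul2l evA orbT.
    apply: (@le_trans _ _ (2%:R ^+ kp * `|em i (al e0)| * 2%:R ^+ (kp * A)%N)).
      apply: ler_pM => //; rewrite ?two_ge0 //; last by rewrite ler_wpM2l ?two_ge0.
      by rewrite mulr_ge0 ?two_ge0 // divr_ge0 ?two_ge0.
    rewrite mulrAC ler_pM2r // -exprD two_le -mulnS leq_mul2r.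
    by apply/orP; right; rewrite leq_pmulr.
  move=> i; have [/bnd//|] := boolP (i \in R); rewrite -(reps_cj tc) => /bnd.
  by rewrite norm_cj.
rewrite size_map -cardE; apply: (leq_trans ht); rewrite leq_mul2r; apply/orP; right.
by rewrite (leq_trans _ (leqnSn _)) // leq_pmull // muln_gt0 r0 andbT muln_gt0 r0.
Qed.
End UnitsLower.

(** * Unramified quadratic extensions *)

Lemma expn_le m n e : (m <= n)%N -> (m ^ e <= n ^ e)%N.
Proof. by case: e => // e h; rewrite leq_exp2r. Qed.
Lemma pow2_gt0 k : (0 < 2 ^ k)%N. Proof. by rewrite expn_gt0. Qed.

(** * Square classes of units and the Herbrand inequality *)

Section UnitSquares.
Variables (K : cpred) (N : nf K).
Let hK := nf_sf N.
Local Notation ix := (ix N).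
Local Notation house x A := (forall i : ix, `|em i x| <= 2%:R ^+ A).
Local Notation r := #|reps N|.

Lemma house_seq (c : seq algC) : exists A, forall x, x \in c -> house x A.
Proof.
elim: c => [|x c [A hA]]; first by exists 0%N.
have [B hB] := house_ex N x; exists (A + B)%N => y; rewrite inE => /predU1P[->|/hA h].
  by apply: house_le hB; rewrite leq_addl.
by apply: house_le h; rewrite leq_addr.
Qed.

Hypothesis tc : forall i : ix, cj i <> i.

(* If c represents M square classes of units, then (c, theta) |-> c theta^2
   multiplies the number of units by M / 2 while the logarithmic size doubles;
   this is compared with the bound of order r - 1 on the growth. *)
Lemma sq_upper (c : seq algC) : uniq c -> (forall x, x \in c -> unit K x) ->
  (forall x y t, x \in c -> y \in c -> unit K t -> x = y * t ^+ 2 -> x = y) ->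
  (size c <= 2 ^ r)%N.
Proof.
move=> uc hc dc; have [A hA] := house_seq c; have [C hC] := units_upper tc.
have [i0 hi0] := reps_inh tc.
have r0 : (0 < r)%N by apply/card_gt0P; exists i0.
have step k : exists s : seq algC, [/\ uniq s,
    forall u, u \in s -> unit K u /\ house u (A * (2 ^ k).-1)%N & (size c ^ k <= 2 ^ k * size s)%N].
  elim: k => [|k [s [us hs cs]]].
    exists [:: 1]; split=> // u; rewrite inE => /eqP ->; split; first exact: unit1.
    by move=> i; rewrite rmorph1 normr1 muln0 expr0.
  pose l := [seq (x, t) | x <- c, t <- s]; pose f (p : algC * algC) := p.1 * p.2 ^+ 2.
  have ul : uniq l by apply: allpairs_uniq => // -[a b] [a' b'].
  have hl p : p \in l -> p.1 \in c /\ p.2 \in s by case/allpairsP => q [a b ->].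
  exists (undup (map f l)); split; first exact: undup_uniq.
    move=> u; rewrite mem_undup => /mapP[p /hl [a b] ->]; have [ub hb] := hs _ b.
    split; first by apply: unitM => //; [exact: hc|exact: unitX].
    apply: house_le (houseM (hA _ a) (houseM hb hb)).
    rewrite -mulnDr -{1}[A]muln1 -mulnDr leq_mul2l; apply/orP; right.
    by have := pow2_gt0 k; rewrite expnS; move: (2 ^ k)%N; clear; lia.
  have := @fiber_bound _ _ f l 2 ul.
  have -> : size l = (size c * size s)%N by rewrite size_allpairs.
  move=> /(_ _) h; have {h} : (size c * size s <= 2 * size (undup (map f l)))%N.
    apply: h => -[|p s'] us' sub ef //.
    have -> : 2%N = size [:: p; (p.1, - p.2)] by [].
    apply: uniq_leq_size => // q hq; have [pc ps] := hl p (sub p (mem_head _ _)).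
    have [qc qs] := hl q (sub q hq); have e := ef q p hq (mem_head _ _).
    have [up _] := hs _ ps; have [uq _] := hs _ qs.
    have n1 := unit_neq0 uq; have n2 := unit_neq0 (hc _ pc).
    have e1 : q.1 = p.1.
      apply: (dc _ _ (p.2 / q.2)) => //; first by apply: unitM => //; exact: unitV.
      rewrite expr_div_n mulrA -[LHS](mulfK (expf_neq0 2 n1)); congr (_ / _).
      exact: e.
    move: e; rewrite /f e1 => /(mulfI n2) /eqP; rewrite eqf_sqr.
    by case: q e1 {hq qc qs uq n1} => a b /= -> /orP[/eqP->|/eqP->]; rewrite !inE ?eqxx ?orbT // -surjective_pairing eqxx.
  move=> h; rewrite !expnS.
  apply: (@leq_trans (size c * (2 ^ k * size s))%N); first by rewrite leq_mul2l cs orbT.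
  by rewrite mulnCA (mulnC 2) -mulnA leq_mul2l h orbT.
apply: (@pow_growth _ _ (C * A.+1 ^ r.-1)%N) => [|k]; first by rewrite expn_gt0.
have [s [us hs cs]] := step k; apply: (leq_trans cs).
have := hC (A * (2 ^ k).-1)%N s us hs => h1.
have h2 : ((A * (2 ^ k).-1).+1 <= A.+1 * 2 ^ k)%N.
  by have := pow2_gt0 k; move: (2 ^ k)%N; clear; nia.
have h3 := expn_le r.-1 h2.
apply: (@leq_trans (2 ^ k * (C * (A.+1 * 2 ^ k) ^ r.-1))%N).
  by rewrite leq_mul2l (leq_trans h1) ?orbT // leq_mul2l h3 orbT.
have er : (r * k = k + k * r.-1)%N by rewrite -mulnS prednK // mulnC.
rewrite expnMn -!expnM er expnD.
by move: (2 ^ k)%N (2 ^ _)%N (A.+1 ^ _)%N => a b d; clear; nia.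
Qed.
End UnitSquares.

Section UnitIndex.
Variables (K : cpred) (N : nf K) (s : algC) (rho : {rmorphism algC -> algC}).
Hypotheses (Q : quad K s rho) (sA : s \in Aint).
Hypothesis tc : forall i : ix N, cj i <> i.
Local Notation L := (qext K s).
Local Notation r := #|reps N|.
Let hK := qd_sf Q.
Let rK := qd_fix Q.
Let hL := quad_sf Q.

Definition normone u := unit L u /\ u * rho u = 1.

Lemma normone1 : normone 1.
Proof. by split; [exact: unit1|rewrite rmorph1 mulr1]. Qed.
Lemma normoneV x : normone x -> normone x^-1.
Proof. by move=> [a b]; split; [exact: unitV|rewrite fmorphV -invfM b invr1]. Qed.

(** The map u -> u / rho u sends units of L to norm-one units, and two units with the same image
    differ by a unit of K. Up to logarithmic size A there are of order A^(2 r - 1) units of L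
    against A^(r - 1) units of K, which leaves A^r values. *)
Lemma normone_lower (N' : nf L) : #|ix N'| = (2 * #|ix N|)%N ->
  (forall i : ix N, exists j : ix N', forall x, em j x = em i x) ->
  (forall j : ix N', exists j' : ix N', forall x, L x -> em j (rho x) = em j' x) ->
  (forall j : ix N', cj j <> j) ->
  exists D : nat, forall A : nat, exists l : seq algC,
  [/\ uniq l, forall u, u \in l -> normone u /\ (forall j : ix N', `|em j u| <= 2%:R ^+ (D * A.+1)%N) &
     (A.+1 ^ r <= D * size l)%N].
Proof.
move=> cN p1 p2 tc'; have [D1 [D10 hD1]] := units_lower tc'; have [C hC] := units_upper tc.
have [i0 hi0] := reps_inh tc.
have r0 : (0 < r)%N by apply/card_gt0P; exists i0.
have rr : #|reps N'| = (2 * r)%N.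
  by move: cN; rewrite (card_reps tc) (card_reps tc') => /eqP; rewrite eqn_pmul2l // => /eqP.
set n' := #|ix N'| in cN *.
pose D2 := (D1 + D1 * n')%N; pose D3 := (D1 * (C * D2.+1 ^ r.-1))%N.
exists (D2 + D3)%N => A; have [l [ul hl cl]] := hD1 A.
pose f u := u / rho u; exists (undup (map f l)); split; first exact: undup_uniq.
  move=> w; rewrite mem_undup => /mapP[u hu ->]; have [U hu'] := hl u hu.
  have Ur := unit_rho Q U; have n0 := unit_neq0 U; have lu := unit_sub U.
  split.
    split; first by apply: unitM => //; exact: unitV.
    by rewrite /f rmorphM fmorphV (rhoK Q lu) mulrA divfK ?divff // (unit_neq0 Ur).
  have hr : forall j : ix N', `|em j (rho u)| <= 2%:R ^+ (D1 * A.+1)%N.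
    by move=> j; have [j' ->] := p2 j.
  have := houseM hu' (houseV Ur hr); apply: house_le.
  by rewrite /D2 -/n'; nia.
have h := @fiber_bound _ _ f l (C * (D2.+1 * A.+1) ^ r.-1)%N ul.
have {h} h : (size l <= C * (D2.+1 * A.+1) ^ r.-1 * size (undup (map f l)))%N.
  apply: h => -[|u0 s'] us' sub ef //.
  have [U0 h0] := hl _ (sub _ (mem_head _ _)); have n0 := unit_neq0 U0.
  rewrite -(size_map (fun u => u / u0)); apply: (@leq_trans (C * (D2 * A.+1).+1 ^ r.-1)%N).
    apply: hC; first by rewrite map_inj_uniq // => x y; apply: mulIf; rewrite invr_eq0.
    move=> w /mapP[u hu ->]; have [U hu'] := hl _ (sub _ hu).
    have UU : unit L (u / u0) by apply: unitM => //; exact: unitV.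
    split.
      apply: (unit_restr Q UU); apply: (rho_fix Q); first exact: (unit_sub UU).
      have r1 : rho u != 0 by rewrite fmorph_eq0 (unit_neq0 U).
      have r2 : rho u0 != 0 by rewrite fmorph_eq0.
      have /eqP := ef u u0 hu (mem_head _ _); rewrite /f eqr_div // => /eqP e.
      by apply/eqP; rewrite rmorphM fmorphV eqr_div // e mulrC.
    move=> i; have [j ej] := p1 i; rewrite -ej.
    have := houseM hu' (houseV U0 h0) j; move=> /le_trans; apply.
    by rewrite two_le /D2 -/n'; nia.
  rewrite leq_mul2l; apply/orP; right; apply: expn_le; nia.
have := leq_trans cl (leq_mul (leqnn D1) h); rewrite rr.
have -> : (2 * r).-1 = (r + r.-1)%N by move: r0; clear; lia.
rewrite expnD expnMn => h2.
have A0 : (0 < A.+1 ^ r.-1)%N by rewrite expn_gt0.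
rewrite -(leq_pmul2r A0); apply: (leq_trans h2).
rewrite !mulnA mulnAC leq_mul2r; apply/orP; right.
by rewrite mulnDl -!mulnA /D3 leq_addl.
Qed.

(** Let a family with the greatest number M of classes be given, so that every norm-one unit is x
    t^2 with x in it. Passing from x t^2 to t halves the logarithmic size and divides the count by
    at most M / 2, since t and -t both occur. After k halvings (2^k)^r is at most a constant times
    (M / 2)^k, whence 2^(r+1) <= M. *)
Lemma normone_squares : exists c : seq algC, [/\ uniq c, forall x, x \in c -> normone x,
  forall x y t, x \in c -> y \in c -> normone t -> x = y * t ^+ 2 -> x = y & (2 ^ r.+1 <= size c)%N].
Proof.
pose good (c : seq algC) := [/\ uniq c, forall x, x \in c -> normone x &
  forall x y t, x \in c -> y \in c -> normone t -> x = y * t ^+ 2 -> x = y].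
apply: contrapT => hn.
have small c : good c -> (size c < 2 ^ r.+1)%N.
  by move=> [a b d]; rewrite ltnNge; apply/negP => h; apply: hn; exists c.
have ex0 : exists k, exists2 c, good c & (2 ^ r.+1 - size c)%N = k.
  by exists (2 ^ r.+1 - 0)%N, [::] => //; split=> // x y t.
have [k0 [c gc ek] kmin] := natP_min ex0.
have cmax c' : good c' -> (size c' <= size c)%N.
  move=> g; have := kmin _ (ex_intro2 _ _ c' g erefl); rewrite -ek.
  by have := small _ g; have := small _ gc; lia.
have [uc hc dc] := gc; set M := size c in cmax.
have rep x : exists p : algC * algC, normone x -> [/\ p.1 \in c, normone p.2 & x = p.1 * p.2 ^+ 2].
  have [hx|hx] := pselect (normone x); last by exists (0, 0).
  apply: contrapT => hne.
  have nx y t : y \in c -> normone t -> x != y * t ^+ 2.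
    by move=> hy ht; apply/eqP => e; apply: hne; exists (y, t).
  have : good (x :: c).
    split.
    - rewrite /= uc andbT; apply/negP => hxc; have := nx x 1 hxc normone1.
      by rewrite expr1n mulr1 eqxx.
    - by move=> y; rewrite inE => /predU1P[->|/hc].
    move=> y z t; rewrite !inE => /predU1P[->|hy] /predU1P[->|hz] ht e //.
    - by have := nx z t hz ht; rewrite e eqxx.
    - have [[nt _ _] _] := ht; have := nx y t^-1 hy (normoneV ht).
      by rewrite e exprVn mulfK ?expf_neq0 ?eqxx.
    exact: (dc y z t).
  by move/cmax; rewrite /= ltnn.
have /choice [p hp] := rep.
have [N' [cN p1 p2 p3]] := nf_qext N Q sA; have tc' := p3 tc.
have [D hD] := normone_lower cN p1 p2 tc'.
have [A0 hA0] := house_seq N' (map (fun x => x^-1) c); set A := (A0 + D)%N.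
have [C0 hC0] := northcott N' (A * 2)%N.
(* The summand 1 in A (2^k + 1) absorbs the representatives, of exponent A0 <= A: half of A (2^(k+1)
   + 1) + A0 is at most A (2^k + 1). *)
have bound k : forall l, uniq l -> (forall u, u \in l -> normone u /\
    (forall j : ix N', `|em j u| <= 2%:R ^+ (A * (2 ^ k).+1)%N)) -> (2 ^ k * size l <= M ^ k * C0)%N.
  elim: k => [|k IH] l ul hl.
    rewrite !expn0 !mul1n; apply: hC0 => // x /hl [[[_ a _] _] h]; split=> //.
  have sq u : u \in l -> forall j : ix N', `|em j (p u).2| <= 2%:R ^+ (A * (2 ^ k).+1)%N.
    move=> /hl [hu hb] j; have [a b e] := hp u hu; have [U1 _] := hc _ a; have n1 := unit_neq0 U1.
    rewrite -(ler_pXn2r (isT : (0 < 2)%N)) ?nnegrE ?two_ge0 // -normrX -rmorphXn /=.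
    have -> : (p u).2 ^+ 2 = u * (p u).1^-1 by rewrite {2}e mulrAC divff // mul1r.
    have hi : forall j : ix N', `|em j (p u).1^-1| <= 2%:R ^+ A0.
      by apply: hA0; apply: map_f.
    have := houseM hb hi j; move=> /le_trans; apply.
    by rewrite -exprM two_le expnS /A; move: (2 ^ k)%N; clear; nia.
  have h := @fiber_bound _ _ (fun u => (p u).1) l ((M ^ k * C0) %/ 2 ^ k.+1) ul.
  have {h} h : (size l <= (M ^ k * C0) %/ 2 ^ k.+1 * M)%N.
    apply: leq_trans (h _) _.
      move=> g ug sub eg; rewrite leq_divRL ?pow2_gt0 //.
      pose th := map (fun u => (p u).2) g.
      have gP u : u \in g -> [/\ (p u).1 \in c, normone (p u).2 & u = (p u).1 * (p u).2 ^+ 2].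
        by move=> /sub /hl [hu _]; apply: hp.
      have inj u v : u \in g -> v \in g -> (p u).2 ^+ 2 = (p v).2 ^+ 2 -> u = v.
        move=> hu hv e; have [_ _ ->] := gP u hu; have [_ _ eqv] := gP v hv.
        by rewrite [RHS]eqv (eg u v hu hv) e.
      have uth : uniq (th ++ map -%R th).
        rewrite cat_uniq (map_inj_uniq oppr_inj) andbA andbC andbA; apply/andP; split; last first.
          apply/hasPn => _ /mapP[_ /mapP[u hu ->] ->]; apply/negP => /mapP[v hv e].
          have euv : u = v by apply: inj => //; rewrite -e sqrrN.
          have [_ [U _] _] := gP v hv; move/eqP: e; rewrite -euv eq_sym -addr_eq0 -mulr2n mulrn_eq0 /=.
          by rewrite euv (negPf (unit_neq0 U)).
        have : uniq th by rewrite map_inj_in_uniq // => u v hu hv e; apply: inj => //; rewrite e.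
        by move=> ->.
      have := IH _ uth; rewrite size_cat !size_map addnn -mul2n => IH'.
      have -> : (size g * 2 ^ k.+1 = 2 ^ k * (2 * size g))%N by rewrite expnS mulnA mulnC (mulnC 2).
      apply: IH' => w; rewrite mem_cat => /orP[/mapP[u hu ->]|].
        by have [_ b _] := gP u hu; split=> //; apply: sq; exact: sub.
      move=> /mapP[_ /mapP[u hu ->] ->]; have [_ [b1 b2] _] := gP u hu; split.
        split; first exact: unitN.
        by rewrite rmorphN mulrNN.
      by move=> j; rewrite rmorphN normrN; apply: sq; exact: sub.
    rewrite leq_mul2l; apply/orP; right; apply: uniq_leq_size; first exact: undup_uniq.
    move=> x; rewrite mem_undup => /mapP[u /hl [hu _] ->]; by have [] := hp u hu.
  have h2 : (2 ^ k.+1 * size l <= 2 ^ k.+1 * ((M ^ k * C0) %/ 2 ^ k.+1 * M))%N by rewrite leq_mul2l h orbT.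
  apply: (leq_trans h2); rewrite (expnS M k).
  have := leq_trunc_div (M ^ k * C0) (2 ^ k.+1).
  by set a := (M ^ k * C0 %/ 2 ^ k.+1)%N; move: a (2 ^ k.+1)%N (M ^ k)%N; clear; nia.
have M0 : (0 < M)%N.
  apply: (cmax [:: 1]); split=> // [x|x y t]; rewrite !inE; first by move=> /eqP->; exact: normone1.
  by move=> /eqP-> /eqP->.
have : (2 ^ r.+1 <= M)%N.
  apply: (@pow_growth _ _ (D * C0)%N) => // k.
  have [l [ul hl cl]] := hD (2 ^ k).-1; rewrite prednK ?pow2_gt0 // in hl cl.
  have hl' u : u \in l -> normone u /\ (forall j : ix N', `|em j u| <= 2%:R ^+ (A * (2 ^ k).+1)%N).
    move=> /hl [a b]; split=> //; apply: house_le b.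
    by rewrite /A; move: (2 ^ k)%N; clear; nia.
  have := bound k l ul hl'; rewrite expnS expnMn -!expnM (mulnC r k) expnM => h.
  apply: (@leq_trans (2 ^ k * (D * size l))%N); first by rewrite leq_mul2l cl orbT.
  by rewrite mulnCA -!mulnA leq_mul2l (mulnC C0) h orbT.
by rewrite leqNgt small.
Qed.

(* The Herbrand quotient inequality |H^1(E_L)| >= 2 [E_K : N E_L]. *)
Lemma herbrand (v : seq algC) (J : nat) (col : algC -> 'I_J) :
  uniq v -> (forall x, x \in v -> unit K x) ->
  (forall x y e, x \in v -> y \in v -> unit L e -> x = y * (e * rho e) -> x = y) ->
  (forall x y, normone x -> normone y -> col x = col y ->
     exists2 e, unit L e & x = y * (e / rho e)) ->
  (2 * size v <= J)%N.
Proof.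
move=> uv hv dv hcol; have [c [uc hc dc cc]] := normone_squares.
have [->//|v0] := eqVneq (size v) 0%N; rewrite -lt0n in v0.
(* Each colour takes at most 2^r / |v| of the 2^(r+1) classes in c. Write the elements of one colour
   as x = x1 e / rho e; then (a, x) -> a e rho e, for a in v, is injective into the square classes
   of units of K, of which [sq_upper] allows 2^r. *)
have h := @fiber_bound _ _ col c (2 ^ r %/ size v) uc.
have {h} h : (size c <= 2 ^ r %/ size v * J)%N.
  apply: leq_trans (h _) _; last first.
    rewrite leq_mul2l; apply/orP; right; rewrite -[leqRHS]card_ord cardE.
    by apply: uniq_leq_size; [exact: undup_uniq|move=> x _; rewrite mem_enum].
  move=> [|x1 g'] ug sub eg //; set g := x1 :: g' in ug sub eg *.
  rewrite leq_divRL //.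
  have rep x : exists e, x \in g -> unit L e /\ x = x1 * (e / rho e).
    have [hx|hx] := boolP (x \in g); last by exists 0.
    have [] := hcol x x1 (hc _ (sub _ hx)) (hc _ (sub _ (mem_head _ _))); first exact: eg (mem_head _ _).
    by move=> e he ee; exists e.
  have /choice [e he] := rep.
  pose f (q : algC * algC) := q.1 * (e q.2 * rho (e q.2)).
  have main q q' t : q.1 \in v -> q.2 \in g -> q'.1 \in v -> q'.2 \in g -> unit K t ->
      f q = f q' * t ^+ 2 -> q = q'.
    case: q q' => [a x] [a' x'] /= ha hx ha' hx' ut; rewrite /f /=.
    have [U ex] := he x hx; have [U' ex'] := he x' hx'.
    have n0 := unit_neq0 U; have n0' := unit_neq0 U'; have nt := unit_neq0 ut.
    have rn0 : rho (e x) != 0 by rewrite fmorph_eq0.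
    have rn0' : rho (e x') != 0 by rewrite fmorph_eq0.
    have et : rho t = t by apply: rK; exact: unit_sub ut.
    have na := unit_neq0 (hv _ ha); have na' := unit_neq0 (hv _ ha').
    move=> E; have Ut := unit_ext Q ut.
    have eaa : a = a'.
      apply: (dv a a' (e x' * t / e x)) => //.
        by apply: unitM => //; [exact: unitM|exact: unitV].
      have -> : a = a * (e x * rho (e x)) / (e x * rho (e x)) by rewrite mulfK // mulf_neq0.
      rewrite E !rmorphM fmorphV et; field; by rewrite n0 rn0.
    congr pair => //; rewrite eaa in E.
    have {}E : e x * rho (e x) = e x' * rho (e x') * t ^+ 2.
      by apply: (mulfI na'); rewrite E -!mulrA.
    apply: (dc x x' (e x / (e x' * t))); [exact: sub|exact: sub| |].
      split; first by apply: unitM => //; apply: unitV; exact: unitM.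
      rewrite !rmorphM fmorphV rmorphM et mulrACA E -invfM.
      by field; rewrite nt n0' rn0'.
    have e1 : x = x' * (e x / rho (e x) / (e x' / rho (e x'))).
      have [[nx1 _ _] _] := hc _ (sub _ (mem_head x1 g')).
      by rewrite [LHS]ex [X in _ = X * _]ex'; field; rewrite rn0 rn0' n0'.
    rewrite [LHS]e1; congr (_ * _); have -> : rho (e x) = e x' * rho (e x') * t ^+ 2 / e x by rewrite -E mulrAC divff ?mul1r.
    by field; rewrite n0 rn0' nt n0'.
  have -> : (size g * size v)%N = size [seq f (a, x) | a <- v, x <- g] by rewrite size_allpairs mulnC.
  have allP w : w \in [seq f (a, x) | a <- v, x <- g] -> exists q, [/\ q.1 \in v, q.2 \in g & w = f q].
    by case/allpairsP => q [a b ->]; exists q; case: q a b.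
  apply: (sq_upper tc).
  - apply: allpairs_uniq => // q q' /allpairsP[z [z1 z2 ->]] /allpairsP[z' [z1' z2' ->]] E.
    apply: (main _ _ 1) => //; first exact: unit1.
    by rewrite expr1n mulr1; exact: E.
  - move=> w /allP [q [a b ->]]; apply: unitM => //; first exact: hv.
    by have [U _] := he _ b; apply: (unit_norm Q).
  - move=> w w' t /allP [q [a b ->]] /allP [q' [a' b' ->]] ut E.
    by rewrite (main q q' t).
have h2 : (2 ^ r.+1 <= 2 ^ r %/ size v * J)%N := leq_trans cc h.
have h3 : (size v * 2 ^ r.+1 <= 2 ^ r * J)%N.
  apply: leq_trans (leq_mul (leqnn (size v)) h2) _.
  by rewrite mulnA leq_mul2r mulnC leq_trunc_div orbT.
by move: h3; rewrite expnS mulnCA mulnA (mulnC _ (2 ^ r)%N) leq_pmul2l ?pow2_gt0.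
Qed.

Theorem unramified_even : diffs K s rho 1 -> ~ no2 K.
Proof.
move=> hd n2; have fr := qext_fracs (nf_fr N) sA; have inv := nf_inv N.
(* If all norm-one units were of the form e / rho e, one colour and the single unit 1 would give 2
   <= 1. *)
have := @herbrand [:: 1] 1 (fun=> ord0) isT; move=> /(_ _ _ _) h.
suff : (2 * size [:: (1 : algC)%R] <= 1)%N by [].
apply: h => [x|x y e|x y [Ux ex] [Uy ey] _].
- by rewrite inE => /eqP ->; exact: unit1.
- by rewrite !inE => /eqP-> /eqP->.
have Uxy : unit L (x / y) by apply: unitM => //; exact: unitV.
have ny := unit_neq0 Uy; have rny : rho y != 0 by rewrite fmorph_eq0.
have [|b [lb nb eb]] := hilbert90 Q (unit_sub Uxy).
  by rewrite rmorphM fmorphV mulrACA ex -invfM ey invr1 mulr1.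
have rnb : rho b != 0 by rewrite fmorph_eq0.
have ub : unit L (b / rho b) by rewrite {1}eb mulfK.
have fA := fid_pr hL lb nb.
have rA : rimg K s rho (pr L b) = pr L b.
  by rewrite (rimg_pr Q lb) -[in RHS](divfK rnb b) mulrC (pr_unit hL).
have [a fa ea] := unramified_invariant Q fr fA rA hd.
have [] := ext_prin_sq Q inv n2 fa (g := b * b); [by sf|by rewrite mulf_neq0| |].
  by rewrite -ea imul_pr.
move=> d [nd kd ed]; rewrite ed (ext_pr Q) // in ea.
have ld := qext_subK hK s kd.
have Ue := pr_eq hL lb nb nd ea; exists (b / d) => //.
rewrite rmorphM fmorphV (rK kd) -[x](divfK ny) {1}eb; field.
by rewrite ny rnb nd.
Qed.
End UnitIndex.

(** * Ramified quadratic extensions *)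

Section OddCriteria.
Variables (K : cpred) (N : nf K) (s : algC) (rho : {rmorphism algC -> algC}).
Hypotheses (Q : quad K s rho) (sA : s \in Aint).
Local Notation L := (qext K s).
Let hK := qd_sf Q.
Let rK := qd_fix Q.
Let hL := quad_sf Q.
Let fr := qext_fracs (nf_fr N) sA.
Let inv := nf_inv N.
Let invL := inv_ext Q inv fr.

(** In E A = a O_L the square of E is n O_L = (g)^2, so E = (g) and A = g^-1 a O_L. *)
Lemma ramified_principal d : diffs K s rho d -> d != 0 ->
  (forall n, fid K n -> incl n (OK K) -> n (d * rho d) ->
     exists g, [/\ L g, g != 0 & ext K s n = pr L (g * g)]) ->
  forall A, fid L A -> rimg K s rho A = A ->
     exists x a, [/\ L x, x != 0, fid K a & A = imul (pr L x) (ext K s a)].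
Proof.
move=> hd nd hn A fA rA.
have [a [E [n [[fa fE fn] [[sE Ed e1 e2] [sn hnd]]]]]] := invariant_decomp Q inv fr fA rA hd nd.
have [g [lg ng eg]] := hn n fn sn hnd.
have eE : E = pr L g.
  by apply: (sq_inj hL invL fE (fid_pr hL lg ng)); rewrite e2 eg imul_pr.
exists g^-1, a; split=> //; [by sf|by rewrite invr_eq0|].
by rewrite -e1 eE pr_imulK.
Qed.

(* Modulo P1 the norm form y^2 - s^2 t^2 reduces to a square. *)
Lemma nonnorm P1 P2 v z : maxid K P1 -> maxid K P2 -> imul P1 P2 = pr K (s ^+ 2) ->
  P2 z -> ~ P1 z -> OK K v ->
  (forall w, OK K w -> ~ P1 (v - w ^+ 2)) ->
  forall x, L x -> x * rho x <> v.
Proof.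
move=> m1 m2 eP hz nz ov hv x [y [t [ky kt ->]]]; rewrite (rho_qext Q) // => ev.
have [f1 s1 n1 _] := m1; have [f2 s2 _ _] := m2.
set d := s ^+ 2 in eP; have kd : K d by exact: (qd_s Q).
have nd0 : d != 0.
  by apply: contra_notT (qd_ns Q); rewrite negbK expf_eq0 => /andP[_ /eqP->]; sf.
have {}ev : y ^+ 2 - d * t ^+ 2 = v by rewrite -ev /d; ring.
(* Clears denominators primitively at P1: some c in J^-1 makes c, c y and c t integral without
   putting all three into P1. *)
pose J : cpred := fun u => exists r0 r1 r2, [/\ OK K r0, OK K r1, OK K r2 & u = r0 + r1 * y + r2 * t].
have J1 : J 1 by exists 1, 0, 0; rewrite !mul0r !addr0; split=> //; sf.
have Jy : J y by exists 0, 1, 0; rewrite mul0r mul1r add0r addr0; split=> //; sf.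
have Jt : J t by exists 0, 0, 1; rewrite mul0r mul1r !add0r; split=> //; sf.
have fJ : fid K J.
  split.
  - by move=> _ [a [b [c [[? _] [? _] [? _] ->]]]]; sf.
  - by exists 0, 0, 0; rewrite !mul0r !addr0; split=> //; sf.
  - move=> _ _ [a [b [c [? ? ? ->]]]] [a' [b' [c' [? ? ? ->]]]].
    by exists (a + a'), (b + b'), (c + c'); split; [by sf|by sf|by sf|ring].
  - move=> r _ hr [a [b [c [? ? ? ->]]]]; exists (r * a), (r * b), (r * c).
    by split; [by sf|by sf|by sf|ring].
  - by exists 1; rewrite oner_neq0.
  have [m m0 hm] := nf_fr N ky; have [m' m0' hm'] := nf_fr N kt.
  exists (m%:R * m'%:R); split; [by rewrite -natrM pnatr_eq0 -lt0n muln_gt0 m0|by sf|].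
  move=> _ [a [b [c [[_ ?] [_ ?] [_ ?] ->]]]].
  have -> : m%:R * m'%:R * (a + b * y + c * t) =
    m%:R * m'%:R * a + m'%:R * b * (m%:R * y) + m%:R * c * (m'%:R * t) by ring.
  by apply: rpredD; [apply: rpredD|]; apply: rpredM => //; apply: rpredM => //; exact: rpred_nat.
have [J' fJ' eJ] := inv fJ.
have [c hc nc] : exists2 c, J' c & ~ [/\ P1 c, P1 (c * y) & P1 (c * t)].
  apply: contrapT => hn; apply: n1.
  have : imul J J' 1 by rewrite eJ; sf.
  move: 1; apply: imul_sub => [|a b|u c [r0 [r1 [r2 [h0 h1 h2 ->]]]] hc]; [exact: (fid0 f1)|exact: (fidD f1)|].
  have [a1 a2 a3] : [/\ P1 c, P1 (c * y) & P1 (c * t)].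
    by apply: contrapT => hn'; apply: hn; exists c.
  have -> : (r0 + r1 * y + r2 * t) * c = r0 * c + r1 * (c * y) + r2 * (c * t) by ring.
  by apply: (fidD f1); [apply: (fidD f1)|]; apply: (fidM f1).
have oJ u : J u -> OK K (c * u).
  by move=> hu; rewrite mulrC -eJ; apply: imul_in.
have oc : OK K c by rewrite -[c]mulr1; exact: oJ.
have oy := oJ y Jy; have ot := oJ t Jt.
have P1d : P1 d.
  have : imul P1 P2 d by rewrite eP; exact: pr_id.
  move: (d); apply: imul_sub => [|a b|u w hu /s2 hw]; [exact: (fid0 f1)|exact: (fidD f1)|].
  by rewrite mulrC; apply: (fidM f1).
have ecv : c ^+ 2 * v = (c * y) ^+ 2 - (c * t) ^+ 2 * d by rewrite -ev; ring.
(* If c is outside P1, dividing (c y)^2 = c^2 v + d (c t)^2 by c^2 makes v a square modulo P1.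
   Otherwise c y lies in P1 too, so c t does not, and d (c t)^2 lies in P1^2. Cancelling P1 puts P2
   (c t)^2 inside P1, which z forbids. *)
have [hPc|hPc] := pselect (P1 c); last first.
  have [_ _ _ mx] := m1; have [//|[u ou hu]] := mx c oc.
  apply: (hv (c * y * u)); first by sf.
  have -> : v - (c * y * u) ^+ 2 = - ((c * u + 1) * v) * (c * u - 1) - u ^+ 2 * (c * t) ^+ 2 * d.
    have -> : (c * y * u) ^+ 2 = u ^+ 2 * (c ^+ 2 * v + (c * t) ^+ 2 * d) by rewrite ecv; ring.
    by ring.
  by apply: (fidB hK f1); apply: (fidM f1) => //; sf.
have hPy : P1 (c * y).
  have : P1 (c * y * (c * y)).
    have -> : c * y * (c * y) = c * v * c + (c * t) ^+ 2 * d.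
      by have := ecv; rewrite -[_ - _]/(_ + _) => /eqP; rewrite eq_sym subr_eq => /eqP e; rewrite -expr2 e; ring.
    by apply: (fidD f1); apply: (fidM f1) => //; sf.
  by case/(max_prime hK m1 oy oy).
have nPt : ~ P1 (c * t) by move=> h; apply: nc.
have [t0|t0] := eqVneq (c * t) 0; first by apply: nPt; rewrite t0; exact: (fid0 f1).
have ft : fid K (pr K ((c * t) ^+ 2)) by apply: fid_pr => //; [have [? _] := ot; sf|rewrite expf_neq0].
have sub : incl (imul P2 (pr K ((c * t) ^+ 2))) P1.
  apply: (imul_incl hK inv f1 (fid_imul hK f2 ft) f1).
  have [kct _] := OKX hK 2 ot; rewrite imulA eP imul_pr ?expf_neq0 //.
  apply: pr_mem; first exact: fid_imul.
  have -> : d * (c * t) ^+ 2 = c * y * (c * y) - c * (v * c).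
    have -> : c * (v * c) = c ^+ 2 * v by ring.
    by rewrite ecv; ring.
  apply: (fidB hK (fid_imul hK f1 f1)); apply: imul_in => //; exact: (fidM f1).
have /sub : imul P2 (pr K ((c * t) ^+ 2)) (z * (c * t) ^+ 2) by apply: imul_in => //; exact: pr_id.
have oz := s2 _ hz.
by case/(max_prime hK m1 oz (OKX hK 2 ot)) => // /(max_prime hK m1 ot ot) [].
Qed.

Hypothesis tc : forall i : ix N, cj i <> i.

(* With two ramified primes P1, P2 and a unit that is not a norm, the Herbrand
   inequality forces every ambiguous ideal to be principal up to ideals of K
   and every unit of K that is a norm to be the norm of a unit. *)
Theorem two_ramified d P1 P2 v : no2 K -> diffs K s rho d -> d != 0 ->
  maxid K P1 -> maxid K P2 -> imul P1 P2 = pr K (d * rho d) ->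
  unit K v -> (forall x, L x -> x * rho x <> v) -> no2 L.
Proof.
move=> n2 hd nd m1 m2 eP uv hv.
have [f1 s1 _ _] := m1; have [f2 s2 _ _] := m2; have f12 := fid_imul hK f1 f2.
(* The ideal n of [invariant_decomp] contains P1 P2, so it is one of these four. It serves as the
   colour: two invariant ideals of the same colour differ by an ideal of K, because their squares do
   so compatibly. *)
pose dec (c : 'I_4) : cpred := nth (OK K) [:: OK K; P1; P2; imul P1 P2] c.
have fdec c : fid K (dec c).
  by case: c => -[|[|[|[|//]]]] hc; rewrite /dec //=; exact: fid_OK.
have colour A : exists p : 'I_4 * cpred, fid L A -> rimg K s rho A = A ->
    fid K p.2 /\ imul (ext K s (dec p.1)) (imul A A) = ext K s (imul p.2 p.2).
  have [[fA rA]|hA] := pselect (fid L A /\ rimg K s rho A = A); last first.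
    by exists (ord0, OK K) => a b; case: hA.
  have [a [E [n [[fa fE fn] [[sE Ed e1 e2] [sn hnd]]]]]] := invariant_decomp Q inv fr fA rA hd nd.
  have [c ec] : exists c, dec c = n.
    have := maxid2_over hK inv m1 m2 fn sn; case=> [x||||]; last 4 first.
    - by move=> ->; exists (inord 0); rewrite /dec inordK.
    - by move=> ->; exists (inord 1); rewrite /dec inordK.
    - by move=> ->; exists (inord 2); rewrite /dec inordK.
    - by move=> ->; exists (inord 3); rewrite /dec inordK.
    by rewrite eP => -[r [hr ->]]; rewrite mulrC; apply: (fidM fn).
  by exists (c, a) => _ _ /=; rewrite ec -e2 imulACA e1 (extM Q).
have /choice [p hp] := colour.
have same A A' : fid L A -> rimg K s rho A = A -> fid L A' -> rimg K s rho A' = A' ->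
    (p A).1 = (p A').1 -> imul A (ext K s (p A').2) = imul A' (ext K s (p A).2).
  move=> fA rA fA' rA' e; have [fa ea] := hp A fA rA; have [fa' ea'] := hp A' fA' rA'.
  have fe := fid_ext Q fa; have fe' := fid_ext Q fa'.
  have fX := fid_imul hL fA fe'; have fY := fid_imul hL fA' fe.
  apply: (sq_inj hL invL fX fY).
  have fd := fid_ext Q (fdec (p A).1).
  apply: (imul_inj hL invL fd (fid_imul hL fX fX) (fid_imul hL fY fY)).
  rewrite -e in ea'.
  by rewrite (imulACA A) (imulACA A') (imulA _ (imul A A)) ea (imulA _ (imul A' A')) ea' !(extM Q) imulC.
have h90 x : exists b, normone K s rho x -> [/\ L b, b != 0 & b = x * rho b].
  have [hx|hx] := pselect (normone K s rho x); last by exists 0.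
  have [Ux ex] := hx; have [b hb] := hilbert90 Q (unit_sub Ux) ex; by exists b.
have /choice [b hb] := h90.
have bA x : normone K s rho x -> fid L (pr L (b x)) /\ rimg K s rho (pr L (b x)) = pr L (b x).
  move=> hx; have [lb nb eb] := hb x hx; split; first exact: fid_pr.
  rewrite (rimg_pr Q lb) [in RHS]eb mulrC (pr_unit hL) //; by case: hx.
pose col x := (p (pr L (b x))).1.
have hcol x y : normone K s rho x -> normone K s rho y -> col x = col y ->
    exists2 e, unit L e & x = y * (e / rho e).
  move=> hx hy e; have [fx rx] := bA x hx; have [fy ry] := bA y hy.
  have [lx nx ex] := hb x hx; have [ly ny ey] := hb y hy.
  have E := same _ _ fx rx fy ry e; have [fa _] := hp _ fx rx; have [fa' _] := hp _ fy ry.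
  have [J fJ eJ] := inv fa'.
  have lg : L (b x / b y) by sf.
  have ng : b x / b y != 0 by rewrite mulf_neq0 ?invr_eq0.
  have fe := fid_ext Q fa; have fe' := fid_ext Q fa'; have fj := fid_ext Q fJ.
  have E2 : ext K s (imul (p (pr L (b x))).2 J) = pr L (b x / b y).
    rewrite -(extM Q) -[ext K s (p (pr L (b x))).2](pr_imulK hL ly ny fe) -E -imulA -imulA (extM Q) eJ (ext_OK Q).
    by rewrite imul1r // imul_pr // mulrC.
  have [] := ext_prin_sq Q inv n2 (fid_imul hK fa fJ) (g := b x / b y * (b x / b y)).
  - by sf.
  - by rewrite mulf_neq0.
  - by rewrite E2 imul_pr.
  move=> g [nzg kg eg]; rewrite eg (ext_pr Q) // in E2.
  have Ue := pr_eq hL lg ng nzg (esym E2); exists (b x / b y / g) => //.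
  have rg := rK kg.
  have rbx : rho (b x) != 0 by rewrite fmorph_eq0.
  have rby : rho (b y) != 0 by rewrite fmorph_eq0.
  have ex' : x = b x / rho (b x) by rewrite {1}ex mulfK.
  have ey' : y = b y / rho (b y) by rewrite {1}ey mulfK.
  rewrite [LHS]ex' [X in _ = X * _]ey' !fmorph_div rg; field.
  by rewrite ny nzg rby rbx.
have nv1 : v != 1 by apply/eqP => e; apply: (hv 1); [sf|rewrite rmorph1 mulr1 e].
have nvN x y : L x -> L y -> y != 0 -> x * rho x <> v * (y * rho y).
  move=> lx ly ny E; apply: (hv (x / y)); first by sf.
  rewrite rmorphM fmorphV mulrACA E -invfM mulfK // mulf_neq0 ?fmorph_eq0 //.
(* Were a colour missed by the principal invariant ideals (b x), three colours against the
   inequivalent units 1, v would give 4 <= 3. *)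
have attained c : exists x, normone K s rho x /\ col x = c.
  apply: contrapT => hn.
  pose col' x : 'I_3 := odflt ord0 (unlift c (col x)).
  have hc' x : normone K s rho x -> lift c (col' x) = col x.
    rewrite /col' => hx; case: unliftP => [j -> //|e]; by case: hn; exists x.
  suff : (2 * size [:: (1 : algC)%R; v] <= 3)%N by [].
  apply: (@herbrand K N s rho Q sA tc _ 3 col').
  - by rewrite /= inE eq_sym nv1.
  - by move=> x; rewrite !inE => /orP[]/eqP-> //; exact: unit1.
  - move=> x y e; rewrite !inE => /orP[]/eqP-> /orP[]/eqP-> // ue E.
      exfalso; have [le ne] := (unit_sub ue, unit_neq0 ue).
      by apply: (@nvN 1 e) => //; [sf|rewrite rmorph1 mulr1].
    by case: (hv e); [exact: (unit_sub ue)|rewrite E mul1r].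
  - by move=> x y hx hy e; apply: hcol => //; rewrite -(hc' x) // -(hc' y) // e.
apply: (ambiguous_no2 Q inv fr n2) => [x lx nx ux|A fA rA].
  apply: contrapT => hn; set u := x * rho x in ux hn.
  have nu e : unit L e -> e * rho e <> u by move=> ue E; apply: hn; exists e.
  have Nn0 y : y != 0 -> y * rho y != 0 by move=> h; rewrite mulf_neq0 ?fmorph_eq0.
  (* If u were the norm of an element but of no unit, these four units would be pairwise
     inequivalent modulo norms of units, giving 8 <= 4. *)
  suff : (2 * size [:: (1 : algC)%R; v; u; (u * v)%R] <= 4)%N by [].
  have key : forall y z e, y \in [:: 1; v; u; u * v] -> z \in [:: 1; v; u; u * v] ->
      unit L e -> y = z * (e * rho e) -> y = z.
    move=> y z e hy hz ue E; have le := unit_sub ue; have ne := unit_neq0 ue.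
    have l1 : L 1 by sf.
    have lxe : L (x * e) by sf.
    have nxe : x * e != 0 by rewrite mulf_neq0.
    have nvv := unit_neq0 uv.
    have N1 : 1 * rho 1 = 1 by rewrite rmorph1 mulr1.
    have Nxe : x * e * rho (x * e) = u * (e * rho e) by rewrite rmorphM mulrACA.
    have nuu : u != 0 by exact: Nn0.
    have F1 : 1 <> v * (e * rho e) by rewrite -[X in X <> _]N1; exact: nvN.
    have F2 : 1 <> u * (e * rho e).
      move=> E'; apply: (nu e^-1); first exact: unitV.
      by rewrite fmorphV -invfM -[LHS]mul1r E' mulfK // Nn0.
    move: hy hz E; rewrite !inE => /or4P[]/eqP-> /or4P[]/eqP-> // E; exfalso.
    - by apply: (nvN 1 (x * e)) => //; rewrite N1 Nxe [LHS]E; ring.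
    - by apply: (hv e); rewrite // E mul1r.
    - by apply: (hv (x * e)); rewrite // Nxe.
    - by apply: F2; apply: (mulfI nvv); rewrite mulr1 {1}E; ring.
    - by apply: (nu e); rewrite // E mul1r.
    - by apply: (nvN x e).
    - by apply: F1; apply: (mulfI nuu); rewrite mulr1 [LHS]E; ring.
    - by apply: (nvN e x); rewrite // -[LHS]mul1r -E mulrC.
    - by apply: (nu e) => //; apply: (mulfI nvv); rewrite -E mulrC.
    - by apply: (hv e) => //; apply: (mulfI nuu); rewrite -E.
  apply: (@herbrand K N s rho Q sA tc _ 4 col) => //.
  - have nuu : u != 0 by exact: Nn0.
    have u1 : u != 1.
      apply/eqP => e; apply: (nu 1); first exact: unit1.
      by rewrite rmorph1 mulr1 e.
    have uv' : v != u by apply/eqP => e; exact: (hv x lx).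
    have uv1 : 1 != u * v.
      by apply/eqP => e; apply: (nvN 1 x); rewrite // ?rmorph1 ?mulr1 ?[LHS]e 1?mulrC //; sf.
    have nvv := unit_neq0 uv.
    rewrite /= !inE !negb_or ![1 == _]eq_sym nv1 u1 uv' /= andbT; apply/and3P; split.
    - by rewrite eq_sym.
    - by rewrite -{1}[v]mul1r (inj_eq (mulIf nvv)) eq_sym.
    - by rewrite -{1}[u]mulr1 (inj_eq (mulfI nuu)) eq_sym.
  - move=> y; rewrite !inE => /or4P[]/eqP-> //; [exact: unit1|exact: unitM].
have [x [hx ex]] := attained (p A).1.
have [fx rx] := bA x hx; have [lx nx _] := hb x hx.
have E := same _ _ fx rx fA rA ex; have [fa _] := hp _ fx rx; have [fa' _] := hp _ fA rA.
have [J fJ eJ] := inv fa.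
have fe := fid_ext Q fa; have fe' := fid_ext Q fa'; have fj := fid_ext Q fJ.
exists (b x), (imul (p A).2 J); split=> //; first exact: fid_imul.
by rewrite -(extM Q) imulA E -imulA (extM Q) eJ (ext_OK Q) imul1r.
Qed.
End OddCriteria.

(** * Residues modulo a prime *)

Section ModP.
Variables (p : nat).
Hypotheses (pp : prime p).

Lemma frobA x y : x \in Aint -> y \in Aint ->
  exists2 z, z \in Aint & (x + y) ^+ p = x ^+ p + y ^+ p + p%:R * z.
Proof.
move=> hx hy; have p0 := prime_gt0 pp.
exists (\sum_(i < p.-1) ('C(p, i.+1) %/ p)%:R * (x ^+ (p - i.+1) * y ^+ i.+1)).
  by apply: rpred_sum => i _; rewrite rpredM ?rpred_nat // rpredM // rpredX.
case: p pp {p0} => [//|n] pn; rewrite exprDn big_ord_recr big_ord_recl /=.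
rewrite /bump /= !subnn subn0 !expr0 mulr1 mul1r bin0 binn !mulr1n addrAC; congr (_ + _).
rewrite mulr_sumr; apply: eq_bigr => i _; rewrite mulrA -natrM mulnC divnK ?add1n ?mulr_natl //.
by apply: prime_dvd_bin => //=; rewrite ltnS ltn_ord.
Qed.

Lemma int_Fp (a : int) : (p%:Z %| a)%Z = ((a%:~R : 'F_p) == 0).
Proof.
have cp : p \in [pchar 'F_p] by apply: pchar_Fp.
rewrite dvdzE /= (dvdn_pcharf cp); case: a => n //.
by rewrite NegzE rmorphN oppr_eq0.
Qed.

Lemma Fp_int (x : 'F_p) : exists a : int, x = a%:~R.
Proof. by exists (nat_of_ord x)%:Z; rewrite -[LHS]natr_Zp. Qed.

Lemma card_Fp' : #|{: 'F_p}| = p. Proof. exact: card_Fp. Qed.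

Hypothesis p2 : odd p.

Lemma Fp_fermat (x : 'F_p) : x != 0 -> x ^+ p.-1 = 1.
Proof.
move=> h; apply: (mulfI h); rewrite -exprS prednK ?prime_gt0 // mulr1.
by have := expf_card x; rewrite card_Fp'.
Qed.

Lemma Fp_2 : (2%:R : 'F_p) != 0.
Proof.
have cp : p \in [pchar 'F_p] by apply: pchar_Fp.
rewrite -(dvdn_pcharf cp) gtnNdvd // ltn_neqAle prime_gt1 // andbT.
by apply/eqP => e; move: (p2); rewrite -e.
Qed.

Lemma half_p : (p.-1 = 2 * (p.-1)./2)%N.
Proof. by move: p2 pp; case: (p) => // n /= h _; rewrite -[in LHS](odd_double_half n) (negPf h) mul2n. Qed.

Lemma Fp_pm1 (x : 'F_p) : x != 0 -> x ^+ (p.-1)./2 = 1 \/ x ^+ (p.-1)./2 = -1.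
Proof.
move=> h; have /eqP : (x ^+ (p.-1)./2) ^+ 2 = 1 by rewrite -exprM mulnC -half_p Fp_fermat.
by rewrite sqrf_eq1 => /orP[]/eqP h'; [left|right].
Qed.

Lemma Fp_euler (x : 'F_p) : x ^+ (p.-1)./2 = 1 -> exists y, x = y ^+ 2.
Proof.
move=> e; have x0 : x != 0.
  apply/eqP => x0; move: e; rewrite x0 expr0n; case: eqP => [h|_ /eqP]; last by rewrite eq_sym oner_eq0.
  have : p.-1 = 0%N by rewrite half_p h muln0.
  by move: pp; case: (p) => [|[|n]].
have /cyclicP[g eg] := field_unit_group_cyclic [set: {unit 'F_p}]%G.
have xU : x \is a GRing.unit by rewrite unitfE.
have : FinRing.unit 'F_p xU \in <[g]>%g by rewrite -eg inE.
case/cycleP => k ek.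
have og : #[g]%g = p.-1 by rewrite orderE -eg card_finField_unit card_Fp'.
have vX (u : {unit 'F_p}) n : val (u ^+ n)%g = (val u) ^+ n.
  by elim: n => [|n IH] //; rewrite expgS exprS -IH.
have : (g ^+ (k * (p.-1)./2) == 1)%g.
  by rewrite expgM -ek -(inj_eq val_inj) vX /= e.
rewrite -order_dvdn og {1}half_p (mulnC 2) (mulnC k) dvdn_pmul2l; last first.
  rewrite lt0n; apply/eqP => h; have : p.-1 = 0%N by rewrite half_p h.
  by move: pp; case: (p) => [|[|n]].
move=> /dvdnP[m em]; exists (val (g ^+ m)%g); rewrite vX -exprM.
by have /(congr1 val) := ek; rewrite /= vX em.
Qed.
End ModP.

Lemma sqrt2_ne0 : sqrtC 2 != 0 :> algC. Proof. by rewrite sqrtC_eq0 pnatr_eq0. Qed.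

(* sqrt 2 = z + z^-1 for a primitive 8th root of unity z, and Frobenius sends it
   to z^p + z^-p. *)
Lemma two_mod8 p : prime p -> odd p ->
  (2%:R : 'F_p) ^+ (p.-1)./2 = if (p %% 8 == 1)%N || (p %% 8 == 7)%N then 1 else -1.
Proof.
move=> pp p2; set r := sqrtC 2 : algC.
have er : r ^+ 2 = 2 by rewrite sqrtCK.
have rA : r \in Aint by apply: Aint_sqr; rewrite er; exact: (Aint_int 2).
pose i := 'i : algC; have ei : i ^+ 2 = -1 by rewrite sqrCi.
have r0 : r != 0 := sqrt2_ne0.
pose z := (1 + i) / r; pose z' := (1 - i) / r.
have zz : z * z' = 1.
  have -> : z * z' = (1 - i ^+ 2) / r ^+ 2 by rewrite /z /z'; field.
  by rewrite er ei; field.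
have z2 : z ^+ 2 = i.
  have -> : z ^+ 2 = (1 + 2 * i + i ^+ 2) / r ^+ 2 by rewrite /z; field.
  by rewrite er ei; field.
have z'2 : z' ^+ 2 = - i.
  have -> : z' ^+ 2 = (1 - 2 * i + i ^+ 2) / r ^+ 2 by rewrite /z'; field.
  by rewrite er ei; field.
have iA : i \in Aint by apply: Aint_sqr; rewrite ei rpredN rpred1.
have zA : z \in Aint by apply: Aint_sqr; rewrite z2.
have z'A : z' \in Aint by apply: Aint_sqr; rewrite z'2 rpredN.
have zs : z + z' = r.
  rewrite /z /z' -mulrDl; have -> : 1 + i + (1 - i) = r ^+ 2 by rewrite er; ring.
  by field.
have z8 : z ^+ 8 = 1 by rewrite (exprM z 2 4) z2 (exprM i 2 2) ei sqrrN expr1n.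
have z'8 : z' ^+ 8 = 1 by rewrite (exprM z' 2 4) z'2 (exprM _ 2 2) sqrrN ei sqrrN expr1n.
have zp (x : algC) : x ^+ 8 = 1 -> x ^+ p = x ^+ (p %% 8).
  by move=> h; rewrite {1}(divn_eq p 8) exprD mulnC exprM h expr1n mul1r.
have [w wA ew] := frobA pp zA z'A; rewrite zs (zp z z8) (zp z' z'8) in ew.
have z4 : z ^+ 4 = -1 by rewrite (exprM z 2 2) z2 ei.
have z'4 : z' ^+ 4 = -1 by rewrite (exprM z' 2 2) z'2 sqrrN ei.
set c : int := if (p %% 8 == 1)%N || (p %% 8 == 7)%N then 1 else -1.
have ec : z ^+ (p %% 8) + z' ^+ (p %% 8) = c%:~R * r.
  have : (p %% 8 < 8)%N by rewrite ltn_pmod.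
  have : odd (p %% 8) by rewrite (@odd_mod _ 8).
  have e3 : z ^+ 3 + z' ^+ 3 = - r.
    have -> : z ^+ 3 + z' ^+ 3 = z * z ^+ 2 + z' * z' ^+ 2 by ring.
    rewrite z2 z'2; have -> : z * i + z' * - i = (2 * i ^+ 2) / r by rewrite /z /z'; field.
    by rewrite ei -er; field.
  have mE (x : algC) n : x ^+ (4 + n) = x ^+ 4 * x ^+ n by rewrite exprD.
  rewrite /c; case: (p %% 8)%N => [|[|[|[|[|[|[|[|//]]]]]]]] //= _ _.
  - by rewrite mul1r !expr1.
  - by rewrite e3 mulN1r.
  - by rewrite (mE z 1%N) (mE z' 1%N) z4 z'4 !expr1 -mulrDr zs.
  - by rewrite (mE z 3) (mE z' 3) z4 z'4 -mulrDr e3 mulN1r opprK mul1r.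
rewrite ec in ew.
have e1 : p%:R * (w * r) = (2 ^+ (p.-1)./2 * 2 - c * 2)%:~R :> algC.
  have -> : p%:R * (w * r) = (r ^+ p) * r - c%:~R * r ^+ 2 by rewrite ew; ring.
  have -> : r ^+ p * r = 2 ^+ (p.-1)./2.+1.
    rewrite -er -exprM mulnS -(half_p pp p2) -exprSr; congr (_ ^+ _).
    by have := prime_gt0 pp; lia.
  by rewrite er exprSr rmorphB !rmorphM rmorphXn.
have hd : (p%:Z %| 2 ^+ (p.-1)./2 * 2 - c * 2)%Z.
  have p0 : p%:R != 0 :> algC by rewrite pnatr_eq0 -lt0n prime_gt0.
  have : w * r \in Num.int.
    apply: Cint_rat_Aint; last by rewrite rpredM.
    rewrite -[w * r](mulKf p0) e1 rpredM ?rpredV ?rpred_nat // rpred_int //.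
  case/intrP => m em; apply/dvdzP; exists m.
  apply: (@intr_inj algC); rewrite -e1 em rmorphM /= mulrC.
  by [].
move: hd; rewrite (int_Fp pp) rmorphB !rmorphM rmorphXn /= -mulrBl mulf_eq0 (negPf (Fp_2 pp p2)) orbF.
by rewrite subr_eq0 => /eqP ->; rewrite /c; case: ifP => _; rewrite ?rmorphN.
Qed.

Lemma nat_sqrt n : exists k, (k ^ 2 <= n < k.+1 ^ 2)%N.
Proof.
elim: n => [|n [k hk]]; first by exists 0%N.
have [h|h] := ltnP n.+1 (k.+1 ^ 2); first by exists k; nia.
by exists k.+1; nia.
Qed.

Lemma thue p (c : 'F_p) : prime p -> exists x y : int,
  [/\ x ^+ 2 < p%:Z, y ^+ 2 < p%:Z, ~ (x = 0 /\ y = 0) & x%:~R = c * y%:~R].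
Proof.
move=> pp; have [k /andP[k1 k2]] := nat_sqrt p.
have {}k1 : (k ^ 2 < p)%N.
  rewrite ltn_neqAle k1 andbT; apply/eqP => e; move: pp; rewrite -e => /primeP[h1 h2].
  have := h2 k; rewrite -mulnn dvdn_mulr // => /(_ isT); nia.
pose f (u : 'I_k.+1 * 'I_k.+1) : 'F_p := u.1%:R - c * u.2%:R.
have [hf|/injectivePn[u [v nuv euv]]] := boolP (injectiveb f).
  by have := leq_card f (elimT (injectiveP f) hf); rewrite card_prod card_ord card_Fp //; nia.
have bnd (a b : 'I_k.+1) : (a%:Z - b%:Z) ^+ 2 < p%:Z.
  have ha := ltn_ord a; have hb := ltn_ord b.
  have : (`|a%:Z - b%:Z| <= k)%N by lia.
  by rewrite -[_ ^+ 2](@ger0_norm int) ?sqr_ge0 // normrX -abszE; nia.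
exists (u.1%:Z - v.1%:Z), (u.2%:Z - v.2%:Z); split=> // [[h1 h2]|].
  apply/(negP nuv); case: u v h1 h2 {nuv euv} => u1 u2 [v1 v2] /= h1 h2; apply/eqP.
  by congr (_, _); apply: val_inj => /=; lia.
rewrite !rmorphB /= mulrBr; move: euv; rewrite /f => /eqP; rewrite subr_eq addrAC => /eqP.
by rewrite !pmulrn => ->; ring.
Qed.

Lemma Fp_eq0 p (a : int) : prime p -> (a%:~R : 'F_p) = 0 -> exists b, a = p%:Z * b.
Proof. by move=> pp /eqP; rewrite -int_Fp // => /dvdzP[b ->]; exists b; rewrite mulrC. Qed.

Lemma sum_squares p (c : 'F_p) : prime p -> c ^+ 2 = -1 -> exists x y : int, p%:Z = x ^+ 2 + y ^+ 2.
Proof.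
move=> pp hc; have [x [y [h1 h2 h3 h4]]] := thue c pp.
have /(Fp_eq0 pp)[b eb] : (x ^+ 2 + y ^+ 2)%:~R = 0 :> 'F_p.
  by rewrite rmorphD !rmorphXn /= h4 exprMn hc mulN1r addNr.
have hx := sqr_ge0 x; have hy := sqr_ge0 y.
have h0 : x ^+ 2 + y ^+ 2 != 0.
  apply/eqP => e; apply: h3; split; apply/eqP; rewrite -sqrf_eq0; apply/eqP; lia.
have b1 : b = 1 by move: eb h0 h1 h2; move: (x ^+ 2) (y ^+ 2) hx hy => X Y *; nia.
by exists x, y; rewrite eb b1 mulr1.
Qed.

(** Thue's bounds make the form equal to p or 2 p. In the second case x = 2 z is even, and p = y^2 +
    2 z^2. *)
Lemma sum_square_2square p (c : 'F_p) : prime p -> c ^+ 2 = -2 -> exists x y : int, p%:Z = x ^+ 2 + 2 * y ^+ 2.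
Proof.
move=> pp hc; have [x [y [h1 h2 h3 h4]]] := thue c pp.
have /(Fp_eq0 pp)[b eb] : (x ^+ 2 + 2 * y ^+ 2)%:~R = 0 :> 'F_p.
  by rewrite rmorphD rmorphM !rmorphXn /= h4 exprMn hc mulNr addNr.
have hx := sqr_ge0 x; have hy := sqr_ge0 y.
have h0 : x ^+ 2 + 2 * y ^+ 2 != 0.
  apply/eqP => e; apply: h3; split; apply/eqP; rewrite -sqrf_eq0; apply/eqP; lia.
have hb : b = 1 \/ b = 2 by move: eb h0 h1 h2; move: (x ^+ 2) (y ^+ 2) hx hy => X Y *; nia.
case: hb eb => -> eb; first by exists x, y; lia.
have [z ez] : exists z, x = 2 * z.
  exists (x %/ 2)%Z; have [e1|e1] : (x = 2 * (x %/ 2)%Z \/ x = 2 * (x %/ 2)%Z + 1) by lia.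
    exact: e1.
  by move: eb; rewrite e1; nia.
by exists y, z; rewrite ez in eb; lia.
Qed.

Lemma sq_2sq (x y : int) : x ^+ 2 = 2 * y ^+ 2 -> x = 0 /\ y = 0.
Proof.
move=> /(congr1 absz); rewrite abszM !abszX => e.
have [y0|y0] := posnP `|y|.
  by move: e; rewrite y0 muln0 => /eqP; rewrite expn_eq0 andbT; lia.
have x0 : (0 < `|x|)%N by rewrite lt0n; apply/eqP => h; move: e; rewrite h; nia.
have := congr1 (fun n => odd (logn 2 n)) e.
by rewrite lognM ?expn_gt0 ?y0 // !lognX oddD !oddM.
Qed.

(** Thue's bounds place the form strictly between -2 p and p, and it is a nonzero multiple of p. *)
Lemma square_2square p (c : 'F_p) : prime p -> c ^+ 2 = 2 -> exists x y : int, - p%:Z = x ^+ 2 - 2 * y ^+ 2.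
Proof.
move=> pp hc; have [x [y [h1 h2 h3 h4]]] := thue c pp.
have /(Fp_eq0 pp)[b eb] : (x ^+ 2 - 2 * y ^+ 2)%:~R = 0 :> 'F_p.
  by rewrite rmorphB rmorphXn rmorphM rmorphXn /= h4 exprMn hc subrr.
have hx := sqr_ge0 x; have hy := sqr_ge0 y.
have h0 : x ^+ 2 - 2 * y ^+ 2 != 0.
  by apply/eqP => /eqP; rewrite subr_eq0 => /eqP /sq_2sq.
have b0 : b != 0 by apply: contraNneq h0 => b0; rewrite eb b0 mulr0.
have b1 : b = -1.
  move: eb h1 h2; move: (x ^+ 2) (y ^+ 2) hx hy => X Y hX hY e h1 h2.
  have l1 : b < 1 by nia.
  have l2 : -2 < b by nia.
  lia.
by exists x, y; rewrite eb b1 mulrN1.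
Qed.

(** * The field Q(sqrt 2) *)

Definition sq (d : int) : algC := sqrtC d%:~R.
Lemma sqK d : sq d ^+ 2 = d%:~R. Proof. exact: sqrtCK. Qed.
Lemma sqKm d : sq d * sq d = d%:~R. Proof. by rewrite -expr2 sqK. Qed.
Lemma sqA d : sq d \in Aint. Proof. exact: sqrt_int_Aint. Qed.
Lemma sq_neq0 d : d != 0 -> sq d != 0. Proof. by rewrite sqrtC_eq0 intr_eq0. Qed.

Notation r2 := (sq 2).
Notation F := (gen [:: r2]).

Lemma r2A : r2 \in Aint. Proof. exact: sqA. Qed.
Lemma r2_neq0 : r2 != 0. Proof. exact: sq_neq0. Qed.
Lemma r2sq : r2 ^+ 2 = 2. Proof. exact: (sqK 2). Qed.
Lemma F_sf : is_subfield F. Proof. exact: gen_sf. Qed.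
Lemma F_r2 : F r2. Proof. by apply: gen_in; rewrite mem_head. Qed.

Lemma sq_unit_pm (x y : algC) : x ^+ 2 = y ^+ 2 -> x = y \/ x = - y.
Proof. by move/eqP; rewrite eqf_sqr => /orP[]/eqP; [left|right]. Qed.

Lemma rational_square x (d : int) : gen [::] x -> x ^+ 2 = d%:~R -> exists m, d = m ^+ 2.
Proof.
move=> hx e; have : OK (gen [::]) x by split=> //; apply: Aint_sqr; rewrite e Aint_int.
move/OK_Q/intrP => [m em]; exists m; apply: (@intr_inj algC).
by rewrite -e em rmorphXn.
Qed.

(** Squaring v = y + z u produces the cross term 2 y z u, which has to vanish. *)
Lemma kummer K u v : is_subfield K -> K (u ^+ 2) -> ~ K u -> K (v ^+ 2) -> qext K u v ->
  K v \/ K (u * v).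
Proof.
move=> hK hu nu hv [y [z [ky kz e]]].
have h : y ^+ 2 + z ^+ 2 * u ^+ 2 - v ^+ 2 + 2 * y * z * u = 0 by rewrite e; ring.
have [] := qext_eq0 hK nu _ _ h; [by sf|by sf|] => _ /eqP.
rewrite !mulf_eq0 pnatr_eq0 /= => /orP[]/eqP h0; [right|left]; rewrite e h0.
  by rewrite add0r mulrCA -expr2; sf.
by rewrite mul0r addr0.
Qed.

(** An automorphism fixing u v and negating u also negates v. If u v is outside the base field, it
    is adjoined first, and u is conjugated over the larger field. *)
Lemma flip gs u v : gen gs (u ^+ 2) -> gen gs (v ^+ 2) -> ~ gen gs u -> ~ gen gs v ->
  exists nu : {rmorphism algC -> algC},
    [/\ (forall x, gen gs x -> nu x = x), nu u = - u & nu v = - v].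
Proof.
move=> hu hv nu nv; have hK := gen_sf gs.
have u0 : u != 0 by apply: contra_not_neq nu => ->; sf.
have ruv (rho : {rmorphism algC -> algC}) : rho (u * v) = u * v -> rho u = - u -> rho v = - v.
  move=> e1 e2; apply: (mulfI u0); rewrite mulrN -e1 rmorphM e2; ring.
have [huv|nuv] := pselect (gen gs (u * v)).
  have [rho Q] := rho_exists hu nu; exists rho; have fx := qd_fix Q.
  have ou := qd_opp Q; split=> //; exact: (ruv rho (fx _ huv) ou).
have huv2 : gen gs ((u * v) ^+ 2) by rewrite exprMn; sf.
have e := gen_cons huv2 nuv.
have sub x : gen gs x -> gen (u * v :: gs) x by rewrite e; exact: (qext_subK hK).
have [rho Q] : {rho | quad (gen (u * v :: gs)) u rho}.
  apply: rho_exists; first exact: sub.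
  rewrite e => /(kummer hK huv2 nuv hu) [//|]; rewrite -mulrA mulrC -mulrA -expr2 => h.
  apply: nv; have -> : v = v * u ^+ 2 / u ^+ 2 by field.
  by sf.
exists rho; have fx := qd_fix Q; have ou := qd_opp Q; split=> // [x /sub /fx //|].
by apply: (ruv rho) => //; apply: fx; apply: gen_in; rewrite mem_head.
Qed.

Lemma not_square_2 : forall m : int, 2 <> m ^+ 2.
Proof.
by move=> m /(congr1 absz); rewrite abszX; rewrite -mulnn; by case: `|m|%N => [|[|n]] //= ; lia.
Qed.

Lemma r2_irr : ~ gen [::] r2.
Proof. by move=> h; have [m] := rational_square h (sqK 2); exact: not_square_2. Qed.

Lemma F_qext : F = qext (gen [::]) r2.
Proof. by apply: gen_cons; [rewrite r2sq; apply: (@sf_nat _ (gen_sf [::]))|exact: r2_irr]. Qed.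

Lemma sq_F d : F (sq d) -> (exists m, d = m ^+ 2) \/ (exists m, 2 * d = m ^+ 2).
Proof.
have h0 := gen_sf [::].
have hi (a : int) : gen [::] (a%:~R) by sf.
rewrite F_qext => /(kummer h0) []; rewrite ?sqK //; first exact: r2_irr.
  by move=> /rational_square h; left; apply: h; rewrite sqK.
by move=> /rational_square h; right; apply: h; rewrite exprMn !sqK rmorphM.
Qed.

Lemma rho2_ex : {rho : {rmorphism algC -> algC} | quad (gen [::]) r2 rho}.
Proof. by apply: rho_exists; [rewrite sqK; apply: (@sf_int _ (gen_sf [::]))|exact: r2_irr]. Qed.

Lemma OK_F x : OK F x <-> exists a b : int, x = a%:~R + b%:~R * r2.
Proof.
split; last first.
  move=> [a [b ->]]; have hF := F_sf; have h2 := F_r2; have h3 := r2A.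
  by split; [sf|rewrite rpredD ?rpredM ?Aint_int].
rewrite F_qext => hx; have [rho Q] := rho2_ex.
have [[y [z [ky kz e]]] _] := hx.
have /OK_Q/intrP[t et] := OK_trace Q hx.
have /OK_Q/intrP[n en] := OK_norm Q hx.
move: et en; rewrite e (rho_qext Q ky kz) => et en.
have {}et : y = t%:~R / 2 by rewrite -et; field.
(* With w = 4 z and t = 2 y this reads w^2 = 2 t^2 - 8 n; parity forces 2 | w, then 2 | t, then 4 |
   w. *)
have e4 : (4 * z) ^+ 2 = (2 * t ^+ 2 - 8 * n)%:~R.
  have -> : (4 * z) ^+ 2 = 8 * (y ^+ 2 - (y + z * r2) * (y - z * r2)) * 2 / r2 ^+ 2.
    by field; exact: r2_neq0.
  rewrite en et r2sq rmorphB rmorphM rmorphXn rmorphM /=.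
  by field.
have h0 := gen_sf [::].
have k4 : gen [::] (4 * z) by sf.
have /OK_Q/intrP[w ew] : OK (gen [::]) (4 * z).
  by split=> //; apply: Aint_sqr; rewrite e4 Aint_int.
have {}e4 : w ^+ 2 = 2 * t ^+ 2 - 8 * n.
  by apply: (@intr_inj algC); rewrite -e4 ew rmorphXn.
have [w1 ew1] : exists w1, w = 2 * w1.
  exists (w %/ 2)%Z; have [//|h] : (w = 2 * (w %/ 2)%Z \/ w = 2 * (w %/ 2)%Z + 1) by lia.
  by move: e4; rewrite h; move: (w %/ 2)%Z => v; lia.
have [t1 et1] : exists t1, t = 2 * t1.
  exists (t %/ 2)%Z; have [//|h] : (t = 2 * (t %/ 2)%Z \/ t = 2 * (t %/ 2)%Z + 1) by lia.
  by move: e4; rewrite h ew1; move: (t %/ 2)%Z => v; lia.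
have [w2 ew2] : exists w2, w1 = 2 * w2.
  exists (w1 %/ 2)%Z; have [//|h] : (w1 = 2 * (w1 %/ 2)%Z \/ w1 = 2 * (w1 %/ 2)%Z + 1) by lia.
  by move: e4; rewrite ew1 et1 h; move: (w1 %/ 2)%Z => v; lia.
exists t1, w2; have -> : z = w2%:~R.
  have -> : z = 4 * z / 4 by field.
  by rewrite ew ew1 ew2 mulrA rmorphM /=; field.
by rewrite et et1 rmorphM /=; congr (_ + _); field.
Qed.

Lemma F_eq0 (a b : int) : a%:~R + b%:~R * r2 = 0 -> a = 0 /\ b = 0.
Proof.
have h0 := gen_sf [::]; move=> /(qext_eq0 h0 r2_irr) [||/eqP h1 /eqP h2]; [by sf|by sf|].
by move: h1 h2; rewrite !intr_eq0 => /eqP -> /eqP ->.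
Qed.

Lemma normZ (a b : int) : (a ^+ 2 - 2 * b ^+ 2)%:~R = a%:~R ^+ 2 - 2 * b%:~R ^+ 2 :> algC.
Proof. by rewrite rmorphB rmorphXn rmorphM rmorphXn. Qed.

Lemma normF (rho : {rmorphism algC -> algC}) (a b : int) : quad (gen [::]) r2 rho ->
  (a%:~R + b%:~R * r2) * rho (a%:~R + b%:~R * r2) = (a ^+ 2 - 2 * b ^+ 2)%:~R.
Proof.
move=> Q; have h0 := gen_sf [::]; have ka : gen [::] a%:~R by sf.
have kb : gen [::] b%:~R by sf.
rewrite (rho_qext Q ka kb) rmorphB rmorphXn rmorphM rmorphXn /= -(sqK 2); ring.
Qed.

Lemma round_rat x : gen [::] x -> exists n : int, (x - n%:~R) ^+ 2 <= 4^-1.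
Proof.
rewrite gen_nil => /Creal_Crat rx.
have r2' : (2^-1 : algC) \is Num.real by rewrite realV realn.
have ry : x + 2^-1 \is Num.real by rewrite realD.
exists (Num.floor (x + 2^-1)); have /andP[h1 h2] := real_floor_itv ry.
rewrite rmorphD rmorph1 in h2; set f := (Num.floor _)%:~R in h1 h2 *.
have e1 : 2 * (2^-1 : algC) = 1 by rewrite divff // pnatr_eq0.
have h3 : 0 <= x - f + 2^-1 by rewrite addrAC subr_ge0.
have h4 : 0 <= 2^-1 - (x - f).
  have -> : 2^-1 - (x - f) = f + 1 - (x + 2^-1) by field.
  by rewrite subr_ge0 ltW.
rewrite -subr_ge0; have -> : 4^-1 - (x - f) ^+ 2 = (x - f + 2^-1) * (2^-1 - (x - f)) by field.
exact: mulr_ge0.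
Qed.

Lemma F_fracs : fracs F.
Proof. by rewrite F_qext; apply: qext_fracs; [exact: fracs_Q|exact: r2A]. Qed.

Lemma F_pid : pid F.
Proof.
have [rho Q] := rho2_ex; have h0 := gen_sf [::].
apply: (@euclid_pid _ (fun x => `|x * rho x|)); [exact: F_sf|exact: F_fracs|..].
- by move=> x y _ _; rewrite rmorphM -normrM; congr `|_|; ring.
- by move=> x /OK_F [a [b ->]]; rewrite normF // natr_norm_int // intr_int.
- move=> x _; split=> [/eqP|->]; last by rewrite mul0r normr0.
  by rewrite normr_eq0 mulf_eq0 fmorph_eq0 orbb => /eqP.
move=> x; rewrite F_qext => -[y [z [ky kz ->]]].
have [m hm] := round_rat ky; have [n hn] := round_rat kz.
exists (m%:~R + n%:~R * r2); first by rewrite -F_qext; apply/OK_F; exists m, n.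
have -> : y + z * r2 - (m%:~R + n%:~R * r2) = (y - m%:~R) + (z - n%:~R) * r2 by ring.
set u := y - _ in hm *; set v := z - _ in hn *.
have ku : gen [::] u by rewrite /u; sf.
have kv : gen [::] v by rewrite /v; sf.
have -> : (u + v * r2) * rho (u + v * r2) = u ^+ 2 - 2 * v ^+ 2.
  by rewrite (rho_qext Q ku kv) -[in RHS]r2sq; ring.
have su : 0 <= u ^+ 2.
  by move: ku; rewrite gen_nil => /Creal_Crat h; apply: real_exprn_even_ge0.
have sv : 0 <= v ^+ 2.
  by move: kv; rewrite gen_nil => /Creal_Crat h; apply: real_exprn_even_ge0.
apply: le_lt_trans (ler_normB _ _) _.
have hv : 2 * v ^+ 2 <= 2 * 4^-1 by rewrite ler_pM2l // ltr0n.
rewrite (ger0_norm su) (ger0_norm (mulr_ge0 (ler0n _ 2) sv)). apply: (le_lt_trans (lerD hm hv)).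
have -> : 4^-1 + 2 * 4^-1 = 1 - 4^-1 :> algC by field.
by rewrite ltrBlDr ltrDl invr_gt0.
Qed.

Lemma F_no2 : no2 F. Proof. exact: pid_no2 F_pid. Qed.

Lemma real_sf : is_subfield (fun x : algC => x \is Num.real).
Proof.
split=> [||y z|y|y z hy hz]; rewrite ?real0 ?real1 //; [exact: realD|by rewrite realN|].
by rewrite realM // realV.
Qed.

Lemma F_real x : F x -> x \is Num.real.
Proof.
apply: gen_sub real_sf _ _ => a; rewrite inE => /eqP ->.
by rewrite ger0_real // sqrtC_ge0.
Qed.

(** Descent: multiplying a + b r2 by 3 - 2 r2 = (r2 - 1)^2 decreases a. On the square root c + d r2
    this is undone by multiplying by 1 + r2. *)
Lemma pell_square (a b : int) : 0 < a -> 0 <= b -> a ^+ 2 - 2 * b ^+ 2 = 1 ->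
  exists c d : int, [/\ a = c ^+ 2 + 2 * d ^+ 2, b = 2 * c * d & `|c ^+ 2 - 2 * d ^+ 2| = 1].
Proof.
move=> a0; have [n] := ubnP `|a|%N; elim: n a b a0 => // n IH a b a0 lan b0 e.
have [hb|hb] := eqVneq b 0.
  exists 1, 0; rewrite hb in e *; split=> //; nia.
have b1 : b != 1.
  by apply/eqP => h; rewrite h in e; have [h1|h1] : a = 1 \/ 2 <= a by [lia|]; nia.
have b2 : 2 <= b by lia.
have h1 : 0 < 3 * a - 4 * b by nia.
have h2 : 0 <= 3 * b - 2 * a by nia.
have h3 : a < 2 * b by nia.
have e' : (3 * a - 4 * b) ^+ 2 - 2 * (3 * b - 2 * a) ^+ 2 = 1 by rewrite -[RHS]e; ring.
have lan' : (absz (3 * a - 4 * b)%R < n)%N by lia.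
have [c [d [e1 e2 e3]]] := IH _ _ h1 lan' h2 e'.
exists (c + 2 * d), (c + d).
have ea : a = 3 * (3 * a - 4 * b) + 4 * (3 * b - 2 * a) by ring.
have eb : b = 2 * (3 * a - 4 * b) + 3 * (3 * b - 2 * a) by ring.
split; [by rewrite [LHS]ea e1 e2; ring|by rewrite [LHS]eb e1 e2; ring|].
by rewrite -[RHS]e3 -normrN; congr `|_|; ring.
Qed.

Lemma unit_normF rho (a b : int) : quad (gen [::]) r2 rho ->
  unit F (a%:~R + b%:~R * r2) <-> `|a ^+ 2 - 2 * b ^+ 2| = 1.
Proof.
move=> Q; split=> [|h].
  rewrite F_qext => /(unit_norm Q); rewrite normF // => -[n0 _ /OK_Q /intrP[m em]].
  move: n0; rewrite intr_eq0 => n0.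
  have : (a ^+ 2 - 2 * b ^+ 2) * m = 1.
    by apply: (@intr_inj algC); rewrite rmorphM /= -em divff // intr_eq0.
  move/(congr1 absz); rewrite abszM => /eqP; rewrite muln_eq1 => /andP[/eqP h1 _]; lia.
set x := _ + _; have ex : x * rho x = (a ^+ 2 - 2 * b ^+ 2)%:~R by rewrite normF.
have hx : OK F x by apply/OK_F; exists a, b.
have hr : OK F (rho x) by move: hx; rewrite F_qext; apply: (OK_rho Q).
have n1 : (a ^+ 2 - 2 * b ^+ 2)%:~R ^+ 2 = 1 :> algC.
  by rewrite -rmorphXn /= -[_ ^+ 2](@ger0_norm int) ?sqr_ge0 // normrX h expr1n.
have x0 : x != 0.
  by apply/eqP => h0; move: n1; rewrite -ex h0 mul0r expr0n => /eqP; rewrite eq_sym oner_eq0.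
split=> //; have -> : x^-1 = rho x * (a ^+ 2 - 2 * b ^+ 2)%:~R.
  by apply: (mulfI x0); rewrite divff // mulrA ex -expr2 n1.
have hF := F_sf; sf.
Qed.

Lemma F_totpos_square rho u : quad (gen [::]) r2 rho -> unit F u -> 0 < u -> 0 < rho u ->
  exists2 w, unit F w & u = w ^+ 2.
Proof.
move=> Q uu u0 r0; have [_ /OK_F [a [b eu]] _] := uu; have h0 := gen_sf [::].
have ka : gen [::] a%:~R by sf.
have kb : gen [::] b%:~R by sf.
have er : rho u = a%:~R - b%:~R * r2 by rewrite eu (rho_qext Q).
have a0 : 0 < a.
  have : 0 < u + rho u by rewrite addr_gt0.
  have -> : u + rho u = (2 * a)%:~R by rewrite er eu rmorphM /=; ring.
  by rewrite ltr0z; lia.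
have n1 : a ^+ 2 - 2 * b ^+ 2 = 1.
  have : 0 < u * rho u by rewrite mulr_gt0.
  rewrite eu normF // ltr0z => h; move: uu; rewrite eu => /(unit_normF _ _ Q); lia.
have main (b' : int) : 0 <= b' -> a ^+ 2 - 2 * b' ^+ 2 = 1 ->
    exists2 w, unit F w & a%:~R + b'%:~R * r2 = w ^+ 2.
  move=> b0 e; have [c [d [e1 e2 e3]]] := pell_square a0 b0 e.
  exists (c%:~R + d%:~R * r2); first exact/(unit_normF _ _ Q).
  have -> : (c%:~R + d%:~R * r2) ^+ 2 = c%:~R ^+ 2 + r2 ^+ 2 * d%:~R ^+ 2 + 2 * c%:~R * d%:~R * r2 by ring.
  by rewrite e1 e2 r2sq rmorphD rmorphXn rmorphM rmorphXn /= !rmorphM.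
have [b0|b0] := leP 0 b; first by rewrite eu; apply: main.
have [||w uw ew] := main (- b); [by lia|by rewrite sqrrN|].
exists (rho w); first by move: uw; rewrite F_qext; apply: (unit_rho Q).
have hL := quad_sf Q; rewrite -rmorphXn -ew rmorphN mulNr eu.
by rewrite rmorphB rmorphM (qd_opp Q) !(qd_fix Q) // mulrN opprK.
Qed.

Lemma inv_nat_Aint n : (1 < n)%N -> ~ (n%:R^-1 : algC) \in Aint.
Proof.
move=> n1 h; have : (n%:R^-1 : algC) \in Num.int by apply: Cint_rat_Aint => //; rewrite rpredV rpred_nat.
case/intrP => m em; have : n%:Z * m = 1.
  by apply: (@intr_inj algC); rewrite rmorphM /= -em divff // pnatr_eq0; lia.
move/(congr1 absz); rewrite abszM => /eqP; rewrite muln_eq1 => /andP[/eqP h1 _]; lia.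
Qed.

Lemma int_half (a : int) : exists b, a = 2 * b \/ a = 2 * b + 1.
Proof. by exists (a %/ 2)%Z; lia. Qed.

Lemma maxid_r2 : maxid F (pr F r2).
Proof.
have hF := F_sf; have k2 := F_r2; have o2 : OK F r2 by split=> //; exact: r2A.
split.
- by apply: fid_pr => //; exact: r2_neq0.
- by move=> _ [r [hr ->]]; sf.
- move=> [r [[_ hr] e]]; apply: (@inv_nat_Aint 2) => //.
  have -> : 2%:R^-1 = r ^+ 2.
    by rewrite -r2sq -exprVn; congr (_ ^+ 2); apply: (mulfI r2_neq0); rewrite -e divff // r2_neq0.
  exact: rpredX.
move=> _ /OK_F[a [b ->]]; have [c [e|e]] := int_half a.
  left; exists (c%:~R * r2 + b%:~R); split; first by sf.
  by rewrite e rmorphM /= -(sqK 2); ring.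
right; exists 1; first by sf.
exists (c%:~R * r2 + b%:~R); split; first by sf.
by rewrite e rmorphD rmorphM /= -(sqK 2); ring.
Qed.

Lemma two_nonresidue p (c : 'F_p) : prime p -> (p %% 8 = 3 \/ p %% 8 = 5)%N -> c ^+ 2 <> 2.
Proof.
move=> pp hp e; have p2 : odd p by lia.
have c0 : c != 0 by apply: contra_eqN e => /eqP ->; rewrite expr0n eq_sym (Fp_2 pp p2).
have := two_mod8 pp p2; rewrite -e -exprM -(half_p pp p2) Fp_fermat //.
case: ifP => [|_ /eqP]; first by lia.
by rewrite -subr_eq0 opprK (negPf (Fp_2 pp p2)).
Qed.

Lemma inert p (a b : int) : prime p -> (p %% 8 = 3 \/ p %% 8 = 5)%N ->
  (p%:Z %| a ^+ 2 - 2 * b ^+ 2)%Z -> (p%:Z %| a)%Z /\ (p%:Z %| b)%Z.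
Proof.
move=> pp hp; rewrite !int_Fp // rmorphB rmorphXn rmorphM rmorphXn /= subr_eq0 => /eqP e.
have [b0|b0] := eqVneq (b%:~R : 'F_p) 0.
  by move: e; rewrite b0 expr0n mulr0 => /eqP; rewrite expf_eq0.
by case: (@two_nonresidue p (a%:~R / b%:~R) pp hp); rewrite exprMn e exprVn mulfK // expf_neq0.
Qed.

Lemma bezoutZ p (a : int) : prime p -> ~~ (p%:Z %| a)%Z -> exists u v : int, u * a + v * p%:Z = 1.
Proof.
move=> pp h; have : coprimez a p%:Z.
  by rewrite coprimezE coprime_sym /= prime_coprime.
by case/coprimezP => -[u v] /= e; exists u, v.
Qed.

Lemma F_inv_mod p x : prime p -> (p %% 8 = 3 \/ p %% 8 = 5)%N -> OK F x ->
  (exists2 y, OK F y & x = p%:R * y) \/ (exists y z, [/\ OK F y, OK F z & x * y = 1 + p%:R * z]).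
Proof.
move=> pp hp /OK_F[a [b ->]]; have hF := F_sf; have k2 := F_r2; have o2 : OK F r2 by split=> //; exact: r2A.
have [|n] := boolP (p%:Z %| a ^+ 2 - 2 * b ^+ 2)%Z.
  move/(inert pp hp) => [/dvdzP[c ->] /dvdzP[d ->]]; left.
  by exists (c%:~R + d%:~R * r2); [sf|rewrite !rmorphM /=; ring].
have [u [v e]] := bezoutZ pp n; right.
exists (u%:~R * (a%:~R - b%:~R * r2)), (- v%:~R); split; [by sf|by sf|].
have {}e : u%:~R * (a%:~R ^+ 2 - r2 ^+ 2 * b%:~R ^+ 2) + v%:~R * p%:R = 1 :> algC.
  have := congr1 (intr : int -> algC) e.
  by rewrite r2sq rmorphD 2!rmorphM /= normZ.
by rewrite -[X in X + _ * - _]e; ring.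
Qed.

Lemma maxid_inert p : prime p -> (p %% 8 = 3 \/ p %% 8 = 5)%N -> maxid F (pr F p%:R).
Proof.
move=> pp hp; have hF := F_sf.
have p0 : p%:R != 0 :> algC by rewrite pnatr_eq0 -lt0n prime_gt0.
split.
- by apply: fid_pr => //; sf.
- by move=> _ [r [hr ->]]; sf.
- move=> [r [[_ hr] e]]; apply: (@inv_nat_Aint p); first exact: prime_gt1.
  by have -> : p%:R^-1 = r by apply: (mulfI p0); rewrite -e divff.
move=> x /(F_inv_mod pp hp) [[y hy ->]|[y [z [hy hz e]]]]; [by left; exists y|right].
by exists y => //; exists z; rewrite e addrC addKr.
Qed.

(** * Fields of odd class number *)

Lemma gen_eqi gs hs : gs =i hs -> gen gs = gen hs.
Proof.
by move=> h; apply: incl_eq; apply: gen_sub => [|a ha]; try exact: gen_sf; apply: gen_in; rewrite ?h // -h.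
Qed.

Lemma negative_not_real (x : algC) (d : int) : d < 0 -> x ^+ 2 = d%:~R -> x \is Num.real -> False.
Proof.
move=> d0 e hx; have : 0 <= x ^+ 2 by apply: real_exprn_even_ge0.
by rewrite e ler0z leNgt d0.
Qed.

Lemma tot_complex K (N : nf K) (d : int) : d < 0 -> K (sq d) -> forall i : ix N, cj i <> i.
Proof.
move=> d0 hd i e; apply: (@negative_not_real (em i (sq d)) d d0).
  by rewrite -rmorphXn sqK rmorph_int.
by apply/CrealP; rewrite -(nf_cjP i hd) e.
Qed.

Lemma sq_neg_notF d : d < 0 -> ~ F (sq d).
Proof. by move=> d0 /F_real; apply: negative_not_real d0 (sqK d). Qed.

Lemma nf_F : nf F.
Proof.
apply: nf_gen_cons; [by have [] := nf_Q|exact: r2A|].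
by rewrite sqK; apply: (@sf_int _ (gen_sf [::])).
Qed.

Lemma F_int (a : int) : F a%:~R. Proof. exact: (sf_int F_sf). Qed.

Lemma quadF (d : int) : ~ F (sq d) -> {rho | quad F (sq d) rho}.
Proof. by move=> h; apply: rho_exists => //; rewrite sqK; exact: F_int. Qed.

Lemma rho2_F rho x : quad (gen [::]) r2 rho -> F x -> F (rho x).
Proof. by move=> Q; rewrite F_qext; exact: rho_L. Qed.

(** The norm is y^2 + |d| z^2 with y, z in the real field F, and so is its conjugate. *)
Lemma norm_pos (d : int) rho rho2 x : d < 0 -> quad F (sq d) rho -> quad (gen [::]) r2 rho2 ->
  qext F (sq d) x -> x != 0 -> 0 < x * rho x /\ 0 < rho2 (x * rho x).
Proof.
move=> d0 Q Q2 [y [z [ky kz ex]]] x0.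
have eN : x * rho x = y ^+ 2 + (- d)%:~R * z ^+ 2.
  by rewrite ex (rho_qext Q) // rmorphN /= -sqKm; ring.
have pos y' z' : F y' -> F z' -> 0 <= y' ^+ 2 + (- d)%:~R * z' ^+ 2.
  move=> /F_real ry /F_real rz; apply: addr_ge0; [|apply: mulr_ge0]; try exact: real_exprn_even_ge0.
  by rewrite ler0z; lia.
have n0 : x * rho x != 0 by rewrite mulf_neq0 // fmorph_eq0.
rewrite eN in n0 *; split; rewrite lt_neqAle eq_sym ?fmorph_eq0 n0 /=; first exact: pos.
by rewrite rmorphD rmorphXn rmorphM rmorphXn rmorph_int; apply: pos; exact: rho2_F.
Qed.

(** A unit norm is totally positive, hence w^2 = w rho w for a unit w of F. *)
Lemma norm_totpos (d : int) rho x : d < 0 -> quad F (sq d) rho -> qext F (sq d) x -> x != 0 ->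
  unit F (x * rho x) -> exists2 e, unit (qext F (sq d)) e & e * rho e = x * rho x.
Proof.
move=> d0 Q lx x0 ux; have [rho2 Q2] := rho2_ex.
have [p1 p2] := norm_pos d0 Q Q2 lx x0.
have [w uw ew] := F_totpos_square Q2 ux p1 p2.
exists w; first exact: (unit_ext Q).
by rewrite (qd_fix Q) ?ew //; exact: unit_sub.
Qed.

Lemma ext_square (K : cpred) (s : algC) (rho : {rmorphism algC -> algC}) (Q : quad K s rho) a g u :
  K a -> a != 0 -> qext K s g -> unit (qext K s) u -> g * g = a * u ->
  exists g, [/\ qext K s g, g != 0 & ext K s (pr K a) = pr (qext K s) (g * g)].
Proof.
move=> ka a0 lg uu e; exists g; split=> //.
  have : g * g != 0 by rewrite e mulf_neq0 // (unit_neq0 uu).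
  by rewrite mulf_eq0 orbb.
by rewrite (ext_pr Q) // e (pr_unit (quad_sf Q)).
Qed.

Lemma diffs_sqrt (K : cpred) (s : algC) (rho : {rmorphism algC -> algC}) (D k : int) :
  quad K s rho -> s ^+ 2 = D%:~R -> D = 4 * k + 1 -> diffs K s rho s.
Proof.
move=> Q es eD; have hL := quad_sf Q; have ls : qext K s s := qext_gen (qd_sf Q) s.
have e : s = 1 * ((1 + s) / 2 - rho ((1 + s) / 2)).
  by rewrite fmorph_div rmorphD rmorph1 rmorph_nat (qd_opp Q); field.
rewrite [X in diffs _ _ _ X]e; apply: imul_in; first by sf.
exists ((1 + s) / 2) => //; split; first by sf.
apply: (@Aint_quadratic 1 (- k)%:~R); rewrite ?rpred1 ?Aint_int //.
have -> : ((1 + s) / 2) ^+ 2 - 1 * ((1 + s) / 2) + (- k)%:~R = (s ^+ 2 - (4 * k%:~R + 1)) / 4.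
  by rewrite rmorphN; field.
by rewrite es eD rmorphD rmorphM /= subrr mul0r.
Qed.

(** Since -p = 1 modulo 4, the square root s of -p lies in the different. Hence n contains p, which
    is inert in F: n is trivial or (p), and (p) = (s)^2 in the extension. *)
Lemma no2_sqrt_prime p : prime p -> (p %% 8 = 3)%N -> no2 (qext F (sq (- p%:Z))).
Proof.
move=> pp p3; set d := - p%:Z; have d0 : d < 0 by have := prime_gt0 pp; rewrite /d; lia.
have [rho Q] := quadF (sq_neg_notF d0).
have hF := F_sf; have hL := quad_sf Q; have fr := qext_fracs F_fracs (sqA d).
have inv := pid_invertible hF F_pid.
apply: (ambiguous_no2 Q inv fr F_no2) => [x lx x0 ux|]; first exact: norm_totpos.
have n0 := sq_neq0 (negbT (lt_eqF d0)).
have ls : qext F (sq d) (sq d) := qext_gen hF (sq d).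
have hd : diffs F (sq d) rho (sq d).
  by apply: (diffs_sqrt Q (sqK d) (k := (d %/ 4)%Z)); rewrite /d; lia.
apply: (ramified_principal nf_F Q (sqA d) hd n0) => n fn sn.
have -> : sq d * rho (sq d) = p%:R.
  by rewrite (qd_opp Q) mulrN sqKm /d rmorphN opprK.
move=> hn; have mp := maxid_inert pp (or_introl p3).
have p0 : p%:R != 0 :> algC by rewrite pnatr_eq0 -lt0n prime_gt0.
have [->|->] := maxid_over hF inv mp fn sn (pr_mem fn hn).
  rewrite -(pr1 F); apply: (ext_square Q (u := 1) (g := 1)); [by sf|exact: oner_neq0|by sf|exact: unit1|by []].
apply: (ext_square Q (u := -1) (g := sq d)) => //; [by sf|by apply: unitN => //; exact: unit1|].
by rewrite sqKm /d rmorphN mulrN1.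
Qed.

Definition zeta8 : algC := (1 + sq (-1)) / r2.
Lemma zeta8_sq : zeta8 ^+ 2 = sq (-1).
Proof.
have -> : zeta8 ^+ 2 = (1 + 2 * sq (-1) + sq (-1) ^+ 2) / r2 ^+ 2 by rewrite /zeta8; field; exact: r2_neq0.
by rewrite r2sq sqK; field.
Qed.
Lemma zeta8_A : zeta8 \in Aint. Proof. by apply: Aint_sqr; rewrite zeta8_sq sqA. Qed.

Lemma zeta8_4 : zeta8 ^+ 4 = -1.
Proof. by rewrite (exprM zeta8 2 2) zeta8_sq sqK. Qed.

Lemma unit_zeta8 L : is_subfield L -> L zeta8 -> unit L zeta8.
Proof.
move=> hL lz; have z0 : zeta8 != 0.
  by apply/eqP => h; have /eqP := zeta8_4; rewrite h expr0n eq_sym oppr_eq0 oner_eq0.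
split=> //; first by split=> //; exact: zeta8_A.
have -> : zeta8^-1 = - zeta8 ^+ 3 by apply: (mulfI z0); rewrite divff // mulrN -exprS zeta8_4 opprK.
by split; [sf|rewrite rpredN rpredX // zeta8_A].
Qed.

Lemma unit_eps L : is_subfield L -> L r2 -> unit L (1 + r2).
Proof.
move=> hL l2; have e0 : (1 + r2) * (r2 - 1) = 1.
  by have -> : (1 + r2) * (r2 - 1) = r2 ^+ 2 - 1 by [ring]; rewrite r2sq; ring.
have n1 : 1 + r2 != 0 by apply: contra_eq_neq e0 => ->; rewrite mul0r eq_sym oner_eq0.
split=> //; first by split; [sf|rewrite rpredD ?rpred1 ?r2A].
have -> : (1 + r2)^-1 = r2 - 1 by apply: (mulfI n1); rewrite divff.
by split; [sf|rewrite rpredB ?rpred1 ?r2A].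
Qed.

(** The difference [zeta8] - rho [zeta8] = r2 s has norm 2 = r2^2, so n is 1, (r2) or (2), and each
    becomes the square of a principal ideal. *)
Lemma no2_zeta8 : no2 (qext F (sq (-1))).
Proof.
have [rho Q] := quadF (sq_neg_notF (ltrN10 int)).
have hF := F_sf; have hL := quad_sf Q; have fr := qext_fracs F_fracs (sqA (-1)).
have inv := pid_invertible hF F_pid.
apply: (ambiguous_no2 Q inv fr F_no2) => [x lx x0 ux|]; first exact: norm_totpos.
set s := sq (-1); have n0 : s != 0 by exact: sq_neq0.
have ls : qext F s s := qext_gen hF s.
have k2 := F_r2; have l2 := qext_subK hF s k2; have r0 := r2_neq0.
have es : s ^+ 2 = -1 by rewrite sqK.
have lz : qext F s zeta8 by rewrite /zeta8; sf.
have hd : diffs F s rho (r2 * s).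
  have -> : r2 * s = 1 * (zeta8 - rho zeta8).
    rewrite /zeta8 fmorph_div rmorphD rmorph1 (qd_opp Q) (qd_fix Q k2).
    have -> : 1 * ((1 + s) / r2 - (1 - s) / r2) = 2 * s / r2 by field.
    by rewrite -[in RHS]r2sq; field.
  by apply: imul_in; [sf|exists zeta8 => //; split=> //; exact: zeta8_A].
have nd : r2 * s != 0 by rewrite mulf_neq0.
apply: (ramified_principal nf_F Q (sqA (-1)) hd nd) => n fn sn.
have -> : r2 * s * rho (r2 * s) = r2 * r2.
  rewrite rmorphM (qd_fix Q k2) (qd_opp Q); have -> : r2 * s * (r2 * - s) = r2 * r2 * - (s ^+ 2) by ring.
  by rewrite es opprK mulr1.
move=> hn; have mp := maxid_r2; have u1 : unit (qext F s) 1 := unit1 hL.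
have sub : incl (imul (pr F r2) (pr F r2)) n by rewrite imul_pr //; exact: pr_mem.
have uz := unit_zeta8 hL lz.
have ue := unit_eps hL l2.
(* From [zeta8]^2 = r2 [zeta8] - 1 follows (1 + [zeta8])^2 = r2 [zeta8] (1 + r2), a unit multiple of
   r2. *)
have c2 : exists g, [/\ qext F s g, g != 0 & ext F s (pr F r2) = pr (qext F s) (g * g)].
  apply: (ext_square Q (u := zeta8 * (1 + r2)) (g := 1 + zeta8)) => //; [by sf|exact: unitM|].
  have ez : zeta8 ^+ 2 = r2 * zeta8 - 1.
    by rewrite zeta8_sq /zeta8 mulrC divfK // addrC addKr.
  have -> : (1 + zeta8) * (1 + zeta8) = 1 + 2 * zeta8 + zeta8 ^+ 2 by ring.
  by rewrite ez -r2sq; ring.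
have [->|->|->|->] := maxid2_over hF inv mp mp fn sn sub => //.
  rewrite -(pr1 F); apply: (ext_square Q (u := 1) (g := 1)) => //; [by sf|exact: oner_neq0|by sf].
rewrite imul_pr //; apply: (ext_square Q (u := 1) (g := r2)) => //; [by sf|exact: mulf_neq0|by rewrite mulr1].
Qed.

(** * Congruences modulo a rational prime and the Frobenius map *)

Definition cong (n : nat) (x y : algC) := exists2 z, z \in Aint & x = y + n%:R * z.

Lemma cong_refl n x : cong n x x. Proof. by exists 0; rewrite ?rpred0 // mulr0 addr0. Qed.
Lemma cong_trans n y x z : cong n x y -> cong n y z -> cong n x z.
Proof. by move=> [u hu ->] [v hv ->]; exists (v + u); [rewrite rpredD|ring]. Qed.
Lemma cong_sym n x y : cong n x y -> cong n y x.
Proof. by move=> [u hu ->]; exists (- u); [rewrite rpredN|ring]. Qed.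
Lemma congD n x y x' y' : cong n x x' -> cong n y y' -> cong n (x + y) (x' + y').
Proof. by move=> [u hu ->] [v hv ->]; exists (u + v); [rewrite rpredD|ring]. Qed.
Lemma congM n x y x' y' : x' \in Aint -> y' \in Aint ->
  cong n x x' -> cong n y y' -> cong n (x * y) (x' * y').
Proof.
move=> hx hy [u hu ->] [v hv ->]; exists (x' * v + u * y' + n%:R * u * v); last by ring.
by do !rewrite ?rpredD ?rpredM ?rpred_nat.
Qed.
Lemma congX n x y k : y \in Aint -> cong n x y -> cong n (x ^+ k) (y ^+ k).
Proof.
move=> hy h; elim: k => [|k IH]; first by rewrite !expr0; exact: cong_refl.
by rewrite !exprS; apply: congM => //; rewrite rpredX.
Qed.

Section Frob2.
Variable p : nat.
Hypotheses (pp : prime p) (p2 : odd p).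

Lemma cong_frob x y : x \in Aint -> y \in Aint -> cong p ((x + y) ^+ p) (x ^+ p + y ^+ p).
Proof. by move=> hx hy; have [z hz ->] := frobA pp hx hy; exists z. Qed.

Lemma cong_int (a b : int) : (a%:~R : 'F_p) = b%:~R -> cong p a%:~R b%:~R.
Proof.
move/eqP; rewrite -subr_eq0 -rmorphB => /eqP /(Fp_eq0 pp)[c ec]; exists c%:~R; first exact: Aint_int.
have -> : a = b + p%:Z * c by rewrite -ec; ring.
by rewrite rmorphD rmorphM.
Qed.

Lemma frob_int (a : int) : cong p (a%:~R ^+ p) a%:~R.
Proof.
rewrite -rmorphXn; apply: cong_int; rewrite rmorphXn /=.
by have := expf_card (a%:~R : 'F_p); rewrite (card_Fp' pp).
Qed.

(** Fixed by the square of Frobenius modulo p. This holds for the integers of a multiquadratic field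
    unramified at p, whose residue fields have at most p^2 elements. *)
Definition frob2 x := x \in Aint /\ cong p (x ^+ (p ^ 2)) x.

Lemma frob2D x y : frob2 x -> frob2 y -> frob2 (x + y).
Proof.
move=> [hx ex] [hy ey]; split; first by rewrite rpredD.
apply: cong_trans (congD ex ey); rewrite -mulnn !exprM.
apply: (cong_trans (y := (x ^+ p + y ^+ p) ^+ p)); last by apply: cong_frob; rewrite rpredX.
by apply: congX; [rewrite rpredD ?rpredX|exact: cong_frob].
Qed.

Lemma frob2M x y : frob2 x -> frob2 y -> frob2 (x * y).
Proof. by move=> [hx ex] [hy ey]; split; [rewrite rpredM|rewrite exprMn; exact: congM]. Qed.

Lemma frob2_int (a : int) : frob2 a%:~R.
Proof.
split; first exact: Aint_int.
rewrite -mulnn exprM; apply: (cong_trans (y := a%:~R ^+ p)); last exact: frob_int.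
by apply: congX; [exact: Aint_int|exact: frob_int].
Qed.

Lemma frob_sq (d : int) : ~~ (p%:Z %| d)%Z ->
  cong p (sq d ^+ p) (sq d) \/ cong p (sq d ^+ p) (- sq d).
Proof.
move=> h; have d0 : (d%:~R : 'F_p) != 0 by rewrite -int_Fp.
have e : sq d ^+ p = (d ^+ (p.-1)./2)%:~R * sq d.
  rewrite rmorphXn /= -(sqK d) -exprM -(half_p pp p2) -exprSr prednK //; exact: prime_gt0.
rewrite e; have [h1|h1] := Fp_pm1 pp p2 d0; [left|right].
  rewrite -[X in cong _ _ X]mul1r; apply: congM; rewrite ?rpred1 ?sqA //; last exact: cong_refl.
  by apply: (@cong_int _ 1); rewrite rmorphXn.
rewrite -mulN1r; apply: congM; rewrite ?rpredN ?rpred1 ?sqA //; last exact: cong_refl.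
by apply: (@cong_int _ (-1)); rewrite rmorphXn rmorphN.
Qed.

Lemma frob2_sq (d : int) : ~~ (p%:Z %| d)%Z -> frob2 (sq d).
Proof.
move=> h; split; first exact: sqA.
have hd := sqA d; rewrite -mulnn exprM; have [e|e] := frob_sq h.
  by refine (cong_trans _ e); apply: congX.
apply: (cong_trans (y := (- sq d) ^+ p)); first by apply: congX; rewrite ?rpredN.
rewrite exprNn -signr_odd p2 expr1 mulN1r -[X in cong _ _ X]opprK -2!mulN1r.
rewrite -[X in cong _ _ X]mulN1r; apply: congM; rewrite ?rpredN ?rpred1 ?mulN1r ?rpredN //; exact: cong_refl.
Qed.

Lemma frob2_div (m : int) x : x \in Aint -> ~~ (p%:Z %| m)%Z -> frob2 (m%:~R * x) -> frob2 x.
Proof.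
move=> hx hm [_ h]; split=> //; have [u [v e]] := bezoutZ pp hm.
have {h} : cong p (m%:~R * x ^+ (p ^ 2)) (m%:~R * x).
  refine (cong_trans _ h); rewrite exprMn; apply: congM; rewrite ?rpredX ?Aint_int //; last exact: cong_refl.
  by apply: cong_sym; have [_] := frob2_int m.
case=> z hz ez; exists (u%:~R * z + v%:~R * (x ^+ (p ^ 2) - x)).
  by do !rewrite ?rpredD ?rpredM ?Aint_int ?rpredN ?rpredX.
have /(congr1 (intr : int -> algC)) := e; rewrite rmorphD !rmorphM /= => {}e.
transitivity (x + (u%:~R * m%:~R + v%:~R * p%:R) * (x ^+ (p ^ 2) - x)); first by rewrite e; ring.
have -> : (u%:~R * m%:~R + v%:~R * p%:R) * (x ^+ (p ^ 2) - x) =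
  u%:~R * (m%:~R * x ^+ (p ^ 2) - m%:~R * x) + v%:~R * p%:R * (x ^+ (p ^ 2) - x) by ring.
by rewrite ez; ring.
Qed.

(* An Euler-criterion certificate of non-squareness modulo a prime above p. *)
Lemma nonsquare_mod K P v : is_subfield K -> maxid K P -> P p%:R ->
  (forall w, OK K w -> frob2 w) -> unit K v -> cong p (v ^+ (p ^ 2).-1./2) (-1) ->
  forall w, OK K w -> ~ P (v - w ^+ 2).
Proof.
move=> hK mP Pp hf uv [z hz ez] w hw hP; have [fP sP P1 _] := mP.
have [v0 ov ov'] := uv; set N := (p ^ 2).-1./2 in ez.
have p0 : p%:R != 0 :> algC by rewrite pnatr_eq0 -lt0n prime_gt0.
(* The witness of a congruence is only known to be in [Aint]; it belongs to K because the other
   terms do. *)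
have inp x y : x \in Aint -> OK K y -> OK K (p%:R * x + y) -> P (p%:R * x).
  move=> hx [ky _] [k _]; rewrite mulrC; apply: (fidM fP) => //; split=> //.
  have -> : x = (p%:R * x + y - y) / p%:R by field.
  by sf.
have e2N : (N * 2).+1 = (p ^ 2)%N.
  have : odd (p ^ 2) by rewrite oddX p2 orbT.
  by rewrite /N; case: (p ^ 2)%N => // n /= /negPf o; rewrite muln2 -[in RHS](odd_double_half n) o.
(* If v = w^2 modulo P, then w is invertible modulo P and -1 = v^N = w^(p^2 - 1) = 1, so P contains
   2 as well as the odd p. *)
have h1 : P (v ^+ N - (w ^+ 2) ^+ N).
  rewrite subrXX mulrC; apply: (fidM fP) => //; apply: (OK_sum hK) => i _; sf.
have [_ [z' hz' ez']] := hf w hw.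
have ow : OK K (w ^+ (p ^ 2)) by sf.
have h2 : P (w * ((w ^+ 2) ^+ N - 1)).
  rewrite -exprM mulrBr mulr1 -exprS mulnC e2N ez' addrC addKr.
  by apply: (inp _ w) => //; rewrite addrC -ez'.
have oN : OK K ((w ^+ 2) ^+ N - 1) by sf.
have [h|h] := max_prime hK mP hw oN h2.
  apply: P1; have -> : 1 = v^-1 * (v - w ^+ 2 + w * w) by field.
  by apply: (fidM fP) => //; apply: (fidD fP) => //; apply: (fidM fP).
have h3 : P (-2).
  have -> : -2 = (v ^+ N - (w ^+ 2) ^+ N) + ((w ^+ 2) ^+ N - 1) - p%:R * z.
    by rewrite ez; ring.
  apply: (fidB hK fP); first exact: (fidD fP).
  have on1 : OK K (-1) by sf.
  apply: (inp _ (-1)) => //; rewrite addrC -ez; sf.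
apply: P1; have h4 : (p = (p./2).*2.+1)%N by rewrite -[LHS]odd_double_half p2.
have e1 : p%:R = p./2%:R * 2 + 1 :> algC.
  by have := congr1 (fun n => n%:R : algC) h4; rewrite -natr1 -muln2 natrM.
have -> : 1 = p%:R + p./2%:R * (-2) :> algC by rewrite e1; ring.
by apply: (fidD fP) => //; apply: (fidM fP) => //; sf.
Qed.
End Frob2.

(** Here p is inert in F, so every integer becomes a square modulo p: d itself is a residue, or else
    2 d is, both 2 and d being nonresidues, and r2 enters the root. *)
Lemma split_root p (d : int) : prime p -> (p %% 8 = 3 \/ p %% 8 = 5)%N -> ~~ (p%:Z %| d)%Z ->
  exists t z, [/\ OK F t, OK F z & t ^+ 2 = d%:~R + p%:R * z].
Proof.
move=> pp hp hd; have p2 : odd p by lia.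
have d0 : (d%:~R : 'F_p) != 0 by rewrite -int_Fp.
have hF := F_sf; have k2 := F_r2; have o2 : OK F r2 by split=> //; exact: r2A.
have [h|h] := Fp_pm1 pp p2 d0.
  have [y ey] := Fp_euler pp p2 h; have [a ea] := Fp_int y.
  have /(Fp_eq0 pp)[b eb] : (a ^+ 2 - d)%:~R = 0 :> 'F_p.
    by rewrite rmorphB rmorphXn /= -ea ey subrr.
  exists a%:~R, b%:~R; split; [by sf|by sf|].
  have /(congr1 (intr : int -> algC)) := eb; rewrite rmorphB rmorphXn rmorphM /= => <-.
  by ring.
have n2 := Fp_2 pp p2.
have h2 : (2 * d%:~R : 'F_p) ^+ (p.-1)./2 = 1.
  rewrite exprMn h (two_mod8 pp p2); case: ifP => [|_]; first by lia.
  by rewrite mulrNN mulr1.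
have [y ey] := Fp_euler pp p2 h2; have [a ea] := Fp_int (y / 2).
have /(Fp_eq0 pp)[b eb] : (2 * a ^+ 2 - d)%:~R = 0 :> 'F_p.
  rewrite rmorphB rmorphM rmorphXn /= -ea expr_div_n -ey; apply/eqP; rewrite subr_eq0; apply/eqP.
  have -> : 2 * (2 * d%:~R / 2 ^+ 2) = d%:~R * (2 * 2^-1) * (2 * 2^-1) :> 'F_p.
    by rewrite expr2 invfM; ring.
  by rewrite divff // !mulr1.
exists (a%:~R * r2), b%:~R; split; [by sf|by sf|].
have /(congr1 (intr : int -> algC)) := eb; rewrite rmorphB rmorphM rmorphXn rmorphM /= => <-.
by rewrite exprMn r2sq; ring.
Qed.

(** * Comaximal elements and the primes above p in Q(sqrt 2, sqrt d) *)

Definition comax (K : cpred) x y := exists a b, [/\ OK K a, OK K b & a * x + b * y = 1].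

Section Comax.
Variables (K : cpred) (hK : is_subfield K).

Lemma comax_sym x y : comax K x y -> comax K y x.
Proof. by move=> [a [b [ha hb e]]]; exists b, a; rewrite addrC. Qed.

Lemma comaxM x y y' : OK K x -> OK K y -> comax K x y -> comax K x y' -> comax K x (y * y').
Proof.
move=> hx hy [a [b [ha hb e]]] [a' [b' [ha' hb' e']]].
exists (a + b * y * a'), (b * b'); split; [by sf|by sf|].
by rewrite -[RHS]e -[X in _ = _ + X]mulr1 -e'; ring.
Qed.

Lemma comaxX x y m n : OK K x -> OK K y -> comax K x y -> comax K (x ^+ m) (y ^+ n).
Proof.
move=> hx hy h.
have h0 u : comax K u 1 by exists 0, 1; rewrite mul0r add0r mulr1; split=> //; sf.
have step u v k : OK K u -> OK K v -> comax K u v -> comax K u (v ^+ k).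
  move=> hu hv huv; elim: k => [|k IH]; first exact: h0.
  by rewrite exprS; apply: comaxM.
have hxy := step _ _ n hx hy h; have hyn : OK K (y ^+ n) by sf.
exact: comax_sym (step _ _ m hyn hx (comax_sym hxy)).
Qed.
End Comax.

Section Split.
Variables (d : int) (rho : {rmorphism algC -> algC}) (p : nat).
Hypotheses (Q : quad F (sq d) rho) (pp : prime p) (hp : (p %% 8 = 3 \/ p %% 8 = 5)%N)
  (pd : ~~ (p%:Z %| d)%Z).
Local Notation s := (sq d).
Local Notation K := (qext F s).
Let hF := F_sf.
Let hK : is_subfield K := quad_sf Q.
Let p0 : p%:R != 0 :> algC. Proof. by rewrite pnatr_eq0 -lt0n prime_gt0. Qed.
Let ks : K s := qext_gen hF s.
Let os : OK K s. Proof. by split=> //; exact: sqA. Qed.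
Let p2 : odd p. Proof. by move: hp; lia. Qed.

Lemma split_coords x : OK K x -> exists A B, [/\ OK F A, OK F B & 2 * d%:~R * x = A + B * s].
Proof.
move=> hx; exists (d%:~R * (x + rho x)), ((x - rho x) * s).
have ot := OK_trace Q hx; have orx := OK_rho Q hx; split; first by sf.
  have [kB aB] : OK K ((x - rho x) * s) by sf.
  split=> //; apply: (rho_fix Q) => //.
  have [kx _] := hx; rewrite rmorphM rmorphB (rhoK Q kx) (qd_opp Q); ring.
by rewrite -(sqKm d); ring.
Qed.

Lemma two_d_unit_mod : ~~ (p%:Z %| 2 * d)%Z.
Proof.
by rewrite int_Fp // rmorphM /= mulf_neq0 ?(Fp_2 pp p2) // -int_Fp.
Qed.

Lemma frob2_qext w : OK K w -> frob2 p w.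
Proof.
move=> hw; have [A [B [/OK_F[a [b eA]] /OK_F[a' [b' eB]] e]]] := split_coords hw.
have p22 : ~~ (p%:Z %| 2)%Z by rewrite int_Fp // (Fp_2 pp p2).
have [_ aw] := hw; apply: (frob2_div pp aw two_d_unit_mod).
rewrite rmorphM /= e eA eB.
by do ![apply: frob2D|apply: frob2M|apply: frob2_sq|apply: frob2_int].
Qed.

Variables (t z : algC).
Hypotheses (ot : OK F t) (oz : OK F z) (et : t ^+ 2 = d%:~R + p%:R * z).

(** Dedekind's prime (p, s - t) for a root t of d modulo p; the conjugate prime belongs to -t. *)
Definition split_ideal (t : algC) := iadd (pr K p%:R) (pr K (s - t)).
Local Notation P := split_ideal.
Let kt : OK K t := OK_ext Q ot.
Let kz : OK K z := OK_ext Q oz.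

Lemma split_ideal_mem u a b : OK K a -> OK K b -> P u (p%:R * a + (s - u) * b).
Proof. by move=> ha hb; exists (p%:R * a), ((s - u) * b); split=> //; [exists a|exists b]. Qed.

Lemma split_s_neq u : F u -> s - u != 0.
Proof. by move=> hu; rewrite subr_eq0; apply: contra_not_neq (qd_ns Q) => ->. Qed.

Lemma fid_split u : OK F u -> fid K (P u).
Proof.
move=> [ku au]; have ku' : K u := qext_subK hF s ku; have [ks' as'] := os.
apply: (fid_iadd hK); first by apply: fid_pr => //; sf.
- by apply: fid_pr; [sf|sf|exact: split_s_neq].
- by move=> _ [r [hr ->]]; sf.
- by move=> _ [r [[kr ar] ->]]; split; [sf|rewrite rpredM ?rpredB].
Qed.

Lemma split_sub u : OK F u -> incl (P u) (OK K).
Proof.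
by move=> hu _ [_ [_ [[a [ha ->]] [b [hb ->]] ->]]]; have := OK_ext Q hu; move=> *; sf.
Qed.

Lemma split_rho u x : OK F u -> P u x -> P (- u) (rho x).
Proof.
move=> [ku _] [_ [_ [[a [ha ->]] [b [hb ->]] ->]]].
have -> : rho (p%:R * a + (s - u) * b) = p%:R * rho a + (s - - u) * (- rho b).
  rewrite rmorphD !rmorphM rmorphB rmorph_nat (qd_opp Q) (qd_fix Q ku); ring.
by apply: split_ideal_mem; [exact: (OK_rho Q)|have := OK_rho Q hb => ?; sf].
Qed.

Lemma split_prod : imul (P t) (P (- t)) = pr K p%:R.
Proof.
have fp : fid K (pr K p%:R) by apply: fid_pr => //; sf.
have ont : OK F (- t) by sf.
have f1 := fid_split ot; have f2 := fid_split ont; have f12 := fid_imul hK f1 f2.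
apply: incl_eq.
  apply: imul_sub; [exact: (fid0 fp)|exact: (fidD fp)|].
  move=> _ _ [_ [_ [[a [ha ->]] [b [hb ->]] ->]]] [_ [_ [[a' [ha' ->]] [b' [hb' ->]] ->]]].
  exists (a * (p%:R * a' + (s - - t) * b') + (s - t) * b * a' - z * b * b'); split; first by sf.
  have -> : (p%:R * a + (s - t) * b) * (p%:R * a' + (s - - t) * b') =
     p%:R * (a * (p%:R * a' + (s - - t) * b') + (s - t) * b * a') + (s ^+ 2 - t ^+ 2) * b * b' by ring.
  by rewrite et sqK; ring.
apply: pr_mem => //.
have [u [v e]] := bezoutZ pp two_d_unit_mod.
have in1 (u' : algC) : P u' p%:R.
  by rewrite -[p%:R]mulr1 -[_ * 1]addr0 -(mulr0 (s - u')); apply: split_ideal_mem; sf.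
have in2 (u' : algC) : P u' (s - u').
  by rewrite -[s - u']mulr1 -[_ * 1]add0r -(mulr0 p%:R); apply: split_ideal_mem; sf.
have {}e : u%:~R * (2 * d%:~R) + v%:~R * p%:R = 1 :> algC.
  by have := congr1 (intr : int -> algC) e; rewrite rmorphD !rmorphM.
(* This is p = (2 u d + v p) p with d = t^2 - p z and 2 p t = p (s + t) - (s - t) p. *)
have -> : p%:R = (u%:~R * t) * (p%:R * (s - - t) - (s - t) * p%:R) + (v%:~R - 2 * u%:~R * z) * (p%:R * p%:R).
  transitivity ((u%:~R * (2 * d%:~R) + v%:~R * p%:R) * p%:R : algC); first by rewrite e mul1r.
  have -> : (u%:~R * t) * (p%:R * (s - - t) - (s - t) * p%:R) = u%:~R * 2 * p%:R * t ^+ 2 by ring.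
  by rewrite et; ring.
by apply: (fidD f12); apply: (fidM f12); try (by sf); [apply: (fidB hK f12)|]; apply: imul_in.
Qed.

Lemma split_max : maxid K (P t).
Proof.
have ont : OK F (- t) by sf.
have f1 := fid_split ot; have s1 := split_sub ot.
have in1 : P t p%:R.
  by rewrite -[p%:R]mulr1 -[_ * 1]addr0 -(mulr0 (s - t)); apply: split_ideal_mem; sf.
split=> //.
  move=> h1; have h2 := split_rho ot h1; rewrite rmorph1 in h2.
  have : imul (P t) (P (- t)) (1 * 1) by apply: imul_in.
  rewrite split_prod => -[r [[_ hr] e]]; apply: (@inv_nat_Aint p); first exact: prime_gt1.
  by have -> : p%:R^-1 = r by apply: (mulfI p0); rewrite -e mulr1 divff.
move=> x hx; have [A [B [hA hB e]]] := split_coords hx.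
have oA := OK_ext Q hA; have oB := OK_ext Q hB.
have oc : OK F (A + B * t) by sf.
have {}e : 2 * d%:~R * x = A + B * t + (s - t) * B by rewrite e; ring.
have [[y hy ey]|[y [y' [hy hy' ey]]]] := F_inv_mod pp hp oc.
  left; have [u [v ev]] := bezoutZ pp two_d_unit_mod.
  have {}ev : u%:~R * (2 * d%:~R) + v%:~R * p%:R = 1 :> algC.
    by have := congr1 (intr : int -> algC) ev; rewrite rmorphD !rmorphM.
  have oy := OK_ext Q hy.
  have -> : x = u%:~R * (p%:R * y + (s - t) * B) + v%:~R * x * p%:R.
    by rewrite -ey -e -[LHS]mul1r -{1}ev; ring.
  by apply: (fidD f1); apply: (fidM f1) => //; [sf|exact: split_ideal_mem|sf].
have oy := OK_ext Q hy; have oy' := OK_ext Q hy'.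
right; exists (2 * d%:~R * y); first by sf.
have -> : x * (2 * d%:~R * y) - 1 = p%:R * y' + (s - t) * (B * y).
  have -> : x * (2 * d%:~R * y) = 2 * d%:~R * x * y by ring.
  by rewrite e mulrDl ey; ring.
by apply: split_ideal_mem => //; sf.
Qed.
End Split.

Section RamifiedSplit.
Variables (d D : int) (rho rho' : {rmorphism algC -> algC}) (p : nat).
Local Notation K := (qext F (sq d)).
Hypotheses (Q : quad F (sq d) rho) (d0 : d < 0) (pp : prime p)
  (hp : (p %% 8 = 3 \/ p %% 8 = 5)%N) (pd : ~~ (p%:Z %| d)%Z)
  (Q' : quad K (sq D) rho') (hD : D = p%:Z \/ D = - p%:Z) (D4 : D = 4 * (D %/ 4)%Z + 1).

Lemma ramified_split v : no2 K -> unit K v -> cong p (v ^+ (p ^ 2).-1./2) (-1) ->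
  no2 (qext K (sq D)).
Proof.
move=> n2 uv hv; have hK := quad_sf Q; have hF := F_sf; have p2 : odd p by lia.
have [N _] := nf_qext nf_F Q (sqA d).
have ks : K (sq d) := qext_gen hF (sq d).
have tc : forall i : ix N, cj i <> i by exact: tot_complex d0 ks.
have [t [z [ot oz et]]] := split_root pp hp pd.
have ont : OK F (- t) by sf.
have ent : (- t) ^+ 2 = d%:~R + p%:R * z by rewrite sqrrN.
have m1 := split_max Q pp hp pd ot oz et; have m2 := split_max Q pp hp pd ont oz ent.
have eP := split_prod Q pp hp pd ot oz et.
have ePD : imul (split_ideal d p t) (split_ideal d p (- t)) = pr K (sq D ^+ 2).
  have u1 := unit1 hK.
  rewrite eP sqK; case: hD => -> //; rewrite rmorphN /= -mulrN1 pr_unit //; exact: unitN.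
have in1 (u' : algC) : split_ideal d p u' p%:R.
  by rewrite -[p%:R]mulr1 -[_ * 1]addr0 -(mulr0 (sq d - u')); apply: split_ideal_mem; sf.
have in2 (u' : algC) : split_ideal d p u' (sq d - u').
  by rewrite -[sq d - u']mulr1 -[_ * 1]add0r -(mulr0 p%:R); apply: split_ideal_mem; sf.
have n12 : ~ split_ideal d p t (sq d - - t).
  have [f1 s1 n1 _] := m1; move=> h; apply: n1.
  have kt := OK_ext Q ot; have kz := OK_ext Q oz.
  have [u [w e]] := bezoutZ pp (two_d_unit_mod pp hp pd).
  have {}e : u%:~R * (2 * d%:~R) + w%:~R * p%:R = 1 :> algC.
    by have := congr1 (intr : int -> algC) e; rewrite rmorphD !rmorphM.
  have -> : 1 = (u%:~R * t) * ((sq d - - t) - (sq d - t)) + (w%:~R - 2 * u%:~R * z) * p%:R :> algC.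
    have -> : u%:~R * t * (sq d - - t - (sq d - t)) = 2 * u%:~R * t ^+ 2 by ring.
    by rewrite et -[LHS]e; ring.
  by apply: (fidD f1); apply: (fidM f1) => //; [sf|apply: (fidB hK f1)|sf].
have hw w : OK K w -> ~ split_ideal d p t (v - w ^+ 2).
  by apply: (nonsquare_mod pp p2 hK m1) => // x; apply: (frob2_qext Q pp hp pd).
have [_ ov _] := uv.
have nn := nonnorm N Q' m1 m2 ePD (in2 (- t)) n12 ov hw.
have D0 : D != 0 by case: hD => ->; have := prime_gt0 pp; lia.
have eN : imul (split_ideal d p t) (split_ideal d p (- t)) = pr K (sq D * rho' (sq D)); last first.
  exact: (two_ramified Q' (sqA D) tc n2 (diffs_sqrt Q' (sqK D) D4) (sq_neq0 D0) m1 m2 eN uv nn).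
have u1 := unitN hK (unit1 hK).
by rewrite (qd_opp Q') mulrN -expr2 ePD -mulrN1 [RHS](pr_unit hK _ u1).
Qed.
End RamifiedSplit.

Lemma odd_logn_nonsquare p (n m : int) : odd (logn p `|n|) -> n <> m ^+ 2.
Proof. by move=> h e; move: h; rewrite e abszX lognX mul2n odd_double. Qed.

Lemma odd_logn_notF p x (D : int) : prime p -> odd p -> odd (logn p `|D|) ->
  x ^+ 2 = D%:~R -> ~ F x.
Proof.
move=> pp p2 hD e hx; have : F (sq D).
  have [<-//|h] : x = sq D \/ x = - sq D by apply: sq_unit_pm; rewrite e sqK.
  by rewrite -[sq D]opprK -h; apply: (sfN F_sf).
have D0 : (0 < `|D|)%N by case: (`|D|)%N hD => //; rewrite logn0.
case/sq_F => -[m]; apply: (@odd_logn_nonsquare p) => //.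
rewrite abszM lognM // (logn_prime _ (isT : prime 2)).
by case: eqP p2 => [->|].
Qed.

Lemma logn_self p : prime p -> logn p p = 1%N.
Proof. by move=> pp; rewrite -{2}(expn1 p) pfactorK. Qed.

Lemma logn_signed p (D : int) : prime p -> (D = p%:Z \/ D = - p%:Z) -> logn p `|D| = 1%N.
Proof. by move=> pp [->|->]; rewrite ?abszN logn_self. Qed.

Lemma logn_pq p q : prime p -> prime q -> p <> q -> logn p `|p%:Z * q%:Z| = 1%N.
Proof.
move=> pp pq npq; rewrite abszM lognM ?prime_gt0 // logn_self // (logn_prime _ pq).
by case: eqP.
Qed.

Lemma prime_notF (p : nat) x (D : int) : prime p -> odd p -> (D = p%:Z \/ D = - p%:Z) ->
  x ^+ 2 = D%:~R -> ~ F x.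
Proof. by move=> pp p2 hD; apply: (odd_logn_notF pp p2); rewrite logn_signed. Qed.

Lemma sq_cat (a b : int) : sq a * sq b = sq (a * b) \/ sq a * sq b = - sq (a * b).
Proof. by apply: sq_unit_pm; rewrite exprMn !sqK rmorphM. Qed.

(** Such primes satisfy p^2 = 9 modulo 16, so that [zeta8] to this power is -1. *)
Lemma half_sq p : (p %% 8 = 3 \/ p %% 8 = 5)%N -> exists k, ((p ^ 2).-1./2 = 4 * (2 * k).+1)%N.
Proof.
have hm := divn_eq p 8; set m := (p %/ 8)%N in hm; case=> h; rewrite h in hm.
  exists (4 * (m * m) + 3 * m)%N.
  have -> : (p ^ 2 = (4 * (2 * (4 * (m * m) + 3 * m)).+1).*2.+1)%N by rewrite hm -mulnn; nia.
  by rewrite /= doubleK.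
exists (4 * (m * m) + 5 * m + 1)%N.
have -> : (p ^ 2 = (4 * (2 * (4 * (m * m) + 5 * m + 1)).+1).*2.+1)%N by rewrite hm -mulnn; nia.
by rewrite /= doubleK.
Qed.

Lemma no2_case2 p : prime p -> (p %% 8 = 3 \/ p %% 8 = 5)%N ->
  no2 (gen [:: r2; sq (-1); sq (- p%:Z)]).
Proof.
move=> pp hp; have p2 : odd p by lia.
have ni := sq_neg_notF (ltrN10 int); have [rho Q] := quadF ni.
have hF := F_sf; have hK := quad_sf Q.
have eK : gen [:: sq (-1); r2] = qext F (sq (-1)).
  by apply: gen_cons => //; rewrite sqK; exact: F_int.
(* In the presence of sqrt(-1) the sign of p is free; this choice is 1 modulo 4, which puts sqrt D
   into the different. *)
pose D : int := if (p %% 8 == 3)%N then - p%:Z else p%:Z.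
have hD : D = p%:Z \/ D = - p%:Z by rewrite /D; case: ifP; [right|left].
have D4 : D = 4 * (D %/ 4)%Z + 1 by rewrite /D; case: ifP => /eqP h; lia.
have nD : ~ qext F (sq (-1)) (sq D).
  move=> /(kummer hF) []; rewrite ?sqK //; try exact: F_int.
    exact: (prime_notF pp p2 hD (sqK D)).
  apply: (@prime_notF p _ (- D) pp p2); first by case: hD => ->; [right|left]; rewrite ?opprK.
  by rewrite exprMn !sqK -rmorphM mulN1r.
have hD2 : gen [:: sq (-1); r2] (sq D ^+ 2) by rewrite sqK; apply: (@sf_int _ (gen_sf _)).
have eL : gen [:: r2; sq (-1); sq (- p%:Z)] = qext (qext F (sq (-1))) (sq D).
  rewrite -eK -gen_cons // ?eK //.
  have gi (gs : seq algC) a : a \in gs -> gen gs a by exact: gen_in.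
  apply: incl_eq; apply: gen_sub; try exact: gen_sf; set G := gen _.
    have hG : is_subfield G by exact: gen_sf.
    have GD : G (sq D) by apply: gi; rewrite !inE eqxx.
    have Gi : G (sq (-1)) by apply: gi; rewrite !inE eqxx orbT.
    have G2 : G r2 by apply: gi; rewrite !inE eqxx !orbT.
    move=> a; rewrite !inE => /or3P[]/eqP-> //.
    rewrite /D in GD; case: ifP GD => // _ GD.
    by have [e|e] := sq_cat (-1) p%:Z; rewrite mulN1r in e; [rewrite -e|rewrite -[sq (- _)]opprK -e]; sf.
  have hG : is_subfield G by exact: gen_sf.
  have GD : G (sq (- p%:Z)) by apply: gi; rewrite !inE eqxx !orbT.
  have Gi : G (sq (-1)) by apply: gi; rewrite !inE eqxx orbT.
  have G2 : G r2 by apply: gi; rewrite !inE eqxx.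
  move=> a; rewrite !inE => /or3P[]/eqP-> //.
  rewrite /D; case: ifP => // _.
  by have [e|e] := sq_cat (-1) (- p%:Z); rewrite mulN1r opprK in e; [rewrite -e|rewrite -[sq _]opprK -e]; sf.
rewrite eL; have [rho' Q'] : {rho' | quad (qext F (sq (-1))) (sq D) rho'}.
  by rewrite -eK; apply: rho_exists => //; rewrite eK.
have pd : ~~ (p%:Z %| (-1)%R)%Z by rewrite int_Fp // rmorphN rmorph1 oppr_eq0 oner_eq0.
apply: (ramified_split Q (ltrN10 int) pp hp pd Q' hD D4 (v := zeta8)); first exact: no2_zeta8.
  apply: unit_zeta8 => //; rewrite /zeta8.
  have k2 := qext_subK hF (sq (-1)) F_r2; have ki := qext_gen hF (sq (-1)); sf.
have [k ->] := half_sq hp.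
by rewrite exprM zeta8_4 -signr_odd oddS oddM /= expr1; exact: cong_refl.
Qed.

(** Frobenius at q negates r2, so (1 + r2)^(q+1) is congruent to the norm -1; and (q^2 - 1) / 2 is
    an odd multiple of q + 1 because q = 3 modulo 4. *)
Lemma cong_eps q : prime q -> (q %% 8 = 3)%N -> cong q ((1 + r2) ^+ (q ^ 2).-1./2) (-1).
Proof.
move=> pq q3; have q2 : odd q by lia.
have e1 : cong q (r2 ^+ q) (- r2).
  have -> : r2 ^+ q = (2 ^+ (q.-1)./2)%:~R * r2.
    by rewrite rmorphXn /= -(sqK 2) -exprM -(half_p pq q2) -exprSr prednK ?prime_gt0.
  rewrite -mulN1r; apply: congM; rewrite ?rpredN ?rpred1 ?r2A //; last exact: cong_refl.
  apply: (@cong_int q pq _ (-1)); rewrite rmorphXn /= (two_mod8 pq q2).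
  by case: ifP => [|_]; [lia|rewrite rmorphN].
have e2 : cong q ((1 + r2) ^+ q) (1 - r2).
  apply: cong_trans (cong_frob pq _ r2A) _; rewrite ?rpred1 // expr1n.
  by apply: congD => //; exact: cong_refl.
have a1 : 1 + r2 \in Aint by rewrite rpredD ?rpred1 ?r2A.
have a2 : 1 - r2 \in Aint by rewrite rpredB ?rpred1 ?r2A.
have e3 : cong q ((1 + r2) ^+ q.+1) (-1).
  have -> : -1 = (1 + r2) * (1 - r2).
    have -> : (1 + r2) * (1 - r2) = 1 - r2 ^+ 2 by ring.
    by rewrite r2sq; ring.
  by rewrite exprS; apply: congM => //; exact: cong_refl.
have [k ->] : exists k, ((q ^ 2).-1./2 = q.+1 * (2 * k).+1)%N.
  have hm := divn_eq q 8; set m := (q %/ 8)%N in hm; rewrite q3 in hm.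
  exists (2 * m)%N; have -> : (q ^ 2 = (q.+1 * (2 * (2 * m)).+1).*2.+1)%N by rewrite hm -mulnn; nia.
  by rewrite /= doubleK.
rewrite exprM; have -> : -1 = (-1) ^+ (2 * k).+1 :> algC by rewrite -signr_odd oddS oddM /= expr1.
by apply: congX => //; rewrite rpredN rpred1.
Qed.

Lemma no2_case3 p q : prime p -> prime q -> p <> q -> (p %% 8 = 3)%N -> (q %% 8 = 3)%N ->
  no2 (gen [:: r2; sq (- p%:Z); sq (- q%:Z)]).
Proof.
move=> pp pq npq p3 q3; have q2 : odd q by lia.
have p0 := prime_gt0 pp; have d0 : - p%:Z < 0 by lia.
have ni := sq_neg_notF d0; have [rho Q] := quadF ni.
have hF := F_sf; have hK := quad_sf Q.
have eK : gen [:: sq (- p%:Z); r2] = qext F (sq (- p%:Z)).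
  by apply: gen_cons => //; rewrite sqK; exact: F_int.
have qp : ~~ (q %| p)%N by rewrite dvdn_prime2 //; apply/eqP => h; apply: npq.
have nD : ~ qext F (sq (- p%:Z)) (sq (- q%:Z)).
  move=> /(kummer hF) []; rewrite ?sqK //; try exact: F_int.
    by apply: (prime_notF pq q2 (D := - q%:Z)); [right|rewrite sqK].
  have nqp : q <> p by move=> h; apply: npq.
  apply: (odd_logn_notF pq q2 (D := q%:Z * p%:Z)); first by rewrite logn_pq.
  by rewrite exprMn !sqK -rmorphM mulrNN mulrC.
have hD2 : gen [:: sq (- p%:Z); r2] (sq (- q%:Z) ^+ 2) by rewrite sqK; apply: (@sf_int _ (gen_sf _)).
have eL : gen [:: r2; sq (- p%:Z); sq (- q%:Z)] = qext (qext F (sq (- p%:Z))) (sq (- q%:Z)).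
  rewrite -eK -gen_cons // ?eK //; apply: gen_eqi => x; rewrite !inE.
  by do 3 case: (x == _).
rewrite eL; have [rho' Q'] : {rho' | quad (qext F (sq (- p%:Z))) (sq (- q%:Z)) rho'}.
  by rewrite -eK; apply: rho_exists => //; rewrite eK.
have pd : ~~ (q%:Z %| (- p%:Z)%R)%Z by rewrite dvdzE abszN.
have hq : (q %% 8 = 3 \/ q %% 8 = 5)%N by left.
have D4 : - q%:Z = 4 * ((- q%:Z) %/ 4)%Z + 1 by lia.
apply: (ramified_split Q d0 pq hq pd Q' (or_intror erefl) D4 (v := 1 + r2)).
- have -> : qext F (sq (- p%:Z)) = gen [:: sq (- p%:Z); r2] by [].
  by rewrite eK; exact: no2_sqrt_prime.
- by apply: unit_eps => //; exact: qext_subK F_r2.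
exact: cong_eps.
Qed.

Lemma no2_case1 p : prime p -> (p %% 8 = 3)%N -> no2 (gen [:: r2; sq (- p%:Z)]).
Proof.
move=> pp p3; have d0 : - p%:Z < 0 by have := prime_gt0 pp; lia.
rewrite (gen_eqi (hs := [:: sq (- p%:Z); r2])) => [|x]; last by rewrite !inE orbC.
by rewrite gen_cons; [exact: no2_sqrt_prime|rewrite sqK; exact: F_int|exact: sq_neg_notF].
Qed.

Lemma no2_case4 : no2 (gen [:: r2; sq (-1)]).
Proof.
rewrite (gen_eqi (hs := [:: sq (-1); r2])) => [|x]; last by rewrite !inE orbC.
by rewrite gen_cons; [exact: no2_zeta8|rewrite sqK; exact: F_int|exact: sq_neg_notF].
Qed.

(** * Fields of even class number *)

Notation M S := (gen [seq sq a | a <- S]).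

Lemma M_rmorph S (nu : {rmorphism algC -> algC}) x : M S x -> M S (nu x) /\ nu (nu x) = x.
Proof.
have hK := gen_sf [seq sq a | a <- S]; move: x; apply: gen_sub.
  split=> [||x y [h1 e1] [h2 e2]|x [h1 e1]|x y [h1 e1] [h2 e2]].
  - by rewrite !rmorph0; split=> //; sf.
  - by rewrite !rmorph1; split=> //; sf.
  - by rewrite !rmorphD e1 e2; split=> //; sf.
  - by rewrite !rmorphN e1; split=> //; sf.
  by split; rewrite ?rmorphM ?fmorphV ?e1 ?e2; split=> //; sf.
move=> _ /mapP[a ha ->]; have ka : M S (sq a) by apply: gen_in; apply: map_f.
have [e|e] : nu (sq a) = sq a \/ nu (sq a) = - sq a.
  by apply: sq_unit_pm; rewrite -rmorphXn sqK rmorph_int.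
  by rewrite !e.
by rewrite !(e, rmorphN) opprK; split=> //; sf.
Qed.

Section Diffs.
Variables (K : cpred) (s : algC) (rho : {rmorphism algC -> algC}).
Hypothesis Q : quad K s rho.
Local Notation L := (qext K s).
Let hL : is_subfield L := quad_sf Q.

Lemma diffs_in y : OK L y -> diffs K s rho (y - rho y).
Proof. by move=> hy; rewrite -[_ - _]mul1r; apply: imul_in; [sf|exists y]. Qed.

Lemma diffs_scale r x : OK L r -> diffs K s rho x -> diffs K s rho (r * x).
Proof.
move=> hr; move: x; apply: imul_sub => [|x y h1 h2|u v hu hv].
- by rewrite mulr0; exact: imul_0.
- by rewrite mulrDr; exact: imulD.
by rewrite mulrA; apply: imul_in => //; sf.
Qed.

Lemma diffs_add x y : diffs K s rho x -> diffs K s rho y -> diffs K s rho (x + y).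
Proof. exact: imulD. Qed.
End Diffs.

Section Unramified.
Variables (S : seq int) (d : int).
Local Notation K := (M S).
Hypotheses (d0 : d < 0) (kd : K (sq d)).
Let hK : is_subfield K := gen_sf _.

Lemma nf_M : nf K.
Proof. by have := nf_multiquad S; rewrite multiquad_gen. Qed.

Lemma unramified_odd_class s : s \in Aint -> K (s ^+ 2) -> ~ K s ->
  (forall rho, quad K s rho -> diffs K s rho 1) -> ~ no2 K.
Proof.
move=> sA ks ns h; have [rho Q] := rho_exists ks ns.
apply: (unramified_even (N := nf_M) Q sA _ (h rho Q)); exact: tot_complex d0 kd.
Qed.

(** Otherwise K(sqrt D) / K would be unramified. Both sqrt D and t = sqrt D sqrt a / p^(k+1)
    generate it. The first puts p into the different, the second, with t^2 = c or -c, puts 4 c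
    there, and these are coprime. *)
Lemma ramified_prime_in p (a c D : int) k : prime p -> a = p%:Z ^+ k.*2.+1 * c ->
  ~~ (p%:Z %| c)%Z -> odd p -> (D = p%:Z \/ D = - p%:Z) -> D = 4 * (D %/ 4)%Z + 1 ->
  K (sq a) -> no2 K -> K (sq D).
Proof.
move=> pp ea pc p2 hD D4 ka n2; apply: contrapT => nD; move: n2.
apply: (unramified_odd_class (sqA D) _ nD) => [|rho Q]; first by rewrite sqK; sf.
have p0 : p%:R != 0 :> algC by rewrite pnatr_eq0 -lt0n prime_gt0.
pose t := sq D * sq a / p%:R ^+ k.+1.
have [e he et] : exists2 e : int, e = c \/ e = - c & t ^+ 2 = e%:~R.
  have e1 (D' : algC) : D' * (p%:R ^+ k.*2.+1 * c%:~R) / (p%:R ^+ k.+1) ^+ 2 = (D' / p%:R) * c%:~R.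
    rewrite -exprM muln2 doubleS !exprS; have := expf_neq0 k.*2 p0.
    by move: (_ ^+ _) => X X0; field; rewrite X0 p0.
  have e2 : t ^+ 2 = D%:~R / p%:R * c%:~R.
    by rewrite /t expr_div_n exprMn !sqK ea rmorphM rmorphXn /= e1.
  case: hD e2 => -> e2; [exists c; [by left|]|exists (- c); [by right|]]; rewrite e2.
    by rewrite divff ?mul1r.
  by rewrite !rmorphN mulNr divff // mulN1r.
have hL := quad_sf Q; have ls : qext K (sq D) (sq D) := qext_gen hK (sq D).
have la : qext K (sq D) (sq a) := qext_subK hK (sq D) ka.
have ot : OK (qext K (sq D)) t.
  by split; [rewrite /t; sf|apply: Aint_sqr; rewrite et Aint_int].
have os : OK (qext K (sq D)) (sq D) by split=> //; exact: sqA.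
have d1 := diffs_sqrt Q (sqK D) D4; have d2 := diffs_in Q ot.
have rt : rho t = - t by rewrite /t fmorph_div rmorphM rmorphXn rmorph_nat (qd_opp Q) (qd_fix Q ka) mulNr mulNr.
rewrite rt in d2.
have pc4 : ~~ (p%:Z %| 4 * e)%Z.
  have p22 : ~~ (p%:Z %| 2)%Z by rewrite int_Fp // (Fp_2 pp p2).
  have pe : ~~ (p%:Z %| e)%Z by case: he => ->; rewrite ?rpredN.
  move: p22 pe; rewrite !int_Fp // rmorphM /= => h1 h2.
  rewrite mulf_neq0 //; have -> : (4%Z)%:~R = 2%Z%:~R * 2%Z%:~R :> 'F_p by rewrite -intrM.
  exact: mulf_neq0.
have [u [v euv]] := bezoutZ pp pc4.
have {}euv : u%:~R * (4 * e%:~R) + v%:~R * p%:R = 1 :> algC.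
  by have := congr1 (intr : int -> algC) euv; rewrite rmorphD !rmorphM.
have -> : 1 = u%:~R * 2 * t * (t - - t) + v%:~R * p%:R.
  by rewrite -[LHS]euv -et; ring.
apply: diffs_add; first by apply: (diffs_scale Q) => //; sf.
case: hD => hD; [have -> : p%:R = sq D * sq D by rewrite sqKm hD|have -> : p%:R = - sq D * sq D by rewrite mulNr sqKm hD rmorphN opprK].
  by rewrite mulrA; apply: (diffs_scale Q) => //; sf.
by rewrite mulrA; apply: (diffs_scale Q) => //; sf.
Qed.

(* s = sqrt alpha and t / s generate the same extension, and the two quadratic
   congruences modulo 4 make it unramified. *)
Lemma unramified_sqrt (nu : {rmorphism algC -> algC}) al t ga ka (m : nat) :
  OK K al -> K t -> t != 0 -> t ^+ 2 = al * nu al -> nu t = - t ->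
  OK K ga -> OK K ka -> (m.*2.+1)%:R ^+ 2 * al = ga ^+ 2 + 4 * ka -> comax K al (nu al) -> ~ no2 K.
Proof.
move=> oal kt t0 et nt oga oka eal [a [b [oa ob eab]]].
set s := sqrtC al; have es : s ^+ 2 = al by rewrite sqrtCK.
have [kal aal] := oal; have sA : s \in Aint by apply: Aint_sqr; rewrite es.
have nuOK x : OK K x -> OK K (nu x).
  by move=> [kx ax]; split; [case: (M_rmorph nu kx)|rewrite Aint_aut].
have s0 : s != 0.
  by apply: contraNneq t0 => h; rewrite -sqrf_eq0 et -es h expr0n mul0r.
apply: (unramified_odd_class sA) => [||rho Q]; first by rewrite es.
  move=> ks; have [_ e2] := M_rmorph nu ks.
  have [e|e] : s * nu s = t \/ s * nu s = - t.
    by apply: sq_unit_pm; rewrite et exprMn -rmorphXn es.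
    have : nu t = t by rewrite -e rmorphM e2 mulrC.
    by rewrite nt => /eqP; rewrite eqr_oppLR -addr_eq0 -mulr2n mulrn_eq0 (negPf t0).
  have : nu t = t by rewrite -[t]opprK -e rmorphN rmorphM e2 mulrC.
  by rewrite nt => /eqP; rewrite eqr_oppLR -addr_eq0 -mulr2n mulrn_eq0 (negPf t0).
have hL := quad_sf Q; have ls : qext K s s := qext_gen hK s.
have lift x : OK K x -> OK (qext K s) x := OK_ext Q (x := x).
have main s' g k al' : OK K g -> OK K k -> s' ^+ 2 = al' -> OK K al' -> qext K s s' -> rho s' = - s' ->
    (m.*2.+1)%:R ^+ 2 * al' = g ^+ 2 + 4 * k -> diffs K s rho al'.
  move=> og ok es' [_ aal'] ls' rs' e.
  have os' : OK (qext K s) s' by split=> //; apply: Aint_sqr; rewrite es'.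
  have lg := OK_sub (lift _ og).
  have oy : OK (qext K s) ((g + m.*2.+1%:R * s') / 2).
    split; first by sf.
    have [_ ag] := og; have [_ ak] := ok.
    apply: (@Aint_quadratic g (- k)); rewrite ?rpredN //.
    transitivity (((m.*2.+1)%:R ^+ 2 * s' ^+ 2 - (g ^+ 2 + 4 * k)) / 4); first by field.
    by rewrite es' e subrr mul0r.
  have d1 := diffs_in Q oy; have d2 := diffs_in Q os'.
  have [kg _] := og.
  rewrite rs' in d2; rewrite fmorph_div rmorphD rmorphM !rmorph_nat rs' (qd_fix Q kg) in d1.
  (* The two differences are (2 m + 1) s' and 2 s', so s' lies in the different, and with it
     s'^2. *)
  have -> : al' = s' * ((g + m.*2.+1%:R * s') / 2 - (g + m.*2.+1%:R * - s') / 2) + (- (m%:R * s')) * (s' - - s').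
    by rewrite -es' -natr1 -muln2 natrM; field.
  by apply: diffs_add; apply: (diffs_scale Q) => //; sf.
rewrite -eab; have := lift _ oa; have := lift _ ob => lb la.
apply: diffs_add; apply: (diffs_scale Q) => //; first exact: (main s ga ka al _ _ es oal ls (qd_opp Q) eal).
apply: (main (t / s) (nu ga) (nu ka)); try exact: nuOK.
- by rewrite expr_div_n et es mulrC mulKf // -es expf_neq0.
- by have lt := qext_subK hK s kt; sf.
- by rewrite fmorph_div (qd_fix Q kt) (qd_opp Q) invrN mulrN.
by rewrite -[m.*2.+1%:R](rmorph_nat nu) -rmorphXn -rmorphM eal rmorphD rmorphXn rmorphM !rmorph_nat.
Qed.
End Unramified.

Lemma coprimez_bezout (a b : int) : coprimez a b -> exists u v : algC, [/\ u \in Num.int, v \in Num.int &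
  u * a%:~R + v * b%:~R = 1].
Proof.
case/coprimezP => -[u v] /= e; exists u%:~R, v%:~R; rewrite !intr_int; split=> //.
by have := congr1 (intr : int -> algC) e; rewrite rmorphD !rmorphM.
Qed.

Lemma prime_coprimez p (a : int) : prime p -> coprimez a p%:Z = ~~ (p%:Z %| a)%Z.
Proof. by move=> pp; rewrite coprimezE coprime_sym prime_coprime. Qed.

Lemma odd_int p : odd p -> exists a : int, p%:Z = 2 * a + 1.
Proof. by move=> h; exists (p./2)%:Z; have := odd_double_half p; rewrite h; lia. Qed.

Lemma odd_sqr_mod8 (A A1 : int) : A = 2 * A1 + 1 -> exists k, A ^+ 2 = 8 * k + 1.
Proof.
move=> ->; have [c [->|->]] := int_half A1; first by exists (2 * c ^+ 2 + c); ring.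
by exists (2 * c ^+ 2 + 3 * c + 1); ring.
Qed.

Lemma mod8_odd p : (p %% 8 = 3 \/ p %% 8 = 5)%N -> odd p. Proof. lia. Qed.

Lemma pq_mod8 p q : (p %% 8 = q %% 8)%N -> (p %% 8 = 3 \/ p %% 8 = 5)%N ->
  exists k, p%:Z * q%:Z = 8 * k + 1.
Proof.
move=> e h; have hp := divn_eq p 8; have hq := divn_eq q 8.
rewrite -e in hq; rewrite hp hq; move: (p %/ 8)%N (q %/ 8)%N => a b.
case: h => -> /=.
  by exists (8 * a%:Z * b%:Z + 3 * a%:Z + 3 * b%:Z + 1); rewrite !PoszD !PoszM; ring.
by exists (8 * a%:Z * b%:Z + 5 * a%:Z + 5 * b%:Z + 3); rewrite !PoszD !PoszM; ring.
Qed.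

(** If p divided A it would divide B too, and then p^2 would divide n. As 2 A and n are the trace
    and norm of A + B sqrt m, this makes that element comaximal with its conjugate. *)
Lemma prime_ndvd_double p (m n A B : int) : prime p -> odd p -> A ^+ 2 - m * B ^+ 2 = n ->
  ~~ (p%:Z %| m)%Z -> ~~ (p%:Z * p%:Z %| n)%Z -> (p%:Z %| n)%Z -> ~~ (p%:Z %| 2 * A)%Z.
Proof.
move=> pp p2 e pm ppn pn; have n2 := Fp_2 pp p2.
rewrite int_Fp // rmorphM mulf_neq0 //; apply/negP => /eqP hA.
have hB : (B%:~R : 'F_p) = 0.
  move: pn; rewrite -e int_Fp // rmorphB rmorphXn rmorphM rmorphXn /= hA expr0n sub0r oppr_eq0.
  by rewrite mulf_eq0 -int_Fp // (negPf pm) /= expf_eq0 => /eqP.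
have [A' eA] := Fp_eq0 pp hA; have [B' eB] := Fp_eq0 pp hB.
by case/negP: ppn; apply/dvdzP; exists (A' ^+ 2 - m * B' ^+ 2); rewrite -e eA eB; ring.
Qed.

Section Quadratic.
Variables (S : seq int) (d : int).
Local Notation K := (M S).
Hypotheses (d0 : d < 0) (kd : K (sq d)).
Let hK : is_subfield K := gen_sf _.

(* A + 2 B th or its opposite is 1 or (1 + th)^2 modulo 4. *)
Lemma quadratic_even th t (m n A B : int) : K th -> K t -> th ^+ 2 = m%:~R -> t ^+ 2 = n%:~R ->
  ~ gen [::] th -> ~ gen [::] t -> A ^+ 2 - m * (2 * B) ^+ 2 = n ->
  (exists A', A = 2 * A' + 1) -> ((exists B', B = 2 * B') \/ (exists m', m = 4 * m' - 2)) ->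
  coprimez (2 * A) n -> ~ no2 K.
Proof.
have h0 := gen_sf [::].
move=> kth kt eth et nth nt en [A' eA] hB cop.
have [nu [fx nuth nut]] : exists nu : {rmorphism algC -> algC},
    [/\ (forall x, gen [::] x -> nu x = x), nu th = - th & nu t = - t].
  by apply: flip => //; rewrite ?eth ?et; sf.
have t0 : t != 0 by apply: contra_not_neq nt => ->; sf.
have oth : OK K th by split=> //; apply: Aint_sqr; rewrite eth Aint_int.
have main (a b : int) : a ^+ 2 - m * (2 * b) ^+ 2 = n -> coprimez (2 * a) n ->
    (exists ga ka, [/\ OK K ga, OK K ka & a%:~R + (2 * b)%:~R * th = ga ^+ 2 + 4 * ka]) -> ~ no2 K.
  move=> eab hcop [ga [ka [oga oka e]]]; set al := _ + _ in e.
  have nual : nu al = a%:~R - (2 * b)%:~R * th by rewrite rmorphD rmorphM !rmorph_int nuth mulrN.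
  have eN : al * nu al = n%:~R.
    rewrite nual; have -> : al * (a%:~R - (2 * b)%:~R * th) = a%:~R ^+ 2 - th ^+ 2 * (2 * b)%:~R ^+ 2.
      by rewrite /al; ring.
    by rewrite eth -eab rmorphB rmorphXn [in RHS]rmorphM rmorphXn.
  have oal : OK K al by rewrite /al; sf.
  apply: (unramified_sqrt d0 kd (nu := nu) oal kt t0 _ nut oga oka (m := 0)); rewrite ?eN //.
    by rewrite expr1n mul1r.
  have [u [v [/intrP[u' ->] /intrP[v' ->] euv]]] := coprimez_bezout hcop.
  exists (u'%:~R + v'%:~R * nu al), u'%:~R; split; [by rewrite nual; sf|by sf|].
  rewrite -[RHS]euv -eN rmorphM /=; have -> : 2%Z%:~R * a%:~R = al + nu al by rewrite nual /al; ring.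
  by ring.
have neg (a b : int) : a ^+ 2 - m * (2 * b) ^+ 2 = n -> coprimez (2 * a) n ->
    (- a) ^+ 2 - m * (2 * - b) ^+ 2 = n /\ coprimez (2 * - a) n.
  by move=> <- h; split; [ring|rewrite mulrN coprimeNz].
have c1 a b : a ^+ 2 - m * (2 * b) ^+ 2 = n -> coprimez (2 * a) n ->
    (exists a', a = 4 * a' + 1) -> (exists b', b = 2 * b') -> ~ no2 K.
  move=> h1 h2 [a' ea] [b' eb]; apply: (main a b) => //; exists 1, (a'%:~R + b'%:~R * th).
  by split; [sf|sf|rewrite ea eb !(intrB, intrD, intrM) /=; ring].
have c2 a b : a ^+ 2 - m * (2 * b) ^+ 2 = n -> coprimez (2 * a) n ->
    (exists a', a = 4 * a' - 1) -> (exists b', b = 2 * b' + 1) -> (exists m', m = 4 * m' - 2) -> ~ no2 K.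
  move=> h1 h2 [a' ea] [b' eb] [m' em]; apply: (main a b) => //.
  exists (1 + th), (a'%:~R - m'%:~R + b'%:~R * th); split; [by sf|by sf|].
  have -> : (1 + th) ^+ 2 = 1 + 2 * th + th ^+ 2 by ring.
  by rewrite eth ea eb em !(intrB, intrD, intrM) /=; ring.
have [c hc] := int_half A'; have [b hb] := int_half B.
have [n1 n2] := neg _ _ en cop.
case: hb => hb; case: hc => hc.
- by apply: (c1 A B) => //; [exists c; rewrite eA hc; ring|exists b].
- by apply: (c1 (- A) (- B)) => //; [exists (- c - 1); rewrite eA hc; ring|exists (- b); rewrite hb; ring].
- case: hB => [[B' hB]|hm]; first by lia.
  by apply: (c2 (- A) (- B)) => //; [exists (- c); rewrite eA hc; ring|exists (- b - 1); rewrite hb; ring].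
case: hB => [[B' hB]|hm]; first by lia.
by apply: (c2 A B) => //; [exists (c + 1); rewrite eA hc; ring|exists b].
Qed.

Lemma neg_irr x (m : int) : m < 0 -> x ^+ 2 = m%:~R -> ~ gen [::] x.
Proof. by move=> m0 e hx; have [k ek] := rational_square hx e; have := sqr_ge0 k; lia. Qed.

Hypothesis k2 : K r2.

(** Here p splits in Z[sqrt 2] and D = A^2 - 2 B^2. Since D = 1 modulo 8, A is odd and B even, so A
    + B r2 or its opposite is a square modulo 4. *)
Lemma even_pm1 p (D : int) : prime p -> (p %% 8 = 1 \/ p %% 8 = 7)%N -> (D = p%:Z \/ D = - p%:Z) ->
  D = 4 * (D %/ 4)%Z + 1 -> K (sq D) -> ~ no2 K.
Proof.
move=> pp p8 hD D4 kD; have p2 : odd p by lia.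
have [A [B e]] : exists A B : int, A ^+ 2 - 2 * B ^+ 2 = D.
  have [c ec] : exists c, (2 : 'F_p) = c ^+ 2.
    by apply: (Fp_euler pp p2); rewrite (two_mod8 pp p2); case: ifP => //; lia.
  have [x [y exy]] := square_2square pp (esym ec).
  case: hD => hD; last by exists x, y; rewrite hD exy.
  (* Multiplication by 1 + r2, of norm -1, changes the sign of the norm. *)
  by exists (x + 2 * y), (x + y); rewrite hD -[RHS]opprK exy; ring.
have [A' [eA|eA]] := int_half A; first by exfalso; move: e; rewrite eA; lia.
have [c hc] := int_half A'; have D8 : D = 8 * (D %/ 8)%Z + 1 by case: hD p8 D4 => ->; lia.
have [B' [eB|eB]] := int_half B; last by exfalso; move: e; rewrite eA eB; case: hc => ->; lia.
have pD : (p%:Z %| D)%Z by case: hD => ->; rewrite ?rpredN.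
have cop : coprimez (2 * A) D.
  suff h' : ~~ (p%:Z %| 2 * A)%Z by case: hD => ->; rewrite ?coprimezN prime_coprimez.
  apply: (prime_ndvd_double pp p2 e) => //; first by rewrite int_Fp // (Fp_2 pp p2).
  rewrite dvdzE; have -> : `|D|%N = p by case: hD => ->; lia.
  by rewrite abszM /= gtnNdvd ?prime_gt0 // -[ltnLHS]muln1 ltn_pmul2l ?prime_gt0 ?prime_gt1.
apply: (@quadratic_even r2 (sq D) 2 D A B' k2 kD (sqK 2) (sqK D) r2_irr) => //.
- by move=> hx; have [m] := rational_square hx (sqK D); apply: (@odd_logn_nonsquare p); rewrite logn_signed.
- by rewrite -eB.
- by exists A'.
- by right; exists 1.
Qed.

Lemma pq_ndvd p q (m A B : int) : prime p -> prime q -> p <> q -> odd p ->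
  A ^+ 2 - m * B ^+ 2 = p%:Z * q%:Z -> ~~ (p%:Z %| m)%Z -> ~~ (p%:Z %| 2 * A)%Z.
Proof.
move=> pp pq npq p2 e pm; apply: (prime_ndvd_double pp p2 e) => //; last exact: dvdz_mulr.
rewrite dvdz_mul2l; last by have := prime_gt0 pp; lia.
by rewrite dvdzE dvdn_prime2 //; apply/eqP.
Qed.

Lemma even_pair p q (m A B : int) th t : prime p -> prime q -> p <> q -> odd p -> odd q ->
  K th -> th ^+ 2 = m%:~R -> m < 0 -> K t -> t ^+ 2 = (p%:Z * q%:Z)%:~R ->
  ~~ (p%:Z %| m)%Z -> ~~ (q%:Z %| m)%Z -> A ^+ 2 - m * (2 * B) ^+ 2 = p%:Z * q%:Z ->
  ((exists B', B = 2 * B') \/ (exists m', m = 4 * m' - 2)) -> ~ no2 K.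
Proof.
move=> pp pq npq p2 q2 kth eth m0 kt et pm qm e hB.
have [A' [eA|eA]] := int_half A.
  have [x ex] := odd_int p2; have [y ey] := odd_int q2.
  exfalso; move: e; rewrite eA ex ey.
  have -> : (2 * A') ^+ 2 - m * (2 * B) ^+ 2 = 2 * (2 * A' ^+ 2 - 2 * m * B ^+ 2) by ring.
  have -> : (2 * x + 1) * (2 * y + 1) = 2 * (2 * x * y + x + y) + 1 by ring.
  by move: (_ - _) (_ + y) => X Y; lia.
apply: (@quadratic_even th t m (p%:Z * q%:Z) A B kth kt eth et) => //.
- exact: neg_irr m0 eth.
- by move=> hx; have [k] := rational_square hx et;
    apply: (@odd_logn_nonsquare p); rewrite logn_pq.
- by exists A'.
rewrite coprimezMr !prime_coprimez // (pq_ndvd pp pq npq p2 e) //=.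
have nqp : q <> p by move=> h; apply: npq.
by apply: (pq_ndvd pq pp nqp q2 (m := m) (B := 2 * B)) => //; rewrite e mulrC.
Qed.

Lemma neg1_square p : prime p -> (p %% 8 = 5)%N -> exists c : 'F_p, c ^+ 2 = -1.
Proof.
move=> pp p5; have p2 : odd p by lia.
have [c ec] : exists c, (-1 : 'F_p) = c ^+ 2; last by exists c.
apply: (Fp_euler pp p2); rewrite -signr_odd.
by have -> : odd (p.-1)./2 = false by [lia]; rewrite expr0.
Qed.

Lemma neg2_square p : prime p -> (p %% 8 = 3)%N -> exists c : 'F_p, c ^+ 2 = -2.
Proof.
move=> pp p3; have p2 : odd p by lia.
have [c ec] : exists c, (-2 : 'F_p) = c ^+ 2; last by exists c.
apply: (Fp_euler pp p2); rewrite exprNn -signr_odd (two_mod8 pp p2).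
have -> : odd (p.-1)./2 by lia.
by case: ifP => [|_]; [lia|rewrite expr1 mulrNN mulr1].
Qed.

(** A product of Gaussian integers of norms p and q gives A^2 + B^2 = p q. One coordinate is even;
    as p q = 1 modulo 8, it is divisible by 4, the case of [quadratic_even] with B even. *)
Lemma even_55 p q : prime p -> prime q -> p <> q -> (p %% 8 = 5)%N -> (q %% 8 = 5)%N ->
  K (sq (-1)) -> K (sq p%:Z) -> K (sq q%:Z) -> ~ no2 K.
Proof.
move=> pp pq npq p5 q5 ki kp kq.
have [cp ecp] := neg1_square pp p5; have [a [b ep]] := sum_squares pp ecp.
have [cq ecq] := neg1_square pq q5; have [a' [b' eq]] := sum_squares pq ecq.
have p2 := mod8_odd (or_intror p5); have q2 := mod8_odd (or_intror q5).
have [k ek] : exists k, p%:Z * q%:Z = 8 * k + 1 by apply: pq_mod8; [rewrite p5 q5|right].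
have main A B : A ^+ 2 + B ^+ 2 = p%:Z * q%:Z -> (exists B', B = 2 * B') -> ~ no2 K.
  move=> e [B1 eB].
  have [A1 hA1] := int_half A; have [B2 hB2] := int_half B1.
  apply: (@even_pair p q (-1) A B1 (sq (-1)) (sq p%:Z * sq q%:Z)) => //.
  - exact: sqK.
  - by sf.
  - by rewrite exprMn !sqK rmorphM.
  - by rewrite int_Fp // rmorphN rmorph1 oppr_eq0 oner_eq0.
  - by rewrite int_Fp // rmorphN rmorph1 oppr_eq0 oner_eq0.
  - by rewrite -eB -e; ring.
  left; exists B2; case: hB2 => // hB2; exfalso; move: e; rewrite ek eB exprMn.
  have [j ->] := odd_sqr_mod8 hB2; case: hA1 => [->|/odd_sqr_mod8 [i ->]].
    by rewrite exprMn; move: (A1 ^+ 2) => X; clear; lia.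
  by clear; lia.
have e : (a * a' - b * b') ^+ 2 + (a * b' + b * a') ^+ 2 = p%:Z * q%:Z by rewrite ep eq; ring.
have e' : (a * b' + b * a') ^+ 2 + (a * a' - b * b') ^+ 2 = p%:Z * q%:Z by rewrite addrC.
have [B1 [hB|hB]] := int_half (a * b' + b * a'); first by apply: main e _; exists B1.
have [B3 [hB3|hB3]] := int_half (a * a' - b * b'); first by apply: main e' _; exists B3.
exfalso; move: e; have [i ->] := odd_sqr_mod8 hB; have [j ->] := odd_sqr_mod8 hB3.
by rewrite ek; clear; lia.
Qed.

(** Elements of Z[sqrt -2] of norms p and q give A^2 + 2 B^2 = p q. An odd B would make A^2 = -1
    modulo 8; and m = -2 is the ramified case of [quadratic_even]. *)
Lemma even_33 p q : prime p -> prime q -> p <> q -> (p %% 8 = 3)%N -> (q %% 8 = 3)%N ->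
  K (sq (-1)) -> K (sq (- p%:Z)) -> K (sq (- q%:Z)) -> ~ no2 K.
Proof.
move=> pp pq npq p3 q3 ki kp kq.
have p2 := mod8_odd (or_introl p3); have q2 := mod8_odd (or_introl q3).
have [cp ecp] := neg2_square pp p3; have [a [b ep]] := sum_square_2square pp ecp.
have [cq ecq] := neg2_square pq q3; have [a' [b' eq]] := sum_square_2square pq ecq.
set A := a * a' - 2 * b * b'; set B := a * b' + b * a'.
have e : A ^+ 2 + 2 * B ^+ 2 = p%:Z * q%:Z by rewrite ep eq /A /B; ring.
have n2 r : prime r -> odd r -> ~~ (r%:Z %| (-2)%R)%Z.
  by move=> pr r2'; rewrite int_Fp // rmorphN oppr_eq0 (Fp_2 pr r2').
have [k ek] : exists k, p%:Z * q%:Z = 8 * k + 1 by apply: pq_mod8; [rewrite p3 q3|left].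
have [B1 hB] := int_half B; have [A1 hA] := int_half A.
case: hB => hB; last first.
  exfalso; move: e; have [i ->] := odd_sqr_mod8 hB; rewrite ek; case: hA => [->|/odd_sqr_mod8 [j ->]].
    by rewrite exprMn; move: (A1 ^+ 2) => X; clear; lia.
  by clear; lia.
apply: (@even_pair p q (-2) A B1 (sq (-1) * r2) (sq (- p%:Z) * sq (- q%:Z))) => //.
- by sf.
- by rewrite exprMn !sqK -rmorphM.
- by sf.
- by rewrite exprMn !sqK -rmorphM mulrNN.
- exact: n2.
- exact: n2.
- by rewrite -hB -e; ring.
by right; exists 0.
Qed.
End Quadratic.

(** * Powers of ideals and generators above a split prime *)

Section Powers.
Variables (K : cpred) (N : nf K).
Let hK := nf_sf N.
Let inv := nf_inv N.

Fixpoint ipow (P : cpred) n : cpred := if n is n'.+1 then imul P (ipow P n') else OK K.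

Lemma fid_ipow P n : fid K P -> fid K (ipow P n).
Proof. by move=> fP; elim: n => [|n IH] /=; [exact: fid_OK|exact: fid_imul]. Qed.

Lemma ipowD P m n : fid K P -> ipow P (m + n) = imul (ipow P m) (ipow P n).
Proof.
move=> fP; elim: m => [|m IH] /=; first by rewrite imul1 //; exact: fid_ipow.
by rewrite IH imulA.
Qed.

Lemma ipowM P P' n : imul (ipow P n) (ipow P' n) = ipow (imul P P') n.
Proof. by elim: n => [|n IH] /=; [exact: imul1 (fid_OK hK)|rewrite imulACA IH]. Qed.

Lemma ipow_pr a n : K a -> a != 0 -> ipow (pr K a) n = pr K (a ^+ n).
Proof.
move=> ka a0; elim: n => [|n IH] /=; first by rewrite expr0 pr1.
by rewrite IH exprS imul_pr ?expf_neq0 //; sf.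
Qed.

Lemma ipow_in P x n : P x -> ipow P n (x ^+ n).
Proof. by move=> hx; elim: n => [|n IH] /=; [rewrite expr0; sf|rewrite exprS; exact: imul_in]. Qed.

(** The least positive exponent is odd: by [no2] an even one could be halved. *)
Lemma odd_power_prin P : no2 K -> fid K P -> exists2 m, odd m & prin K (ipow P m).
Proof.
move=> n2 fP; have [h hh] := class_number_ex N.
have [C [cl [fC hcl clE clC]]] := class_fun N hh.
have fX n := fid_ipow n fP.
have hex : exists n, (0 < n)%N /\ prin K (ipow P n).
  have [|i [j [nij eij]]] := @pigeon 'I_h.+1 'I_h (fun i => cl (ipow P i)).
    by rewrite !card_ord.
  have main (a b : nat) : (a < b)%N -> cl (ipow P a) = cl (ipow P b) -> prin K (ipow P (b - a)).
    move=> lij /(clE _ _ (fX a) (fX b)).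
    rewrite -[in X in ieq _ _ X](subnKC (ltnW lij)) ipowD // -{1}(imul1r hK (fX a)).
    move/(ieq_cancel N (fX a) (fid_OK hK) (fX _)) => h'.
    apply: (ieq_prin N (J := OK K)); last exact: prin_OK.
    by apply: (ieq_sym N) => //.
  have [lij|lij|e] := ltngtP i j.
  - by exists (j - i)%N; rewrite subn_gt0; split=> //; exact: main.
  - by exists (i - j)%N; rewrite subn_gt0; split=> //; apply: main.
  - by case/eqP: nij; apply: val_inj.
have [m [m0 pm] hmin] := natP_min hex; exists m => //.
apply: contraT => om; have em : m = (m./2 + m./2)%N.
  by rewrite addnn -[LHS]odd_double_half (negPf om).
move: pm; rewrite em ipowD // => /(n2 _ (fX _)) pm.
have : (m <= m./2)%N by apply: hmin; split=> //; lia.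
by move: m0 em; lia.
Qed.
End Powers.

Section SplitGenerator.
Variables (d : int) (rho : {rmorphism algC -> algC}) (p : nat).
Local Notation K := (qext F (sq d)).
Hypotheses (Q : quad F (sq d) rho) (d0 : d < 0) (pp : prime p)
  (hp : (p %% 8 = 3 \/ p %% 8 = 5)%N) (pd : ~~ (p%:Z %| d)%Z) (n2 : no2 K).

(* The norm of a generator of an odd power of a prime over p is a power of p
   times a totally positive unit, hence times a square. *)
Lemma split_generator : exists m be, [/\ odd m, OK K be, be * rho be = p%:R ^+ m &
  comax K be (rho be)].
Proof.
have hF := F_sf; have hK := quad_sf Q; have p2 : odd p by lia.
have [N _] := nf_qext nf_F Q (sqA d); have inv := nf_inv N.
have [rho2 Q2] := rho2_ex.
have [t [z [ot oz et]]] := split_root pp hp pd.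
have ont : OK F (- t) by sf.
have f1 := fid_split Q pp ot; have f2 := fid_split Q pp ont.
have s1 := split_sub Q (p := p) ot.
have eP := split_prod Q pp hp pd ot oz et.
have p0 : p%:R != 0 :> algC by rewrite pnatr_eq0 -lt0n prime_gt0.
have kp : K p%:R by sf.
have [m om [be [be0 kbe ebe]]] := odd_power_prin N n2 f1.
have erP : rimg F (sq d) rho (split_ideal d p t) = split_ideal d p (- t).
  apply: incl_eq => x; first by move=> [lx /(split_rho Q ot)]; rewrite (rhoK Q lx).
  move=> hx; have := split_rho Q ont hx; rewrite opprK; split=> //.
  exact: (fid_sub f2).
have ebe' : ipow K (split_ideal d p (- t)) m = pr K (rho be).
  rewrite -erP -(rimg_pr Q kbe) -ebe; elim: (m) => [|k IH] /=.
    by rewrite -(pr1 K) (rimg_pr Q) ?rmorph1 //; sf.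
  by rewrite (rimg_imul Q) ?IH //; apply: (fid_ipow N).
have krbe := rho_L Q kbe; have rbe0 : rho be != 0 by rewrite fmorph_eq0.
have eN : pr K (be * rho be) = pr K (p%:R ^+ m).
  by rewrite -imul_pr // -ebe -ebe' ipowM // eP ipow_pr.
have pm0 : p%:R ^+ m != 0 :> algC by rewrite expf_neq0.
have uu : unit K (be * rho be / p%:R ^+ m) by apply: (pr_eq hK) => //; [sf|rewrite mulf_neq0].
have uF : unit F (be * rho be / p%:R ^+ m).
  apply: (unit_restr Q) uu _; have := norm_K Q kbe; move=> ?; sf.
have [q1 q2] := norm_pos d0 Q Q2 kbe be0.
have [||w uw ew] := F_totpos_square Q2 uF.
- by rewrite divr_gt0 // exprn_gt0 // ltr0n prime_gt0.
- by rewrite rmorphM fmorphV rmorphXn rmorph_nat divr_gt0 // exprn_gt0 // ltr0n prime_gt0.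
have [w0 ow ow'] := uw; have kw := unit_sub uw.
have uwK := unit_ext Q uw.
have lw := OK_ext Q ow'; have rw : rho w^-1 = w^-1 by apply: (qd_fix Q); sf.
have epr : pr K (be * w^-1) = pr K be by apply: (pr_unit hK); exact: unitV.
have obe : OK K be.
  have : incl (ipow K (split_ideal d p t) m) (OK K).
    elim: (m) => [|k IH] //=; apply: imul_sub => [|x y|x y /s1 hx /IH hy]; by [sf|move=> *; sf].
  by apply; rewrite ebe; exact: pr_id.
exists m, (be * w^-1); split=> //; first by sf.
  rewrite rmorphM rw; have -> : be * w^-1 * (rho be * w^-1) = be * rho be / w ^+ 2 by field.
  by rewrite -ew invf_div mulrC divfK ?mulf_neq0.
have [u [v e]] := bezoutZ pp (two_d_unit_mod pp hp pd).
have {}e : u%:~R * (2 * d%:~R) + v%:~R * p%:R = 1 :> algC.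
  by have := congr1 (intr : int -> algC) e; rewrite rmorphD !rmorphM.
have in1 (u' : algC) : split_ideal d p u' p%:R.
  by rewrite -[p%:R]mulr1 -[_ * 1]addr0 -(mulr0 (sq d - u')); apply: split_ideal_mem; sf.
have in2 (u' : algC) : split_ideal d p u' (sq d - u').
  by rewrite -[sq d - u']mulr1 -[_ * 1]add0r -(mulr0 p%:R); apply: split_ideal_mem; sf.
have kt := OK_ext Q ot; have kz := OK_ext Q oz.
(* A splitting 1 = x + y along the two conjugate primes; then x^m and y^m are comaximal and
   divisible by the generator and its conjugate. *)
pose x := (v%:~R - 2 * u%:~R * z) * p%:R - u%:~R * t * (sq d - t).
pose y := u%:~R * t * (sq d - - t).
have exy : x + y = 1.
  have -> : x + y = 2 * u%:~R * t ^+ 2 + (v%:~R - 2 * u%:~R * z) * p%:R by rewrite /x /y; ring.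
  by rewrite et -[RHS]e; ring.
have hx : split_ideal d p t x by apply: (fidB hK f1); apply: (fidM f1) => //; sf.
have hy : split_ideal d p (- t) y by apply: (fidM f2) => //; sf.
have ox := s1 _ hx; have oy := split_sub Q (p := p) ont hy.
have hxm : ipow K (split_ideal d p t) m (x ^+ m) by apply: ipow_in.
have hym : ipow K (split_ideal d p (- t)) m (y ^+ m) by apply: ipow_in.
move: hxm hym; rewrite ebe ebe' => -[r [or er]] [r' [or' er']].
have [a [b [oa ob eab]]] : comax K (x ^+ m) (y ^+ m).
  by apply: comaxX => //; exists 1, 1; rewrite !mul1r; split=> //; sf.
have owK := OK_ext Q ow.
exists (a * r * w), (b * r' * w); split; [by sf|by sf|].
rewrite rmorphM rw -[RHS]eab er er'; field; exact: w0.
Qed.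
End SplitGenerator.

(** * Squares modulo 4 in Q(sqrt 2, sqrt -p) *)

Section PairOps.
Variables (T : Type) (add mul : T -> T -> T).
Definition padd (a b : T * T) := (add a.1 b.1, add a.2 b.2).
Definition pscale (k : T) (a : T * T) := (mul k a.1, mul k a.2).
Definition pmul (a b : T * T) :=
  (add (mul a.1 b.1) (add (mul a.2 b.2) (mul a.2 b.2)), add (mul a.1 b.2) (mul a.2 b.1)).
(** Let w = (1 + sqrt(-p)) / 2 and p = 4 g - 1, so that w^2 = w - g. Then [pnorm] is the relative
    norm of c + b w, and for h = -g the next two definitions are the coordinates of (x + y w)^2 on 1
    and w. *)
Definition pnorm (g : T) (c b : T * T) := padd (padd (pmul c c) (pmul c b)) (pscale g (pmul b b)).
Definition psquare0 (h : T) (x y : T * T) := padd (pmul x x) (pscale h (pmul y y)).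
Definition psquare1 (x y : T * T) := padd (padd (pmul x y) (pmul x y)) (pmul y y).
End PairOps.

(* Pairs are coordinates on 1, sqrt 2; the arithmetic modulo 4 is tabulated so
   that the exhaustive check computes quickly. *)
Inductive q4 := Q0 | Q1 | Q2 | Q3.
Definition qsucc a := match a with Q0 => Q1 | Q1 => Q2 | Q2 => Q3 | Q3 => Q0 end.
Definition qadd a b :=
  match a with Q0 => b | Q1 => qsucc b | Q2 => qsucc (qsucc b) | Q3 => qsucc (qsucc (qsucc b)) end.
Definition qmul a b := match a with Q0 => Q0 | Q1 => b | Q2 => qadd b b | Q3 => qadd b (qadd b b) end.
Definition qeq a b :=
  match a, b with Q0, Q0 => true | Q1, Q1 => true | Q2, Q2 => true | Q3, Q3 => true | _, _ => false end.
Definition pqeq (a b : q4 * q4) := qeq a.1 b.1 && qeq a.2 b.2.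
Definition qs := [:: Q0; Q1; Q2; Q3].
Definition pqs := [seq (a, b) | a <- qs, b <- qs].
(** The units 1, -1, 1 + sqrt 2 and its opposite, one for each square class of units of
    Z[sqrt 2]. *)
Definition qunits := [:: (Q1, Q0); (Q3, Q0); (Q1, Q1); (Q3, Q3)].
Definition search4 h ec eb := has (fun x => has (fun y =>
  if pqeq ec (psquare0 qadd qmul h x y) then pqeq eb (psquare1 qadd qmul x y) else false) pqs) pqs.
Definition check4 (gh : q4 * q4) := all (fun c => all (fun b =>
  if pqeq (pnorm qadd qmul gh.1 c b) (Q1, Q0) then
    has (fun e => search4 gh.2 (pmul qadd qmul e c) (pmul qadd qmul e b)) qunits
  else true) pqs) pqs.

(** For p = 3 modulo 8 the number g = (p + 1) / 4 is odd, so (g, -g) modulo 4 is one of these pairs.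
    In both cases an element of norm 1 modulo 4 becomes a square modulo 4 after multiplication by
    one of the four units. *)
Lemma check4_ok : check4 (Q1, Q3) && check4 (Q3, Q1). Proof. by vm_compute. Qed.

Definition qint (a : q4) : int := match a with Q0 => 0 | Q1 => 1 | Q2 => 2 | Q3 => 3 end.
Definition red4 (a : int) (q : q4) := exists k, a = qint q + 4 * k.

Lemma red4_ex a : exists q, red4 a q.
Proof.
have : (a %% 4)%Z = 0 \/ (a %% 4)%Z = 1 \/ (a %% 4)%Z = 2 \/ (a %% 4)%Z = 3 by lia.
by case=> [h|[h|[h|h]]]; [exists Q0|exists Q1|exists Q2|exists Q3]; exists (a %/ 4)%Z => /=; lia.
Qed.

Lemma red4_add a b p q : red4 a p -> red4 b q -> red4 (a + b) (qadd p q).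
Proof.
move=> [k ->] [l ->]; have [c e] : exists c, qint p + qint q = qint (qadd p q) + 4 * c.
  by case: p; case: q; first [by exists 0|by exists 1].
by exists (k + l + c); have -> : qint p + 4 * k + (qint q + 4 * l) = qint p + qint q + 4 * (k + l) by [ring]; rewrite e; ring.
Qed.

Lemma red4_mul a b p q : red4 a p -> red4 b q -> red4 (a * b) (qmul p q).
Proof.
move=> [k ->] [l ->]; have [c e] : exists c, qint p * qint q = qint (qmul p q) + 4 * c.
  by case: p; case: q; first [by exists 0|by exists 1|by exists 2].
exists (c + k * qint q + l * qint p + 4 * k * l).
have -> : (qint p + 4 * k) * (qint q + 4 * l) = qint p * qint q + 4 * (k * qint q + l * qint p + 4 * k * l) by ring.
by rewrite e; ring.
Qed.

Lemma red4_eq a b p q : red4 a p -> red4 b q -> qeq p q -> exists k, a = b + 4 * k.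
Proof.
move=> [k ->] [l ->] h; have -> : p = q by case: p h; case: q.
by exists (k - l); ring.
Qed.

Lemma red4_qeq a p q : red4 a p -> red4 a q -> qeq p q.
Proof. by move=> [k ->] [l]; case: p; case: q => //= h; lia. Qed.

Local Notation pr4 a p := (red4 a.1 p.1 /\ red4 a.2 p.2).
Local Notation imulp := (pmul (@GRing.add int) (@GRing.mul int)).

Lemma pred4_mul (a b : int * int) (p q : q4 * q4) : pr4 a p -> pr4 b q ->
  pr4 (imulp a b) (pmul qadd qmul p q).
Proof. by move=> [? ?] [? ?]; split; do ![apply: red4_add|apply: red4_mul]. Qed.
Lemma pred4_add (a b : int * int) (p q : q4 * q4) : pr4 a p -> pr4 b q ->
  pr4 (padd (@GRing.add int) a b) (padd qadd p q).
Proof. by move=> [? ?] [? ?]; split; apply: red4_add. Qed.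
Lemma pred4_scale (k : int) r (a : int * int) (p : q4 * q4) : red4 k r -> pr4 a p ->
  pr4 (pscale (@GRing.mul int) k a) (pscale qmul r p).
Proof. by move=> ? [? ?]; split; apply: red4_mul. Qed.

Lemma all_pqs (f : pred (q4 * q4)) p : all f pqs -> f p.
Proof.
case: p => [[] []]; rewrite /pqs /=; do !case/andP=> ?; by do ?case/andP.
Qed.

Lemma has_exists (T : Type) (f : pred T) s : has f s -> exists x, f x.
Proof. by elim: s => //= x s IH /orP[h|/IH //]; exists x. Qed.

Lemma qint_red4 q : red4 (qint q) q. Proof. by exists 0; rewrite mulr0 addr0. Qed.

Local Notation ipadd := (padd (@GRing.add int)).
Local Notation ipnorm := (pnorm (@GRing.add int) (@GRing.mul int)).
Local Notation ipscale := (pscale (@GRing.mul int)).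
Local Notation isquare0 := (psquare0 (@GRing.add int) (@GRing.mul int)).
Local Notation isquare1 := (psquare1 (@GRing.add int) (@GRing.mul int)).

Lemma pred4_eq (a b : int * int) p q : pr4 a p -> pr4 b q -> pqeq p q ->
  exists k : int * int, a = ipadd b (ipscale 4 k).
Proof.
move=> [h1 h2] [h3 h4] /andP[e1 e2]; have [k ek] := red4_eq h1 h3 e1; have [l el] := red4_eq h2 h4 e2.
by exists (k, l); case: a b {h1 h2 h3 h4} ek el => ? ? [? ?] /= -> ->.
Qed.

Lemma square_mod4 (g : int) (c b : int * int) : (exists k, g = 2 * k + 1) ->
  (exists k, (ipnorm g c b).1 = 1 + 4 * k) -> (exists k, (ipnorm g c b).2 = 4 * k) ->
  exists e x y : int * int, [/\ e \in [:: (1, 0); (-1, 0); (1, 1); (-1, -1)],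
    exists k : int * int, imulp e c = ipadd (isquare0 (- g) x y) (ipscale 4 k) &
    exists k : int * int, imulp e b = ipadd (isquare1 x y) (ipscale 4 k)].
Proof.
move=> [k0 eg] [k1 n1] [k2 n2].
have [gh hgh [rg rh]] : exists2 gh, gh = (Q1, Q3) \/ gh = (Q3, Q1) & red4 g gh.1 /\ red4 (- g) gh.2.
  have [m [hm|hm]] := int_half k0; [exists (Q1, Q3); first by left|exists (Q3, Q1); first by right].
    by split; [exists m|exists (- m - 1)]; rewrite eg hm /=; ring.
  by split; [exists m|exists (- m - 1)]; rewrite eg hm /=; ring.
have pex (a : int * int) : exists p, pr4 a p.
  by have [p hp] := red4_ex a.1; have [q hq] := red4_ex a.2; exists (p, q).
have [c' rc] := pex c; have [b' rb] := pex b.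
have hN : pqeq (pnorm qadd qmul gh.1 c' b') (Q1, Q0).
  have [h1 h2] : pr4 (ipnorm g c b) (pnorm qadd qmul gh.1 c' b').
    by do ![apply: pred4_add|apply: pred4_mul|apply: pred4_scale].
  by apply/andP; split; [apply: red4_qeq h1 _; exists k1|apply: red4_qeq h2 _; exists k2; rewrite add0r].
have : has (fun e => search4 gh.2 (pmul qadd qmul e c') (pmul qadd qmul e b')) qunits.
  have ck : check4 gh by have /andP[? ?] := check4_ok; case: hgh => ->.
  by have := all_pqs b' (all_pqs c' ck); rewrite hN.
have main (e : int * int) (e' : q4 * q4) : e \in [:: (1, 0); (-1, 0); (1, 1); (-1, -1)] -> pr4 e e' ->
  search4 gh.2 (pmul qadd qmul e' c') (pmul qadd qmul e' b') ->
  exists e x y : int * int, [/\ e \in [:: (1, 0); (-1, 0); (1, 1); (-1, -1)],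
    exists k : int * int, imulp e c = ipadd (isquare0 (- g) x y) (ipscale 4 k) &
    exists k : int * int, imulp e b = ipadd (isquare1 x y) (ipscale 4 k)].
  move=> he re /has_exists[x /has_exists[y]]; case: ifP => // h1 h2.
  have rx : pr4 (qint x.1, qint x.2) x by split; exact: qint_red4.
  have ry : pr4 (qint y.1, qint y.2) y by split; exact: qint_red4.
  exists e, (qint x.1, qint x.2), (qint y.1, qint y.2); split=> //.
    apply: (pred4_eq _ _ h1); first exact: pred4_mul.
    by apply: pred4_add; [exact: pred4_mul|apply: pred4_scale => //; exact: pred4_mul].
  apply: (pred4_eq _ _ h2); first exact: pred4_mul.
  by apply: pred4_add; [apply: pred4_add|]; exact: pred4_mul.
rewrite /qunits /= orbF => /or4P[]; [apply: (main (1, 0))|apply: (main (-1, 0))|apply: (main (1, 1))|apply: (main (-1, -1))];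
  rewrite ?inE //=; by split; first [by exists 0|by exists (-1)].
Qed.

(** The coordinate on w is the difference be - rho be divided by s, and p = - s^2 clears s. The
    denominator p is odd, so congruences modulo 4 survive. *)
Lemma split_coords_half (g : int) (p : nat) (rho : {rmorphism algC -> algC}) be :
  quad F (sq (- p%:Z)) rho -> p%:Z = 4 * g - 1 -> OK (qext F (sq (- p%:Z))) be ->
  exists C B, [/\ OK F C, OK F B & p%:R * be = C + B * ((1 + sq (- p%:Z)) / 2)].
Proof.
set s := sq (- p%:Z) => Q eg obe; have hF := F_sf; have hL := quad_sf Q.
have ks : qext F s s := qext_gen hF s.
have es : s ^+ 2 = - p%:R by rewrite sqK rmorphN.
have os : OK (qext F s) s by split=> //; exact: sqA.
have ot := OK_trace Q obe; have orb := OK_rho Q obe; have [kbe abe] := obe.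
have ow : OK (qext F s) ((1 + s) / 2).
  split; first by sf.
  apply: (@Aint_quadratic 1 g%:~R); rewrite ?rpred1 ?Aint_int //.
  transitivity ((s ^+ 2 - 1 + 4 * g%:~R) / 4); first by field.
  have -> : 4 * g%:~R = p%:R + 1 :> algC.
    have := congr1 (intr : int -> algC) eg; rewrite rmorphB rmorphM /= => e.
    by rewrite -[p%:R]/(p%:Z%:~R : algC) e; ring.
  by rewrite es; field.
pose U := (be - rho be) * s.
have oU : OK F U.
  have [kU aU] : OK (qext F s) U by rewrite /U; sf.
  split=> //; apply: (rho_fix Q) => //.
  by rewrite /U rmorphM rmorphB (rhoK Q kbe) (qd_opp Q); ring.
have eC : (p%:R * (be + rho be) + U) / 2 = p%:R * be + U * ((1 + s) / 2).
  transitivity (p%:R * be + U / 2 + (- s ^+ 2) * (rho be - be) / 2); first by rewrite es; field.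
  by rewrite /U; field.
exists ((p%:R * (be + rho be) + U) / 2), (- U); split.
- split; first by have [? _] := ot; have [? _] := oU; sf.
  by have [_ ?] : OK (qext F s) (p%:R * be + U * ((1 + s) / 2)) by [have := OK_ext Q oU => ?; sf]; rewrite eC.
- by sf.
by rewrite eC; ring.
Qed.

Definition pval (a : int * int) : algC := a.1%:~R + a.2%:~R * r2.
Lemma pval_mul a b : pval (pmul (@GRing.add int) (@GRing.mul int) a b) = pval a * pval b.
Proof.
rewrite /pval /= !(rmorphD, rmorphM) /=.
transitivity (a.1%:~R * b.1%:~R + r2 ^+ 2 * (a.2%:~R * b.2%:~R) + (a.1%:~R * b.2%:~R + a.2%:~R * b.1%:~R) * r2); last by ring.
by rewrite r2sq; ring.
Qed.
Lemma pval_add a b : pval (padd (@GRing.add int) a b) = pval a + pval b.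
Proof. by rewrite /pval /= !rmorphD /=; ring. Qed.
Lemma pval_scale k a : pval (pscale (@GRing.mul int) k a) = k%:~R * pval a.
Proof. by rewrite /pval /= !rmorphM /=; ring. Qed.
Lemma pval_OK a : OK F (pval a). Proof. by apply/OK_F; exists a.1, a.2. Qed.
Lemma pval_unit a : a \in [:: (1, 0); (-1, 0); (1, 1); (-1, -1)] -> unit F (pval a).
Proof.
have hF := F_sf; have ue := unit_eps hF F_r2; have u1 := unit1 hF.
have e4 : pval (-1, -1) = - (1 + r2).
  by transitivity ((-1 : int)%:~R + (-1 : int)%:~R * r2 : algC) => //; rewrite rmorphN; ring.
have e2 : pval (-1, 0) = - 1.
  by transitivity ((-1 : int)%:~R + (0 : int)%:~R * r2 : algC) => //; rewrite rmorphN; ring.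
have e1 : pval (1, 0) = 1 by rewrite /pval /=; ring.
have e3 : pval (1, 1) = 1 + r2 by rewrite /pval /=; ring.
by rewrite !inE => /or4P[]/eqP->; rewrite ?e1 ?e2 ?e3 ?e4 //; exact: unitN.
Qed.

Section Biquadratic.
Variables (S : seq int) (p : nat) (rho : {rmorphism algC -> algC}).
Local Notation K := (M S).
Local Notation s := (sq (- p%:Z)).
Local Notation k := (qext F s).
Hypotheses (pp : prime p) (p3 : (p %% 8 = 3)%N) (k2 : K r2) (ks : K s) (Q : quad F s rho).
Let hK : is_subfield K := gen_sf _.
Let hF := F_sf.
Let d0 : - p%:Z < 0. Proof. by have := prime_gt0 pp; lia. Qed.

Lemma F_sub x : F x -> K x.
Proof. by move: x; apply: gen_sub => // a; rewrite inE => /eqP->. Qed.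

Lemma biquad_sub x : k x -> K x.
Proof. by move=> [y [z [/F_sub ky /F_sub kz ->]]]; sf. Qed.

Lemma unit_multiple_square be (n j : int) : OK k be -> be * rho be = n%:~R -> n = 4 * j + 1 ->
  exists et ga ka, [/\ unit F et, OK K ga, OK K ka & p%:R ^+ 2 * (et * be) = ga ^+ 2 + 4 * ka].
Proof.
move=> obe en ej; have [g eg] : exists g, p%:Z = 4 * g - 1 by exists ((p%:Z + 1) %/ 4)%Z; lia.
have [C [B [/OK_F[c1 [c2 eC]] /OK_F[b1 [b2 eB]] eb]]] := split_coords_half Q eg obe.
set w := (1 + s) / 2 in eb; have rw : rho w = 1 - w.
  by rewrite /w fmorph_div rmorphD rmorph1 rmorph_nat (qd_opp Q); field.
have ew : w ^+ 2 = w - g%:~R.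
  transitivity ((1 + 2 * s + s ^+ 2) / 4); first by rewrite /w; field.
  have -> : s ^+ 2 = - p%:R by rewrite sqK rmorphN.
  have -> : p%:R = 4 * g%:~R - 1 :> algC by have := congr1 (intr : int -> algC) eg; rewrite rmorphB rmorphM.
  by rewrite /w; field.
(* A second factor p makes the total multiplier the odd square p^2 that [unramified_sqrt] accepts;
   the norm p^4 n is still 1 modulo 4. *)
pose c := (p%:Z * c1, p%:Z * c2); pose b := (p%:Z * b1, p%:Z * b2).
have vc : pval c = p%:R * C by rewrite /pval eC /= !rmorphM /=; ring.
have vb : pval b = p%:R * B by rewrite /pval eB /= !rmorphM /=; ring.
have kC : F C by rewrite eC; have := F_r2 => ?; sf.
have kB : F B by rewrite eB; have := F_r2 => ?; sf.
have eN : pval (pnorm (@GRing.add int) (@GRing.mul int) g c b) = (p%:Z ^+ 4 * n)%:~R.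
  have e1 : (C + B * w) * (C + B * (1 - w)) = (p%:Z ^+ 2 * n)%:~R.
    rewrite rmorphM rmorphXn /= -en -eb.
    have -> : C + B * (1 - w) = rho (p%:R * be).
      by rewrite eb rmorphD rmorphM rw !(qd_fix Q).
    by rewrite rmorphM rmorph_nat; ring.
  rewrite /pnorm !pval_add pval_scale !pval_mul vc vb.
  transitivity (p%:R ^+ 2 * (C ^+ 2 + B * C + B ^+ 2 * (w - w ^+ 2))); first by rewrite ew; ring.
  transitivity (p%:R ^+ 2 * ((C + B * w) * (C + B * (1 - w)))); first by ring.
  by rewrite e1 rmorphM rmorphXn [in RHS]rmorphM rmorphXn /=; ring.
have [N1 N2] : (pnorm (@GRing.add int) (@GRing.mul int) g c b).1 = p%:Z ^+ 4 * n /\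
    (pnorm (@GRing.add int) (@GRing.mul int) g c b).2 = 0.
  set N := pnorm _ _ _ _ _ in eN *.
  have [] := @F_eq0 (N.1 - p%:Z ^+ 4 * n) N.2.
    by rewrite rmorphB addrAC /= -[_ + _ * r2]/(pval N) eN subrr.
  by move=> /eqP; rewrite subr_eq0 => /eqP.
have p2 := mod8_odd (or_introl p3).
have [e [x [y [he [kc ekc] [kb ekb]]]]] : exists e x y : int * int,
  [/\ e \in [:: (1, 0); (-1, 0); (1, 1); (-1, -1)],
    exists k : int * int, pmul (@GRing.add int) (@GRing.mul int) e c =
      padd (@GRing.add int) (psquare0 (@GRing.add int) (@GRing.mul int) (- g) x y) (pscale (@GRing.mul int) 4 k) &
    exists k : int * int, pmul (@GRing.add int) (@GRing.mul int) e b =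
      padd (@GRing.add int) (psquare1 (@GRing.add int) (@GRing.mul int) x y) (pscale (@GRing.mul int) 4 k)].
  apply: square_mod4.
  - by exists (g %/ 2)%Z; lia.
  - rewrite N1; have [a ea] := odd_int p2; have [i ei] := odd_sqr_mod8 ea.
    exists (16 * i ^+ 2 * n + 4 * i * n + j); rewrite (exprM _ 2 2) ei; rewrite {2}ej; rewrite ej; ring.
  - by rewrite N2; exists 0; rewrite mulr0.
have lift a : OK K (pval a).
  by have [/F_sub h1 h2] := pval_OK a.
have ow : OK K w.
  have ks' := ks; split; first by rewrite /w; sf.
  apply: (@Aint_quadratic 1 g%:~R); rewrite ?rpred1 ?Aint_int //.
  by rewrite ew; ring.
exists (pval e), (pval x + pval y * w), (pval kc + pval kb * w); split.
- exact: pval_unit.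
- by have := lift x; have := lift y; move=> *; sf.
- by have := lift kc; have := lift kb; move=> *; sf.
have := congr1 pval ekc; have := congr1 pval ekb.
rewrite /psquare0 /psquare1 !pval_add !pval_scale !pval_mul vc vb rmorphN /= => eB' eC'.
transitivity (pval e * (p%:R * C) + pval e * (p%:R * B) * w).
  transitivity (pval e * p%:R * (p%:R * be)); first by ring.
  by rewrite eb; ring.
rewrite eB' eC'.
transitivity (pval x ^+ 2 + pval y ^+ 2 * (w - g%:~R) + 2 * pval x * pval y * w + 4 * (pval kc + pval kb * w)); first by ring.
by rewrite -ew; ring.
Qed.

(** With al = et be for the unit et of F found by [unit_multiple_square], al nu(al) = et^2 n is the
    square of t = et c v. The automorphism nu extends the conjugation of k / F and negates v, hence
    t, so al cannot be a square in K. *)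
Lemma biquad_even be (n j n0 c : int) v : OK k be -> be * rho be = n%:~R -> n = 4 * j + 1 ->
  comax k be (rho be) -> K v -> ~ F v -> v ^+ 2 = n0%:~R -> n = n0 * c ^+ 2 -> ~ no2 K.
Proof.
move=> obe en ej [a [b [oa ob eab]]] kv nFv ev enc.
have nFs : ~ F s := qd_ns Q.
have [nu [fx nus nuv]] : exists nu : {rmorphism algC -> algC},
    [/\ (forall x, F x -> nu x = x), nu s = - s & nu v = - v].
  by apply: flip => //; rewrite ?sqK ?ev; exact: F_int.
have nurho x : k x -> nu x = rho x.
  by move=> [y [z [ky kz ->]]]; rewrite (rho_qext Q) // rmorphD rmorphM nus !fx // mulrN.
have [et [ga [ka [[et0 [ket oet] [ket' oet']] oga oka esq]]]] := unit_multiple_square obe en ej.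
have [kbe abe] := obe; have KO x : OK k x -> OK K x by move=> [/biquad_sub].
have oK := KO _ obe.
have oe : OK K et by split=> //; exact: F_sub.
have oe' : OK K et^-1 by split=> //; exact: F_sub.
have n_0 : n != 0 by rewrite ej; lia.
have c0 : c != 0 by apply: contraNneq n_0 => c0; rewrite enc c0 expr0n mulr0.
have v0 : v != 0 by apply: contra_not_neq nFv => ->; sf.
have nual : nu (et * be) = et * rho be by rewrite rmorphM fx // nurho.
apply: (unramified_sqrt d0 ks (nu := nu) (al := et * be) (t := et * c%:~R * v) (ga := ga) (ka := ka) (m := p./2)) => //.
- by sf.
- by have [? _] := oe; sf.
- by rewrite !mulf_neq0 // intr_eq0.
- rewrite nual; transitivity (et ^+ 2 * (be * rho be)); last by ring.
  by rewrite en enc !exprMn ev rmorphM rmorphXn /=; ring.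
- by rewrite !rmorphM nuv rmorph_int fx // mulrN.
- by have := odd_double_half p; rewrite (mod8_odd (or_introl p3)) add1n => ->.
exists (a / et), (b / et); split.
- by have := KO _ oa => ?; sf.
- by have := KO _ ob => ?; sf.
by rewrite nual -[RHS]eab; field.
Qed.
Let n2 : no2 k := no2_sqrt_prime pp p3.

Lemma split_generator_int q : prime q -> (q %% 8 = 3 \/ q %% 8 = 5)%N -> q <> p ->
  exists j be, [/\ OK k be, be * rho be = (q%:Z * (q%:Z ^+ j) ^+ 2)%:~R & comax k be (rho be)].
Proof.
move=> pq hq nqp; have qd : ~~ (q%:Z %| (- p%:Z)%R)%Z.
  by rewrite dvdzE abszN /= dvdn_prime2 //; apply/eqP.
have [m [be [om obe eN cop]]] := split_generator Q d0 pq hq qd n2.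
exists m./2, be; split=> //; rewrite eN rmorphM !rmorphXn /= -exprM -exprS.
by rewrite muln2 -[in LHS](odd_double_half m) om.
Qed.

(** The norm of the generator is an odd power of q, which is 1 modulo 4. *)
Lemma even_35 q : prime q -> (q %% 8 = 5)%N -> K (sq q%:Z) -> ~ no2 K.
Proof.
move=> pq q5 kq; have hq : (q %% 8 = 3 \/ q %% 8 = 5)%N by right.
have q2 := mod8_odd hq; have nqp : q <> p by move=> h; rewrite h p3 in q5.
have [j [be [obe eN cop]]] := split_generator_int pq hq nqp.
have [a ea] := odd_int q2.
have [i ei] : exists i, (q%:Z ^+ j) ^+ 2 = 8 * i + 1.
  have : odd (q ^ j) by rewrite oddX q2 orbT.
  by move=> /odd_int [b eb]; apply: (@odd_sqr_mod8 _ b); rewrite -eb -rmorphXn.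
have [l el] : exists l, q%:Z = 4 * l + 1 by exists (q %/ 4)%N%:Z; lia.
apply: (@biquad_even be (q%:Z * (q%:Z ^+ j) ^+ 2) (8 * l * i + l + 2 * i) q%:Z (q%:Z ^+ j) (sq q%:Z)) => //.
- by rewrite ei el; ring.
- exact: (prime_notF pq q2 (or_introl erefl) (sqK _)).
exact: sqK.
Qed.

(** An odd power of q or of r alone is 3 modulo 4; the product of the two generators has norm 1
    modulo 4. *)
Lemma even_333 q r : prime q -> prime r -> (q %% 8 = 3)%N -> (r %% 8 = 3)%N -> q <> p -> r <> p ->
  q <> r -> K (sq (- q%:Z)) -> K (sq (- r%:Z)) -> ~ no2 K.
Proof.
move=> pq pr q3 r3 nqp nrp nqr kq kr.
have hq : (q %% 8 = 3 \/ q %% 8 = 5)%N by left.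
have hr : (r %% 8 = 3 \/ r %% 8 = 5)%N by left.
have q2 := mod8_odd hq; have r2' := mod8_odd hr; have hk := quad_sf Q.
have [j [be [obe eN cop]]] := split_generator_int pq hq nqp.
have [j' [be' [obe' eN' cop']]] := split_generator_int pr hr nrp.
have [i ei] : exists i, (q%:Z ^+ j * r%:Z ^+ j') ^+ 2 = 8 * i + 1.
  have : odd (q ^ j * r ^ j') by rewrite oddM !oddX q2 r2' !orbT.
  by move=> /odd_int [b eb]; apply: (@odd_sqr_mod8 _ b); rewrite -eb PoszM -!rmorphXn.
have [l el] : exists l, q%:Z * r%:Z = 8 * l + 1 by apply: pq_mod8; [rewrite q3 r3|left].
have orb := OK_rho Q obe; have orb' := OK_rho Q obe'.
have cross : comax k be (rho be') /\ comax k be' (rho be).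
  have cqr : coprimez (q%:Z ^+ j.*2.+1) (r%:Z ^+ j'.*2.+1).
    by rewrite coprimezXl // coprimezXr // coprimezE /= prime_coprime // dvdn_prime2 //; apply/eqP.
  have [u [v [/intrP[u' ->] /intrP[v' ->] e]]] := coprimez_bezout cqr.
  have {}e : u'%:~R * (be * rho be) + v'%:~R * (be' * rho be') = 1.
    by rewrite eN eN' -[RHS]e -!exprM !muln2 -!exprS.
  split.
    by exists (u'%:~R * rho be), (v'%:~R * be'); split; [sf|sf|rewrite -[RHS]e; ring].
  by exists (v'%:~R * rho be'), (u'%:~R * be); split; [sf|sf|rewrite -[RHS]e; ring].
have [cr1 cr2] := cross.
apply: (@biquad_even (be * be') (q%:Z * r%:Z * (q%:Z ^+ j * r%:Z ^+ j') ^+ 2)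
  (2 * (8 * l * i + l + i)) (q%:Z * r%:Z) (q%:Z ^+ j * r%:Z ^+ j') (sq (- q%:Z) * sq (- r%:Z))) => //.
- by sf.
- transitivity ((be * rho be) * (be' * rho be')); first by rewrite rmorphM; ring.
  by rewrite eN eN' -rmorphM; congr _%:~R; ring.
- by rewrite ei el; ring.
- rewrite rmorphM; have ok2 : OK k (be * be') by sf.
  apply: (comaxM hk) => //; apply: comax_sym; apply: (comaxM hk) => //; exact: comax_sym.
- by sf.
- apply: (odd_logn_notF pq q2 (D := q%:Z * r%:Z)); first by rewrite logn_pq.
  by rewrite exprMn !sqK -rmorphM mulrNN.
by rewrite exprMn !sqK -rmorphM mulrNN.
Qed.
End Biquadratic.

(** * The field Q(sqrt 2, sqrt -p), p = 5 mod 8 *)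

Lemma dvdz_Aint (n : nat) (a : int) z : (0 < n)%N -> z \in Aint -> a%:~R = n%:R * z -> (n%:Z %| a)%Z.
Proof.
move=> n0 hz e; have n0' : n%:R != 0 :> algC by rewrite pnatr_eq0 -lt0n.
have : z \in Num.int.
  by apply: Cint_rat_Aint => //; rewrite -[z](mulKf n0') -e rpredM ?rpredV ?rpred_nat // rpred_int.
case/intrP => m em; apply/dvdzP; exists m.
by apply: (@intr_inj algC); rewrite e em rmorphM /= mulrC.
Qed.

(* The norm of 2 + sqrt 2 is 2, a nonresidue modulo p. *)
Lemma not_norm_form p y z : prime p -> (p %% 8 = 3 \/ p %% 8 = 5)%N -> F y -> F z ->
  y ^+ 2 + p%:R * z ^+ 2 <> 2 + r2.
Proof.
move=> pp hp ky kz e0; have hF := F_sf; have [rho Q] := rho2_ex.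
have p0 : p%:R != 0 :> algC by rewrite pnatr_eq0 -lt0n prime_gt0.
pose P (m : nat) := (0 < m)%N /\ exists Y Z, [/\ OK F Y, OK F Z & Y ^+ 2 + p%:R * Z ^+ 2 = m%:R ^+ 2 * (2 + r2)].
have [m [m0 [Y [Z [oY oZ e]]]] hmin] : exists2 m, P m & forall m', P m' -> (m <= m')%N.
  apply: natP_min; have [a a0 ha] := F_fracs ky; have [b b0 hb] := F_fracs kz.
  exists (a * b)%N; split; first by rewrite muln_gt0 a0.
  exists (b%:R * (a%:R * y)), (a%:R * (b%:R * z)); split.
  - by split; [sf|rewrite rpredM ?rpred_nat].
  - by split; [sf|rewrite rpredM ?rpred_nat].
  by rewrite -e0 natrM; ring.
(* Descent on the common denominator m: if p divides m, the equation forces p to divide Y and then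
   Z, and m / p is a smaller denominator. *)
have [pm|npm] := boolP (p%:Z %| m%:Z)%Z.
  have [m' em] : exists m', m = (p * m')%N.
    by move: pm; rewrite dvdzE => /dvdnP[m' em]; exists m'; rewrite mulnC.
  have pdiv x w : OK F x -> OK F w -> x ^+ 2 = p%:R * w -> exists2 x', OK F x' & x = p%:R * x'.
    move=> ox ow ex; have [//|[u [v [ou ov euv]]]] := F_inv_mod pp hp ox.
    exists (w * u - x * v); first by sf.
    have -> : p%:R * (w * u - x * v) = x ^+ 2 * u - x * (p%:R * v) by rewrite ex; ring.
    have -> : x ^+ 2 * u = x + x * (p%:R * v) by rewrite expr2 -mulrA euv; ring.
    by rewrite addrK.
  have k2 := F_r2; have o2 : OK F r2 by split=> //; exact: r2A.
  rewrite em natrM in e.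
  have [||Y' oY' eY] := pdiv Y (p%:R * m'%:R ^+ 2 * (2 + r2) - Z ^+ 2) oY; first by sf.
    by rewrite -[LHS](addrK (p%:R * Z ^+ 2)) e; ring.
  have [||Z' oZ' eZ] := pdiv Z (m'%:R ^+ 2 * (2 + r2) - Y' ^+ 2) oZ; first by sf.
    apply: (mulfI p0); rewrite -[LHS](addKr (Y ^+ 2)) e eY; ring.
  have /hmin : P m'.
    split; first by move: m0; rewrite em muln_gt0 => /andP[].
    exists Y', Z'; split=> //; apply: (mulfI (expf_neq0 2 p0)).
    by rewrite [RHS]mulrA -[in RHS]exprMn -e eY eZ; ring.
  have m'0 : (0 < m')%N by move: m0; rewrite em muln_gt0 => /andP[].
  by rewrite em leqNgt -[ltnLHS]mul1n ltn_pmul2r // prime_gt1.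
have oY' : OK F (rho Y) by move: oY; rewrite F_qext; apply: (OK_rho Q).
have oZ' : OK F (rho Z) by move: oZ; rewrite F_qext; apply: (OK_rho Q).
have [a [b eY]] := (OK_F Y).1 oY.
have eN : Y * rho Y = (a ^+ 2 - 2 * b ^+ 2)%:~R by rewrite eY normF.
set n := a ^+ 2 - 2 * b ^+ 2 in eN.
have e' : rho Y ^+ 2 + p%:R * rho Z ^+ 2 = m%:R ^+ 2 * (2 - r2).
  have := congr1 rho e; rewrite rmorphD rmorphXn rmorphM rmorphXn rmorph_nat => ->.
  by rewrite rmorphM rmorphXn rmorph_nat rmorphD rmorph_nat (qd_opp Q).
have pn : (p%:Z %| 2 * m%:Z ^+ 4 - n ^+ 2)%Z.
  apply: (@dvdz_Aint p _ (Y ^+ 2 * rho Z ^+ 2 + Z ^+ 2 * rho Y ^+ 2 + p%:R * Z ^+ 2 * rho Z ^+ 2)).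
  - exact: prime_gt0.
  - have [_ a1] := oY; have [_ a2] := oY'; have [_ a3] := oZ; have [_ a4] := oZ'.
    by do !rewrite ?rpredD ?rpredM ?rpredX ?rpred_nat.
  rewrite rmorphB rmorphM !rmorphXn /= -eN.
  have -> : 2%:~R * m%:R ^+ 4 = (m%:R ^+ 2 * (2 + r2)) * (m%:R ^+ 2 * (2 - r2)) :> algC.
    have -> : (m%:R ^+ 2 * (2 + r2)) * (m%:R ^+ 2 * (2 - r2)) = m%:R ^+ 4 * (2 ^+ 2 - r2 ^+ 2) by ring.
    by rewrite r2sq; ring.
  by rewrite -e -e'; ring.
move: npm pn; rewrite !int_Fp // rmorphB rmorphM !rmorphXn /= subr_eq0 => m0' /eqP e1.
apply: (@two_nonresidue p (n%:~R / m%:R ^+ 2)) => //.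
by rewrite expr_div_n -e1 -exprM mulfK // expf_neq0.
Qed.

Section Moreover.
Variables (p : nat) (rho : {rmorphism algC -> algC}).
Local Notation s := (sq (- p%:Z)).
Local Notation L := (qext F s).
Hypotheses (pp : prime p) (p5 : (p %% 8 = 5)%N) (Q : quad F s rho).
Let hF := F_sf.
Let hL : is_subfield L := quad_sf Q.
Let d0 : - p%:Z < 0. Proof. by have := prime_gt0 pp; lia. Qed.
Let p0 : p%:R != 0 :> algC. Proof. by rewrite pnatr_eq0 -lt0n prime_gt0. Qed.
Let fr := qext_fracs F_fracs (sqA (- p%:Z)).
Let inv := pid_invertible hF F_pid.
Let invL := inv_ext Q inv fr.
Let k2 : L r2 := qext_subK hF s F_r2.
Let o2 : OK L r2. Proof. by split=> //; exact: r2A. Qed.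
Let ks : L s := qext_gen hF s.
Let s0 : s != 0. Proof. by apply: sq_neq0; have := prime_gt0 pp; lia. Qed.
Let es : s ^+ 2 = - p%:R. Proof. by rewrite sqK rmorphN. Qed.
Let u1 := unit1 hL.

(** The analogue of [zeta8], which is the value for p = 1: with p = 4 o + 1, y^2 = s - 2 o, so y is
    integral. *)
Let y := (1 + s) / r2.
Let ex_o : exists o : int, p%:R = 4 * o%:~R + 1 :> algC.
Proof.
have [o eo] : exists o : int, p%:Z = 4 * o + 1 by exists ((p%:Z - 1) %/ 4)%Z; lia.
by exists o; have := congr1 (intr : int -> algC) eo; rewrite rmorphD rmorphM.
Qed.
Let ey : r2 * y = 1 + s. Proof. by rewrite mulrC divfK // r2_neq0. Qed.

Let oy : OK L y.
Proof.
split; first by rewrite /y; have := k2 => ?; sf.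
have [o eo] := ex_o; apply: Aint_sqr.
have -> : y ^+ 2 = s - 2 * o%:~R.
  transitivity ((1 + 2 * s + s ^+ 2) / r2 ^+ 2); first by rewrite /y; field; exact: r2_neq0.
  by rewrite es r2sq eo; field.
by rewrite rpredB ?rpredM ?rpred_nat ?Aint_int // sqA.
Qed.

Definition I2 := iadd (pr L r2) (pr L (1 + y)).

Lemma I2_in a b : OK L a -> OK L b -> I2 (r2 * a + (1 + y) * b).
Proof. by move=> ha hb; exists (r2 * a), ((1 + y) * b); split=> //; [exists a|exists b]. Qed.

Let y1 : 1 + y != 0.
Proof.
apply/eqP => h; apply: (qd_ns Q); have -> : s = - r2 - 1.
  have -> : s = r2 * (1 + y) - r2 - 1 by rewrite mulrDr ey mulr1; ring.
  by rewrite h mulr0 sub0r.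
by have := F_r2 => ?; sf.
Qed.

Lemma fid_I2 : fid L I2.
Proof.
have [ky ay] := oy.
apply: (fid_iadd hL); first by apply: fid_pr => //; exact: r2_neq0.
- by apply: fid_pr => //; sf.
- by move=> _ [r [hr ->]]; have := o2 => ?; sf.
- by move=> _ [r [hr ->]]; have := oy => ?; sf.
Qed.

Lemma I2_sq : imul I2 I2 = pr L r2.
Proof.
have h2 := o2; have hy := oy; have [o eo] := ex_o; have fI := fid_I2; have f2 := fid_imul hL fI fI.
have fr2 : fid L (pr L r2) by apply: fid_pr => //; exact: r2_neq0.
have eyy : (1 + y) ^+ 2 = r2 * (y * (r2 + 1) - r2 * o%:~R).
  have -> : (1 + y) ^+ 2 = 1 + 2 * y + y ^+ 2 by ring.
  have -> : y ^+ 2 = s - 2 * o%:~R.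
    transitivity ((1 + 2 * s + s ^+ 2) / r2 ^+ 2); first by rewrite /y; field; exact: r2_neq0.
    by rewrite es r2sq eo; field.
  have -> : s = r2 * y - 1 by rewrite ey; ring.
  transitivity (r2 ^+ 2 * y + r2 * y - r2 ^+ 2 * o%:~R); last by ring.
  by rewrite r2sq; ring.
apply: incl_eq.
  apply: imul_sub; [exact: (fid0 fr2)|exact: (fidD fr2)|].
  move=> _ _ [_ [_ [[a [ha ->]] [b [hb ->]] ->]]] [_ [_ [[a' [ha' ->]] [b' [hb' ->]] ->]]].
  exists (r2 * a * a' + (1 + y) * (a * b' + a' * b) + (y * (r2 + 1) - r2 * o%:~R) * (b * b')); split; first by sf.
  transitivity (r2 * r2 * a * a' + r2 * (1 + y) * (a * b' + a' * b) + (1 + y) ^+ 2 * (b * b')); first by ring.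
  by rewrite eyy; ring.
apply: pr_mem => //.
have i1 : I2 r2 by rewrite -[r2]mulr1 -[_ * 1]addr0 -(mulr0 (1 + y)); apply: I2_in; sf.
have i2 : I2 (1 + y) by rewrite -[1 + y]mulr1 -[_ * 1]add0r -(mulr0 r2); apply: I2_in; sf.
(* Since (1 + y)^2 + 2 o = r2 (r2 + 1) y and r2 - 1 is the inverse of r2 + 1, the subtracted term is
   r2 y. *)
have -> : r2 = r2 * (1 + y) - (r2 - 1) * ((1 + y) * (1 + y) + o%:~R * (r2 * r2)).
  rewrite -(expr2 (1 + y)) eyy.
  transitivity (r2 + r2 * y - r2 * y * (r2 ^+ 2 - 1)); last by ring.
  by rewrite r2sq; ring.
apply: (fidB hL f2); first exact: imul_in.
by apply: (fidM f2); [sf|apply: (fidD f2); [|apply: (fidM f2); first by sf]; exact: imul_in].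
Qed.

(** The primes r2, r2, p are stripped off one after another. In L the prime p = - s^2 is a square up
    to a unit, so only the parity of the exponent of r2 remains. *)
Lemma divisor_2p nu mu : OK F nu -> OK F mu -> nu * mu = r2 * (r2 * (p%:R * 1)) ->
  exists g u, [/\ L g, unit L u & nu = g ^+ 2 * u \/ nu = r2 * g ^+ 2 * u].
Proof.
pose P nu := exists g u, [/\ L g, unit L u & nu = g ^+ 2 * u \/ nu = r2 * g ^+ 2 * u].
have hk2 := k2; have hks := ks; have o2F : OK F r2 by split; [exact: F_r2|exact: r2A].
have base n m : OK F n -> OK F m -> n * m = 1 -> P n.
  move=> on om e; exists 1, n; split; [by sf| |by left; rewrite expr1n mul1r].
  have n0 : n != 0 by apply: contra_eq_neq e => ->; rewrite mul0r eq_sym oner_eq0.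
  apply: (unit_ext Q); split=> //; have -> : n^-1 = m by apply: (mulfI n0); rewrite divff.
  by [].
have step q x : maxid F (pr F q) -> q != 0 -> (forall n, P n -> P (q * n)) ->
    (forall n m, OK F n -> OK F m -> n * m = x -> P n) -> OK F x ->
    forall n m, OK F n -> OK F m -> n * m = q * x -> P n.
  move=> mq q0 Pq IH ox n m on om e.
  have : pr F q (n * m) by exists x.
  case/(max_prime hF mq on om) => -[r [or er]].
    by rewrite er; apply/Pq/(IH r m) => //; apply: (mulfI q0); rewrite mulrA -er.
  by apply: (IH n r) => //; apply: (mulfI q0); rewrite -e er; ring.
have P2 n : P n -> P (r2 * n).
  case=> g [u [lg uu [->|->]]].
    by exists g, u; split=> //; right; rewrite mulrA.
  by exists (r2 * g), u; split=> //; [sf|left; rewrite exprMn; ring].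
have Pp n : P n -> P (p%:R * n).
  have um := unitN hL u1.
  case=> g [u [lg uu h]]; exists (s * g), (-1 * u); split; [by sf|exact: unitM|].
  by case: h => ->; [left|right]; rewrite exprMn es; ring.
have oo : OK F (p%:R * 1) by sf.
have oo2 : OK F (r2 * (p%:R * 1)) by sf.
have h1 := step _ _ (maxid_inert pp (or_intror p5)) p0 Pp base (OK1 hF).
have h2 := step _ _ maxid_r2 r2_neq0 P2 h1 oo.
have h3 := step _ _ maxid_r2 r2_neq0 P2 h2 oo2.
by move=> on om e; apply: (h3 nu mu).
Qed.

(** The class of I contains an invariant ideal A with E A principal and E^2 = (nu), where nu divides
    2 p in F. By [divisor_2p] and (r2) = [I2]^2, E is (x) or [I2] (x). *)
Lemma order2_classes I : fid L I -> prin L (imul I I) -> prin L I \/ prin L (imul I2 I).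
Proof.
move=> fI [g [g0 lg eg]]; have hks := ks; have hk2 := k2.
have [n fn en] := norm_ideal Q inv fr fI; have [c [c0 kc ec]] := F_pid fn.
have lc : L c := qext_subK hF s kc.
have h1 x := norm_totpos d0 Q (x := x).
have [|b [lb b0 eb]] := ambiguous_rep Q inv fr h1 fI lg g0 eg lc c0.
  by rewrite en ec (ext_pr Q).
set A := imul (pr L b) I in eb; have fb := fid_pr hL lb b0.
have fA : fid L A := fid_imul hL fb fI.
have hd : diffs F s rho (r2 * s).
  have -> : r2 * s = y - rho y.
    rewrite /y fmorph_div rmorphD rmorph1 (qd_opp Q) (qd_fix Q F_r2).
    have -> : (1 + s) / r2 - (1 - s) / r2 = 2 * s / r2 by field; exact: r2_neq0.
    by rewrite -[in RHS]r2sq; field; exact: r2_neq0.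
  exact: (diffs_in Q oy).
have nd : r2 * s != 0 by rewrite mulf_neq0 ?r2_neq0.
have [a [E [n' [[fa fE fn'] [[sE Ed e1 e2] [sn hnd]]]]]] := invariant_decomp Q inv fr fA eb hd nd.
have [a' [a'0 ka' ea']] := F_pid fa; have [nu [nu0 knu enu]] := F_pid fn'.
have la' : L a' := qext_subK hF s ka'.
have onu : OK F nu by apply: sn; rewrite enu; exact: pr_id.
have [mu [omu emu]] : exists mu, OK F mu /\ nu * mu = r2 * (r2 * (p%:R * 1)).
  move: hnd; rewrite enu => -[mu [omu e]]; exists mu; split=> //.
  rewrite -e rmorphM (qd_opp Q) (qd_fix Q F_r2).
  have -> : r2 * s * (r2 * - s) = r2 * r2 * - (s ^+ 2) by ring.
  by rewrite es; ring.
have [x [u [lx uu eE]]] := divisor_2p onu omu emu.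
have x0 : x != 0 by apply: contraNneq nu0 => x0; case: eE => ->; rewrite x0 expr0n !(mulr0, mul0r).
have fx := fid_pr hL lx x0.
have eEE : imul E E = pr L nu by rewrite e2 enu (ext_pr Q).
have back J : fid L J -> imul (pr L b^-1) (imul (pr L b) J) = J by exact: pr_imulK.
have lb' : L b^-1 by sf.
have b'0 : b^-1 != 0 by rewrite invr_eq0.
case: eE => eE; [left|right].
  have eEx : E = pr L x.
    by apply: (sq_inj hL invL fE fx); rewrite eEE imul_pr // eE (pr_unit hL) // expr2.
  move: e1; rewrite eEx ea' (ext_pr Q) // => e1.
  have pA : prin L A.
    rewrite -(pr_imulK hL lx x0 fA) e1; apply: prinM => //; apply: prin_pr => //; [by sf|by rewrite invr_eq0].
  by rewrite -(back I fI); apply: prinM => //; exact: prin_pr.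
have fI2 := fid_I2; have fX := fid_imul hL fI2 fx.
have eEx : E = imul I2 (pr L x).
  apply: (sq_inj hL invL fE fX); rewrite eEE imulACA I2_sq !imul_pr ?mulf_neq0 //; try (by sf).
  by rewrite eE (pr_unit hL) // -expr2.
move: e1; rewrite eEx ea' (ext_pr Q) // => e1.
have pA : prin L (imul (pr L (x * b)) (imul I2 I)).
  have -> : imul (pr L (x * b)) (imul I2 I) = imul (imul I2 (pr L x)) A.
    by rewrite /A -(imul_pr hL) // (imulC I2 (pr L x)) -!imulA (imulCA I2 (pr L b)).
  by rewrite e1; exact: prin_pr.
have lxb : L (x * b) by sf.
have xb0 : x * b != 0 by rewrite mulf_neq0.
rewrite -(pr_imulK hL lxb xb0 (fid_imul hL fI2 fI)); apply: prinM => //.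
by apply: prin_pr => //; [sf|rewrite invr_eq0].
Qed.

(** If [I2] I^2 = (g), taking norms gives g rho g = r2 c^2 up to a unit of F. Positivity determines
    that unit up to squares as 1 + r2, so r2 (1 + r2) = 2 + r2 would be a norm. *)
Lemma no_square_root_class I : fid L I -> ~ prin L (imul I2 (imul I I)).
Proof.
move=> fI [g [g0 lg eg]]; have hks := ks; have hk2 := k2; have fI2 := fid_I2.
have [n fn en] := norm_ideal Q inv fr fI; have [c [c0 kc ec]] := F_pid fn.
have lc : L c := qext_subK hF s kc.
rewrite ec (ext_pr Q) // in en.
have rI2 : rimg F s rho I2 = I2.
  have fr2 := rimg_fid Q fI2; apply: (sq_inj hL invL fr2 fI2).
  by rewrite -(rimg_imul Q) // I2_sq (rimg_pr Q) // (qd_fix Q F_r2).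
have lrg := rho_L Q lg; have rg0 : rho g != 0 by rewrite fmorph_eq0.
have eN : pr L (g * rho g) = pr L (r2 * c ^+ 2).
  have fII := fid_imul hL fI fI; have fR := rimg_fid Q fI.
  rewrite -(imul_pr hL) // -(rimg_pr Q) // -eg (rimg_imul Q) // rI2 (rimg_imul Q) //.
  rewrite (imulACA I2) I2_sq (imulACA I) en !imul_pr ?mulf_neq0 //; by sf.
have [rho2 Q2] := rho2_ex; have kr2 := F_r2.
have rc0 : r2 * c ^+ 2 != 0 by rewrite mulf_neq0 ?expf_neq0 // r2_neq0.
have ue := unit_eps hF F_r2.
have uu : unit L (g * rho g / (r2 * c ^+ 2)).
  by apply: (pr_eq hL) => //; [sf|rewrite mulf_neq0].
have kN := norm_K Q lg.
have uF : unit F (g * rho g / (r2 * c ^+ 2)) by apply: (unit_restr Q uu); sf.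
(* The norm of g is totally positive, while r2 and 1 + r2 are both positive with negative conjugate;
   so this quotient is totally positive, hence a square. *)
have uF' : unit F (g * rho g / (r2 * c ^+ 2) / (1 + r2)) by apply: unitM => //; exact: unitV.
have [q1 q2] := norm_pos d0 Q Q2 lg g0.
have epos : (1 + r2) != 0 := unit_neq0 ue.
have r20 := r2_neq0; have r2p : 0 < r2 by rewrite lt_neqAle eq_sym r20 sqrtC_ge0 ler0n.
have cpos x : F x -> x != 0 -> 0 < x ^+ 2.
  by move=> /F_real rx x0; rewrite lt_neqAle eq_sym expf_neq0 //= real_exprn_even_ge0.
have r2lt2 : r2 < 2.
  rewrite -subr_gt0; have -> : 2 - r2 = r2 * (r2 - 1) by rewrite mulrBr -expr2 r2sq mulr1.
  rewrite mulr_gt0 // subr_gt0 -(ltr_pXn2r (n := 2)) ?nnegrE ?ler01 ?ltW //.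
  by rewrite r2sq expr1n ltr1n.
have [||w uw ew] := F_totpos_square Q2 uF'.
- apply: divr_gt0; last exact: addr_gt0 ltr01 r2p.
  by apply: divr_gt0 => //; apply: mulr_gt0 => //; exact: cpos.
- have e1 : rho2 (r2 * c ^+ 2) = - r2 * rho2 c ^+ 2 by rewrite rmorphM rmorphXn (qd_opp Q2).
  have e2 : rho2 (1 + r2) = 1 - r2 by rewrite rmorphD rmorph1 (qd_opp Q2).
  rewrite !fmorph_div e1 e2 -mulrA -invfM; apply: divr_gt0 => //.
  have -> : - r2 * rho2 c ^+ 2 * (1 - r2) = (2 - r2) * rho2 c ^+ 2.
    by rewrite -[in RHS]r2sq; ring.
  by rewrite mulr_gt0 ?subr_gt0 // cpos ?fmorph_eq0 //; exact: rho2_F.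
have [w0 [kw _] _] := uw.
have [yy [zz [kyy kzz ex]]] : L (g / (c * w)) by have lw := qext_subK hF s kw; sf.
apply: (@not_norm_form p yy zz pp (or_intror p5)) => //.
transitivity ((yy + zz * s) * rho (yy + zz * s)).
  by rewrite (rho_qext Q) // -[p%:R]opprK -es; ring.
have kcw : F (c * w) by sf.
rewrite -ex fmorph_div (qd_fix Q kcw).
have -> : g / (c * w) * (rho g / (c * w)) = (g * rho g / (r2 * c ^+ 2) / (1 + r2)) / w ^+ 2 * (r2 * (1 + r2)).
  by field; rewrite w0 c0 epos r20.
by rewrite ew divff ?expf_neq0 // mul1r mulrDr mulr1 -expr2 r2sq addrC.
Qed.
End Moreover.

Lemma moreover p : prime p -> (p %% 8 = 5)%N ->
  exists h : nat, class_number (M [:: 2; - p%:Z]) h /\ (2 %| h)%N /\ ~~ (4 %| h)%N.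
Proof.
move=> pp p5; have d0 : - p%:Z < 0 by have := prime_gt0 pp; lia.
have nF := sq_neg_notF d0; have [rho Q] := quadF nF; have p2 := mod8_odd (or_intror p5).
have eL : M [:: 2; - p%:Z] = qext F (sq (- p%:Z)).
  rewrite (@gen_eqi _ [:: sq (- p%:Z); r2]) => [|x]; last by rewrite !inE orbC.
  by apply: gen_cons => //; rewrite sqK; exact: F_int.
have nP : ~ M [:: 2; - p%:Z] (sq p%:Z).
  rewrite eL => /(kummer F_sf) []; rewrite ?sqK //; try exact: F_int.
    exact: (prime_notF pp p2 (or_introl erefl) (sqK _)).
  move/F_real; apply: (@negative_not_real _ (- (p%:Z ^+ 2))).
    by rewrite oppr_lt0 exprn_gt0 //; have := prime_gt0 pp; lia.
  by rewrite exprMn !sqK -rmorphM mulNr -expr2.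
have kd : M [:: 2; - p%:Z] (sq (- p%:Z)) by apply: gen_in; rewrite !inE eqxx orbT.
(* The prime p is ramified and p = 1 modulo 4, so an odd class number would force sqrt p into the
   field. *)
have n2 : ~ no2 (M [:: 2; - p%:Z]).
  move=> n2; apply: nP.
  apply: (@ramified_prime_in _ (- p%:Z) d0 kd p (- p%:Z) (-1) p%:Z 0) => //.
  - by rewrite expr1 mulrN1.
  - by rewrite int_Fp // rmorphN rmorph1 oppr_eq0 oner_eq0.
  - by left.
  - by lia.
have N := nf_M [:: 2; - p%:Z]; have [h hh] := class_number_ex N; exists h; split=> //.
rewrite eL in N h hh n2 *.
have fI2 := fid_I2 pp p5 Q; have eI2 := I2_sq pp p5 Q.
have pI2 : prin (qext F (sq (- p%:Z))) (imul (I2 p) (I2 p)).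
  rewrite eI2; apply: prin_pr; [exact: (qext_subK F_sf _ F_r2)|exact: r2_neq0].
apply: (class_2mod4 N hh fI2 pI2).
- move=> pr2; apply: n2 => I fI pI; have [//|] := order2_classes pp p5 Q fI pI.
  case: pr2 => a [a0 ka ->] hp; rewrite -(pr_imulK (quad_sf Q) ka a0 fI); apply: (prinM (quad_sf Q)) => //.
  apply: prin_pr; [have hL := quad_sf Q; sf|by rewrite invr_eq0].
- exact: (order2_classes pp p5 Q).
- exact: (no_square_root_class pp p5 Q).
Qed.

(** * Classification *)

Section Kernel.
Variables (G : cpred) (hG : is_subfield G) (g2 : G r2).

Lemma sq_mul_in a b : G (sq a) -> G (sq b) -> G (sq (a * b)).
Proof.
move=> ha hb; have [<-|e] := sq_cat a b; first by sf.
by rewrite -[sq (a * b)]opprK -e; sf.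
Qed.

Lemma sq_sqr (q : int) : G (sq (q ^+ 2)).
Proof.
have [->|->] : sq (q ^+ 2) = q%:~R \/ sq (q ^+ 2) = - q%:~R; [|by sf|by sf].
by apply: sq_unit_pm; rewrite sqK rmorphXn.
Qed.

Lemma sq_opp_in a : a != 0 -> G (sq a) -> G (sq (- a)) -> G (sq (-1)).
Proof.
move=> a0 h1 h2; have a0' : a%:~R != 0 :> algC by rewrite intr_eq0.
have [->|->] : sq (-1) = sq a * sq (- a) / a%:~R \/ sq (-1) = - (sq a * sq (- a) / a%:~R); [|by sf|by sf].
by apply: sq_unit_pm; rewrite expr_div_n exprMn !sqK !rmorphN rmorph1; field.
Qed.

(* Up to sign, an integer is a square times its prime divisors of odd multiplicity. *)
Lemma sq_generated (a : int) : a != 0 ->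
  (forall q, prime q -> odd q -> odd (logn q `|a|) -> G (sq q%:Z) \/ G (sq (- q%:Z))) ->
  G (sq a) \/ G (sq (- a)).
Proof.
have [n] := ubnP `|a|%N; elim: n a => // n IH a lan a0 hq.
have [a1|a1] := leqP `|a| 1.
  have G1 : G (sq 1) by have := sq_sqr 1; rewrite expr1n.
  by have [->|->] : a = 1 \/ a = -1; [lia|left|right; rewrite opprK].
set q := pdiv `|a|; have pq : prime q := pdiv_prime a1; have q1 := prime_gt1 pq.
have /dvdzP[b eb] : (q%:Z %| a)%Z by rewrite dvdzE pdiv_dvd.
rewrite mulrC in eb; have b0 : b != 0 by apply: contra_neq a0 => b0; rewrite eb b0 mulr0.
have [/dvdzP[c ec]|nqb] := boolP (q%:Z %| b)%Z.
  have ea : a = q%:Z ^+ 2 * c by rewrite eb ec; ring.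
  have c0 : c != 0 by apply: contra_neq b0 => c0; rewrite ec c0 mul0r.
  have c1 : (0 < `|c|)%N by rewrite absz_gt0.
  have q2 : (0 < q ^ 2)%N by rewrite expn_gt0 prime_gt0.
  have [|||h|h] := IH c.
  - move: lan; rewrite ea abszM abszX /= ltnS; apply: leq_trans.
    by rewrite -[ltnLHS]mul1n ltn_pmul2r // -(exp1n 2) ltn_exp2r.
  - exact: c0.
  - move=> r pr r2' hr; apply: hq => //; rewrite ea abszM abszX lognM //.
    by rewrite lognX oddD mul2n odd_double.
  - by left; rewrite ea; apply: sq_mul_in => //; exact: sq_sqr.
  by right; rewrite ea -mulrN; apply: sq_mul_in => //; exact: sq_sqr.
have nqb' : ~~ (q %| `|b|)%N by rewrite -[q]/(`|q%:Z|%N) -dvdzE.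
have b1 : (0 < `|b|)%N by rewrite absz_gt0.
have q0 : (0 < `|q%:Z|)%N := prime_gt0 pq.
have hGq : G (sq q%:Z) \/ G (sq (- q%:Z)).
  have [q2|] := boolP (odd q); last first.
    by move=> h; left; have -> : q = 2 by case: (even_prime pq) h => // ->.
  have lq : logn q `|q%:Z| = 1%N := logn_self pq.
  apply: hq => //; rewrite eb abszM lognM // lq oddD.
  by rewrite lognE (negPf nqb') !andbF.
have hGb : G (sq b) \/ G (sq (- b)).
  apply: IH => //.
    move: lan; rewrite eb abszM /= ltnS; apply: leq_trans.
    by rewrite -[ltnLHS]mul1n ltn_pmul2r.
  move=> r pr r2' hr; apply: hq => //; rewrite eb abszM lognM // oddD hr.
  have nrq : r != q by apply: contraTneq hr => ->; rewrite lognE (negPf nqb') !andbF.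
  by rewrite (logn_prime _ pq) (negPf nrq).
rewrite eb; case: hGq => h1; case: hGb => h2; have h3 := sq_mul_in h1 h2.
- by left.
- by right; rewrite mulrN in h3.
- by right; rewrite mulNr in h3.
by left; rewrite mulrNN in h3.
Qed.
End Kernel.

(** For a multiquadratic K this is ramification of the odd prime p, read off from a square root in K
    of an integer with odd exponent at p. *)
Definition ramified (K : cpred) p :=
  [/\ prime p, odd p & exists a : int, [/\ a != 0, K (sq a) & odd (logn p `|a|)]].

Section Classification.
Variables (S : seq int) (d : int).
Local Notation K := (M S).
Hypotheses (d0 : d < 0) (kd : K (sq d)) (k2 : K r2) (n2 : no2 K).
Let hK : is_subfield K := gen_sf _.

Lemma ramified_sqrt p (D : int) : ramified K p -> (D = p%:Z \/ D = - p%:Z) ->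
  D = 4 * (D %/ 4)%Z + 1 -> K (sq D).
Proof.
move=> [pp p2 [a [a0 ka oa]]] hD D4; set e := logn p `|a| in oa.
have a1 : (0 < `|a|)%N by rewrite absz_gt0.
have ee : e = (e./2).*2.+1 by rewrite -[LHS]odd_double_half oa.
have /dvdzP[c ec] : (p%:Z ^+ e %| a)%Z by rewrite dvdzE abszX /= pfactor_dvdnn.
apply: (@ramified_prime_in S d d0 kd p a c D e./2) => //; first by rewrite -ee mulrC.
rewrite dvdzE /=; apply/negP => hc.
have : (p ^ e.+1 %| `|a|)%N by rewrite ec abszM abszX /= mulnC expnSr dvdn_pmul2l // expn_gt0 prime_gt0.
by rewrite pfactor_dvdn // ltnn.
Qed.

Lemma ramified_mod8 p : ramified K p ->
  ((p %% 8 = 3)%N /\ K (sq (- p%:Z))) \/ ((p %% 8 = 5)%N /\ K (sq p%:Z)).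
Proof.
move=> rp; have [pp p2 _] := rp.
have [h|[h|[h|h]]] : (p %% 8 = 3 \/ p %% 8 = 5 \/ p %% 8 = 1 \/ p %% 8 = 7)%N by lia.
- by left; split=> //; apply: (ramified_sqrt rp); [right|lia].
- by right; split=> //; apply: (ramified_sqrt rp); [left|lia].
- exfalso; apply: (@even_pm1 S d d0 kd k2 p p%:Z) => //; [by left|by left|by lia|].
  by apply: (ramified_sqrt rp); [left|lia].
exfalso; apply: (@even_pm1 S d d0 kd k2 p (- p%:Z)) => //; [by right|by right|by lia|].
by apply: (ramified_sqrt rp); [right|lia].
Qed.

Lemma not_35 p q : ramified K p -> ramified K q -> (p %% 8 = 3)%N -> (q %% 8 = 5)%N -> False.
Proof.
move=> rp rq p3 q5; have [pp _ _] := rp; have [pq _ _] := rq.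
have kp : K (sq (- p%:Z)) by case: (ramified_mod8 rp) => [[]|[h]] //; rewrite p3 in h.
have kq : K (sq q%:Z) by case: (ramified_mod8 rq) => [[h]|[]] //; rewrite q5 in h.
have dp : - p%:Z < 0 by have := prime_gt0 pp; lia.
have [rho Q] := quadF (sq_neg_notF dp).
exact: (even_35 pp p3 k2 kp Q pq q5 kq n2).
Qed.

Lemma generated_by T : incl (M T) K -> M T r2 ->
  (forall q, ramified K q -> M T (sq q%:Z) \/ M T (sq (- q%:Z))) ->
  (M T (sq (-1)) \/ ~ K (sq (-1))) -> K = M T.
Proof.
move=> sub t2 hq hi; have hT := gen_sf [seq sq a | a <- T].
apply: incl_eq => //; apply: gen_sub => // _ /mapP[a ha ->].
have ka : K (sq a) by apply: gen_in; apply: map_f.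
have [->|a0] := eqVneq a 0; first by rewrite /sq sqrtC0; sf.
have [//|h] : M T (sq a) \/ M T (sq (- a)).
  by apply: sq_generated => // q pq q2 oq; apply: hq; split=> //; exists a.
case: hi => hi; last by case: hi; apply: (sq_opp_in hK a0 ka); exact: sub.
by rewrite -[a]opprK -mulN1r; exact: (sq_mul_in hT hi h).
Qed.

Lemma M_sub T : (forall a, a \in T -> K (sq a)) -> incl (M T) K.
Proof. by move=> h; apply: gen_sub => // _ /mapP[a ha ->]; exact: h. Qed.

Lemma classification :
  [\/ exists p : nat, [/\ prime p, (p %% 8 = 3)%N & K = M [:: 2; - p%:Z]],
      exists p : nat, [/\ prime p, (p %% 8 = 3)%N \/ (p %% 8 = 5)%N & K = M [:: 2; -1; - p%:Z]],
      exists p q : nat, [/\ prime p, prime q, p <> q, (p %% 8 = 3)%N /\ (q %% 8 = 3)%N &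
        K = M [:: 2; - p%:Z; - q%:Z]]
    | K = M [:: 2; -1]].
Proof.
have gin (T : seq int) a : a \in T -> M T (sq a) by move=> h; apply: gen_in; apply: map_f.
have in0 (T : seq int) : M (2 :: T) r2 by apply: gin; rewrite mem_head.
have kp3 p : ramified K p -> (p %% 8 = 3)%N -> K (sq (- p%:Z)).
  by move=> /ramified_mod8 [[]|[h]] // _ h'; rewrite h' in h.
have [ki|nki] := pselect (K (sq (-1))).
  have [[p rp]|np] := pselect (exists p, ramified K p); last first.
    constructor 4; apply: generated_by => //.
    - by apply: M_sub => a; rewrite !inE => /orP[]/eqP->.
    - by move=> q rq; case: np; exists q.
    by left; apply: gin; rewrite !inE eqxx orbT.
  have [pp p2 _] := rp; constructor 2; exists p; split=> //.
    by case: (ramified_mod8 rp) => [[]|[]]; [left|right].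
  have kp : K (sq (- p%:Z)).
    case: (ramified_mod8 rp) => [[]|[_ h]] //; rewrite -mulN1r; exact: (sq_mul_in hK ki h).
  apply: generated_by => //.
  - by apply: M_sub => a; rewrite !inE => /or3P[]/eqP->.
  - move=> q rq; have [<-|nqp] := eqVneq p q; first by right; apply: gin; rewrite !inE eqxx !orbT.
    exfalso; have [pq _ _] := rq; move/eqP in nqp.
    case: (ramified_mod8 rp) => [[p3 k1]|[p5 k1]]; case: (ramified_mod8 rq) => [[q3 k3]|[q5 k3]].
    + exact: (even_33 d0 kd k2 pp pq nqp p3 q3 ki k1 k3 n2).
    + exact: (not_35 rp rq).
    + exact: (not_35 rq rp).
    + exact: (even_55 d0 kd pp pq nqp p5 q5 ki k1 k3 n2).
  by left; apply: gin; rewrite !inE eqxx orbT.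
(* Otherwise every ramified q is 5 modulo 8 and sqrt q lies in the real subfield G of K. Then G
   contains sqrt d or sqrt(-d); as d < 0 it is the latter, and sqrt d sqrt(-d) / d gives sqrt(-1) in
   K up to sign. *)
have [p [rp p3]] : exists p, ramified K p /\ (p %% 8 = 3)%N.
  apply: contrapT => h; apply: nki.
  have all5 q : ramified K q -> K (sq q%:Z).
    by move=> rq; case: (ramified_mod8 rq) => [[q3 _]|[]] //; case: h; exists q.
  pose G : cpred := fun x => K x /\ x \is Num.real.
  have hG : is_subfield G.
    split=> [||x y [kx rx] [ky ry]|x [kx rx]|x y [kx rx] [ky ry]].
    - by split; [sf|exact: real0].
    - by split; [sf|exact: real1].
    - by split; [sf|exact: realD].
    - by split; [sf|rewrite realN].
    by split; split; [sf|rewrite realM|sf|rewrite realV].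
  have rsq (a : int) : 0 <= a -> sq a \is Num.real by move=> ha; rewrite ger0_real // sqrtC_ge0 ler0z.
  have g2 : G r2 by split=> //; exact: rsq.
  have dn0 : d != 0 by rewrite lt_eqF.
  have [[_ h1]|[h1 _]] : G (sq d) \/ G (sq (- d)).
  - apply: sq_generated => // q pq q2 oq; left; split; last exact: rsq.
    by apply: all5; split=> //; exists d.
  - by case: (negative_not_real d0 (sqK d) h1).
  exact: (sq_opp_in hK dn0 kd h1).
have [pp p2 _] := rp; have kp := kp3 p rp p3.
have all3 q : ramified K q -> (q %% 8 = 3)%N.
  by move=> rq; case: (ramified_mod8 rq) => [[]|[q5 _]] //; case: (not_35 rp rq p3 q5).
have [[q [rq nqp]]|nq] := pselect (exists q, ramified K q /\ q <> p); last first.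
  constructor 1; exists p; split=> //; apply: generated_by => //; last by right.
    by apply: M_sub => a; rewrite !inE => /orP[]/eqP->.
  move=> q rq; right; have -> : q = p by apply: contrapT => h; apply: nq; exists q.
  by apply: gin; rewrite !inE eqxx orbT.
have [pq _ _] := rq; have kq := kp3 q rq (all3 q rq).
constructor 3; exists p, q; split=> //.
- by move=> h; apply: nqp.
- by split=> //; exact: all3.
apply: generated_by => //; last by right.
  by apply: M_sub => a; rewrite !inE => /or3P[]/eqP->.
move=> r rr; right; have [->|/eqP nrp] := eqVneq r p; first by apply: gin; rewrite !inE eqxx !orbT.
have [->|/eqP nrq] := eqVneq r q; first by apply: gin; rewrite !inE eqxx !orbT.
exfalso; have [pr _ _] := rr; have nqr : q <> r by move=> h; apply: nrq.
have dp : - p%:Z < 0 by have := prime_gt0 pp; lia.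
have [rho Q] := quadF (sq_neg_notF dp).
exact: (even_333 pp p3 k2 kp Q pq pr (all3 q rq) (all3 r rr) nqp nrp nqr kq (kp3 r rr (all3 r rr)) n2).
Qed.
End Classification.

Lemma imaginary_neg s : imaginary (multiquad s) -> exists2 d : int, d < 0 & M s (sq d).
Proof.
move=> [x [hx nx]]; apply: contrapT => h; move/negP: nx; apply; rewrite multiquad_gen in hx.
apply: (gen_sub real_sf _ hx) => _ /mapP[a ha ->].
rewrite ger0_real // sqrtC_ge0 ler0z leNgt; apply/negP => a0; apply: h.
by exists a => //; apply: gen_in; apply: map_f.
Qed.

Lemma same_fieldP (K L : cpred) : same_field K L <-> K = L.
Proof. by split=> [h|->] //; rewrite predeqE. Qed.

Theorem theorem4p5 :
  (forall s : seq int,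
     imaginary (multiquad s) -> multiquad s (sqrtC 2) ->
     exists h : nat, class_number (multiquad s) h /\
       (odd h <->
         [\/ (exists p : nat, [/\ prime p, (p %% 8 = 3)%N &
                same_field (multiquad s) (multiquad [:: 2; - (p%:Z)])]),
             (exists p : nat, [/\ prime p, ((p %% 8 = 3)%N \/ (p %% 8 = 5)%N) &
                same_field (multiquad s) (multiquad [:: 2; -1; - (p%:Z)])]),
             (exists p q : nat, [/\ prime p, prime q, p <> q,
                (p %% 8 = 3)%N /\ (q %% 8 = 3)%N &
                same_field (multiquad s) (multiquad [:: 2; - (p%:Z); - (q%:Z)])])
           | same_field (multiquad s) (multiquad [:: 2; -1])]))
  /\
  (forall p : nat, prime p -> (p %% 8 = 5)%N ->
     exists h : nat, class_number (multiquad [:: 2; - (p%:Z)]) h /\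
       (2 %| h)%N /\ ~~ (4 %| h)%N).
Proof.
split=> [s him h2|p pp p5]; last first.
  by have [h hh] := moreover pp p5; exists h; rewrite multiquad_gen.
have [d d0 kd] := imaginary_neg him; have N := nf_multiquad s.
have [h hh] := class_number_ex N; exists h; split=> //.
have h2' : M s r2 by rewrite -multiquad_gen.
have e_odd : odd h <-> no2 (multiquad s).
  split=> [oh|]; last exact: (odd_class N hh).
  by apply: contrapT => hn; have := even_class N hh hn; rewrite oh.
split=> [/e_odd n2|cases].
  rewrite multiquad_gen in n2 *.
  have [[p [pp p8 e]]|[p [pp p8 e]]|[p [q [pp pq npq p8 e]]]|e] := classification d0 kd h2' n2.
  - by constructor 1; exists p; split=> //; rewrite multiquad_gen; apply/same_fieldP.
  - by constructor 2; exists p; split=> //; rewrite multiquad_gen; apply/same_fieldP.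
  - by constructor 3; exists p, q; split=> //; rewrite multiquad_gen; apply/same_fieldP.
  by constructor 4; rewrite multiquad_gen; apply/same_fieldP.
apply/e_odd; case: cases => [[p [pp p8 /same_fieldP->]]|[p [pp p8 /same_fieldP->]]|[p [q [pp pq npq [p8 q8] /same_fieldP->]]]|/same_fieldP->];
  rewrite multiquad_gen.
- exact: no2_case1.
- exact: no2_case2.
- exact: no2_case3.
exact: no2_case4.
Qed.
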